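(* Let $E$ be a separable real Banach space, let $p\in[1,\infty)$, and let $q\in(1,\infty]$ satisfy $p^{-1}+q^{-1}=1$. Let $F\colon I\times E\multimap E$ be a set-valued map such that: (H1) the set $F(t,x)$ is nonempty, closed and bounded for every $(t,x)\in I\times E$; (H2) the map $F(\cdot,x)$ is $\Sigma$-measurable for every $x\in E$; (H3) there exists $\alpha\in L^p(I,\mathbb{R})$ such that $d_H(F(t,x),F(t,y))\leqslant\alpha(t)|x-y|$ for all $x,y\in E$, a.e. in $I$; (H4) there exists $\beta\in L^p(I,\mathbb{R})$ such that $d(0,F(t,0))\leqslant\beta(t)$ a.e. in $I$; and, if $p\in(1,\infty)$, assume in addition that $F$ has convex values. Let $k\colon\triangle\to\mathcal{L}(E)$, let $h\in C(I,E)$, and let $S_F^p(h)\subset C(I,E)$ be the set of all solutions of the Volterra integral inclusion $$x(t)\in h(t)+\int_0^tk(t,s)F(s,x(s))\,ds,\quad t\in I.$$ Then: (i) the solution set $S_F^p(h)$ is arcwise connected, provided that $k(t,\cdot)\in L^q([0,t],\mathcal{L}(E))$ for every $t\in I$ and the function $I\ni t\mapsto k(t,\cdot)\in L^q([0,t],\mathcal{L}(E))$ is continuous in the norm $\|\cdot\|_q$ of the space $L^q(I,\mathcal{L}(E))$; (ii) the solution set $S_F^p(h)$ is an absolute retract, provided that $k$ satisfies: for every $s\in I$ the function $k(\cdot,s)\colon[s,T]\to\mathcal{L}(E)$ is differentiable; for all $t\in I$ the function $k(t,\cdot)\colon[0,t]\to\mathcal{L}(E)$ is continuous; the function $(t,t)\mapsto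 k(t,t)\in\mathcal{L}(E)$ is continuous on the diagonal $\{(t,t)\colon t\in I\}$ and the operator $k(t,t)$ is invertible for all $t\in I$; and there exists $\mu\in L^q(I,\mathbb{R})$ such that $\left\|\frac{\partial}{\partial t}k(t,s)\right\|_{\mathcal{L}}\leqslant\mu(s)$ for every $(t,s)\in\triangle$.
   Context: $I=[0,T]$, $\triangle=\{(t,s)\in I\times I\colon 0\leqslant s\leqslant t\leqslant T\}$, and $\Sigma$ is the $\sigma$-algebra of Lebesgue measurable subsets of $I$. $E$ has norm $|\cdot|$; $\mathcal{L}(E)$ is the space of bounded linear endomorphisms of $E$ with operator norm $\|\cdot\|_{\mathcal{L}}$. $C(I,E)$ is the Banach space of continuous maps $I\to E$ with the maximum norm; $L^p(I,E)$ is the Banach space of Bochner $p$-integrable maps $I\to E$ with its usual norm $\|\cdot\|_p$. $d(x,A)=\inf\{|x-y|\colon y\in A\}$, and $d_H(A,B)=\max\{\sup_{x\in A}d(x,B),\sup_{y\in B}d(y,A)\}$ is the Hausdorff distance. The notation $\multimap$ indicates a set-valued map with nonempty values. A set-valued map $G\colon I\multimap E$ is $\Sigma$-measurable if $\{t\in I\colon G(t)\subset C\}\in\Sigma$ for every open $C\subset E$. In (i), $k(t,\cdot)$ is regarded as an element of $L^q(I,\mathcal{L}(E))$ by extending it by $0$ outside $[0,t]$. A solution of the integral inclusion is a function $x\in C(I,E)$ such that $x(t)=h(t)+\int_0^tk(t,s)w(s)\,ds$ for all $t\in I$, for some $w\in L^p(I,E)$ with $w(t)\in F(t,x(t))$ for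 a.a. $t\in I$. An absolute retract is a metrizable space that is a retract of every metrizable space containing it as a closed subspace. *)

(* Defs.v *)
From HB Require Import structures.
From mathcomp Require Import all_boot all_order all_algebra.
From mathcomp Require Import all_classical all_reals all_analysis.

Set Implicit Arguments.
Unset Strict Implicit.
Unset Printing Implicit Defensive.

Import Order.TTheory GRing.Theory Num.Theory.
Import numFieldNormedType.Exports.

Local Open Scope classical_set_scope.
Local Open Scope ring_scope.

Section metrizable_spaces.
Context {R : realType}.

Definition metrizable (X : topologicalType) : Prop :=
  exists d : X -> X -> R,
    [/\ forall x y, 0 <= d x y,
        forall x y, d x y = 0 <-> x = y,
        forall x y, d x y = d y x,
        forall x y z, d x z <= d x y + d y z &
        forall x (U : set X),
          nbhs x U <-> exists2 e : R, 0 < e & [set y | d x y < e] `<=` U].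

Definition embedding (X Y : topologicalType) (f : X -> Y) : Prop :=
  injective f /\
  forall U : set X, open U <-> exists2 V : set Y, open V & U = f @^-1` V.

Definition absolute_retract (X : topologicalType) : Prop :=
  metrizable X /\
  forall (Y : topologicalType) (i : X -> Y),
    metrizable Y -> embedding i -> closed (range i) ->
    exists2 r : Y -> X, continuous r & cancel i r.

(* Distinct points are joined by an arc, i.e. a homeomorphic image of [0, 1]. *)
Definition arcwise_connected (X : topologicalType) : Prop :=
  forall x y : X, x <> y ->
  exists g : (`[0, 1]%classic : set R) -> X,
    [/\ embedding g,
        forall t, set_val t = 0 -> g t = x &
        forall t, set_val t = 1 -> g t = y].

End metrizable_spaces.
Arguments metrizable R X : clear implicits.
Arguments absolute_retract R X : clear implicits.
Arguments arcwise_connected R X : clear implicits.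

Definition separable (X : topologicalType) : Prop :=
  exists2 S : set X, countable S & dense S.

Section bounded_linear_endomorphisms.
Context {R : realType} {E : normedModType R}.

Definition blin_pred : {pred E -> E} :=
  [pred f | `[< linear f /\ exists M : R, forall x, `|f x| <= M * `|x| >]].

Record blin := Blin { blin_fun :> E -> E ; _ : blin_fun \in blin_pred }.

HB.instance Definition _ := [isSub for blin_fun].
HB.instance Definition _ := [Choice of blin by <:].

Lemma blin_pred_submod_closed : submod_closed blin_pred.
Proof.
split.
  apply/asboolP; split; last first.
    by exists 0 => x; rewrite mul0r; change (`|0 : E| <= 0); rewrite normr0.
  by move=> a x y; change (0 = a *: (0 : E) + 0); rewrite scaler0 addr0.
move=> a f g /asboolP[lf [M fM]] /asboolP[lg [N gN]].
apply/asboolP; split.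
  move=> b x y; rewrite !fctE lf lg !scalerDr !scalerA (mulrC a b).
  by rewrite addrACA.
exists (`|a| * M + N) => x; rewrite !fctE mulrDl -mulrA.
by rewrite (le_trans (ler_normD _ _))// lerD// normrZ ler_wpM2l.
Qed.

HB.instance Definition _ :=
  GRing.isSubmodClosed.Build R (E -> E) blin_pred blin_pred_submod_closed.

HB.instance Definition _ := [SubChoice_isSubLmodule of blin by <:].

Definition opnorm (A : blin) : R :=
  sup [set `|A x| | x in [set x : E | `|x| <= 1]].

Lemma blin_lin (A : blin) : linear A.
Proof. by case: A => f /= /asboolP[]. Qed.

Lemma blin_bounded (A : blin) : exists M : R, forall x, `|A x| <= M * `|x|.
Proof. by case: A => f /= /asboolP[]. Qed.

Lemma opnorm_has_sup (A : blin) :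
  has_sup [set `|A x| | x in [set x : E | `|x| <= 1]].
Proof.
split; first by exists `|A 0|, 0 => //=; rewrite normr0.
have [M AM] := blin_bounded A; exists `|M| => _ [x x1 <-].
rewrite (le_trans (AM x))// (le_trans (ler_norm _))// normrM normr_id.
by rewrite ler_piMr.
Qed.

Lemma le_opnorm (A : blin) (x : E) : `|x| <= 1 -> `|A x| <= opnorm A.
Proof. by move=> x1; apply: (sup_upper_bound (opnorm_has_sup A)); exists x. Qed.

Lemma opnorm_le (A : blin) (M : R) :
  (forall x : E, `|x| <= 1 -> `|A x| <= M) -> opnorm A <= M.
Proof.
move=> AM; apply: sup_le_ub; first by case: (opnorm_has_sup A).
by move=> _ [x x1 <-]; exact: AM.
Qed.

Lemma ler_opnormD (A B : blin) : opnorm (A + B) <= opnorm A + opnorm B.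
Proof.
apply: opnorm_le => x x1.
by rewrite (le_trans (ler_normD _ _))// lerD// le_opnorm.
Qed.

Lemma opnormZ (a : R) (A : blin) : opnorm (a *: A) = `|a| * opnorm A.
Proof.
have leZ b B : opnorm (b *: B) <= `|b| * opnorm B.
  by apply: opnorm_le => x x1; rewrite normrZ ler_wpM2l// le_opnorm.
apply/eqP; rewrite eq_le leZ/=.
have [->|a0] := eqVneq a 0.
  by rewrite normr0 mul0r (le_trans (normr_ge0 _) (@le_opnorm _ 0 _))// normr0.
have := leZ a^-1 (a *: A); rewrite scalerA mulVf// scale1r normfV.
by rewrite ler_pdivlMl// normr_gt0.
Qed.

Lemma opnorm0_eq0 (A : blin) : opnorm A = 0 -> A = 0.
Proof.
move=> A0; apply/val_inj/funext => x /=.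
have [->|x0] := eqVneq x 0.
  by have := @blin_lin A (-1) 0 0; rewrite scaleN1r oppr0 addr0 scaleN1r addNr.
have Ax1 : A (`|x|^-1 *: x) = 0.
  apply/eqP; rewrite -normr_le0 -A0 le_opnorm// normrZ normfV normr_id.
  by rewrite mulVf// normr_eq0.
have -> : x = `|x| *: (`|x|^-1 *: x).
  by rewrite scalerA divff ?scale1r// normr_eq0.
have := @blin_lin A `|x| (`|x|^-1 *: x) 0.
rewrite addr0 => ->; rewrite Ax1 scaler0 add0r.
by have := @blin_lin A (-1) 0 0; rewrite scaleN1r oppr0 addr0 scaleN1r addNr.
Qed.

HB.instance Definition _ :=
  Lmodule_isNormed.Build R blin ler_opnormD opnormZ opnorm0_eq0.

Definition invertible (A : blin) : Prop :=
  exists B : blin, cancel A B /\ cancel B A.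

End bounded_linear_endomorphisms.
Arguments blin {R} E.

Section continuous_functions.
Context {R : realType} {T : R} {E : normedModType R}.

(* Elements of C([0, T], E) are total functions, equal to 0 off [0, T]. *)
Definition cfun_pred : {pred R -> E} :=
  [pred f | `[< {within `[0, T], continuous f} /\
               forall t : R, ~ `[0, T]%classic t -> f t = 0 >]].

Record cfun := CFun { cfun_fun :> R -> E ; _ : cfun_fun \in cfun_pred }.

HB.instance Definition _ := [isSub for cfun_fun].
HB.instance Definition _ := [Choice of cfun by <:].

Lemma cfun_pred_submod_closed : submod_closed cfun_pred.
Proof.
split.
  by apply/asboolP; split => // x; exact: cvg_cst.
move=> a f g /asboolP[cf f0] /asboolP[cg g0]; apply/asboolP; split.
  move=> x; apply: cvgD; last exact: cg.
  by apply: cvgZl_tmp; exact: cf.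
by move=> t It; rewrite !fctE f0// g0// scaler0 addr0.
Qed.

HB.instance Definition _ :=
  GRing.isSubmodClosed.Build R (R -> E) cfun_pred cfun_pred_submod_closed.

HB.instance Definition _ := [SubChoice_isSubLmodule of cfun by <:].

Definition maxnorm (f : cfun) : R := sup [set `|f t| | t in `[0, T]].

Lemma cfun_bounded (f : cfun) : exists M, forall t, `|f t| <= M.
Proof.
case: f => f /= /asboolP[cf f0].
have /pinfty_ex_gt0[M _ fM] : bounded_set (f @` `[0, T]).
  apply: compact_bounded; apply: continuous_compact => //.
  exact: segment_compact.
exists (Num.max M 0) => t.
have [It|It] := pselect (`[0, T]%classic t).
  by rewrite le_max fM//; exists t.
by rewrite f0// normr0 le_max lexx orbT.
Qed.

Lemma le_maxnorm (f : cfun) (t : R) : `|f t| <= maxnorm f.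
Proof.
have [M fM] := cfun_bounded f.
have ub : has_ubound [set `|f t| | t in `[0, T]] by exists M => _ [s _ <-].
have [It|It] := pselect (`[0, T]%classic t).
  by apply: ub_le_sup => //; exists t.
have -> : f t = 0 by case: (f) It => g /= /asboolP[_]; apply.
rewrite normr0.
have [[s Is]|/set0P/negP/negPn/eqP e] := pselect (`[0, T]%classic !=set0).
  by rewrite (@le_trans _ _ `|f s|)//; apply: ub_le_sup => //; exists s.
by rewrite /maxnorm e image_set0 sup0.
Qed.

Lemma maxnorm_le (f : cfun) (M : R) :
  0 <= M -> (forall t, `|f t| <= M) -> maxnorm f <= M.
Proof.
move=> M0 fM; rewrite /maxnorm.
have [->|/set0P[s Is]] := eqVneq (`[0, T]%classic : set R) set0.
  by rewrite image_set0 sup0.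
by apply: sup_le_ub; [exists `|f s|, s | move=> _ [t _ <-]].
Qed.

Lemma maxnorm_ge0 (f : cfun) : 0 <= maxnorm f.
Proof. exact: le_trans (normr_ge0 _) (le_maxnorm f 0). Qed.

Lemma ler_maxnormD (f g : cfun) : maxnorm (f + g) <= maxnorm f + maxnorm g.
Proof.
apply: maxnorm_le => [|t]; first by rewrite addr_ge0// maxnorm_ge0.
by rewrite (le_trans (ler_normD _ _))// lerD// le_maxnorm.
Qed.

Lemma maxnormZ (a : R) (f : cfun) : maxnorm (a *: f) = `|a| * maxnorm f.
Proof.
have leZ b g : maxnorm (b *: g) <= `|b| * maxnorm g.
  apply: maxnorm_le => [|t]; first by rewrite mulr_ge0// maxnorm_ge0.
  by rewrite normrZ ler_wpM2l// le_maxnorm.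
apply/eqP; rewrite eq_le leZ/=.
have [->|a0] := eqVneq a 0; first by rewrite normr0 mul0r maxnorm_ge0.
have := leZ a^-1 (a *: f); rewrite scalerA mulVf// scale1r normfV.
by rewrite ler_pdivlMl// normr_gt0.
Qed.

Lemma maxnorm0_eq0 (f : cfun) : maxnorm f = 0 -> f = 0.
Proof.
move=> f0; apply/val_inj/funext => t /=.
by apply/eqP; rewrite -normr_le0 -f0 le_maxnorm.
Qed.

HB.instance Definition _ :=
  Lmodule_isNormed.Build R cfun ler_maxnormD maxnormZ maxnorm0_eq0.

End continuous_functions.
Arguments cfun {R} T E.

Section bochner.
Context d (S : measurableType d) (R : realType).
Variables (mu : {measure set S -> \bar R}) (D : set S) (V : normedModType R).
Implicit Types (f s : S -> V) (p : \bar R).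

(* Simple on D: finitely many values, each nonzero one taken on a measurable
   subset of D of finite measure. *)
Definition simple_on s : Prop :=
  finite_set (s @` D) /\
  forall v, measurable (D `&` s @^-1` [set v]) /\
            (v != 0 -> (mu (D `&` s @^-1` [set v]) < +oo)%E).

Definition simple_integral s : V :=
  \sum_(v \in s @` D) fine (mu (D `&` s @^-1` [set v])) *: v.

Definition strongly_measurable f : Prop :=
  exists2 s : nat -> S -> V, forall n, simple_on (s n) &
    {ae mu, forall t, D t -> s n t @[n --> \oo] --> f t}.

(* f is Bochner integrable over D, with integral v. *)
Definition is_bochner_integral f (v : V) : Prop :=
  strongly_measurable f /\
  exists s : nat -> S -> V,
    [/\ forall n, simple_on (s n),
        (\int[mu]_(t in D) `|f t - s n t|%:E)%E @[n --> \oo] --> 0%E &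
        simple_integral (s n) @[n --> \oo] --> v].

(* The functions are extended by 0 off D. *)
Definition Lpnorm p f : \bar R :=
  ('N[mu]_p[(fun t => `|patch (cst 0%R) D f t|%:E)])%E.

Definition in_Lp p f : Prop := strongly_measurable f /\ (Lpnorm p f < +oo)%E.

End bochner.

Section hausdorff_distance.
Context {R : realType} {E : normedModType R}.
Local Open Scope ereal_scope.

Definition dist (x : E) (A : set E) : \bar R :=
  ereal_inf [set `|x - y|%:E | y in A].

Definition hausdorff_dist (A B : set E) : \bar R :=
  maxe (ereal_sup [set dist x B | x in A]) (ereal_sup [set dist y A | y in B]).

End hausdorff_distance.

Notation leb R := (@completed_lebesgue_measure R).

Section volterra.
Context {R : realType} {E : normedModType R}.
Variable T : R.

(* The Caratheodory sets of the outer measure generated by interval lengths,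
   that is, the sigma-algebra on which completed_lebesgue_measure lives. *)
Definition lebesgue_measurable (A : set R) : Prop :=
  (wlength idfun)^*%mu.-cara.-measurable A.

Definition Sigma_measurable (G : R -> set E) : Prop :=
  forall C : set E, open C ->
    lebesgue_measurable [set t | `[0, T]%classic t /\ G t `<=` C].

(* Only the values k t s with 0 <= s <= t <= T are meaningful; the section
   k t is extended by 0 outside [0, t]. *)
Definition kernel_section (k : R -> R -> blin E) (t : R) : R -> blin E :=
  patch (cst 0) `[0, t] (k t).

Definition volterra_solutions (p : R) (F : R -> E -> set E)
    (k : R -> R -> blin E) (h : cfun T E) : set (cfun T E) :=
  [set x | exists w : R -> E,
     [/\ in_Lp (leb R) `[0, T] p%:E w,
         {ae leb R, forall t, `[0, T]%classic t -> F t (x t) (w t)} &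
         forall t, `[0, T]%classic t ->
           exists2 v : E,
             is_bochner_integral (leb R) `[0, t] (fun s => k t s (w s)) v &
             x t = h t + v]].

End volterra.

(* Main.v *)
Require Import Defs.
From HB Require Import structures.
From mathcomp Require Import all_boot all_order all_algebra.
From mathcomp Require Import all_classical all_reals all_analysis.
From mathcomp Require Import measurable_realfun ring lra.

Set Implicit Arguments.
Unset Strict Implicit.
Unset Printing Implicit Defensive.

Import Order.TTheory GRing.Theory Num.Theory.
Import numFieldNormedType.Exports.

Local Open Scope classical_set_scope.
Local Open Scope ring_scope.

(** For w in L^p write x_w = h + K w, where K is the Volterra operator of k: the solutions are
    the x_w with w(t) in F(t, x_w(t)) for almost every t. Both kernel assumptions make K
    bounded from L^p([0,t],E) to E uniformly in t, and t |-> k(t,.) continuous into L^1. This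
    is enough for an extension property: a continuous map from a closed subset A of a metric
    space Y into the solution set extends to Y. With Y an ambient space this is (ii); with Y
    the line and A = {0,1} it joins any two solutions by a path, and every path contains an
    arc.

    To extend, Dugundji's convex combinations are replaced by chattering: functions u_j are
    combined with weights l_j by using u_j at the times t for which the fractional part of N t
    lies in an interval of length l_j. For N large the norms and the Volterra integrals of the
    combination are, up to a small error, those of the convex combination, while its values are
    values of the u_j; and N can be chosen as a continuous function of the parameter. The
    resulting near-solutions depend continuously on the parameter and are corrected by
    Filippov's successive approximations, whose steps are again produced by chattering and
    which contract in a weighted norm.

    A path is turned into an arc by skipping a maximal family of loops, which leaves a path
    whose fibres are intervals, and by reparametrizing it with a continuous function that
    increases exactly where the path moves. *)

(** * Measurability of vector-valued functions *)

(** A convex combination of elements of a nonconvex value F(t,x) may leave it, whereas a function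
    pieced together in time from selections keeps its values in F. Norms average only through their
    p-th powers: a piece used for a fraction l of the time has norm about l^(1/p) times the full
    norm. As the p-th powers of these factors sum to 1, a combination of small functions stays small
    whatever their number. The frequency needed depends on the functions combined, and infinitely
    many of them occur as the parameter varies. The estimates are therefore uniform in the end
    points of the intervals and in t, and their errors are turned into continuous functions of the
    parameter before the frequency is chosen. The gap d(w(t), F(t,x_w(t))) measures how far w is
    from a solution. It is measurable and Lipschitz in w and x_w, and each correction divides its
    weighted norm by 4 up to the tolerance. That norm is a discrete form of Bielecki's norm, built
    from the norms on [0,t] for finitely many t. *)

Section strong_measurability.
Context d (S : measurableType d) (R : realType) (D : set S).
Hypothesis mD : measurable D.

Lemma measurable_glue (C : countType) (k : S -> C) (h : C -> S -> R) :
  (forall c, measurable (D `&` k @^-1` [set c])) ->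
  (forall c, measurable_fun D (h c)) -> measurable_fun D (fun t => h (k t) t).
Proof.
move=> mk mh _ Y mY.
rewrite (_ : _ `&` _ =
    \bigcup_c ((D `&` k @^-1` [set c]) `&` (D `&` h c @^-1` Y))); last first.
  apply/seteqP; split => [t [Dt Yt]|t [c _ [[Dt /= <-] [_ Yt]]]] //.
  by exists (k t).
apply: countable_bigcupT_measurable => // c.
by apply: measurableI => //; exact: mh.
Qed.

Lemma measurable_idxP (k : S -> nat) :
  (forall n, measurable (D `&` k @^-1` [set n])) <-> measurable_fun D k.
Proof.
split => [mk _ Y _|mk n]; last exact: mk.
rewrite (_ : _ `&` _ = \bigcup_(n in Y) (D `&` k @^-1` [set n])).
  by apply: bigcup_measurable => n _.
apply/seteqP; split => [t [Dt Yt]|t [n Yn [Dt /= ktn]]]; first by exists (k t).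
by split => //; rewrite /= ktn.
Qed.

Lemma measurable_idx_pair (C C' : Type) (k : S -> C) (k' : S -> C') :
  (forall c, measurable (D `&` k @^-1` [set c])) ->
  (forall c, measurable (D `&` k' @^-1` [set c])) ->
  forall c, measurable (D `&` (fun t => (k t, k' t)) @^-1` [set c]).
Proof.
move=> mk mk' [c c'].
rewrite (_ : _ `&` _ = (D `&` k @^-1` [set c]) `&` (D `&` k' @^-1` [set c'])).
  exact: measurableI.
apply/seteqP; split => [t [Dt [kc k'c]]|t [[Dt /= kc] [_ /= k'c]]].
  by split.
by split => //=; rewrite kc k'c.
Qed.

Context {V : normedModType R}.

Definition dense_seq (e : nat -> V) : Prop :=
  forall x r, 0 < r -> exists n, `|x - e n| < r.

(* For separable V and a complete measure this is equivalent to Defs' [strongly_measurable]. *)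
Record smeas (f : S -> V) : Prop := Smeas
  { smeas_dist : forall c, measurable_fun D (fun t => `|f t - c|) }.

(** Index of a point of [e 0], ..., [e n] nearest to [x], the first one in case of ties. It results
    from finitely many comparisons of distances, so [smeas f] alone makes [nearest e (f t) n]
    measurable in [t]. *)
Fixpoint nearest (e : nat -> V) (x : V) (n : nat) : nat :=
  if n is n'.+1 then
    if `|x - e n| < `|x - e (nearest e x n')| then n else nearest e x n'
  else 0.

Lemma nearest_le e x n : (nearest e x n <= n)%N.
Proof.
elim: n => //= n IHn; case: ifP => // _; exact: leq_trans IHn _.
Qed.

Lemma nearest_min e x n j : (j <= n)%N -> `|x - e (nearest e x n)| <= `|x - e j|.
Proof.
elim: n => [|n IHn]; first by rewrite leqn0 => /eqP ->.
rewrite leq_eqVlt ltnS => /predU1P[->|jn] /=.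
  by case: ifPn => //; rewrite -leNgt.
by case: ifPn => [/ltW/le_trans|_]; [apply|]; exact: IHn.
Qed.

Lemma nearest_cvg e x : dense_seq e -> e (nearest e x n) @[n --> \oo] --> x.
Proof.
move=> ed; apply/cvgrPdist_lt => r r0; have [m xm] := ed x r r0.
by exists m => // n /= mn; exact: le_lt_trans (nearest_min _ _ mn) xm.
Qed.

Lemma smeas_idx (k : S -> nat) (c : nat -> V) :
  measurable_fun D k -> smeas (fun t => c (k t)).
Proof.
move=> /measurable_idxP mk; split => a.
by apply: (measurable_glue (h := fun n _ => `|c n - a|)) => // n;
  exact: measurable_cst.
Qed.

Lemma measurable_nearest e f n :
  smeas f -> measurable_fun D (fun t => nearest e (f t) n).
Proof.
move=> mf; elim: n => [|n IHn] /=; first exact: measurable_cst.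
apply: measurable_fun_if => //.
- apply: measurable_fun_ltr; first exact: smeas_dist mf _.
  apply: (measurable_glue (h := fun k t => `|f t - e k|)).
    exact/measurable_idxP.
  by move=> k; exact: smeas_dist mf _.
- exact: measurable_funS IHn.
Qed.

Lemma smeas_norm f : smeas f -> measurable_fun D (fun t => `|f t|).
Proof. by move=> /smeas_dist/(_ 0); under eq_fun do rewrite subr0. Qed.

Lemma smeas_cvg (f_ : nat -> S -> V) f : (forall n, smeas (f_ n)) ->
  (forall t, D t -> f_ n t @[n --> \oo] --> f t) -> smeas f.
Proof.
move=> mf_ ff; split => c.
apply: (measurable_fun_cvg (h := fun n t => `|f_ n t - c|)).
  by move=> n; exact: smeas_dist (mf_ n) c.
by move=> t Dt; apply: cvg_norm; apply: cvgB; [exact: ff|exact: cvg_cst].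
Qed.

Lemma smeas_glue (C : countType) (k : S -> C) (h : C -> S -> V) :
  (forall c, measurable (D `&` k @^-1` [set c])) ->
  (forall c, smeas (h c)) -> smeas (fun t => h (k t) t).
Proof.
move=> mk mh; split => c.
apply: (measurable_glue (h := fun k t => `|h k t - c|)) => // n.
exact: smeas_dist (mh n) c.
Qed.

End strong_measurability.
Arguments smeas {d S R} D {V} f.

Section smeas_theory.
Context d (S : measurableType d) (R : realType) (D : set S).
Hypothesis mD : measurable D.

(** The nearest-point approximations of [f] and [g] take countably many values, so [phi] applied to
    them is glued from constants; sequential continuity of [phi] carries measurability to the
    limit. *)
Lemma smeas_comp2 (V W U : normedModType R) (e : nat -> V) (e' : nat -> W)
    (phi : V -> W -> U) (f : S -> V) (g : S -> W) : dense_seq e -> dense_seq e' ->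
  (forall x y (xs : nat -> V) (ys : nat -> W), xs n @[n --> \oo] --> x ->
     ys n @[n --> \oo] --> y -> phi (xs n) (ys n) @[n --> \oo] --> phi x y) ->
  smeas D f -> smeas D g -> smeas D (fun t => phi (f t) (g t)).
Proof.
move=> de de' cphi mf mg.
pose k n t := (nearest e (f t) n, nearest e' (g t) n).
apply: (smeas_cvg (f_ := fun n t => phi (e (k n t).1) (e' (k n t).2))).
  move=> n; split => c.
  apply: (measurable_glue mD (k := k n)
    (h := fun k _ => `|phi (e k.1) (e' k.2) - c|)).
    by apply: measurable_idx_pair; apply/(measurable_idxP mD);
      exact: measurable_nearest.
  by move=> ?; exact: measurable_cst.
by move=> t _; apply: cphi; exact: nearest_cvg.
Qed.

Lemma smeasD (V : normedModType R) (e : nat -> V) (f g : S -> V) : dense_seq e ->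
  smeas D f -> smeas D g -> smeas D (f \+ g).
Proof.
move=> de; apply: (smeas_comp2 (phi := fun x y => x + y) de de).
by move=> x y xs ys; exact: cvgD.
Qed.

Lemma smeasB (V : normedModType R) (e : nat -> V) (f g : S -> V) : dense_seq e ->
  smeas D f -> smeas D g -> smeas D (f \- g).
Proof.
move=> de; apply: (smeas_comp2 (phi := fun x y => x - y) de de).
by move=> x y xs ys; exact: cvgB.
Qed.

Lemma smeas_measurable (f : S -> R) : measurable_fun D f -> smeas D f.
Proof.
move=> mf; split => c; apply: measurableT_comp => //.
by apply: measurable_funB => //; exact: measurable_cst.
Qed.

Lemma dense_seq_real : exists e : nat -> R, dense_seq e.
Proof.
pose e n : R := if unpickle n is Some q then ratr q else 0.
exists e => x r r0.
have /rat_in_itvoo[q] : x - r < x + r by lra.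
rewrite in_itv /= => /andP[xq qx]; exists (pickle q).
by rewrite /e pickleK ltr_distl; lra.
Qed.

End smeas_theory.

(** * Functions with finitely many values and their integrals *)

Section finite_index.
Context d (S : measurableType d) (R : realType).
Variables (mu : {measure set S -> \bar R}) (D : set S).
Hypotheses (mD : measurable D) (muD : (mu D < +oo)%E).

(** The labels lie in an arbitrary type, so that simple functions can be refined by pairing and then
    relabelled. *)
Definition fin_idx (C : Type) (k : S -> C) : Prop :=
  finite_set (k @` D) /\ forall c, measurable (D `&` k @^-1` [set c]).

Lemma fin_idx_comp (C C' : Type) (k : S -> C) (h : C -> C') :
  fin_idx k -> fin_idx (h \o k).
Proof.
move=> [fk mk]; split; first by rewrite -image_comp; exact: finite_image.
move=> c.
rewrite (_ : _ `&` _ =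
    \bigcup_(x in (k @` D) `&` h @^-1` [set c]) (D `&` k @^-1` [set x])).
  by apply: fin_bigcup_measurable => // ; exact: finite_setIl.
apply/seteqP; split => [t [Dt htc]|t [x [_ hxc] [Dt kt]]].
  by exists (k t) => //; split => //; exists t.
by split => //=; rewrite kt.
Qed.

Lemma fin_idx_pair (C C' : Type) (k : S -> C) (k' : S -> C') :
  fin_idx k -> fin_idx k' -> fin_idx (fun t => (k t, k' t)).
Proof.
move=> [fk mk] [fk' mk']; split; last exact: measurable_idx_pair.
apply: sub_finite_set (finite_setX fk fk') => _ [t Dt <-].
by split; exists t.
Qed.

Lemma measurable_fin_idx (C : Type) (k : S -> C) (h : C -> R) :
  fin_idx k -> measurable_fun D (h \o k).
Proof.
move=> /(fin_idx_comp h)[fh mh] _ Y _.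
rewrite (_ : _ `&` _ =
    \bigcup_(x in ((h \o k) @` D) `&` Y) (D `&` (h \o k) @^-1` [set x])).
  by apply: fin_bigcup_measurable => // ; exact: finite_setIl.
apply/seteqP; split => [t [Dt Yt]|t [x [_ Yx] [Dt kt]]].
  by exists (h (k t)) => //; split => //; exists t.
by split => //; rewrite /preimage /= in kt *; rewrite kt.
Qed.

Lemma fin_idx_bool (A : set S) : measurable A -> fin_idx (fun t => t \in A).
Proof.
move=> mA; split; first exact: finite_finset.
move=> b; rewrite (_ : _ `&` _ = D `&` if b then A else ~` A).
  by apply: measurableI => //; case: b => //; exact: measurableC.
apply/seteqP; split => [t [Dt /= <-]|t [Dt]].
  by split => //; case: ifPn => [/set_mem//|/negP tA At]; apply: tA; rewrite inE.
by case: b => At; split => //=; [exact: mem_set|exact: memNset].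
Qed.

Context {V : normedModType R}.
Implicit Types f g s : S -> V.

Lemma simple_onP s : simple_on mu D s <-> fin_idx s.
Proof.
split => [[fs ms]|[fs ms]]; split => // v; first exact: (ms v).1.
split => // _; apply: le_lt_trans muD; apply: le_measure; rewrite ?inE//.
Qed.

Lemma smeas_simple s : fin_idx s -> smeas D s.
Proof.
by move=> fs; split => c; apply: (measurable_fin_idx (fun x => `|x - c|) fs).
Qed.

Local Notation fmu A := (fine (mu A)).

(** The simple integral may be computed on any finer finite partition, by grouping the cells [x]
    with the same value [c x]. Linearity then reduces to the partition into common level sets. *)
Lemma simple_integral_idx (X : choiceType) (r : seq X) (k : S -> X) (c : X -> V) :
  uniq r -> (forall t, D t -> k t \in r) -> fin_idx k ->
  simple_integral mu D (c \o k) =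
  \sum_(x <- r) fmu (D `&` k @^-1` [set x]) *: c x.
Proof.
move=> ur kr [fk mk].
pose vs := undup (map c r).
rewrite /simple_integral (fsbig_fwiden vs) ?undup_uniq//; first last.
- move=> v [vr vD] /=; rewrite (_ : _ `&` _ = set0).
    by rewrite measure0 scale0r.
  by rewrite -subset0 => t [Dt ktv]; apply: vD; exists t.
- move=> _ [t Dt <-] /=; rewrite mem_undup; apply/mapP; exists (k t) => //.
  exact: kr.
have E v : fmu (D `&` (c \o k) @^-1` [set v]) =
    \sum_(x <- r | c x == v) fmu (D `&` k @^-1` [set x]).
  pose A := [set` [seq x <- r | c x == v]].
  rewrite (_ : _ `&` _ = \bigcup_(x in A) (D `&` k @^-1` [set x])); last first.
    apply/seteqP; split => [t [Dt ktv]|t [x]].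
      by exists (k t) => //; rewrite /A /= mem_filter kr// andbT; exact/eqP.
    by rewrite /A /= mem_filter => /andP[/eqP cx _] [Dt /= ktx]; split => //=; rewrite ktx.
  rewrite measure_fin_bigcup//; last first.
    by move=> x y _ _ [t [[_ /= <-] [_ /= <-]]].
    exact: finite_seq.
  rewrite /A -fsbig_seq ?filter_uniq// big_filter sum_fine// => x _.
  rewrite ge0_fin_numE//; apply: le_lt_trans muD.
  by apply: le_measure; rewrite ?inE//; exact: subIsetl.
under eq_bigr do rewrite E scaler_suml.
rewrite (exchange_big_dep xpredT)//=; apply: eq_big_seq => x xr.
rewrite -big_filter (_ : [seq _ <- _ | _] = [:: c x]) ?big_seq1//.
rewrite -(filter_pred1_uniq (undup_uniq (map c r)) (_ : c x \in _)).
  by apply: eq_filter => v /=; rewrite eq_sym.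
by rewrite mem_undup map_f.
Qed.

Lemma fin_idx_seq (X : choiceType) (k : S -> X) : fin_idx k ->
  exists2 r : seq X, uniq r & forall t, D t -> k t \in r.
Proof.
move=> [fk _]; exists (finmap.enum_fset (fset_set (k @` D))) => [|t Dt].
  exact: finmap.fset_uniq.
by rewrite in_fset_set// inE; exists t.
Qed.

Lemma integral_idx (X : choiceType) (r : seq X) (k : S -> X) (c : X -> R) :
  uniq r -> (forall t, D t -> k t \in r) -> fin_idx k -> (forall x, 0 <= c x) ->
  (\int[mu]_(t in D) (c (k t))%:E =
   (\sum_(x <- r) fmu (D `&` k @^-1` [set x]) * c x)%:E)%E.
Proof.
move=> ur kr [fk mk] c0.
transitivity (\int[mu]_(t in D)
    \sum_(x <- r) ((c x)%:E * (\1_(D `&` k @^-1` [set x]) t)%:E))%E.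
  apply: eq_integral => t; rewrite inE => Dt.
  rewrite (bigD1_seq (k t)) ?kr//= indicE mem_set// mule1 big1 ?adde0//.
  move=> x xk; rewrite indicE memNset ?mule0// => -[_ /= ktx].
  by rewrite ktx eqxx in xk.
rewrite ge0_integral_sum//; first last.
- by move=> x t _; rewrite -EFinM lee_fin mulr_ge0.
- move=> x; apply: emeasurable_funM => //; apply/measurable_EFinP.
  exact: measurable_indic.
rewrite -sumEFin; apply: eq_bigr => x _.
rewrite ge0_integralZl_EFin//; last first.
  by apply/measurable_EFinP; exact: measurable_indic.
rewrite integral_indic// setIAC setIid EFinM muleC fineK//.
rewrite ge0_fin_numE//; apply: le_lt_trans muD.
by apply: le_measure; rewrite ?inE//; exact: subIsetl.
Qed.

Lemma norm_simple_integral s : fin_idx s ->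
  (`|simple_integral mu D s|%:E <= \int[mu]_(t in D) `|s t|%:E)%E.
Proof.
move=> fs; have [r ur sr] := fin_idx_seq fs.
rewrite (simple_integral_idx id ur sr fs : simple_integral mu D s = _).
rewrite (@integral_idx _ r s (fun v => `|v|))// lee_fin.
rewrite (le_trans (ler_norm_sum _ _ _))// ler_sum// => v _.
by rewrite normrZ ger0_norm// fine_ge0.
Qed.

Lemma simple_integral_lin (a b : R) s s' : fin_idx s -> fin_idx s' ->
  simple_integral mu D (fun t => a *: s t + b *: s' t) =
  a *: simple_integral mu D s + b *: simple_integral mu D s'.
Proof.
move=> fs fs'; have fss := fin_idx_pair fs fs'.
have [r ur sr] := fin_idx_seq fss.
rewrite (simple_integral_idx (fun x : V * V => x.1) ur sr fss : _ = _ :> V).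
rewrite (simple_integral_idx (fun x : V * V => x.2) ur sr fss : _ = _ :> V).
rewrite (simple_integral_idx (fun x : V * V => a *: x.1 + b *: x.2) ur sr fss : _ = _ :> V).
rewrite !scaler_sumr -big_split/=; apply: eq_bigr => x _.
by rewrite scalerDr !scalerA mulrC (mulrC _ b).
Qed.

End finite_index.

Lemma cvg_of_cauchy (R : realType) (V : completeNormedModType R) (u : nat -> V) :
  (forall r, 0 < r -> exists N, forall n m, (N <= n)%N -> (N <= m)%N ->
    `|u n - u m| <= r) -> exists v : V, u n @[n --> \oo] --> v.
Proof.
move=> cu; apply/cvg_ex/cauchy_cvgP/cauchy_exP => r r0.
have [N uN] := cu (r / 2) (divr_gt0 r0 (ltr0Sn _ 1)); exists (u N), N => // n /= Nn.
rewrite -ball_normE /=; apply: le_lt_trans (uN _ _ (leqnn N) Nn) _; lra.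
Qed.

(** * Bochner integral *)

Section bochner_theory.
Context d (S : measurableType d) (R : realType).
Variables (mu : {measure set S -> \bar R}) (D : set S).
Hypotheses (mD : measurable D) (muD : (mu D < +oo)%E).
Hypothesis cmu : measure_is_complete mu.

(** Off the exceptional null set the convergence holds everywhere; completeness of [mu] makes the
    values on that set irrelevant. *)
Lemma ae_cvg_measurable (h : nat -> S -> R) (f : S -> R) :
  (forall n, measurable_fun D (h n)) ->
  {ae mu, forall t, D t -> h n t @[n --> \oo] --> f t} -> measurable_fun D f.
Proof.
move=> mh [N [mN N0 sN]].
have mf' : measurable_fun D (f \_ (D `\` N)).
  apply: (measurable_fun_cvg (h := fun n => h n \_ (D `\` N))) => [n|t Dt].
    apply/measurable_restrict => //; first exact: measurableD.
    exact: measurable_funS (mh n).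
  rewrite /restrict; case: ifPn => [|_]; last exact: cvg_cst.
  rewrite inE => -[_ tN]; apply: contrapT => ct; apply: tN; apply: sN => /=.
  by move=> /(_ Dt).
apply/measurable_EFinP.
apply: (ae_measurable_fun cmu (f := EFin \o (f \_ (D `\` N)))); last first.
  exact/measurable_EFinP.
exists N; split => // t /= tN; apply: contrapT => Nt; apply: tN => Dt.
by rewrite /restrict mem_set.
Qed.

Lemma smeas_ae_cvg (V : normedModType R) (f_ : nat -> S -> V) (f : S -> V) :
  (forall n, smeas D (f_ n)) ->
  {ae mu, forall t, D t -> f_ n t @[n --> \oo] --> f t} -> smeas D f.
Proof.
move=> mf_ ff; split => c.
apply: (ae_cvg_measurable (h := fun n t => `|f_ n t - c|)).
  by move=> n; exact: smeas_dist (mf_ n) c.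
apply: filterS ff => t ft Dt.
by apply: cvg_norm; apply: cvgB; [exact: ft|exact: cvg_cst].
Qed.

Section general.
Context {V : normedModType R}.
Implicit Types f g s : S -> V.

Lemma strong_smeas f : strongly_measurable mu D f -> smeas D f.
Proof.
move=> [s ss sf]; apply: smeas_ae_cvg sf => n.
by apply: smeas_simple; apply/(simple_onP mD muD).
Qed.

Lemma fin_idx_lin (a b : R) s s' : fin_idx D s -> fin_idx D s' ->
  fin_idx D (fun t => a *: s t + b *: s' t).
Proof.
move=> fs fs'.
exact: (fin_idx_comp (fun x : V * V => a *: x.1 + b *: x.2) (fin_idx_pair fs fs')).
Qed.

Lemma strong_simple s : fin_idx D s -> strongly_measurable mu D s.
Proof.
move=> fs; exists (fun=> s); first by move=> _; apply/simple_onP.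
by apply: aeW => t _; exact: cvg_cst.
Qed.

Lemma strong_lin (a b : R) f g : strongly_measurable mu D f ->
  strongly_measurable mu D g ->
  strongly_measurable mu D (fun t => a *: f t + b *: g t).
Proof.
move=> [s ss sf] [s' ss' sg].
exists (fun n t => a *: s n t + b *: s' n t).
  by move=> n; apply/(simple_onP mD muD)/(fin_idx_lin a b); apply/(simple_onP mD muD).
apply: filterS2 sf sg => t sf sg Dt.
by apply: cvgD; apply: cvgZl_tmp; [exact: sf|exact: sg].
Qed.

Lemma strong_ext f g : (forall t, D t -> f t = g t) ->
  strongly_measurable mu D f -> strongly_measurable mu D g.
Proof.
move=> fg [s ss sf]; exists s => //; apply: filterS sf => t sf Dt.
by rewrite -fg//; exact: sf.
Qed.

Lemma measurable_strong_norm f : strongly_measurable mu D f ->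
  measurable_fun D (fun t => `|f t|).
Proof. by move=> /strong_smeas/smeas_norm. Qed.

Lemma integral_norm_lin (a b : R) f g : strongly_measurable mu D f ->
  strongly_measurable mu D g ->
  (\int[mu]_(t in D) `|a *: f t + b *: g t|%:E <=
   `|a|%:E * \int[mu]_(t in D) `|f t|%:E +
   `|b|%:E * \int[mu]_(t in D) `|g t|%:E)%E.
Proof.
move=> mf mg; have ma := measurable_strong_norm (strong_lin a b mf mg).
move/measurable_strong_norm : mf => mf; move/measurable_strong_norm : mg => mg.
have mc c (h : S -> V) : measurable_fun D (fun t => `|h t|) ->
    measurable_fun D (fun t => (c%:E * `|h t|%:E)%E).
  by move=> mh; apply: emeasurable_funM => //; exact/measurable_EFinP.
rewrite -!ge0_integralZl_EFin//; [|exact/measurable_EFinP..].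
rewrite -ge0_integralD//; [|exact: mc..].
apply: ge0_le_integral => //.
- exact/measurable_EFinP.
- by apply: emeasurable_funD; exact: mc.
- by move=> t Dt; rewrite -!EFinM -EFinD lee_fin -!normrZ ler_normD.
Qed.

Lemma bochner_ext f g v : (forall t, D t -> f t = g t) ->
  is_bochner_integral mu D f v -> is_bochner_integral mu D g v.
Proof.
move=> fg [mf [s [ss sf sv]]]; split; first exact: strong_ext mf.
exists s; split => //; apply: cvg_trans sf; apply: near_eq_cvg; near=> n.
by apply: eq_integral => t; rewrite inE => /fg ->.
Unshelve. all: by end_near. Qed.

Lemma bochner_lin (a b : R) f g v w : is_bochner_integral mu D f v ->
  is_bochner_integral mu D g w ->
  is_bochner_integral mu D (fun t => a *: f t + b *: g t) (a *: v + b *: w).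
Proof.
move=> [mf [s [ss sf sv]]] [mg [s' [ss' sg sw]]]; split; first exact: strong_lin.
have fs n : fin_idx D (s n) by apply/(simple_onP mD muD).
have fs' n : fin_idx D (s' n) by apply/(simple_onP mD muD).
exists (fun n t => a *: s n t + b *: s' n t); split.
- by move=> n; apply/(simple_onP mD muD)/fin_idx_lin.
- apply: (@squeeze_cvge _ _ _ _ (cst 0%E) _ (fun n =>
    `|a|%:E * \int[mu]_(t in D) `|f t - s n t|%:E +
    `|b|%:E * \int[mu]_(t in D) `|g t - s' n t|%:E)%E).
  + near=> n; rewrite integral_ge0//=.
    have E (x y : V) : x - y = 1 *: x + (-1) *: y.
      by rewrite scale1r scaleN1r.
    have H1 := strong_lin 1 (-1) mf (strong_simple (fs n)).
    have H2 := strong_lin 1 (-1) mg (strong_simple (fs' n)).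
    under [X in (_ <= _ * X + _)%E]eq_integral do rewrite E.
    under [X in (_ <= _ + _ * X)%E]eq_integral do rewrite E.
    apply: le_trans (integral_norm_lin a b H1 H2).
    apply: ge0_le_integral => //.
    * apply/measurable_EFinP; under eq_fun do rewrite E; apply: measurable_strong_norm.
      apply: strong_lin; first exact: strong_lin.
      by apply: strong_simple; exact: fin_idx_lin.
    * by apply/measurable_EFinP; apply: measurable_strong_norm; exact: strong_lin.
    * by move=> t _; rewrite lee_fin !scale1r !scaleN1r !scalerBr opprD addrACA.
  + exact: cvg_cst.
  + rewrite -[X in _ --> X](_ : (`|a|%:E * 0 + `|b|%:E * 0)%E = _); last first.
      by rewrite !mule0 adde0.
    by apply: cvgeD; [rewrite !mule0|exact: cvgeZl|exact: cvgeZl].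
- under eq_fun do rewrite (simple_integral_lin mD muD)//.
  by apply: cvgD; apply: cvgZl_tmp.
Unshelve. all: by end_near. Qed.

Lemma bochner_norm f v : is_bochner_integral mu D f v ->
  (`|v|%:E <= \int[mu]_(t in D) `|f t|%:E)%E.
Proof.
move=> [mf [s [ss sf sv]]].
have fs n : fin_idx D (s n) by apply/(simple_onP mD muD).
have H1 : `|simple_integral mu D (s n)|%:E @[n --> \oo] --> `|v|%:E.
  by apply: cvg_EFin; [exact: nearW|exact: cvg_norm].
have H2 : (\int[mu]_(t in D) `|f t|%:E +
    \int[mu]_(t in D) `|f t - s n t|%:E)%E @[n --> \oo] -->
    (\int[mu]_(t in D) `|f t|%:E + 0)%E.
  apply: cvgeD => //; last exact: cvg_cst.
  by rewrite ge0_adde_def// inE// integral_ge0// => t _; rewrite lee_fin.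
rewrite -(cvg_lim _ H1)// -[X in (_ <= X)%E]adde0 -(cvg_lim _ H2)//.
apply: lee_lim; [by apply/cvg_ex; eexists; exact: H1|
  by apply/cvg_ex; eexists; exact: H2|].
near=> n; apply: le_trans (norm_simple_integral mD muD (fs n)) _.
have := integral_norm_lin 1 (-1) mf
  (strong_lin 1 (-1) mf (strong_simple (fs n))).
rewrite normrN normr1 !mul1e; under eq_integral => t _.
  rewrite !scale1r !scaleN1r opprB addrCA subrr addr0; over.
move/le_trans; apply; rewrite leeD2l//.
by under eq_integral do rewrite scale1r scaleN1r.
Unshelve. all: by end_near. Qed.

Lemma bochner_sub_norm f g v w : is_bochner_integral mu D f v ->
  is_bochner_integral mu D g w ->
  (`|v - w|%:E <= \int[mu]_(t in D) `|f t - g t|%:E)%E.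
Proof.
move=> fv gw; have := bochner_norm (bochner_lin 1 (-1) fv gw).
rewrite scale1r scaleN1r.
by under eq_integral do rewrite scale1r scaleN1r.
Qed.

Lemma bochner_unique f v w : is_bochner_integral mu D f v ->
  is_bochner_integral mu D f w -> v = w.
Proof.
move=> fv fw; apply/eqP; rewrite -subr_eq0 -normr_le0 -lee_fin.
apply: le_trans (bochner_sub_norm fv fw) _.
by under eq_integral do rewrite subrr normr0; rewrite integral0.
Qed.

End general.

Lemma simple_approx (V : normedModType R) (e : nat -> V) (f : S -> V) : dense_seq e ->
  smeas D f -> exists s : nat -> S -> V,
  [/\ forall n, fin_idx D (s n), forall n t, `|f t - s n t| <= `|f t| &
      forall t, s n t @[n --> \oo] --> f t].
Proof.
(* With 0 put in front of the dense sequence, the nearest point is at least as close to [f t] as 0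
   is; this is the domination by the norm of [f t]. *)
move=> de mf; pose e0 n := if n is n'.+1 then e n' else 0.
have de0 : dense_seq e0.
  by move=> x r r0; have [n xn] := de x r r0; exists n.+1.
exists (fun n t => e0 (nearest e0 (f t) n)); split.
- move=> n; apply: fin_idx_comp; split.
    apply: (sub_finite_set _ (finite_II n.+1)) => _ [t _ <-] /=.
    by rewrite ltnS; exact: nearest_le.
  by apply/(measurable_idxP mD); exact: measurable_nearest.
- by move=> n t; have := nearest_min e0 (f t) (leq0n n); rewrite subr0.
- by move=> t; exact: nearest_cvg.
Qed.

Lemma smeas_strong (V : normedModType R) (e : nat -> V) (f : S -> V) : dense_seq e ->
  smeas D f -> strongly_measurable mu D f.
Proof.
move=> de /(simple_approx de)[s [fs _ sf]]; exists s.
  by move=> n; apply/simple_onP.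
by apply: aeW => t _; exact: sf.
Qed.

Lemma bochner_exists (V : completeNormedModType R) (e : nat -> V) (f : S -> V) :
  dense_seq e -> smeas D f -> (\int[mu]_(t in D) `|f t|%:E < +oo)%E ->
  exists v, is_bochner_integral mu D f v.
Proof.
move=> de mf intf; have sf := smeas_strong de mf.
have [s [fs sf_ sfc]] := simple_approx de mf.
have dsf n : strongly_measurable mu D (fun t => f t - s n t).
  apply: (strong_ext _ (strong_lin 1 (-1) sf (strong_simple (fs n)))) => t _.
  by rewrite scale1r scaleN1r.
have s0 : (\int[mu]_(t in D) `|f t - s n t|%:E @[n --> \oo] --> 0)%E.
  have [|||||_ _] := @dominated_convergence _ _ _ mu D mD
      (fun n t => `|f t - s n t|%:E) (cst 0%E) (fun t => `|f t|%:E).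
  - by move=> n; apply/measurable_EFinP; exact: measurable_strong_norm.
  - exact: measurable_cst.
  - apply: aeW => t Dt; apply: cvg_EFin; first exact: nearW.
    have -> : 0 = `|f t - f t| by rewrite subrr normr0.
    by apply: cvg_norm; apply: cvgB; [exact: cvg_cst|exact: sfc].
  - apply/integrableP; split; last by under eq_integral do rewrite abse_EFin normr_id.
    by apply/measurable_EFinP; exact: measurable_strong_norm.
  - by apply: aeW => t n Dt; rewrite abse_EFin normr_id lee_fin.
  by rewrite integral0.
have cs n m : (`|simple_integral mu D (s n) - simple_integral mu D (s m)|%:E <=
    \int[mu]_(t in D) `|f t - s n t|%:E + \int[mu]_(t in D) `|f t - s m t|%:E)%E.
  have := simple_integral_lin mD muD 1 (-1) (fs n) (fs m).
  rewrite scale1r scaleN1r => <-.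
  apply: le_trans (norm_simple_integral mD muD _) _; first exact: fin_idx_lin.
  have := integral_norm_lin (-1) 1 (dsf n) (dsf m).
  rewrite normrN normr1 !mul1e; apply: le_trans.
  rewrite le_eqVlt; apply/orP; left; apply/eqP; apply: eq_integral => t _.
  by rewrite !scale1r !scaleN1r opprB addrA subrK.
have [r r0|v sv] := cvg_of_cauchy (u := fun n => simple_integral mu D (s n)).
  have /fine_cvgP[fin /cvgrPdist_lt/(_ (r / 2) (divr_gt0 r0 (ltr0Sn _ 1)))] := s0.
  rewrite (_ : @fine R \o _ = fun n =>
    fine (\int[mu]_(t in D) `|f t - s n t|%:E)%E)// => small.
  have [N _ NP] := filterI fin small; exists N => n m Nn Nm.
  have [finn smn] := NP n Nn; have [finm smm] := NP m Nm.
  have := cs n m; rewrite -(fineK finn) -(fineK finm) -EFinD lee_fin.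
  move: smn smm; rewrite /= !sub0r !normrN.
  move=> /(le_lt_trans (ler_norm _)) + /(le_lt_trans (ler_norm _)).
  by move: (simple_integral _ _ (s n)) => *; lra.
exists v; split => //; exists s; split => // n.
by apply/simple_onP.
Qed.

End bochner_theory.

(** * L^p norms *)

(* Locked: unification would otherwise unfold the integrals. *)
HB.lock Definition nint {d} {S : measurableType d} {R : realType}
    (mu : {measure set S -> \bar R}) (D : set S) (p : R) {V : normedModType R}
    (f : S -> V) : \bar R :=
  (\int[mu]_(t in D) (`|f t| `^ p)%:E)%E.
Canonical locked_nint := Unlockable nint.unlock.
Arguments nint {d S R} mu D p {V} f.

HB.lock Definition Lnrm {d} {S : measurableType d} {R : realType}
    (mu : {measure set S -> \bar R}) (D : set S) (p : R) {V : normedModType R}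
    (f : S -> V) : R :=
  fine (nint mu D p f) `^ p^-1.
Canonical locked_Lnrm := Unlockable Lnrm.unlock.
Arguments Lnrm {d S R} mu D p {V} f.

Section Lp_theory.
Context d (S : measurableType d) (R : realType).
Variables (mu : {measure set S -> \bar R}) (D : set S) (p : R).
Hypotheses (mD : measurable D) (p1 : 1 <= p).

Let p0 : 0 < p. Proof. exact: lt_le_trans ltr01 p1. Qed.
Let pN0 : p != 0. Proof. by rewrite gt_eqF. Qed.
Let pV0 : 0 <= p^-1. Proof. by rewrite invr_ge0 ltW. Qed.

Section defs.
Context {V : normedModType R}.
Implicit Types f : S -> V.

Local Notation nint := (nint mu D p).
Local Notation Lnrm := (Lnrm mu D p).

Lemma nint_integral f : nint f = (\int[mu]_(t in D) (`|f t| `^ p)%:E)%E.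
Proof. by rewrite unlock. Qed.

Definition Lp (f : S -> V) : Prop := smeas D f /\ (nint f < +oo)%E.

Lemma nint_ge0 f : (0 <= nint f)%E.
Proof. by rewrite nint_integral; apply: integral_ge0 => t _; rewrite lee_fin powR_ge0. Qed.

Lemma LnrmE f : Lnrm f = fine (nint f) `^ p^-1.
Proof. by rewrite unlock. Qed.

Lemma Lnrm_ge0 f : 0 <= Lnrm f. Proof. by rewrite LnrmE powR_ge0. Qed.

Lemma measurable_norm_powR f :
  smeas D f -> measurable_fun D (fun t => (`|f t| `^ p)%:E).
Proof.
move=> /smeas_norm mf; apply/measurable_EFinP.
exact: (measurableT_comp (measurable_powR _)).
Qed.

Lemma powRKV (x : R) : 0 <= x -> (x `^ p^-1) `^ p = x.
Proof. by move=> x0; rewrite -powRrM mulVf// powRr1. Qed.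

Lemma powRK (x : R) : 0 <= x -> (x `^ p) `^ p^-1 = x.
Proof. by move=> x0; rewrite -powRrM mulfV// powRr1. Qed.

Lemma nintE f : Lp f -> nint f = (Lnrm f `^ p)%:E.
Proof.
move=> [mf foo]; rewrite LnrmE powRKV ?fine_ge0 ?nint_ge0// fineK//.
by rewrite ge0_fin_numE ?nint_ge0.
Qed.

Lemma nint_le f r : 0 <= r -> (nint f <= (r `^ p)%:E)%E -> Lnrm f <= r.
Proof.
move=> r0 fr; rewrite -[leRHS]powRK// LnrmE ge0_ler_powR// ?nnegrE.
- by rewrite fine_ge0 ?nint_ge0.
- exact: powR_ge0.
- rewrite -lee_fin fineK// ge0_fin_numE ?nint_ge0//.
  exact: le_lt_trans fr (ltry _).
Qed.

Lemma nint_le_powR f r : Lp f -> Lnrm f <= r -> (nint f <= (r `^ p)%:E)%E.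
Proof.
move=> Lf fr; rewrite nintE// lee_fin ge0_ler_powR ?nnegrE ?(ltW p0) ?Lnrm_ge0//.
exact: le_trans (Lnrm_ge0 _) fr.
Qed.

Lemma Lp_nint_le f r : smeas D f -> (nint f <= r%:E)%E -> Lp f.
Proof. by move=> mf fr; split => //; exact: le_lt_trans fr (ltry _). Qed.

End defs.
Arguments nint_ge0 {V} f.
Arguments Lnrm_ge0 {V} f.
Local Notation nint := (nint mu D p).
Local Notation Lnrm := (Lnrm mu D p).

Lemma powR_norm_le (x y : R) : 0 <= x -> x <= y -> x `^ p <= y `^ p.
Proof.
by move=> x0 xy; rewrite ge0_ler_powR ?nnegrE ?(ltW p0)// (le_trans x0).
Qed.

Lemma nint_mono (U V : normedModType R) (h : S -> U) (f : S -> V) :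
  smeas D h -> smeas D f -> {ae mu, forall t, D t -> `|h t| <= `|f t|} ->
  (nint h <= nint f)%E.
Proof.
move=> mh mf hf; rewrite !nint_integral; apply: ae_ge0_le_integral => //.
- exact: measurable_norm_powR.
- exact: measurable_norm_powR.
- by apply: filterS hf => t ht Dt; rewrite lee_fin powR_norm_le ?ht.
Qed.

Lemma Lp_mono (U V : normedModType R) (h : S -> U) (f : S -> V) :
  smeas D h -> Lp f -> {ae mu, forall t, D t -> `|h t| <= `|f t|} -> Lp h.
Proof.
move=> mh Lf hf; split => //; apply: le_lt_trans (Lf.2).
by apply: nint_mono => //; case: Lf.
Qed.

Lemma Lnrm_mono (U V : normedModType R) (h : S -> U) (f : S -> V) :
  smeas D h -> Lp f -> {ae mu, forall t, D t -> `|h t| <= `|f t|} ->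
  Lnrm h <= Lnrm f.
Proof.
move=> mh Lf hf; apply: nint_le; first exact: Lnrm_ge0.
by rewrite -nintE; [apply: nint_mono => //; case: Lf|].
Qed.

Lemma Lnorm_patchE (h : S -> R) :
  ('N[mu]_p%:E[EFin \o (h \_ D)] =
   (\int[mu]_(t in D) (`|h t| `^ p)%:E) `^ p^-1)%E.
Proof.
rewrite unlock [in RHS]integral_mkcond; congr (_ `^ _)%E.
apply: eq_integral => t _; rewrite /= /patch.
by case: ifPn => //= _; rewrite normr0 powR0.
Qed.

Lemma Lnorm_norm_patchE (V : normedModType R) (f : S -> V) :
  ('N[mu]_p%:E[EFin \o ((fun t => `|f t|%R) \_ D)] = nint f `^ p^-1)%E.
Proof.
rewrite Lnorm_patchE nint_integral; apply: (congr1 (poweR ^~ p^-1)).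
by apply: eq_integral => t _; rewrite normr_id.
Qed.

Lemma poweR_tri (a : \bar R) (x y : R) : (0 <= a)%E -> 0 <= x -> 0 <= y ->
  (a `^ p^-1 <= (x `^ p)%:E `^ p^-1 + (y `^ p)%:E `^ p^-1)%E ->
  (a <= ((x + y) `^ p)%:E)%E.
Proof.
move=> a0 x0 y0; rewrite !poweR_EFin !powRK// -EFinD => H.
case: a a0 H => [a||//]; rewrite ?lee_fin => a0; last first.
  by rewrite poweRyr ?invr_eq0 ?leye_eq.
rewrite -{2}(powRKV a0) => /powR_norm_le; apply.
exact: powR_ge0.
Qed.

(** Minkowski's inequality for |f| and |g|. Asking only that |h| be dominated by the sum, with three
    possibly different spaces, covers sums, differences and patched functions at once. *)
Lemma nint_tri (U V W : normedModType R) (h : S -> U) (f : S -> V) (g : S -> W) :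
  smeas D h -> Lp f -> Lp g ->
  {ae mu, forall t, D t -> `|h t| <= `|f t| + `|g t|} ->
  (nint h <= ((Lnrm f + Lnrm g) `^ p)%:E)%E.
Proof.
move=> mh Lf Lg hfg; have [mf _] := Lf; have [mg _] := Lg.
pose s t := `|f t| + `|g t|.
have ms : measurable_fun D s by apply: measurable_funD; exact: smeas_norm.
apply: (@le_trans _ _ (nint (s : S -> R))).
  apply: nint_mono => //; first exact: smeas_measurable.
  by apply: filterS hfg => t ht Dt; rewrite (ger0_norm (addr_ge0 _ _))// ht.
have mpatch (V' : normedModType R) (f' : S -> V') : smeas D f' ->
    measurable_fun setT ((fun t => `|f' t|) \_ D).
  by move=> mf'; apply/(measurable_restrict _ mD measurableT); rewrite setTI;
    exact: smeas_norm.
have := minkowski_EFin mu (mpatch _ _ mf) (mpatch _ _ mg) p1.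
rewrite (_ : (_ \+ _) = s \_ D); last first.
  by apply/funext => t /=; rewrite /patch; case: ifPn => // _; rewrite addr0.
rewrite Lnorm_patchE !Lnorm_norm_patchE (nintE Lf) (nintE Lg).
rewrite -(nint_integral (s : S -> R)).
by apply: poweR_tri; rewrite ?nint_ge0 ?Lnrm_ge0.
Qed.

Lemma Lp_tri (U V W : normedModType R) (h : S -> U) (f : S -> V) (g : S -> W) :
  smeas D h -> Lp f -> Lp g ->
  {ae mu, forall t, D t -> `|h t| <= `|f t| + `|g t|} -> Lp h.
Proof. by move=> mh Lf Lg hfg; apply: Lp_nint_le (nint_tri mh Lf Lg hfg). Qed.

Lemma Lnrm_tri (U V W : normedModType R) (h : S -> U) (f : S -> V) (g : S -> W) :
  smeas D h -> Lp f -> Lp g ->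
  {ae mu, forall t, D t -> `|h t| <= `|f t| + `|g t|} ->
  Lnrm h <= Lnrm f + Lnrm g.
Proof.
move=> mh Lf Lg hfg; apply: nint_le; first by rewrite addr_ge0// Lnrm_ge0.
exact: nint_tri.
Qed.

Lemma nint_scale (V : normedModType R) (f : S -> V) (c : R) : 0 <= c -> Lp f ->
  (nint (fun t => c *: f t) = ((c * Lnrm f) `^ p)%:E)%E.
Proof.
move=> c0 Lf; rewrite powRM// ?Lnrm_ge0// EFinM -nintE// !nint_integral.
rewrite -ge0_integralZl_EFin// ?powR_ge0//.
- by apply: eq_integral => t _; rewrite normrZ ger0_norm// powRM// EFinM.
- by apply: measurable_norm_powR; case: Lf.
Qed.

Lemma smeas_scale (V : normedModType R) (f : S -> V) (c : R) :
  smeas D f -> smeas D (fun t => c *: f t).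
Proof.
have [->|c0] := eqVneq c 0.
  move=> mf; split => a; under eq_fun do rewrite scale0r.
  exact: measurable_cst.
move=> mf; split => a; rewrite (_ : (fun _ => _) = fun t => `|c| * `|f t - c^-1 *: a|).
  by apply: measurable_funM => //; exact: smeas_dist mf _.
by apply/funext => t; rewrite -normrZ scalerBr scalerA divff// scale1r.
Qed.

Lemma Lp_scale (V : normedModType R) (f : S -> V) (c : R) :
  0 <= c -> Lp f -> Lp (fun t => c *: f t).
Proof.
move=> c0 Lf; apply: Lp_nint_le; first by apply: smeas_scale; case: Lf.
by rewrite nint_scale.
Qed.

Lemma Lnrm_scale (V : normedModType R) (f : S -> V) (c : R) :
  0 <= c -> Lp f -> Lnrm (fun t => c *: f t) = c * Lnrm f.
Proof.
by move=> c0 Lf; rewrite {1}LnrmE nint_scale//= powRK// mulr_ge0// Lnrm_ge0.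
Qed.

Lemma Lnrm_dom (U V : normedModType R) (h : S -> U) (f : S -> V) (c : R) :
  smeas D h -> 0 <= c -> Lp f ->
  {ae mu, forall t, D t -> `|h t| <= c * `|f t|} -> Lnrm h <= c * Lnrm f.
Proof.
move=> mh c0 Lf hf; rewrite -Lnrm_scale//.
apply: Lnrm_mono; [by []|exact: Lp_scale|].
by apply: filterS hf => t ht Dt; rewrite normrZ ger0_norm// ht.
Qed.

Lemma nint_cst (V : normedModType R) (c : V) :
  nint (fun=> c) = ((`|c| `^ p)%:E * mu D)%E.
Proof. by rewrite nint_integral integral_cst. Qed.

Lemma Lp_cst (V : normedModType R) (c : V) : (mu D < +oo)%E -> Lp (fun=> c).
Proof.
move=> muD; split; first by split => a; exact: measurable_cst.
by rewrite nint_cst lte_mul_pinfty// lee_fin powR_ge0.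
Qed.

Lemma Lnrm_cvg0 (V : normedModType R) (f : nat -> S -> V) (g : S -> R) :
  (forall n, smeas D (f n)) -> Lp g ->
  (\forall n \near \oo, {ae mu, forall t, D t -> `|f n t| <= `|g t|}) ->
  {ae mu, forall t, D t -> f n t @[n --> \oo] --> (0 : V)} ->
  Lnrm (f n) @[n --> \oo] --> (0 : R).
Proof.
(* The domination is only eventual, hence the shift by [M] before dominated convergence. *)
move=> mf Lg [M _ fg] f0; rewrite -(cvg_shiftn M).
have [|||||_ _] := @dominated_convergence _ _ _ mu D mD
    (fun n t => (`|f (n + M)%N t| `^ p)%:E) (cst 0%E) (fun t => (`|g t| `^ p)%:E).
- by move=> n; exact: measurable_norm_powR.
- exact: measurable_cst.
- apply: filterS f0 => t f0 Dt.
  apply: cvg_EFin; first exact: nearW.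
  apply/cvgrPdist_lt => r r0; near=> n.
  rewrite sub0r normrN ger0_norm ?powR_ge0//= -[ltRHS]powRKV ?(ltW r0)//.
  rewrite gt0_ltr_powR ?nnegrE ?powR_ge0//.
  near: n; have : f (n + M)%N t @[n --> \oo] --> (0 : V).
    by rewrite (cvg_shiftn M (fun n => f n t)); exact: f0.
  move=> /cvgrPdist_lt/(_ (r `^ p^-1)); rewrite powR_gt0// => /(_ isT).
  by apply: filterS => n; rewrite sub0r normrN.
- apply/integrableP; split; first by apply: measurable_norm_powR; case: Lg.
  under eq_integral do rewrite abse_EFin ger0_norm ?powR_ge0//.
  by rewrite -nint_integral; case: Lg.
- apply: ae_foralln => n; have := fg (n + M)%N (leq_addl _ _).
  apply: filterS => t fgt Dt.
  by rewrite abse_EFin ger0_norm ?powR_ge0// lee_fin powR_norm_le// fgt.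
rewrite integral0 => H; apply/cvgrPdist_lt => r r0.
have rp : 0 < r `^ p by rewrite powR_gt0.
have /fine_cvgP[_ /cvgrPdist_lt/(_ _ rp)] := H.
apply: filterS => n /=; rewrite !sub0r !normrN -nint_integral => nr.
rewrite ger0_norm ?Lnrm_ge0// LnrmE -[ltRHS]powRK ?(ltW r0)//.
rewrite gt0_ltr_powR ?invr_gt0 ?nnegrE ?fine_ge0 ?nint_ge0 ?powR_ge0//.
exact: le_lt_trans (ler_norm _) nr.
Unshelve. all: by end_near. Qed.

End Lp_theory.

(** * Completeness of L^p *)

Section Lp_completeness.
Context d (S : measurableType d) (R : realType).
Variables (mu : {measure set S -> \bar R}) (D : set S) (p : R).
Hypotheses (mD : measurable D) (muD : (mu D < +oo)%E).
Hypothesis cmu : measure_is_complete mu.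
Hypothesis p1 : 1 <= p.

Local Notation nint := (nint mu D p).
Local Notation Lnrm := (Lnrm mu D p).
Local Notation Lp := (Lp mu D p).

Let p0 : 0 < p. Proof. exact: lt_le_trans ltr01 p1. Qed.

(** Minkowski bounds the partial sums of |f n| in L^p. By monotone convergence their p-th powers
    have an integrable, hence almost everywhere finite, limit, and [G] is its p-th root. *)
Lemma Lp_sum_bound (V : normedModType R) (f : nat -> S -> V) (c : nat -> R) (C : R) :
  (forall n, Lp (f n)) -> (forall n, Lnrm (f n) <= c n) ->
  (forall m, \sum_(n < m) c n <= C) ->
  exists G : S -> R, [/\ Lp G, forall t, 0 <= G t, Lnrm G <= C &
    {ae mu, forall t, D t -> forall m, \sum_(n < m) `|f n t| <= G t}].
Proof.
move=> Lf fc cC; pose s m t : R := \sum_(n < m) `|f n t|.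
have s0 m t : 0 <= s m t by exact: sumr_ge0.
have C0 : 0 <= C by have := cC 0; rewrite big_ord0.
have [Ls sc] : (forall m, Lp (s m)) /\ forall m, Lnrm (s m) <= \sum_(n < m) c n.
  apply: all_and2; elim=> [|m [IH1 IH2]].
    have E : s 0 = fun=> 0 by apply/funext => t; rewrite /s big_ord0.
    rewrite E big_ord0; split; first exact: Lp_cst.
    have L0 : Lp (fun=> 0 : R) by exact: Lp_cst.
    rewrite -[leRHS](mul0r (Lnrm (fun=> 0 : R))).
    apply: (Lnrm_dom mD p1 L0.1 (lexx 0) L0).
    by apply: aeW => t _; rewrite mul0r normr0.
  have ms : smeas D (s m.+1).
    apply: smeas_measurable; rewrite (_ : s _ = fun t => s m t + `|f m t|).
      apply: measurable_funD; last by apply: smeas_norm; case: (Lf m).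
      have := smeas_norm IH1.1; apply: eq_measurable_fun => t _.
      by rewrite ger0_norm.
    by apply/funext => t; rewrite /s big_ord_recr.
  have sle : {ae mu, forall t, D t -> `|s m.+1 t| <= `|s m t| + `|f m t|}.
    by apply: aeW => t _; rewrite !ger0_norm// /s big_ord_recr.
  split; first exact: (Lp_tri mD p1 ms IH1 (Lf m) sle).
  rewrite big_ord_recr/=; apply: le_trans (lerD IH2 (fc m)).
  exact: (Lnrm_tri mD p1 ms IH1 (Lf m) sle).
pose h m t := (s m t `^ p)%:E.
have hE m t : (`|s m t| `^ p)%:E = h m t by rewrite ger0_norm.
have mh m : measurable_fun D (h m).
  have := measurable_norm_powR p (Ls m).1.
  by apply: eq_measurable_fun => t _; rewrite hE.
have h0 m t : D t -> (0 <= h m t)%E by move=> _; rewrite lee_fin powR_ge0.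
have ndh t : D t -> {homo h ^~ t : n m / (n <= m)%N >-> (n <= m)%E}.
  move=> Dt; apply/nondecreasing_seqP => m.
  by rewrite lee_fin powR_norm_le// /s big_ord_recr lerDl.
pose H t := limn (h ^~ t).
have cvgh t : D t -> h m t @[m --> \oo] --> H t.
  by move=> /ndh /ereal_nondecreasing_is_cvgn.
have mH : measurable_fun D H by exact: emeasurable_fun_cvg mh cvgh.
have H0 t : D t -> (0 <= H t)%E.
  move=> Dt; rewrite /H; apply: lime_ge; first by apply/cvg_ex; eexists; exact: cvgh.
  by apply: nearW => m; exact: h0.
have hH m t : D t -> (h m t <= H t)%E.
  move=> Dt; apply: lime_ge; first by apply/cvg_ex; eexists; exact: cvgh.
  by exists m => // n /= mn; exact: ndh.
have intH : (\int[mu]_(t in D) H t <= (C `^ p)%:E)%E.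
  have cvgI := @cvg_monotone_convergence _ _ _ mu D mD h mh (fun n => h0 n) ndh.
  rewrite -(cvg_lim _ cvgI)//; apply: lime_le.
    by apply/cvg_ex; eexists; exact: cvgI.
  apply: nearW => m; have := nint_le_powR p1 (Ls m) (le_trans (sc m) (cC m)).
  by rewrite nint_integral; under eq_integral do rewrite hE.
have finH : {ae mu, forall t, D t -> H t \is a fin_num}.
  apply: integrable_ae => //; apply/integrableP; split => //.
  rewrite (eq_integral H); last by move=> t; rewrite inE => Dt; rewrite gee0_abs// H0.
  exact: le_lt_trans intH (ltry _).
pose G t := fine (H t) `^ p^-1.
have G0 t : 0 <= G t by exact: powR_ge0.
have mG : smeas D G.
  apply: smeas_measurable; apply: (measurableT_comp (measurable_powR _)).
  exact: measurableT_comp.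
have nG : (nint G <= (C `^ p)%:E)%E.
  rewrite nint_integral; apply: le_trans intH; apply: ge0_le_integral => //.
  - exact: measurable_norm_powR.
  - move=> t Dt; rewrite ger0_norm// /G.
    have := H0 _ Dt; case: (H t) => [r||]; rewrite ?lee_fin//.
      by move=> r0; rewrite (powRKV p1).
    by move=> _; rewrite leey.
exists G; split => //.
- exact: Lp_nint_le nG.
- exact: (nint_le p1 C0 nG).
- apply: filterS finH => t finHt Dt m; have := hH m t Dt.
  rewrite -(fineK (finHt Dt)) lee_fin -(powRKV p1 (fine_ge0 (H0 t Dt))) => sG.
  change (s m t <= G t); rewrite -(powRK p1 (s0 m t)) -[leRHS](powRK p1 (G0 t)).
  by rewrite ge0_ler_powR ?invr_ge0 ?(ltW p0) ?nnegrE ?powR_ge0.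
Qed.

Lemma geometric_sum_le (c : R) N m : 0 <= c ->
  \sum_(n < m) c / 2 ^+ (N + n) <= 2 * c / 2 ^+ N.
Proof.
move=> c0; suff -> : \sum_(n < m) c / 2 ^+ (N + n) =
    2 * c / 2 ^+ N - 2 * c / 2 ^+ (N + m).
  by rewrite lerBlDr lerDl divr_ge0 ?exprn_ge0// mulr_ge0.
elim: m => [|m IHm]; first by rewrite big_ord0 addn0 subrr.
rewrite big_ord_recr/= IHm addnS exprS; field.
by rewrite !expf_neq0.
Qed.

(** The series of norms has an L^p majorant, so it converges almost everywhere and its terms tend to
    0; no subsequence is extracted. *)
Lemma Lp_fast_ae0 (V : normedModType R) (f : nat -> S -> V) (c : R) : 0 <= c ->
  (forall n, Lp (f n)) -> (forall n, Lnrm (f n) <= c / 2 ^+ n) ->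
  {ae mu, forall t, D t -> f n t @[n --> \oo] --> (0 : V)}.
Proof.
move=> c0 Lf fc.
have [|G [_ _ _]] := @Lp_sum_bound _ f (fun n => c / 2 ^+ n) (2 * c) Lf fc.
  by move=> m; have := geometric_sum_le 0 m c0; rewrite expr0 divr1.
apply: filterS => t fG Dt; apply/norm_cvg0P; apply: cvg_series_cvg_0.
apply: nondecreasing_is_cvgn.
  by apply/nondecreasing_seqP => n; rewrite /series/= big_nat_recr//= lerDl.
by exists (G t) => _ [n _ <-]; rewrite /series/= big_mkord; exact: fG.
Qed.

(** Riesz-Fischer. The majorant [G N] of the increments from N on bounds w - u N, which gives both
    membership in L^p and the rate: the geometric tail from n on sums to 2c/2^n. The almost
    everywhere convergence is kept for passing to the limit in the inclusion. *)
Lemma Lp_complete (V : completeNormedModType R) (e : nat -> V) (u : nat -> S -> V)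
    (c : R) : dense_seq e -> 0 <= c -> (forall n, Lp (u n)) ->
  (forall n, Lnrm (u n.+1 \- u n) <= c / 2 ^+ n) ->
  exists w, [/\ Lp w, {ae mu, forall t, D t -> u n t @[n --> \oo] --> w t} &
    forall n, Lnrm (w \- u n) <= 2 * c / 2 ^+ n].
Proof.
move=> de c0 Lu uc; pose f n := u n.+1 \- u n.
have mu_ n : smeas D (u n) by case: (Lu n).
have Lf n : Lp (f n).
  apply: (Lp_tri mD p1 _ (Lu n.+1) (Lu n)); first exact: (smeasB mD de).
  by apply: aeW => t _; exact: ler_normB.
have /boolp.choice[G GP] : forall N, exists G : S -> R, [/\ Lp G, forall t, 0 <= G t,
    Lnrm G <= 2 * c / 2 ^+ N & {ae mu, forall t, D t ->
      forall m, \sum_(n < m) `|f (N + n)%N t| <= G t}].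
  move=> N; apply: (@Lp_sum_bound _ (fun n => f (N + n)%N) (fun n => c / 2 ^+ (N + n))) =>
    [n|n|m].
  - exact: Lf.
  - exact: uc.
  - exact: geometric_sum_le.
pose w t := limn (u ^~ t).
have fE N m t : \sum_(n < m) f (N + n)%N t = u (N + m)%N t - u N t.
  elim: m => [|m IHm]; first by rewrite big_ord0 addn0 subrr.
  by rewrite big_ord_recr/= IHm addnS /f/= addrC addrA subrK.
have aeG : {ae mu, forall t, D t ->
    forall N m, \sum_(n < m) `|f (N + n)%N t| <= G N t}.
  have : {ae mu, forall t N, D t -> forall m, \sum_(n < m) `|f (N + n)%N t| <= G N t}.
    by apply: ae_foralln => N; case: (GP N).
  by apply: filterS => t H Dt N; exact: H.
have cvgu : {ae mu, forall t, D t -> u n t @[n --> \oo] --> w t}.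
  apply: filterS aeG => t fG Dt.
  have : cvgn (series (f ^~ t)).
    apply: normed_cvg; apply: nondecreasing_is_cvgn.
      apply/nondecreasing_seqP => n.
      change (\sum_(0 <= k < n) `|f k t| <= \sum_(0 <= k < n.+1) `|f k t|).
      by rewrite big_nat_recr//= lerDl.
    exists (G 0 t) => _ [n _ <-].
    change (\sum_(0 <= k < n) `|f k t| <= G 0 t); rewrite big_mkord.
    exact: (fG Dt 0).
  move=> /cvg_ex[l sl]; suff : cvgn (u ^~ t) by [].
  apply/cvg_ex; exists (u 0 t + l).
  have -> : u ^~ t = (fun n => u 0 t + series (f ^~ t) n).
    by apply/funext => n; rewrite /series/= big_mkord (fE 0) addrC subrK.
  by apply: cvgD => //; exact: cvg_cst.
have mw : smeas D w by exact: (smeas_ae_cvg mD cmu mu_ cvgu).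
have wG N : {ae mu, forall t, D t -> `|(w \- u N) t| <= `|G N t|}.
  apply: filterS2 aeG cvgu => t fG ut Dt.
  have [_ G0 _ _] := GP N; rewrite (ger0_norm (G0 t)).
  have cu : `|u n t - u N t| @[n --> \oo] --> `|w t - u N t|.
    by apply: cvg_norm; apply: cvgB; [exact: ut|exact: cvg_cst].
  rewrite -(cvg_lim _ cu)//; apply: limr_le; first by apply/cvg_ex; eexists; exact: cu.
  exists N => // n /= Nn; rewrite -(subnKC Nn) -fE.
  by apply: le_trans (ler_norm_sum _ _ _) _; exact: fG.
have mwu N : smeas D (w \- u N) by exact: (smeasB mD de).
exists w; split => //.
  have [LG _ _ _] := GP 0.
  apply: (Lp_tri mD p1 mw LG (Lu 0)); apply: filterS (wG 0) => t wt Dt.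
  apply: le_trans (lerD (wt Dt) (lexx _)).
  by rewrite (le_trans _ (ler_normD _ _))//= subrK.
move=> n; have [LG _ Gn _] := GP n; apply: le_trans Gn.
exact: (Lnrm_mono mD p1 (mwu n) LG (wG n)).
Qed.

End Lp_completeness.

Section Lp_glue.
Context d (S : measurableType d) (R : realType).
Variables (mu : {measure set S -> \bar R}) (D : set S) (p : R).
Hypotheses (mD : measurable D) (p1 : 1 <= p).
Context {V : normedModType R}.

Local Notation nint := (nint mu D p).
Local Notation Lnrm := (Lnrm mu D p).
Local Notation Lp := (Lp mu D p).

Let p0 : 0 < p. Proof. exact: lt_le_trans ltr01 p1. Qed.

Lemma smeas_patch (A : set S) (f : S -> V) : measurable (D `&` A) -> smeas D f ->
  smeas D (patch (fun=> 0) A f).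
Proof.
move=> mA mf; split => c.
apply: (@eq_measurable_fun _ _ _ _ D (fun t => if t \in D `&` A then `|f t - c| else `|0 - c|)).
  move=> t; rewrite inE => Dt; rewrite /patch.
  have -> : (t \in D `&` A) = (t \in A) by apply/idP/idP; rewrite !inE => //; case.
  by case: ifP.
apply: measurable_fun_if => //.
- apply: (measurable_fun_bool true); rewrite (_ : _ `&` _ = D `&` A)//.
  by apply/seteqP; split => [t [Dt /set_mem]//|t At]; split => //=; [case: At|exact: mem_set].
- by apply: measurable_funS (smeas_dist mf c) => // t [].
Qed.

Lemma nint_glue (k : S -> nat) (h : nat -> S -> V) (m : nat) :
  (forall t, D t -> (k t < m)%N) -> measurable_fun D k ->
  (forall j, smeas D (h j)) ->
  nint (fun t => h (k t) t) =
    (\sum_(j < m) nint (patch (fun=> 0%R) (k @^-1` [set nat_of_ord j]) (h j)))%E.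
Proof.
move=> km mk mh; rewrite nint_integral.
pose F j t := (`|patch (fun=> 0) (k @^-1` [set j]) (h j) t| `^ p)%:E.
transitivity (\int[mu]_(t in D) \sum_(j <- iota 0 m) F j t)%E.
  apply: eq_integral => t; rewrite inE => Dt.
  rewrite (bigD1_seq (k t)) ?iota_uniq ?mem_iota//=; last by rewrite km.
  rewrite big1 ?adde0; last first.
    move=> j /negP jk; rewrite /F /patch memNset ?normr0 ?powR0 ?gt_eqF//.
    by move=> /= E; apply: jk; rewrite E.
  by rewrite /F /patch mem_set.
rewrite ge0_integral_sum//.
- rewrite -(big_mkord xpredT (fun j => nint (patch (fun=> 0) (k @^-1` [set j]) (h j)))).
  rewrite /index_iota subn0; apply: eq_bigr => j _; rewrite nint_integral.
  by [].
- move=> j; apply: measurable_norm_powR; apply: smeas_patch => //.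
  exact: mk.
- by move=> j t _; rewrite lee_fin powR_ge0.
Qed.

Lemma Lp_glue (k : S -> nat) (h : nat -> S -> V) (m : nat) :
  (forall t, D t -> (k t < m)%N) -> measurable_fun D k ->
  (forall j, Lp (h j)) -> Lp (fun t => h (k t) t).
Proof.
move=> km mk Lh; have mh j : smeas D (h j) by case: (Lh j).
split; first by apply: smeas_glue => //; apply/measurable_idxP.
rewrite (nint_glue km mk mh) lte_sum_pinfty// => j _.
suff [] : Lp (patch (fun=> 0) (k @^-1` [set nat_of_ord j]) (h j)) by [].
apply: (Lp_mono mD p1 _ (Lh j)).
  by apply: smeas_patch => //; exact: mk.
by apply: aeW => t Dt; rewrite /patch; case: ifP => //; rewrite normr0.
Qed.

End Lp_glue.

(** * Chattering *)

Section lebesgue.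
Context {R : realType}.
Implicit Types (A B : set R) (a b e x y N T : R).

Lemma leb_measurable A :
  @measurable _ (measurableTypeR R) A -> lebesgue_measurable A.
Proof. exact: sub_caratheodory. Qed.

Lemma leb_le A B : A `<=` B -> (leb R A <= leb R B)%E.
Proof. by move=> AB; apply: le_outer_measure. Qed.

Lemma leb_ge0 A : (0 <= leb R A)%E.
Proof. exact: mu_ext_ge0. Qed.

Lemma lebU2 A B : (leb R (A `|` B) <= leb R A + leb R B)%E.
Proof. by apply: outer_measureU2. Qed.

Lemma leb_bigcup_le (F : nat -> set R) :
  (leb R (\bigcup_k F k) <= \sum_(0 <= k <oo) leb R (F k))%E.
Proof. by apply: outer_measure_sigma_subadditive. Qed.

Lemma lebU A B : lebesgue_measurable A -> lebesgue_measurable B ->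
  A `&` B = set0 -> leb R (A `|` B) = (leb R A + leb R B)%E.
Proof. exact: (measureU (@completed_lebesgue_measure R)). Qed.

Lemma leb_itv_bnd a b (l r : bool) : a <= b ->
  leb R [set` Interval (BSide l a) (BSide r b)] = (b - a)%:E.
Proof.
have := lebesgue_measure_itv (Interval (BSide l a) (BSide r b)).
rewrite /= lte_fin => H; rewrite le_eqVlt => /predU1P[E|ab].
  by move: H; rewrite E ltxx subrr.
by move: H; rewrite ab.
Qed.

Lemma leb_itv_measurable (i : interval R) : lebesgue_measurable [set` i].
Proof. by apply: leb_measurable; exact: measurable_itv. Qed.

Lemma leb_fin_num A T : A `<=` `[0, T] -> leb R A \is a fin_num.
Proof.
move=> AT; rewrite ge0_fin_numE; last exact: leb_ge0.
apply: le_lt_trans (leb_le AT) _; have [T0|T0] := leP 0 T.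
  by rewrite leb_itv_bnd// ltry.
by rewrite set_itv_ge -?leNgt ?bnd_simp ?leNgt ?T0// measure0.
Qed.

(** Half of [e] pays for a cover that nearly attains the outer measure, the other half for moving
    its end points to rationals. Rational end points keep the step functions of the separability
    proof countable. *)
Lemma leb_rat_cover B e : (leb R B < +oo)%E -> 0 < e ->
  exists x y : nat -> rat, [/\ forall k, x k <= y k,
    B `<=` \bigcup_k `]ratr (x k), ratr (y k)]%classic &
    (\sum_(0 <= k <oo) (ratr (y k) - ratr (x k))%:E <= leb R B + e%:E)%E].
Proof.
move=> Boo e0.
have Bfin : leb R B \is a fin_num by rewrite ge0_fin_numE// leb_ge0.
have e20 : 0 < e / 2 by rewrite divr_gt0.
have [_ [/= A [mA BA] <-] sA] := lb_ereal_inf_adherent e20 Bfin.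
have xyP k : exists xy : rat * rat, [/\ xy.1 <= xy.2,
    A k `<=` `]ratr xy.1, ratr xy.2]%classic &
    ((ratr xy.2 - ratr xy.1)%:E <=
      wlength idfun (A k) + (e / 2 / (2 ^ k.+1)%:R)%:E)%E].
  have [[a b] _ Aab] := mA k; set d := e / 2 / (2 ^ k.+1)%:R.
  have d0 : 0 < d by rewrite !divr_gt0// ltr0n expn_gt0.
  (* An interval whose end points are in the wrong order is empty; [b'] gives it length 0. *)
  pose b' := Num.max a b.
  have wA : wlength idfun (A k) = (b' - a)%:E.
    rewrite -Aab /b'; have [ab|ab] := leP a b; first by rewrite wlength_itv_bnd.
    by rewrite set_itv_ge ?bnd_simp -?leNgt ?(ltW ab)// wlength0 subrr.
  have /rat_in_itvoo[x] : a - d / 2 < a by lra.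
  have /rat_in_itvoo[y] : b' < b' + d / 2 by lra.
  rewrite !in_itv/= => /andP[by_ yb] /andP[ax xa].
  have ab' : a <= b' by rewrite le_max lexx.
  have bb' : b <= b' by rewrite le_max lexx orbT.
  exists (x, y); split => /=.
  - rewrite -(@ler_rat R); lra.
  - move=> t; rewrite -Aab /= !in_itv/= => /andP[at_ tb]; apply/andP; split; lra.
  - rewrite wA -EFinD lee_fin; lra.
have [xy xyE] := boolp.choice xyP.
exists (fun k => (xy k).1), (fun k => (xy k).2); split.
- by move=> k; case: (xyE k).
- move=> t /BA[k _ Akt]; exists k => //; by case: (xyE k) => _ /(_ _ Akt).
- apply: (@le_trans _ _ (\sum_(0 <= k <oo)
      (wlength idfun (A k) + (e / 2 / (2 ^ k.+1)%:R)%:E)))%E.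
    apply: lee_nneseries => k _; last by case: (xyE k).
    by rewrite lee_fin subr_ge0 ler_rat; case: (xyE k).
  apply: le_trans (epsilon_trick _ _ (ltW e20)) _.
    by move=> k; exact: wlength_ge0.
  rewrite [X in (_ <= _ + X%:E)%E](splitr e) EFinD addeA leeD2r//.
  exact: ltW.
Qed.

Definition phase N t : R := N * t - (Num.floor (N * t))%:~R.

(** Half-open, so that increasing break points from 0 to 1 cut the line into disjoint sets. *)
Definition chatter_set a b N : set R := [set t | a <= phase N t < b].

Lemma phase_itv N t : 0 <= phase N t < 1.
Proof. by rewrite /phase; have := floor_itv (N * t); rewrite intrD; lra. Qed.

Lemma phaseE N t (m : int) : m%:~R <= N * t < (m + 1)%:~R ->
  phase N t = N * t - m%:~R.
Proof. by move=> mN; rewrite /phase (floor_def mN). Qed.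

Lemma chatter_setE a b N : 0 < N -> 0 <= a -> b <= 1 ->
  chatter_set a b N = \bigcup_(m : int) `[(m%:~R + a) / N, (m%:~R + b) / N[%classic.
Proof.
move=> N0 a0 b1; apply/seteqP; split => t; rewrite /chatter_set /=.
  move=> abt; exists (Num.floor (N * t)) => //=; move: abt; rewrite /phase in_itv/=.
  by rewrite ler_pdivrMr// ltr_pdivlMr// [t * N]mulrC; lra.
move=> [m _] /=; rewrite in_itv/= ler_pdivrMr// ltr_pdivlMr// [t * N]mulrC => H.
by rewrite (@phaseE _ _ m) ?intrD; lra.
Qed.

Lemma measurable_chatter_set a b N : 0 < N -> 0 <= a -> b <= 1 ->
  lebesgue_measurable (chatter_set a b N).
Proof.
move=> N0 a0 b1; rewrite chatter_setE//; apply: leb_measurable.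
apply: countable_bigcupT_measurable => [|m]; last exact: measurable_itv.
exact: countableP.
Qed.

(** Each full period of length 1/N contributes exactly (b - a)/N. *)
Lemma chatter_prefix a b N (m : nat) : 0 < N -> 0 <= a -> a <= b -> b <= 1 ->
  leb R (chatter_set a b N `&` `[0, m%:R / N[) = (m%:R * (b - a) / N)%:E.
Proof.
move=> N0 a0 ab b1; elim: m => [|m IHm].
  by rewrite !mul0r set_itvco0 setI0 measure0.
have -> : chatter_set a b N `&` `[0, m.+1%:R / N[ =
    (chatter_set a b N `&` `[0, m%:R / N[) `|` `[(m%:R + a) / N, (m%:R + b) / N[.
  have mE t : (m%:R / N <= t < m.+1%:R / N) -> phase N t = N * t - m%:R.
    move=> H; apply: (@phaseE _ _ m); rewrite intrD -!pmulrn.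
    by move: H; rewrite ler_pdivrMr// ltr_pdivlMr// [t * N]mulrC -natr1; lra.
  apply/seteqP; split => t; rewrite /chatter_set /= !in_itv/=.
    move=> [abt /andP[t0 tm]]; have [tm'|mt] := ltP t (m%:R / N); first by left; rewrite t0.
    right; move: abt; rewrite mE ?mt//.
    by rewrite ler_pdivrMr// ltr_pdivlMr// [t * N]mulrC; lra.
  move=> [[abt /andP[t0 tm]]|].
    split => //; rewrite t0/=; apply: lt_le_trans tm _.
    by rewrite ler_pM2r ?invr_gt0// ler_nat.
  rewrite ler_pdivrMr// ltr_pdivlMr// => H.
  have H' : m%:R / N <= t < m.+1%:R / N.
    by rewrite ler_pdivrMr// ltr_pdivlMr// -natr1; lra.
  split; first by rewrite mE// [N * t]mulrC; lra.
  by apply/andP; split; [apply: le_trans (proj1 (andP H')); rewrite divr_ge0// ltW|case/andP: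
    H'].
rewrite lebU; last first.
- apply/seteqP; split => // t [[_ +]]; rewrite /= !in_itv/= => /andP[_ tm] /andP[mt _].
  have : m%:R / N <= (m%:R + a) / N by rewrite ler_pM2r ?invr_gt0// lerDl.
  by move: mt tm; lra.
- exact: leb_itv_measurable.
- by apply: measurableI; [exact: measurable_chatter_set|exact: leb_itv_measurable].
rewrite IHm leb_itv_bnd; last by rewrite ler_pM2r ?invr_gt0// lerD2l.
rewrite -EFinD; congr EFin; rewrite -natr1; field; lra.
Qed.


(** Squeezed between the two numbers of whole periods around c, the measure is off by at most one
    period. *)
Lemma chatter_itv0 a b N c : 0 < N -> 0 <= a -> a <= b -> b <= 1 -> 0 <= c ->
  exists2 r : R, leb R (chatter_set a b N `&` `[0, c[) = r%:E &
    `|r - (b - a) * c| <= N^-1.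
Proof.
move=> N0 a0 ab b1 c0.
have Nc0 : 0 <= N * c by rewrite mulr_ge0// ltW.
have /andP[] := truncn_itv Nc0; set m := Num.truncn _ => mc cm.
have mc' : m%:R / N <= c by rewrite ler_pdivrMr// mulrC.
have cm' : c <= m.+1%:R / N by rewrite ler_pdivlMr// mulrC ltW.
have sub x y : x <= y -> chatter_set a b N `&` `[0, x[ `<=` chatter_set a b N `&` `[0, y[.
  move=> xy; apply: setIS => t /=; rewrite !in_itv/= => /andP[-> tx].
  exact: lt_le_trans tx xy.
have lo := leb_le (sub _ _ mc'); have hi := leb_le (sub _ _ cm').
rewrite chatter_prefix// in lo; rewrite chatter_prefix// in hi.
have fin : leb R (chatter_set a b N `&` `[0, c[) \is a fin_num.
  by rewrite ge0_fin_numE ?leb_ge0// (le_lt_trans hi)// ltry.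
exists (fine (leb R (chatter_set a b N `&` `[0, c[))); first by rewrite fineK.
rewrite -(fineK fin) !lee_fin in lo hi; move: lo hi; set r := fine _ => lo hi.
have v0 : 0 < N^-1 by rewrite invr_gt0.
move: lo hi mc' cm'; rewrite -natr1; set v := N^-1 in v0 *.
rewrite -!mulrA ![(b - a) * _]mulrC !mulrA [(_ + 1) * v]mulrDl mul1r.
move: (_ * v) => u lo hi uc cu.
have w0 : 0 <= b - a by lra.
have h1 : 0 <= (b - a) * (c - u) by rewrite mulr_ge0; lra.
have h2 : 0 <= (b - a) * (u + v - c) by rewrite mulr_ge0; lra.
have h3 : 0 <= (1 - (b - a)) * v by apply: mulr_ge0; lra.
rewrite ler_norml; apply/andP; split; nra.
Qed.

Lemma chatter_itv a b N T x y : 0 < N -> 0 <= a -> a <= b -> b <= 1 -> x <= y ->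
  (leb R (chatter_set a b N `&` (`[0%R, T] `&` `]x, y])) <=
   ((b - a) * (y - x) + 2 / N)%:E)%E.
Proof.
move=> N0 a0 ab b1 xy; pose x' := Num.max x 0; pose y' := Num.max y 0.
have xy' : 0 <= x' <= y' by rewrite /x' /y'; have [] := leP x 0; have [] := leP y 0; lra.
have /andP[x0 xy0] := xy'; have y0 : 0 <= y' by exact: le_trans x0 xy0.
have [rx Ex rxP] := chatter_itv0 N0 a0 ab b1 x0.
have [ry Ey ryP] := chatter_itv0 N0 a0 ab b1 y0.
pose C := chatter_set a b N.
have mC : lebesgue_measurable C by exact: measurable_chatter_set.
have EU : (leb R (C `&` `[0%R, y'[) = leb R (C `&` `[0%R, x'[) + leb R (C `&` `[x', y'[))%E.
  rewrite -lebU.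
  - rewrite -setIUr; congr (leb R (_ `&` _)); apply/seteqP; split => t /=; rewrite !in_itv/=.
      by have [|] := ltP t x'; [left|right]; lra.
    by move=> [|]; lra.
  - by apply: measurableI => //; exact: leb_itv_measurable.
  - by apply: measurableI => //; exact: leb_itv_measurable.
  - rewrite -subset0 => t [[_ +] [_]] /=; rewrite !in_itv/= => /andP[_ tx] /andP[xt _].
    by move: (lt_le_trans tx xt); rewrite ltxx.
(* The covering intervals contain their right end point and those just measured do not; the extra
   point has measure 0. *)
have sub : C `&` (`[0, T] `&` `]x, y]) `<=` (C `&` `[x', y'[) `|` `[y, y].
  move=> t [Ct [+ +]]; rewrite /= !in_itv/= => /andP[t0 tT] /andP[xt yt].
  have [->|ty] := eqVneq t y; first by right; rewrite lexx.
  left; split => //.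
  have ty' : t < y by rewrite lt_neqAle ty.
  by rewrite /x' /y' ge_max lt_max ty' t0 (ltW xt).
apply: le_trans (leb_le sub) _; apply: le_trans (lebU2 _ _) _.
rewrite leb_itv_bnd// subrr adde0.
have fin : leb R (C `&` `[x', y'[) \is a fin_num.
  rewrite ge0_fin_numE ?leb_ge0//; apply: le_lt_trans (ltry ry).
  by rewrite -Ey EU leeDr// leb_ge0.
move: EU; rewrite Ex Ey -(fineK fin) -EFinD => -[].
move: (fine _) => r yr; rewrite lee_fin.
move: rxP ryP; rewrite !ler_norml yr => rxP ryP.
have w0 : 0 <= b - a by lra.
have xy2 : y' - x' <= y - x.
  by rewrite /x' /y'; have [] := leP x 0; have [] := leP y 0; lra.
have h1 : 0 <= (b - a) * ((y - x) - (y' - x')) by rewrite mulr_ge0; lra.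
move: (N^-1) rxP ryP => v rxP ryP; lra.
Qed.

(** Cover B by intervals: finitely many of them are equidistributed with error 2/N each, and the
    others have small total length. Only subadditivity is used, so the estimate is one-sided. *)
Lemma chatter_upper T B e : B `<=` `[0, T] -> 0 < e ->
  exists2 N0, 0 < N0 & forall N a b, N0 <= N -> 0 <= a -> a <= b -> b <= 1 ->
    fine (leb R (B `&` chatter_set a b N)) <= (b - a) * fine (leb R B) + e.
Proof.
move=> BT e0; have Bfin := leb_fin_num BT.
have e3 : 0 < e / 3 by rewrite divr_gt0.
have [|x [y [xy Bxy sxy]]] := @leb_rat_cover B (e / 3) _ e3.
  by rewrite ltey_eq Bfin.
pose l k : R := ratr (y k) - ratr (x k).
have l0 k : (0 <= (l k)%:E)%E by rewrite lee_fin subr_ge0 ler_rat.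
have soo : (\sum_(0 <= k <oo) (l k)%:E < +oo)%E.
  by apply: le_lt_trans sxy _; rewrite -(fineK Bfin) -EFinD ltry.
have [n tl] : exists n, (\sum_(n <= k <oo) (l k)%:E <= (e / 3)%:E)%E.
  have /fine_cvgP[fin] := nneseries_tail_cvg (P := xpredT) soo (fun k _ => l0 k).
  move=> /cvgrPdist_lt/(_ _ e3) sm; have [n _ nP] := filterI fin sm.
  have [fn smn] := nP n (leqnn n); exists n; rewrite -(fineK fn) lee_fin.
  by move: smn; rewrite /= sub0r normrN => /ltW; apply: le_trans; exact: ler_norm.
(* For such N the n errors 2/N add up to at most e/3; the successor keeps the threshold positive
   when n = 0. *)
exists (n.*2.+1%:R * 3 / e) => [|N a b NN a0 ab b1]; first by rewrite !divr_gt0// mulr_gt0.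
have N0 : 0 < N by apply: lt_le_trans NN; rewrite !divr_gt0// mulr_gt0.
have BCfin : leb R (B `&` chatter_set a b N) \is a fin_num.
  by apply: (@leb_fin_num _ T) => t [/BT].
rewrite -lee_fin fineK//; pose C := chatter_set a b N.
pose G k := C `&` (`[0, T] `&` `](ratr (x k) : R), ratr (y k)]).
have sub : B `&` C `<=` \bigcup_k G k.
  by move=> t [Bt Ct]; have [k _ kt] := Bxy _ Bt; exists k => //; split => //; split => //;
    exact: BT.
apply: le_trans (leb_le sub) _.
apply: le_trans (leb_bigcup_le G) _.
rewrite (nneseries_split 0 n); last by move=> k _; exact: leb_ge0.
rewrite add0n.
have tail : (\sum_(n <= k <oo) leb R (G k) <= (e / 3)%:E)%E.
  apply: le_trans tl; apply: lee_nneseries => [k _ _|k _]; first exact: leb_ge0.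
  have -> : (l k)%:E = leb R `](ratr (x k) : R), ratr (y k)] by rewrite leb_itv_bnd// ler_rat.
  by apply: leb_le => t [_ []].
have head : (\sum_(0 <= k < n) leb R (G k) <=
    ((b - a) * (fine (leb R B) + e / 3) + n%:R * (2 / N))%:E)%E.
  apply: (@le_trans _ _ (\sum_(0 <= k < n) ((b - a) * l k + 2 / N)%:E)%E).
    by apply: lee_sum => k _; apply: chatter_itv => //; rewrite ler_rat.
  rewrite sumEFin lee_fin big_split/= -mulr_sumr sumr_const_nat subn0 -[X in _ + X]mulr_natl.
  rewrite lerD2r ler_wpM2l ?subr_ge0// -lee_fin -sumEFin EFinD fineK//.
  by apply: le_trans sxy; apply: nneseries_lim_ge => k _ _; exact: l0.
apply: le_trans (leeD head tail) _; rewrite -EFinD lee_fin.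
have H : n%:R * (2 / N) <= e / 3.
  rewrite mulrA ler_pdivrMr// [_ / 3 * N]mulrC.
  move: NN; rewrite ler_pdivrMr// -[n.*2.+1%:R]natr1 -muln2 natrM.
  lra.
have w1 : (b - a) * (e / 3) <= e / 3 by rewrite ler_piMl; lra.
by rewrite mulrDr; lra.
Qed.

(** The lower bound for B is the upper bound for its complement in [0,T], since the two parts
    together have measure (b - a) T up to 1/N. The threshold does not depend on a and b, which will
    vary with the parameter. *)
Lemma chatter_measure T B e : 0 <= T -> lebesgue_measurable B ->
  B `<=` `[0, T] -> 0 < e ->
  exists2 N0, 0 < N0 & forall N a b, N0 <= N -> 0 <= a -> a <= b -> b <= 1 ->
    `|fine (leb R (B `&` chatter_set a b N)) - (b - a) * fine (leb R B)| <= e.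
Proof.
move=> T0 mB BT e0; have e2 : 0 < e / 2 by rewrite divr_gt0.
pose I : set R := `[0, T]%classic; pose B' := I `\` B.
have B'T : B' `<=` `[0, T] by move=> t [].
have [N1 N10 N1P] := chatter_upper BT e2.
have [N2 N20 N2P] := chatter_upper B'T e2.
exists (Num.max (Num.max N1 N2) (2 / e)); first by rewrite lt_max lt_max N10.
move=> N a b; rewrite !ge_max => /andP[/andP[NN1 NN2] NN3] a0 ab b1.
have N0 : 0 < N by exact: lt_le_trans NN1.
have {}N1P := N1P _ _ _ NN1 a0 ab b1; have {}N2P := N2P _ _ _ NN2 a0 ab b1.
pose C := chatter_set a b N; have mC : lebesgue_measurable C by exact: measurable_chatter_set.
have mI : lebesgue_measurable I by exact: leb_itv_measurable.
have finT A : A `<=` I -> leb R A \is a fin_num by exact: leb_fin_num.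
have fU A A' : A `<=` I -> A' `<=` I -> lebesgue_measurable A -> lebesgue_measurable A' ->
    A `&` A' = set0 -> fine (leb R (A `|` A')) = fine (leb R A) + fine (leb R A').
  by move=> AI A'I mA mA' AA'; rewrite lebU// fineD// finT.
have mB' : lebesgue_measurable B' by exact: measurableD.
have EI : fine (leb R B) + fine (leb R B') = T.
  rewrite -fU//; first by rewrite setDUK//= leb_itv_bnd// subr0.
  by rewrite setDIK.
have EC : T * (b - a) - N^-1 <= fine (leb R (B `&` C)) + fine (leb R (B' `&` C)).
  rewrite -fU.
  - have [r Er rP] := chatter_itv0 N0 a0 ab b1 T0.
    apply: (@le_trans _ _ r); first by move: rP; rewrite ler_norml [T * _]mulrC; lra.
    rewrite -lee_fin fineK; last by apply: finT => t [[/BT]|[[]]].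
    rewrite -Er; apply: leb_le => t [Ct]; rewrite /= in_itv/= => /andP[t0 tT].
    have It : I t by rewrite /I /= in_itv/= t0 ltW.
    by have [Bt|Bt] := pselect (B t); [left|right].
  - by move=> t [/BT].
  - by move=> t [[]].
  - exact: measurableI.
  - exact: measurableI.
  - by rewrite -subset0 => t [[Bt _] [[_ ]]].
have NV : N^-1 <= e / 2.
  by rewrite -[leRHS]invrK lef_pV2 ?posrE ?invr_gt0// invf_div.
rewrite ler_norml; move: N1P N2P EI EC NV; rewrite -/C.
move: (fine (leb R B)) (fine (leb R B')) => m m' H1 H2 EI EC NV.
rewrite -EI in EC; nra.
Qed.

End lebesgue.

(** * Chattering in L^p and under the Bochner integral *)

Section chatter.
Context {R : realType}.
Implicit Types (T N a b : R).

Local Notation LT := (caratheodory_type (wlength (@idfun R))^*%mu).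
Local Notation I T := (`[0, T]%classic : set LT).
Local Notation LR := (@completed_lebesgue_measure R).

Lemma measurable_I T : measurable (I T).
Proof. exact: leb_itv_measurable. Qed.

Lemma leb_I_lty T : (LR (I T) < +oo)%E.
Proof.
by rewrite -ge0_fin_numE; [exact: (@leb_fin_num _ _ T)|exact: leb_ge0].
Qed.

Lemma leb_complete : measure_is_complete LR.
Proof. exact: completed_lebesgue_measure_is_complete. Qed.

Lemma fin_idx_chatter T a b N (X : Type) (s : R -> X) :
  0 < N -> 0 <= a -> b <= 1 -> fin_idx (I T) s ->
  fin_idx (I T) (fun t : LT => (t \in chatter_set a b N, s t)).
Proof.
move=> N0 a0 b1 fs; apply: fin_idx_pair => //; apply: (fin_idx_bool (measurable_I T)).
exact: measurable_chatter_set.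
Qed.

Lemma chatter_simple T (X : choiceType) (s : R -> X) (r : seq X) e : 0 <= T ->
  fin_idx (I T) s -> 0 < e ->
  exists2 N0, 0 < N0 & forall N a b, N0 <= N -> 0 <= a -> a <= b -> b <= 1 ->
    forall x, x \in r ->
    `|fine (LR (I T `&` (fun t : LT => (t \in chatter_set a b N, s t)) @^-1` [set (true, x)])) -
      (b - a) * fine (LR (I T `&` s @^-1` [set x]))| <= e.
Proof.
move=> T0 [_ ms] e0; elim: r => [|x r [N1 N10 N1P]]; first by exists 1.
have [|N2 N20 N2P] := chatter_measure T0 (ms x) _ e0; first exact: subIsetl.
exists (Num.max N1 N2); first by rewrite lt_max N10.
move=> N a b; rewrite ge_max => /andP[NN1 NN2] a0 ab b1 y.
rewrite inE => /predU1P[->{y}|]; last exact: N1P.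
have := N2P N a b NN2 a0 ab b1; congr (`|fine (LR _) - _| <= e).
apply/seteqP; split => [t [[It sx] Ct]|t [It [/set_mem Ct sx]]]; last by split.
by split => //=; rewrite mem_set//; congr pair.
Qed.

Lemma sum_pair_true (V : zmodType) (X : choiceType) (r : seq X) (F : bool * X -> V) :
  (forall x, F (false, x) = 0) ->
  \sum_(y <- [seq (c, x) | c <- [:: true; false], x <- r]) F y =
  \sum_(x <- r) F (true, x).
Proof.
move=> F0; rewrite big_allpairs big_cons big_seq1.
have -> : \sum_(x <- r) F (false, x) = 0 by apply: big1 => x _; exact: F0.
exact: addr0.
Qed.

Lemma mem_pair_true (X : choiceType) (r : seq X) (c : bool) (x : X) :
  x \in r -> (c, x) \in [seq (c, x) | c <- [:: true; false], x <- r].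
Proof. by move=> xr; apply/allpairsP; exists (c, x); split => //; case: c. Qed.

Lemma uniq_pair_true (X : choiceType) (r : seq X) :
  uniq r -> uniq [seq (c, x) | c <- [:: true; false], x <- r].
Proof.
move=> ur; apply: allpairs_uniq => //.
by move=> [? ?] [? ?] _ _ [-> ->].
Qed.

Section Lp_chatter.
Variables (p : R) (V : normedModType R).
Hypothesis p1 : 1 <= p.
Implicit Types f g s : R -> V.

Let p0 : 0 < p. Proof. exact: lt_le_trans ltr01 p1. Qed.

(** Write w^p = w w^(p-1) and use that w^(p-1) is nondecreasing: for the roots u, v this gives u^p +
    v^p <= (u + v)^p. *)
Lemma powR_subadd (x y : R) : 0 <= x -> 0 <= y ->
  (x + y) `^ p^-1 <= x `^ p^-1 + y `^ p^-1.
Proof.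
move=> x0 y0; set u := x `^ p^-1; set v := y `^ p^-1.
have u0 : 0 <= u by exact: powR_ge0.
have v0 : 0 <= v by exact: powR_ge0.
rewrite -[leRHS](powRK p1) ?addr_ge0// ge0_ler_powR ?nnegrE ?invr_ge0 ?(ltW p0) ?powR_ge0
  ?addr_ge0//.
rewrite -(powRKV p1 x0) -(powRKV p1 y0) -/u -/v.
have pE w : 0 <= w -> w `^ p = w * w `^ (p - 1).
  move=> w0; have [->|wN0] := eqVneq w 0; first by rewrite mul0r powR0// gt_eqF.
  by rewrite -{2}(powRr1 w0) -powRD ?subrKC// wN0 implybT.
rewrite !pE ?addr_ge0// mulrDl lerD// ler_wpM2l// ge0_ler_powR ?nnegrE ?subr_ge0 ?addr_ge0//.
  by rewrite lerDl.
by rewrite lerDr.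
Qed.

Local Notation chi a b N f := (patch (fun=> 0) (chatter_set a b N) f).

Lemma smeas_chatter T a b N f : 0 < N -> 0 <= a -> b <= 1 ->
  smeas (I T) f -> smeas (I T) (chi a b N f).
Proof.
move=> N0 a0 b1 mf; apply: smeas_patch => //; first exact: measurable_I.
by apply: measurableI; [exact: measurable_I|exact: measurable_chatter_set].
Qed.

Lemma Lp_chatter T a b N f : 0 < N -> 0 <= a -> b <= 1 ->
  Lp LR (I T) p f -> Lp LR (I T) p (chi a b N f).
Proof.
move=> N0 a0 b1 Lf; apply: (Lp_mono (measurable_I T) p1 _ Lf).
  exact: (smeas_chatter N0 a0 b1 Lf.1).
by apply: aeW => t _; rewrite /patch; case: ifP; rewrite ?normr0.
Qed.

Lemma Lnrm_chatter_le T a b N f : 0 < N -> 0 <= a -> b <= 1 ->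
  Lp LR (I T) p f -> Lnrm LR (I T) p (chi a b N f) <= Lnrm LR (I T) p f.
Proof.
move=> N0 a0 b1 Lf; apply: (Lnrm_mono (measurable_I T) p1 _ Lf).
  exact: (smeas_chatter N0 a0 b1 Lf.1).
by apply: aeW => t _; rewrite /patch; case: ifP; rewrite ?normr0.
Qed.

Lemma Lnrm_chatter_simple T s e : 0 <= T -> fin_idx (I T) s -> 0 < e ->
  exists2 N0, 0 < N0 & forall N a b, N0 <= N -> 0 <= a -> a <= b -> b <= 1 ->
    Lnrm LR (I T) p (chi a b N s) <= (b - a) `^ p^-1 * Lnrm LR (I T) p s + e.
Proof.
move=> T0 fs e0; have [r ur sr] := fin_idx_seq fs.
pose K := \sum_(x <- r) `|x| `^ p.
have K0 : 0 <= K by apply: sumr_ge0 => x _; exact: powR_ge0.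
(* With this error per value, the errors weighted by the |x|^p add up to at most e^p, and the p-th
   root, being subadditive, turns this into e. *)
have e'0 : 0 < e `^ p / (1 + K) by rewrite divr_gt0 ?powR_gt0// ltr_pwDl.
have [N0 N00 N0P] := chatter_simple r T0 fs e'0; exists N0 => // N a b NN a0 ab b1.
have {}N00 : 0 < N by exact: lt_le_trans NN.
have fk := fin_idx_chatter N00 a0 b1 fs.
pose fm (x : V) := fine (LR (I T `&` s @^-1` [set x])).
have ns : nint LR (I T) p s = (\sum_(x <- r) fm x * (`|x| `^ p))%:E.
  rewrite nint_integral (integral_idx (measurable_I T) (leb_I_lty T) ur sr fs (c := fun x =>
    `|x| `^ p))//.
pose c (y : bool * V) := if y.1 then `|y.2| `^ p else 0.
have nc : nint LR (I T) p (chi a b N s) = (\sum_(x <- r) fine (LR (I T `&` (fun t : LT =>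
    (t \in chatter_set a b N, s t)) @^-1` [set (true, x)])) * (`|x| `^ p))%:E.
  rewrite nint_integral; transitivity (\int[LR]_(t in I T)
      (c (t \in chatter_set a b N, s t))%:E)%E.
    apply: eq_integral => t _; rewrite /c /patch /=; case: ifP => // _.
    by rewrite normr0 powR0// gt_eqF.
  rewrite (integral_idx (measurable_I T) (leb_I_lty T) (uniq_pair_true ur) _ fk (c := c)).
  - by rewrite sum_pair_true// => x; rewrite /c mulr0.
  - by move=> t It; apply: mem_pair_true; exact: sr.
  - by move=> x; rewrite /c; case: ifP => // _; exact: powR_ge0.
have fm0 x : 0 <= fm x by rewrite fine_ge0// leb_ge0.
have w0 : 0 <= b - a by rewrite subr_ge0.
have S0 : 0 <= \sum_(x <- r) fm x * (`|x| `^ p).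
  by apply: sumr_ge0 => x _; rewrite mulr_ge0// powR_ge0.
rewrite !LnrmE ns nc /=.
apply: (@le_trans _ _ (((b - a) * (\sum_(x <- r) fm x * (`|x| `^ p)) + e `^ p) `^ p^-1)).
  rewrite ge0_ler_powR ?nnegrE ?invr_ge0 ?(ltW p0)//.
  - by apply: sumr_ge0 => x _; rewrite mulr_ge0 ?powR_ge0// fine_ge0// leb_ge0.
  - by rewrite addr_ge0 ?powR_ge0// mulr_ge0.
  - apply: (@le_trans _ _ (\sum_(x <- r) ((b - a) * fm x + e `^ p / (1 + K)) * (`|x| `^ p))).
      rewrite big_seq [leRHS]big_seq; apply: ler_sum => x xr.
      rewrite ler_wpM2r ?powR_ge0//.
      have := N0P N a b NN a0 ab b1 x xr; rewrite ler_norml -/(fm x); lra.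
    under eq_bigr do rewrite mulrDl -mulrA.
    rewrite big_split/= -!mulr_sumr lerD2l -/K mulrAC ler_pdivrMr ?ltr_pwDl//.
    by rewrite ler_wpM2l ?powR_ge0// lerDr.
apply: le_trans (powR_subadd _ _) _; rewrite ?powR_ge0 ?mulr_ge0//.
by rewrite (powRK p1 (ltW e0)) powRM.
Qed.

Lemma Lp_simple T s : fin_idx (I T) s -> Lp LR (I T) p s.
Proof.
move=> fs; have [r ur sr] := fin_idx_seq fs; split; first exact: smeas_simple.
rewrite nint_integral (integral_idx (measurable_I T) (leb_I_lty T) ur sr fs (c := fun x => `|x|
  `^ p)) ?ltry//.
Qed.

Lemma Lp_simple_approx T (d : nat -> V) f e : dense_seq d -> Lp LR (I T) p f -> 0 < e ->
  exists2 s : R -> V, fin_idx (I T) s & Lnrm LR (I T) p (f \- s) < e.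
Proof.
move=> dd Lf e0; have [s [fs fsf sf]] := simple_approx (measurable_I T) dd Lf.1.
have : Lnrm LR (I T) p (f \- s n) @[n --> \oo] --> (0 : R).
  have Lnf : Lp LR (I T) p (fun t => `|f t|).
    apply: (Lp_mono (measurable_I T) p1 _ Lf).
      by apply: smeas_measurable; exact: smeas_norm Lf.1.
    by apply: aeW => t _; rewrite normr_id.
  apply: (Lnrm_cvg0 (measurable_I T) p1 _ Lnf).
  - move=> n; apply: (smeasB (measurable_I T) dd); first by case: Lf.
    exact: smeas_simple.
  - by apply: nearW => n; apply: aeW => t _; rewrite normr_id; exact: fsf.
  - apply: aeW => t _; rewrite -(subrr (f t)); apply: cvgB; first exact: cvg_cst.
    exact: sf.
move=> /cvgrPdist_lt/(_ _ e0)[n _ /(_ n (leqnn n))] /=.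
rewrite sub0r normrN ger0_norm ?Lnrm_ge0// => H; by exists (s n).
Qed.

Lemma powR_le1 (w : R) : 0 <= w -> w <= 1 -> w `^ p^-1 <= 1.
Proof.
move=> w0 w1; rewrite [leRHS](_ : 1 = 1 `^ p^-1); last by rewrite powR1.
by apply: ge0_ler_powR; rewrite ?nnegrE// invr_ge0 ltW.
Qed.

Let chatter_arith (q s g r c c' e : R) : 0 <= q -> q <= 1 -> 0 <= r ->
  r < e / 3 -> c <= q * s + e / 3 -> c' <= c + r -> s <= g + r -> c' <= q * g + e.
Proof.
move=> q0 q1 r0 re cs cc sg.
have h : q * s <= q * g + r.
  by rewrite (le_trans (ler_wpM2l q0 sg))// mulrDr lerD2l ler_piMl.
lra.
Qed.

Lemma Lnrm_chatter T (d : nat -> V) g e : 0 <= T -> dense_seq d -> Lp LR (I T) p g -> 0 < e ->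
  exists2 N0, 0 < N0 & forall N a b, N0 <= N -> 0 <= a -> a <= b -> b <= 1 ->
    Lnrm LR (I T) p (chi a b N g) <= (b - a) `^ p^-1 * Lnrm LR (I T) p g + e.
Proof.
move=> T0 dd Lg e0; have e3 : 0 < e / 3 by rewrite divr_gt0.
have [s fs gs] := Lp_simple_approx dd Lg e3.
have Ls := Lp_simple fs.
have [N0 N00 N0P] := Lnrm_chatter_simple T0 fs e3; exists N0 => // N a b NN a0 ab b1.
have {}N0P := N0P N a b NN a0 ab b1.
have {}N00 : 0 < N by exact: lt_le_trans NN.
have mgs : smeas (I T) (g \- s) by apply: (smeasB (measurable_I T) dd); [case: Lg|case: Ls].
have Lgs : Lp LR (I T) p (g \- s).
  by apply: (Lp_tri (measurable_I T) p1 mgs Lg Ls); apply: aeW => t _; exact: ler_normB.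
have aec : {ae LR, forall t, I T t ->
    `|chi a b N g t| <= `|chi a b N s t| + `|(g \- s) t|}.
  apply: aeW => t _; rewrite /patch; case: ifP => _ /=.
    by rewrite (le_trans _ (ler_normD _ _))// subrKC.
  by rewrite normr0 add0r.
have H1 := Lnrm_tri (measurable_I T) p1 (smeas_chatter N00 a0 b1 Lg.1)
  (Lp_chatter N00 a0 b1 Ls) Lgs aec.
have H2 : Lnrm LR (I T) p s <= Lnrm LR (I T) p g + Lnrm LR (I T) p (g \- s).
  apply: (Lnrm_tri (measurable_I T) p1 Ls.1 Lg Lgs).
  by apply: aeW => t _ /=; rewrite -{1}(subKr (g t) (s t)) ler_normB.
have q1 : (b - a) `^ p^-1 <= 1 by apply: powR_le1; rewrite ?subr_ge0// lerBlDr (le_trans b1)//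
  lerDl.
exact: (chatter_arith (powR_ge0 _ _) q1 (Lnrm_ge0 _ _ _ _) gs N0P H1 H2).
Qed.

End Lp_chatter.

Section bochner_chatter.
Variable V : normedModType R.
Implicit Types f s : R -> V.

Local Notation chi a b N f := (patch (fun=> 0) (chatter_set a b N) f).

Lemma bochner_chatter_simple T s e : 0 <= T -> fin_idx (I T) s -> 0 < e ->
  exists2 N0, 0 < N0 & forall N a b, N0 <= N -> 0 <= a -> a <= b -> b <= 1 ->
    `|simple_integral LR (I T) (chi a b N s) -
      (b - a) *: simple_integral LR (I T) s| <= e.
Proof.
move=> T0 fs e0; have [r ur sr] := fin_idx_seq fs.
pose K := \sum_(x <- r) `|x|.
have K0 : 0 <= K by apply: sumr_ge0.
have e'0 : 0 < e / (1 + K) by rewrite divr_gt0// ltr_pwDl.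
have [N0 N00 N0P] := chatter_simple r T0 fs e'0; exists N0 => // N a b NN a0 ab b1.
have {}N00 : 0 < N by exact: lt_le_trans NN.
have fk := fin_idx_chatter N00 a0 b1 fs.
rewrite (simple_integral_idx (measurable_I T) (leb_I_lty T) id ur sr fs : simple_integral LR (I
  T) s = _).
rewrite (simple_integral_idx (measurable_I T) (leb_I_lty T) (fun y : bool * V => if y.1 then
  y.2 else 0) (uniq_pair_true ur) _ fk
   : simple_integral LR (I T) (chi a b N s) = _); last first.
  by move=> t It; apply: mem_pair_true; exact: sr.
rewrite sum_pair_true; last by move=> x /=; rewrite scaler0.
rewrite scaler_sumr -sumrB /=.
apply: (@le_trans _ _ (\sum_(x <- r) e / (1 + K) * `|x|)).
  rewrite (le_trans (ler_norm_sum _ _ _))// big_seq [leRHS]big_seq.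
  apply: ler_sum => x xr; rewrite scalerA -scalerBl normrZ ler_wpM2r//.
  exact: N0P.
rewrite -mulr_sumr -/K mulrAC ler_pdivrMr ?ltr_pwDl// ler_wpM2l ?(ltW e0)//.
by rewrite lerDr.
Qed.

Let chatter_bochner_arith (v v' c c' : V) (w r e : R) : 0 <= w -> w <= 1 ->
  `|v - c| <= r -> `|v' - c'| <= r -> `|c' - w *: c| <= e / 3 -> r <= e / 3 ->
  `|v' - w *: v| <= e.
Proof.
move=> w0 w1 vc vc' cc re.
have -> : v' - w *: v = (v' - c') + (c' - w *: c) + w *: (c - v).
  by rewrite scalerBr !addrA !subrK.
have : `|w *: (c - v)| <= r.
  by rewrite normrZ ger0_norm// distrC (le_trans _ vc)// ler_piMl.
have := ler_normD (v' - c' + (c' - w *: c)) (w *: (c - v)).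
have := ler_normD (v' - c') (c' - w *: c); lra.
Qed.

(** A Riemann-Lebesgue phenomenon: the indicator of the chattering set tends weakly to its mean b -
    a, uniformly in a and b. It is checked on simple functions and extended by approximation in
    L^1. *)
Lemma bochner_chatter T (d : nat -> V) f e : 0 <= T -> dense_seq d ->
  Lp LR (I T) 1 f -> 0 < e ->
  exists2 N0, 0 < N0 & forall N a b v v', N0 <= N -> 0 <= a -> a <= b -> b <= 1 ->
    is_bochner_integral LR (I T) f v ->
    is_bochner_integral LR (I T) (chi a b N f) v' -> `|v' - (b - a) *: v| <= e.
Proof.
move=> T0 dd Lf e0; have e3 : 0 < e / 3 by rewrite divr_gt0.
have [s fs gs] := Lp_simple_approx (lexx 1) dd Lf e3.
have [N0 N00 N0P] := bochner_chatter_simple T0 fs e3.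
exists N0 => // N a b v v' NN a0 ab b1 fv fv'.
have {}N0P := N0P N a b NN a0 ab b1.
have {}N00 : 0 < N by exact: lt_le_trans NN.
have bs s' : fin_idx (I T) s' -> is_bochner_integral LR (I T) s' (simple_integral LR (I T) s').
  move=> fs'; split.
    exact: (strong_simple (measurable_I T) (leb_I_lty T) fs').
  exists (fun=> s'); split => //.
  - by move=> _; apply/(simple_onP (measurable_I T) (leb_I_lty T)).
  - under eq_fun do under eq_integral do rewrite subrr normr0.
    by rewrite integral0; exact: cvg_cst.
  - exact: cvg_cst.
have fcs : fin_idx (I T) (chi a b N s).
  exact: (fin_idx_comp (fun y : bool * V => if y.1 then y.2 else 0) (fin_idx_chatter N00 a0 b1
    fs)).
have H1 := bochner_sub_norm (measurable_I T) (leb_I_lty T) leb_complete fv (bs _ fs).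
have H2 := bochner_sub_norm (measurable_I T) (leb_I_lty T) leb_complete fv' (bs _ fcs).
have Ls := Lp_simple 1 fs; have Lcs := Lp_simple 1 fcs.
have mfs : smeas (I T) (f \- s).
  by apply: (smeasB (measurable_I T) dd); [case: Lf|case: Ls].
have Lfs : Lp LR (I T) 1 (f \- s).
  apply: (Lp_tri (measurable_I T) (lexx 1) mfs Lf (Lp_simple 1 fs)).
  by apply: aeW => t _; exact: ler_normB.
have int1 (g : R -> V) : Lp LR (I T) 1 g -> (\int[LR]_(t in I T) `|g t|%:E)%E = (Lnrm LR (I T)
  1 g)%:E.
  move=> Lg; have := nintE (lexx 1) Lg; rewrite powRr1 ?Lnrm_ge0// => <-.
  by rewrite nint_integral; apply: eq_integral => t _; rewrite powRr1.
have {}H1 : `|v - simple_integral LR (I T) s| <= Lnrm LR (I T) 1 (f \- s).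
  by rewrite -lee_fin -(int1 _ Lfs); exact: H1.
have {}H2 : `|v' - simple_integral LR (I T) (chi a b N s)| <= Lnrm LR (I T) 1 (f \- s).
  rewrite -lee_fin -(int1 _ Lfs); apply: le_trans H2 _; apply: ge0_le_integral.
  - exact: measurable_I.
  - by move=> t _; rewrite lee_fin.
  - apply/measurable_EFinP; apply: smeas_norm.
    have mc := smeas_chatter N00 a0 b1 Lf.1.
    by apply: (smeasB (measurable_I T) dd); [exact: mc|case: Lcs].
  - by apply/measurable_EFinP; exact: smeas_norm.
  - by move=> t _; rewrite lee_fin /patch; case: ifP => //; rewrite subrr normr0.
apply: (chatter_bochner_arith _ _ H1 H2 N0P (ltW gs)); first by rewrite subr_ge0.
by rewrite lerBlDr (le_trans b1)// lerDl.
Qed.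

End bochner_chatter.
End chatter.

(** * Separability of L^p *)

Section Lp_separable.
Context {R : realType}.
Local Notation LT := (caratheodory_type (wlength (@idfun R))^*%mu).
Local Notation I T := (`[0, T]%classic : set LT).
Local Notation LR := (@completed_lebesgue_measure R).
Variables (p T : R) (V : normedModType R) (d : nat -> V).
Hypotheses (p1 : 1 <= p) (T0 : 0 <= T) (dd : dense_seq d).
Local Notation Lp := (Lp LR (I T) p).
Local Notation Lnrm := (Lnrm LR (I T) p).
Let mI := measurable_I T.

Definition step_set (l : seq (rat * rat)) : set R :=
  [set t | has (fun x : rat * rat => t \in `](ratr x.1 : R), ratr x.2]) l].

(** The code [c] ranges over a countable type: finite unions of intervals with rational end points,
    paired with indices of the dense sequence. Density of these functions is the separability of
    L^p. *)
Definition step_fun (c : seq (seq (rat * rat) * nat)) (t : R) : V :=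
  \sum_(x <- c) patch (fun=> 0) (step_set x.1) (fun=> d x.2) t.

Lemma measurable_step_set l : lebesgue_measurable (step_set l).
Proof.
elim: l => [|x l IHl].
  rewrite (_ : step_set _ = set0); first exact: measurable0.
  by apply/seteqP; split => t.
rewrite (_ : step_set _ = `](ratr x.1 : R), ratr x.2] `|` step_set l).
  by apply: measurableU => //; exact: leb_itv_measurable.
by apply/seteqP; split => t; rewrite /step_set /= => /orP.
Qed.

Lemma Lp_patch (A : set R) (v : V) : lebesgue_measurable A ->
  Lp (patch (fun=> 0) A (fun=> v)).
Proof.
move=> mA; have Lv := Lp_cst p mI v (leb_I_lty T).
apply: (Lp_mono mI p1 _ Lv).
  by apply: (smeas_patch mI (measurableI _ _ mI mA)); case: Lv.
by apply: aeW => t _; rewrite /patch; case: ifP => //; rewrite normr0.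
Qed.

Lemma LpD (f g : R -> V) : Lp f -> Lp g -> Lp (f \+ g).
Proof.
move=> Lf Lg; have m := smeasD mI dd Lf.1 Lg.1.
by apply: (Lp_tri mI p1 m Lf Lg); apply: aeW => t _; exact: ler_normD.
Qed.

Lemma LpB (f g : R -> V) : Lp f -> Lp g -> Lp (f \- g).
Proof.
move=> Lf Lg; have m := smeasB mI dd Lf.1 Lg.1.
by apply: (Lp_tri mI p1 m Lf Lg); apply: aeW => t _; exact: ler_normB.
Qed.

Lemma LnrmD (f g : R -> V) : Lp f -> Lp g -> Lnrm (f \+ g) <= Lnrm f + Lnrm g.
Proof.
move=> Lf Lg; have m := smeasD mI dd Lf.1 Lg.1.
by apply: (Lnrm_tri mI p1 m Lf Lg); apply: aeW => t _; exact: ler_normD.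
Qed.

Lemma Lnrm_sub_le (f g h : R -> V) : Lp f -> Lp g -> Lp h ->
  Lnrm (f \- h) <= Lnrm (f \- g) + Lnrm (g \- h).
Proof.
move=> Lf Lg Lh; have L1 := LpB Lf Lg; have L2 := LpB Lg Lh.
have [m _] := LpB Lf Lh; apply: (Lnrm_tri mI p1 m L1 L2).
by apply: aeW => t _; rewrite (le_trans _ (ler_normD _ _))//= addrA subrK.
Qed.

Lemma Lp_step_fun c : Lp (step_fun c).
Proof.
elim: c => [|x c IHc].
  rewrite (_ : step_fun _ = fun=> 0); first exact: Lp_cst (leb_I_lty T).
  by apply/funext => t; rewrite /step_fun big_nil.
rewrite (_ : step_fun _ = patch (fun=> 0) (step_set x.1) (fun=> d x.2) \+ step_fun c).
  apply: LpD IHc; apply: Lp_patch; exact: measurable_step_set.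
by apply/funext => t; rewrite /step_fun big_cons.
Qed.

Lemma Lnrm_indic (A : set R) : lebesgue_measurable A ->
  Lnrm (fun t => \1_A t : R) = fine (LR (A `&` I T)) `^ p^-1.
Proof.
move=> mA; rewrite LnrmE; congr (fine _ `^ _); rewrite nint_integral.
rewrite -(integral_indic LR mI mA); apply: eq_integral => t _.
rewrite indicE; case: (t \in A) => /=.
  by rewrite normr1 powR1.
by rewrite normr0 powR0// gt_eqF// (lt_le_trans ltr01).
Qed.

(** Take a cover nearly attaining the measure of B and cut it off after finitely many intervals. The
    part of B missed is bounded by the tail of the cover, the excess by its total length minus the
    measure of B. *)
Lemma step_set_approx (B : set R) e : lebesgue_measurable B -> B `<=` `[0, T] -> 0 < e ->
  exists l, (leb R ((B `\` step_set l) `|` (step_set l `\` B)) <= e%:E)%E.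
Proof.
move=> mB BT e0; have e2 : 0 < e / 2 by rewrite divr_gt0.
have Bfin := leb_fin_num BT.
have [|x [y [xy Bxy sxy]]] := @leb_rat_cover R B (e / 2) _ e2.
  by rewrite ltey_eq Bfin.
pose J k : set R := `](ratr (x k) : R), ratr (y k)]%classic.
have mJ k : lebesgue_measurable (J k) by exact: leb_itv_measurable.
have lJ k : leb R (J k) = (ratr (y k) - ratr (x k))%:E.
  by rewrite leb_itv_bnd// ler_rat.
have soo : (\sum_(0 <= k <oo) leb R (J k) <= leb R B + (e / 2)%:E)%E.
  by under eq_eseriesr do rewrite lJ.
have soo' : (\sum_(0 <= k <oo) leb R (J k) < +oo)%E.
  by apply: le_lt_trans soo _; rewrite -(fineK Bfin) -EFinD ltry.
have [n tl] : exists n, (\sum_(n <= k <oo) leb R (J k) <= (e / 2)%:E)%E.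
  have /fine_cvgP[fin] := nneseries_tail_cvg (P := xpredT) soo' (fun k _ => leb_ge0 _).
  move=> /cvgrPdist_lt/(_ _ e2) sm; have [n _ nP] := filterI fin sm.
  have [fn smn] := nP n (leqnn n); exists n; rewrite -(fineK fn) lee_fin.
  by move: smn; rewrite /= sub0r normrN => /ltW; apply: le_trans; exact: ler_norm.
pose l := [seq (x k, y k) | k <- iota 0 n]; exists l.
have lP t : step_set l t -> exists k, J k t.
  by move=> /hasP[_ /mapP[k _ ->] kt]; exists k.
have H1 : (leb R (B `\` step_set l) <= (e / 2)%:E)%E.
  apply: le_trans tl; have := @outer_measure_sigma_subadditive_tail _ _ (mu_ext (wlength
    (@idfun R))) n J.
  apply: le_trans; apply: leb_le => t [Bt tl]; have [k _ kt] := Bxy _ Bt.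
  exists k => //= kn; apply: tl; apply/hasP; exists (x k, y k) => //.
  by apply/mapP; exists k => //; rewrite mem_iota.
have H2 : (leb R (step_set l `\` B) <= (e / 2)%:E)%E.
  have sub : step_set l `\` B `<=` \bigcup_k J k `\` B.
    by move=> t [/lP[k kt] Bt]; split => //; exists k.
  apply: le_trans (leb_le sub) _.
  have mU : lebesgue_measurable (\bigcup_k J k) by exact: bigcupT_measurable.
  have mUB : lebesgue_measurable (\bigcup_k J k `\` B) by exact: measurableD.
  have E : leb R (\bigcup_k J k) = (leb R B + leb R (\bigcup_k J k `\` B))%E.
    by rewrite -lebU// ?setDIK// setDUK.
  have : (leb R B + leb R (\bigcup_k J k `\` B) <= leb R B + (e / 2)%:E)%E.
    by rewrite -E; apply: le_trans soo; exact: leb_bigcup_le.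
  by rewrite leeD2lE.
apply: le_trans (lebU2 _ _) _; apply: le_trans (leeD H1 H2) _.
by rewrite -EFinD lee_fin -splitr.
Qed.

Lemma patch_approx (B : set R) (v : V) e : lebesgue_measurable B -> 0 < e ->
  exists c, Lnrm (patch (fun=> 0) B (fun=> v) \- step_fun c) <= e.
Proof.
move=> mB e0; have p0 : 0 < p by exact: lt_le_trans p1.
pose K := Lnrm (fun=> 1 : R).
have K0 : 0 <= K by exact: Lnrm_ge0.
(* Half of [e] pays for replacing the value [v] by a member [d j] of the dense sequence, the other
   half for replacing [B] by a step set. *)
have e10 : 0 < e / (2 * (1 + K)) by rewrite divr_gt0// mulr_gt0// ltr_pwDl.
have [j vj] := dd v e10.
pose w := e / (2 * (1 + `|v|)).
have w0 : 0 < w by rewrite divr_gt0// mulr_gt0// ltr_pwDl.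
have wp0 : 0 < w `^ p by rewrite powR_gt0.
have mBI : lebesgue_measurable (B `&` I T) by exact: measurableI.
have [l lP] := step_set_approx mBI (@subIsetr _ _ _) wp0.
exists [:: (l, j)].
set A := _ `|` _ in lP.
have ml := measurable_step_set l.
have mA : lebesgue_measurable A by apply: measurableU; exact: measurableD.
have LA : Lp (fun t => `|v| * \1_A t : R).
  have L1 := Lp_cst p mI `|v| (leb_I_lty T).
  apply: (Lp_mono mI p1 _ L1).
    apply: smeas_measurable; apply: measurable_funM => //.
  apply: aeW => t _; rewrite normrM normr_id ler_piMr// indicE.
  by case: (_ \in _); rewrite ?normr1 ?normr0.
have LB := Lp_patch v mB; have Ls := Lp_step_fun [:: (l, j)].
have L0 : Lp (fun=> v - d j) by exact: Lp_cst (leb_I_lty T).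
have m := (LpB LB Ls).1.
have H : Lnrm (patch (fun=> 0) B (fun=> v) \- step_fun [:: (l, j)]) <=
    Lnrm (fun=> v - d j) + Lnrm (fun t => `|v| * \1_A t : R).
  apply: (Lnrm_tri mI p1 m L0 LA); apply: aeW => t It.
  rewrite /= /step_fun big_seq1 /= /patch indicE.
  have inA : (t \in A) = ((t \in B) != (t \in step_set l)).
    apply/idP/idP; rewrite /A.
      rewrite inE => -[[[Bt _] lt]|[lt Bt]].
        by rewrite (mem_set Bt) (memNset lt).
      rewrite (mem_set lt); apply/eqP => /set_mem Bt'; apply: Bt; split => //.
    rewrite inE; have [/set_mem Bt|/negP Bt] := boolP (t \in B).
      by move=> /eqP lt; left; split => // lt'; apply: lt; rewrite mem_set.
    have [/set_mem lt _|//] := boolP (t \in step_set l).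
    by right; split => // -[Bt' _]; apply: Bt; rewrite inE.
  rewrite inA; case: (t \in B); case: (t \in step_set l) => /=.
  - by rewrite mulr0 normr0 addr0.
  - by rewrite subr0 mulr1 normr_id lerDr.
  - rewrite sub0r normrN mulr1 normr_id.
    by rewrite -{1}(subKr v (d j)) (le_trans (ler_normB _ _))// addrC.
  - by rewrite subrr normr0 addr_ge0.
apply: le_trans H _; rewrite [e in leRHS]splitr lerD//.
  have : Lnrm (fun=> v - d j) <= `|v - d j| * K.
    apply: (Lnrm_dom mI p1 L0.1 (normr_ge0 _) (Lp_cst p mI (1 : R) (leb_I_lty T))).
    by apply: aeW => t _; rewrite normr1 mulr1.
  move=> /le_trans; apply; apply: (le_trans (ler_wpM2r K0 (ltW vj))).
  rewrite invfM mulrA mulrAC ler_pdivrMr ?ltr_pwDl// ler_wpM2l//.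
    by rewrite divr_ge0// ltW.
  by rewrite lerDr.
have L1 : Lp (fun t => \1_A t : R).
  have L1 := Lp_cst p mI (1 : R) (leb_I_lty T).
  apply: (Lp_mono mI p1 _ L1).
    by apply: smeas_measurable; exact: (@measurable_indic _ LT R (I T) A mA).
  by apply: aeW => t _; rewrite indicE; case: (_ \in _); rewrite ?normr1 ?normr0.
have : Lnrm (fun t => `|v| * \1_A t : R) <= `|v| * Lnrm (fun t => \1_A t : R).
  apply: (Lnrm_dom mI p1 LA.1 (normr_ge0 v) L1).
  by apply: aeW => t _; rewrite normrM normr_id.
move=> /le_trans; apply.
rewrite Lnrm_indic//.
have Aw : fine (LR (A `&` I T)) `^ p^-1 <= w.
  have AT : leb R (A `&` I T) \is a fin_num by apply: leb_fin_num; exact: subIsetr.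
  rewrite -[leRHS](powRK p1 (ltW w0)) ge0_ler_powR ?nnegrE ?invr_ge0 ?(ltW p0) ?powR_ge0
    ?fine_ge0 ?leb_ge0//.
  rewrite -lee_fin fineK//; apply: le_trans lP; apply: leb_le; exact: subIsetl.
apply: (le_trans (ler_wpM2l (normr_ge0 v) Aw)).
have -> : `|v| * w = e / 2 * (`|v| / (1 + `|v|)) by rewrite /w invfM; ring.
rewrite ler_piMr ?divr_ge0 ?(ltW e0)//.
by rewrite ler_pdivrMr ?ltr_pwDl// mul1r lerDr.
Qed.

Lemma Lp_step_dense f e : Lp f -> 0 < e -> exists c, Lnrm (f \- step_fun c) < e.
Proof.
move=> Lf e0; have e2 : 0 < e / 2 by rewrite divr_gt0.
have [s fs fse] := Lp_simple_approx p1 dd Lf e2.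
have [r ur sr] := fin_idx_seq fs.
have Ls := Lp_simple p fs.
have mB v : lebesgue_measurable (I T `&` s @^-1` [set v]) by exact: (fs.2 v).
pose g r' t := \sum_(v <- r') patch (fun=> 0) (I T `&` s @^-1` [set v]) (fun=> v) t.
have gE v r' : g (v :: r') = patch (fun=> 0) (I T `&` s @^-1` [set v]) (fun=> v) \+ g r'.
  by apply/funext => t; rewrite /g big_cons.
have Lg r' : Lp (g r').
  elim: r' => [|v r' IH]; last by rewrite gE; apply: LpD IH; exact: Lp_patch.
  rewrite (_ : g _ = fun=> 0); first exact: Lp_cst (leb_I_lty T).
  by apply/funext => t; rewrite /g big_nil.
have [c cP] : exists c, Lnrm (g r \- step_fun c) <= e / 2.
  elim: (r) (e / 2) e2 => [|v r' IH] e' e'0.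
    exists [::]; rewrite (_ : _ \- _ = fun=> 0).
      rewrite (_ : Lnrm _ = 0) ?(ltW e'0)//; apply/eqP; rewrite eq_le Lnrm_ge0 andbT.
      have L0 : Lp (fun=> 0 : V) by exact: Lp_cst (leb_I_lty T).
      rewrite -[leRHS](mul0r (Lnrm (fun=> 0 : V))).
      by apply: (Lnrm_dom mI p1 L0.1 (lexx 0) L0); apply: aeW => t _; rewrite mul0r normr0.
    by apply/funext => t; rewrite /= /g /step_fun !big_nil subrr.
  have e'2 : 0 < e' / 2 by rewrite divr_gt0.
  have [c1 c1P] := IH _ e'2; have [c2 c2P] := patch_approx v (mB v) e'2.
  exists (c2 ++ c1); rewrite gE.
  rewrite (_ : _ \- _ = (patch (fun=> 0) (I T `&` s @^-1` [set v]) (fun=> v) \- step_fun c2) \+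
    (g r' \- step_fun c1)); last first.
    by apply/funext => t; rewrite /= /step_fun big_cat/= opprD addrACA.
  have A1 := LpB (Lp_patch v (mB v)) (Lp_step_fun c2).
  have A2 := LpB (Lg r') (Lp_step_fun c1).
  by apply: (le_trans (LnrmD A1 A2)); rewrite [leRHS]splitr; exact: lerD.
exists c; apply: (@le_lt_trans _ _ (Lnrm (f \- s) + Lnrm (s \- step_fun c))).
  exact: (Lnrm_sub_le Lf Ls (Lp_step_fun c)).
rewrite [ltRHS]splitr; apply: ltr_leD fse _; apply: le_trans cP.
have Lgc := LpB (Lg r) (Lp_step_fun c).
apply: (Lnrm_mono mI p1 (LpB Ls (Lp_step_fun c)).1 Lgc); apply: aeW => t It /=.
rewrite /g (bigD1_seq (s t)) ?sr//= /patch mem_set// big1 ?addr0// => v vs.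
by rewrite memNset// => -[_ /= E]; rewrite E eqxx in vs.
Qed.

(** Separability passes to subsets: for each step function and each radius 1/(m+1), one member of
    the family within that radius is chosen, if there is one. Density is meant in L^p through [v],
    so [Z] may be a bare type. *)
Lemma Lp_dense_family (Z : Type) (z0 : Z) (v : Z -> R -> V) : (forall z, Lp (v z)) ->
  exists zs : nat -> Z, forall z e, 0 < e -> exists n, Lnrm (v z \- v (zs n)) < e.
Proof.
move=> Lv; pose P (c : seq (seq (rat * rat) * nat)) (m : nat) z :=
  Lnrm (v z \- step_fun c) < m.+1%:R^-1.
have /boolp.choice[zs zsP] : forall n : nat, exists z, forall c m,
    unpickle n = Some (c, m) -> (exists z', P c m z') -> P c m z.
  move=> n; case: (unpickle n) => [[c m]|]; last by exists z0.
  have [[z' z'P]|nP] := pselect (exists z', P c m z').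
    by exists z' => _ _ [<- <-].
  by exists z0 => _ _ [<- <-] /nP.
exists zs => z e e0; have e2 : 0 < e / 2 by rewrite divr_gt0.
have [m _ /(_ m (leqnn m)) /= me] := near_infty_natSinv_lt (PosNum e2).
have m0 : 0 < m.+1%:R^-1 :> R by rewrite invr_gt0.
have [c cP] := Lp_step_dense (Lv z) m0.
pose n := pickle (c, m); exists n.
have znP : P c m (zs n) by apply: zsP; [rewrite /n pickleK|exists z].
apply: le_lt_trans (Lnrm_sub_le (Lv z) (Lp_step_fun c) (Lv (zs n))) _.
have -> : Lnrm (step_fun c \- v (zs n)) = Lnrm (v (zs n) \- step_fun c).
  have L1 := LpB (Lp_step_fun c) (Lv (zs n)); have L2 := LpB (Lv (zs n)) (Lp_step_fun c).
  apply/eqP; rewrite eq_le; apply/andP; split.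
    by apply: (Lnrm_mono mI p1 L1.1 L2); apply: aeW => t _; rewrite /= distrC.
  by apply: (Lnrm_mono mI p1 L2.1 L1); apply: aeW => t _; rewrite /= distrC.
rewrite [ltRHS]splitr; apply: ltrD; first exact: lt_trans cP me.
exact: lt_trans znP me.
Qed.

End Lp_separable.

(** * Continuous chattering of a sequence of functions *)

Section cvg_lattice.
Context {R : realType}.
Implicit Types (f g : nat -> R) (a b : R).

Lemma cvgr_max f g a b : f n @[n --> \oo] --> a -> g n @[n --> \oo] --> b ->
  Num.max (f n) (g n) @[n --> \oo] --> Num.max a b.
Proof.
move=> fa gb; under eq_fun do rewrite maxr_absE; rewrite maxr_absE.
apply: cvgM; last exact: cvg_cst.
by apply: cvgD; [exact: cvgD|apply: cvg_norm; exact: cvgB].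
Qed.

Lemma cvgr_min f g a b : f n @[n --> \oo] --> a -> g n @[n --> \oo] --> b ->
  Num.min (f n) (g n) @[n --> \oo] --> Num.min a b.
Proof.
move=> fa gb; under eq_fun do rewrite minr_absE; rewrite minr_absE.
apply: cvgM; last exact: cvg_cst.
by apply: cvgB; [exact: cvgD|apply: cvg_norm; exact: cvgB].
Qed.

Definition clamp01 a : R := Num.min 1 (Num.max 0 a).

Lemma cvg_clamp01 f a : f n @[n --> \oo] --> a ->
  clamp01 (f n) @[n --> \oo] --> clamp01 a.
Proof.
by move=> fa; apply: cvgr_min; [exact: cvg_cst|apply: cvgr_max => //; exact: cvg_cst].
Qed.

Lemma clamp01_ge0 a : 0 <= clamp01 a.
Proof. by rewrite /clamp01 le_min ler01 le_max lexx. Qed.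

Lemma clamp01_eq1 a : 1 <= a -> clamp01 a = 1.
Proof. by move=> x1; rewrite /clamp01 min_l// le_max x1 orbT. Qed.

Lemma clamp01_eq0 a : a <= 0 -> clamp01 a = 0.
Proof. by move=> x0; rewrite /clamp01 max_l// min_r. Qed.

End cvg_lattice.

Section seqcont.
Context {R : realType} {Z : Type} (conv : (nat -> Z) -> Z -> Prop).
Implicit Types f g : Z -> R.

(** [conv] is an arbitrary relation: continuity is used only along sequences, and the parameter
    space carries no declared topology. *)
Definition seqcont (V : normedModType R) (f : Z -> V) : Prop :=
  forall zs z, conv zs z -> f (zs n) @[n --> \oo] --> f z.

Lemma seqcont_sum (f : nat -> Z -> R) m : (forall j, seqcont (f j)) ->
  seqcont (fun z => \sum_(j < m) f j z).
Proof.
move=> cf; elim: m => [|m IHm].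
  by move=> zs z _; rewrite big_ord0; under eq_fun do rewrite big_ord0; exact: cvg_cst.
move=> zs z zc; rewrite big_ord_recr/=; under eq_fun do rewrite big_ord_recr/=.
by apply: cvgD; [exact: IHm|exact: cf].
Qed.

Lemma sum_tail0 (f : nat -> R) m m' : (forall j, (m <= j)%N -> f j = 0) -> (m <= m')%N ->
  \sum_(j < m') f j = \sum_(j < m) f j.
Proof.
move=> f0 mm'; rewrite -(subnKC mm'); elim: (m' - m)%N => [|k IHk]; first by rewrite addn0.
by rewrite addnS big_ord_recr/= IHk f0 ?addr0// leq_addr.
Qed.

(** The cut-off [M] may jump: near [z] all terms from [M z] on vanish, so the sums there can be
    taken up to the fixed [M z]. *)
Lemma seqcont_locsum (f : nat -> Z -> R) (M : Z -> nat) : (forall j, seqcont (f j)) ->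
  (forall z j, (M z <= j)%N -> f j z = 0) ->
  (forall zs z, conv zs z -> \forall n \near \oo, forall j, (M z <= j)%N -> f j (zs n) = 0) ->
  seqcont (fun z => \sum_(j < M z) f j z).
Proof.
move=> cf f0 f0n zs z zc.
apply: (@cvg_trans _ (\sum_(j < M z) f j (zs n) @[n --> \oo])); last first.
  exact: (seqcont_sum cf zc).
apply: near_eq_cvg; apply: filterS (f0n _ _ zc) => n fn.
have fn' j : (M (zs n) <= j)%N -> f j (zs n) = 0 by exact: f0.
have [le|/ltnW le] := leqP (M z) (M (zs n)).
  by rewrite (sum_tail0 fn le).
by rewrite (sum_tail0 fn' le).
Qed.

End seqcont.

Lemma countable_negligible (R : realType) (A : set R) : countable A ->
  (@completed_lebesgue_measure R).-negligible A.
Proof.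
move=> cA; exists A; split => //.
  by apply: leb_measurable; exact: countable_measurable.
exact: (countable_lebesgue_measure0 cA).
Qed.

Section chatter_frequency.
Context {R : realType} {Z : Type} (conv : (nat -> Z) -> Z -> Prop).
Variables (gs : nat -> Z -> R) (rate : nat -> nat -> Z -> R) (eps : Z -> R).
Hypotheses (gs0 : forall j z, 0 <= gs j z) (gsc : forall j, seqcont conv (gs j)).
Hypothesis gsdiv : forall z (C : R), exists m, C <= \sum_(j < m) gs j z.
Hypotheses (rate_ge0 : forall j n z, 0 <= rate j n z)
  (rate_sc : forall j n, seqcont conv (rate j n))
  (rate_mono : forall j n n' z, (n <= n')%N -> rate j n' z <= rate j n z)
  (rate0 : forall j z, rate j n z @[n --> \oo] --> (0 : R)).
Hypotheses (eps0 : forall z, 0 < eps z) (eps_sc : seqcont conv eps).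

Let psum j z := \sum_(i < j) gs i z.

Let psum_mono j j' z : (j <= j')%N -> psum j z <= psum j' z.
Proof.
move=> jj'; rewrite /psum -(subnKC jj'); elim: (j' - j)%N => [|k IHk]; first by rewrite addn0.
by rewrite addnS big_ord_recr/= (le_trans IHk)// lerDl.
Qed.

Let psum_sc j : seqcont conv (psum j). Proof. exact: seqcont_sum. Qed.

(* [Lam] are the break points of a partition of [0,1] built from the cover functions [gs]:
   every [gs j] is used until the partial sums reach 1, and [sigma] cuts off the indices
   beyond. The frequency [N] exceeds each [n] whose total error rate [D n] is not yet below
   [eps]. *)
Lemma glue_weights : exists (Lam : nat -> Z -> R) (N : Z -> R) (M : Z -> nat),
  [/\ [/\ forall j, seqcont conv (Lam j), seqcont conv N,
        forall z, Lam 0%N z = 0 & forall j j' z, (j <= j')%N -> Lam j z <= Lam j' z],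
      forall j z, Lam j z <= 1,
      forall zs z, conv zs z -> \forall n \near \oo, forall j, (M z <= j)%N -> Lam j (zs n) = 1,
      forall z j, (M z <= j)%N -> Lam j z = 1 &
      forall z, 0 < N z /\ exists n (rho : nat -> R),
        [/\ n%:R <= N z, forall j, 0 <= rho j,
            \sum_(j < M z) rho j <= eps z &
            forall j, Lam j z < Lam j.+1 z -> 0 < gs j z /\ rate j n z <= rho j]].
Proof.
(* Reaching 3 at [z] leaves room to stay above 2 nearby; from 2 on [sigma] vanishes and the break
   points equal 1. *)
have /boolp.choice[M MP] : forall z, exists m, 3 <= psum m z by move=> z; exact: gsdiv.
pose sigma j z := clamp01 (2 - psum j z).
have sig0 j z : 2 <= psum j z -> sigma j z = 0.
  by move=> h; rewrite /sigma clamp01_eq0// subr_le0.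
have sig1 j z : psum j z <= 1 -> sigma j z = 1.
  by move=> h; rewrite /sigma clamp01_eq1//; lra.
have sigc j : seqcont conv (sigma j).
  by move=> zs z zc; apply: cvg_clamp01; apply: cvgB; [exact: cvg_cst|exact: psum_sc].
have Mn zs z : conv zs z -> \forall n \near \oo, forall j, (M z <= j)%N -> 2 <= psum j (zs n).
  move=> zc; have lt : 2 < psum (M z) z by apply: lt_le_trans (MP z); lra.
  apply: filterS (cvgr_ge _ (@psum_sc (M z) _ _ zc) _ lt) => n h j Mj.
  by apply: le_trans h _; exact: psum_mono.
have M2 z j : (M z <= j)%N -> 2 <= psum j z.
  by move=> Mj; apply: le_trans (psum_mono z Mj); apply: le_trans (MP z); lra.
pose D n z := \sum_(j < M z) sigma j z * rate j n z.
have Dsc n : seqcont conv (D n).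
  apply: (@seqcont_locsum _ _ conv (fun j z => sigma j z * rate j n z) M).
  - by move=> j zs z zc; apply: cvgM; [exact: sigc|exact: rate_sc].
  - by move=> z j Mj; rewrite sig0 ?mul0r// M2.
  - move=> zs z zc; apply: filterS (Mn _ _ zc) => i h j Mj.
    by rewrite sig0 ?mul0r// h.
have D0 n z : 0 <= D n z.
  by apply: sumr_ge0 => j _; rewrite mulr_ge0// clamp01_ge0.
have Dmono n n' z : (n <= n')%N -> D n' z <= D n z.
  by move=> nn'; apply: ler_sum => j _; rewrite ler_wpM2l ?clamp01_ge0// rate_mono.
have Dcvg z : D n z @[n --> \oo] --> (0 : R).
  rewrite /D; elim: (M z) => [|m IHm].
    by under eq_fun do rewrite big_ord0; exact: cvg_cst.
  under eq_fun do rewrite big_ord_recr/=.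
  suff : (\sum_(j < m) sigma j z * rate j n z + sigma m z * rate m n z) @[n --> \oo] -->
    (0 + sigma m z * 0) by rewrite mulr0 addr0.
  by apply: cvgD => //; apply: cvgM; [exact: cvg_cst|exact: rate0].
have /boolp.choice[P PP] : forall z, exists n, D n z < eps z / 2.
  move=> z; have e2 : 0 < eps z / 2 by rewrite divr_gt0.
  by have [n _ nP] := cvgr_lt _ (Dcvg z) _ e2; exists n; exact: (nP n (leqnn n)).
(* [c n z] is 1 when [D n z] is at least [eps z] and 0 when it is at most half of [eps z]. The
   interpolation in between makes [N], which counts the insufficient frequencies, continuous. *)
pose c n z := clamp01 (2 * D n z / eps z - 1).
have c0 n z : D n z <= eps z / 2 -> c n z = 0.
  move=> h; rewrite /c clamp01_eq0// subr_le0 ler_pdivrMr// mul1r; lra.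
have c1 n z : eps z <= D n z -> c n z = 1.
  by move=> h; rewrite /c clamp01_eq1// lerBrDr ler_pdivlMr//; lra.
pose N z := 1 + \sum_(n < P z) c n z.
have csc n : seqcont conv (c n).
  move=> zs z zc; apply: cvg_clamp01; apply: cvgB; last exact: cvg_cst.
  apply: cvgM; first by apply: cvgM; [exact: cvg_cst|exact: Dsc].
  by apply: cvgV; [rewrite gt_eqF|exact: eps_sc].
have Nsc : seqcont conv N.
  suff sc : seqcont conv (fun z => \sum_(n < P z) c n z).
    by move=> zs z zc; apply: cvgD; [exact: cvg_cst|exact: sc].
  apply: (@seqcont_locsum _ _ conv c P) => //.
    by move=> z j Pj; apply: c0; apply: le_trans (Dmono _ _ z Pj) _; exact: ltW.
  move=> zs z zc.
  have h0 : 0 < eps z / 2 - D (P z) z by rewrite subr_gt0.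
  have sc' : seqcont conv (fun z' => eps z' / 2 - D (P z) z').
    move=> zs' z' zc'; apply: cvgB; last exact: Dsc.
    by apply: cvgM; [exact: eps_sc|exact: cvg_cst].
  apply: filterS (cvgr_ge _ (sc' _ _ zc) _ h0) => n; rewrite subr_ge0 => h j Pj.
  by apply: c0; exact: le_trans (Dmono _ _ _ Pj) h.
exists (fun j z => Num.min 1 (psum j z)), N, M; split.
- split => [j||z|j j' z jj'].
  + by move=> zs z zc; apply: cvgr_min; [exact: cvg_cst|exact: psum_sc].
  + exact: Nsc.
  + by rewrite /psum big_ord0 min_r.
  + by rewrite le_min ge_min lexx/= ge_min psum_mono// orbT.
- by move=> j z; rewrite ge_min lexx.
- move=> zs z zc; apply: filterS (Mn _ _ zc) => n h j Mj.
  by rewrite min_l//; apply: le_trans (h j Mj); lra.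
- by move=> z j Mj; rewrite min_l//; apply: le_trans (M2 z j Mj); lra.
move=> z; split.
  by rewrite /N ltr_pwDl// sumr_ge0// => n _; exact: clamp01_ge0.
have ex : exists n, D n z <= eps z.
  by exists (P z); apply: le_trans (ltW (PP z)) _; rewrite ler_pdivrMr// ler_peMr ?ltW//; lra.
(* [n] is the first frequency with admissible total error; all smaller ones count fully in [N],
   hence n <= N. *)
have [n Dn nmin] := ex_minnP ex; exists n, (fun j => sigma j z * rate j n z).
have nP : (n <= P z)%N.
  by apply: nmin; apply: le_trans (ltW (PP z)) _; rewrite ler_pdivrMr// ler_peMr ?ltW//; lra.
split => //.
- have : \sum_(i < n) c i z = n%:R.
    rewrite (eq_bigr (fun=> 1)) => [|i _]; first by rewrite sumr_const card_ord.
    apply: c1; rewrite leNgt; apply/negP => /ltW /nmin; by rewrite leqNgt ltn_ord.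
  move=> <-; rewrite /N; apply: le_trans (_ : \sum_(i < P z) c i z <= _); last by rewrite lerDr.
  rewrite -(subnKC nP); elim: (P z - n)%N => [|k IHk]; first by rewrite addn0.
  by rewrite addnS big_ord_recr/= (le_trans IHk)// lerDl clamp01_ge0.
- by move=> j; rewrite mulr_ge0// clamp01_ge0.
- move=> j; rewrite {2}/psum big_ord_recr/= -/(psum j z) => lt.
  have s1 : psum j z <= 1.
    rewrite leNgt; apply/negP => gt.
    have g2 : 1 <= psum j z + gs j z by apply: le_trans (ltW gt) _; rewrite lerDl.
    by move: lt; rewrite (min_l (ltW gt)) (min_l g2) ltxx.
  rewrite sig1// mul1r lexx; split => //.
  rewrite lt_neqAle gs0 andbT; apply/eqP => g0.
  by move: lt; rewrite -g0 addr0 ltxx.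
Qed.

End chatter_frequency.

Section glue.
Context {R : realType} {Z : Type} (conv : (nat -> Z) -> Z -> Prop).
Local Notation LT := (caratheodory_type (wlength (@idfun R))^*%mu).
Local Notation I T := (`[0, T]%classic : set LT).
Local Notation LR := (@completed_lebesgue_measure R).
Variables (p T : R) (V : normedModType R) (d : nat -> V).
Hypotheses (p1 : 1 <= p) (T0 : 0 <= T) (dd : dense_seq d).
Local Notation Lp := (Lp LR (I T) p).
Local Notation Lnrm := (Lnrm LR (I T) p).
Let mI := measurable_I T.

Definition Lpcont (v : Z -> R -> V) : Prop := forall zs z, conv zs z ->
  Lnrm (v (zs n) \- v z) @[n --> \oo] --> (0 : R).

Lemma phase_cvg (N : nat -> R) (N0 t : R) : N n @[n --> \oo] --> N0 ->
  phase N0 t != 0 -> phase (N n) t @[n --> \oo] --> phase N0 t.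
Proof.
move=> NN ph; have Nt : N n * t @[n --> \oo] --> N0 * t by apply: cvgM => //; exact: cvg_cst.
set m := Num.floor (N0 * t).
have phE : phase N0 t = N0 * t - m%:~R by [].
have ph01 := phase_itv N0 t.
have lo : m%:~R < N0 * t by rewrite -subr_gt0 -phE lt_neqAle eq_sym ph; case/andP: ph01.
have hi : N0 * t < (m + 1)%:~R by rewrite intrD; case/andP: ph01; rewrite phE => _; lra.
apply: (@cvg_trans _ (N n * t - m%:~R @[n --> \oo])); last first.
  by rewrite phE; apply: cvgB => //; exact: cvg_cst.
apply: near_eq_cvg; near=> n; apply/esym; apply: phaseE.
by apply/andP; split; [near: n; exact: cvgr_ge _ Nt _ lo|near: n; exact: cvgr_lt _ Nt _ hi].
Unshelve. all: by end_near. Qed.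

(** Only at these times can the function in use jump under a small change of the parameter; being
    countable, they are negligible. *)
Lemma phase_level_countable (N : R) (Lam : nat -> R) : 0 < N ->
  countable [set t | exists j, phase N t = Lam j].
Proof.
move=> N0; apply: (@sub_countable _ _ _
    (range (fun x : nat * int => (x.2%:~R + Lam x.1) / N))); last exact: card_le_trans
      (card_image_le _ _) (countableP _).
apply: subset_card_le => t [j jP]; exists (j, Num.floor (N * t)) => //=.
by rewrite -jP /phase addrC subrK mulrC mulKf// gt_eqF.
Qed.

Lemma Lp_norm_sum (u : nat -> R -> V) m : (forall j, Lp (u j)) ->
  Lp (fun t => \sum_(j < m) `|u j t| : R).
Proof.
move=> Lu; have [dR ddR] := @dense_seq_real R; elim: m => [|m IHm].
  rewrite (_ : (fun t => _) = fun=> 0); first exact: Lp_cst (leb_I_lty T).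
  by apply/funext => t; rewrite big_ord0.
rewrite (_ : (fun t => _) = (fun t => \sum_(j < m) `|u j t| : R) \+ (fun t => `|u m t|)).
  apply: (LpD p1 ddR IHm); apply: (Lp_mono mI p1 _ (Lu m)).
    by apply: smeas_measurable; exact: (smeas_norm (Lu m).1).
  by apply: aeW => t _; rewrite normr_id.
by apply/funext => t; rewrite big_ord_recr.
Qed.

Variables (gs : nat -> Z -> R) (rate : nat -> nat -> Z -> R) (eps : Z -> R).
Hypotheses (gs0 : forall j z, 0 <= gs j z) (gsc : forall j, seqcont conv (gs j)).
Hypothesis gsdiv : forall z (C : R), exists m, C <= \sum_(j < m) gs j z.
Hypotheses (rate_ge0 : forall j n z, 0 <= rate j n z)
  (rate_sc : forall j n, seqcont conv (rate j n))
  (rate_mono : forall j n n' z, (n <= n')%N -> rate j n' z <= rate j n z)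
  (rate0 : forall j z, rate j n z @[n --> \oo] --> (0 : R)).
Hypotheses (eps0 : forall z, 0 < eps z) (eps_sc : seqcont conv eps).
Variable u : nat -> R -> V.
Hypothesis Lu : forall j, Lp (u j).

(** Off the countably many times whose phase is a break point, the function in use is locally
    constant in the parameter; continuity in L^p then follows by dominated convergence. The last
    clause exposes the construction for later estimates. *)
Lemma chatter_glue : exists v : Z -> R -> V, [/\ forall z, Lp (v z), Lpcont v &
  forall z, exists (N : R) (Lam : nat -> R) (m n : nat) (rho : nat -> R) (k : R -> nat),
   [/\ [/\ 0 < N, n%:R <= N, Lam 0%N = 0, Lam m = 1 & forall j, 0 <= Lam j <= Lam j.+1 /\ Lam j
     <= 1],
       [/\ forall j, 0 <= rho j, \sum_(j < m) rho j <= eps z &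
          forall j, Lam j < Lam j.+1 -> 0 < gs j z /\ rate j n z <= rho j],
       forall t, v z t = u (k t) t,
       forall t, (k t < m)%N & forall t j, k t = j <-> chatter_set (Lam j) (Lam j.+1) N t]].
Proof.
have [Lam [N [M [[Lsc Nsc Lam0 Lmono] L1 Mn M1 NP]]]] :=
  glue_weights gs0 gsc gsdiv rate_ge0 rate_sc rate_mono rate0 eps0 eps_sc.
have ex z t : exists j, phase (N z) t < Lam j.+1 z.
  by exists (M z); rewrite M1//; case/andP: (phase_itv (N z) t).
(* The least admissible index; a [j] with [Lam j z = Lam j.+1 z] is never chosen. *)
pose k z t := ex_minn (ex z t).
have kP z t j : k z t = j <-> chatter_set (Lam j z) (Lam j.+1 z) (N z) t.
  rewrite /k; case: ex_minnP => i iP imin; rewrite /chatter_set /=; split.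
    move=> <-; rewrite iP andbT; case: i iP imin => [|i] iP imin.
      by rewrite Lam0; case/andP: (phase_itv (N z) t).
    by rewrite leNgt; apply/negP => /imin; rewrite ltnn.
  move=> /andP[lo hi]; apply/eqP; rewrite eqn_leq imin//= leqNgt; apply/negP => ij.
  by have := lt_le_trans iP (le_trans (Lmono _ _ z ij) lo); rewrite ltxx.
have kM z t : (k z t < M z)%N.
  rewrite ltnNge; apply/negP => le.
  have /kP/andP[+ _] := erefl (k z t); rewrite M1// => h.
  by case/andP: (phase_itv (N z) t) => _ /(le_lt_trans h); rewrite ltxx.
have L0 z j : 0 <= Lam j z by rewrite -(Lam0 z) Lmono.
have mk z : measurable_fun (I T) (k z).
  apply/(measurable_idxP mI) => j; rewrite (_ : _ @^-1` _ = chatter_set (Lam j z) (Lam j.+1 z)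
    (N z)).
    by apply: measurableI => //; apply: measurable_chatter_set => //; case: (NP z).
  by apply/seteqP; split => t /= /kP.
have Lv z : Lp (fun t => u (k z t) t).
  by apply: (Lp_glue mI p1 (m := M z)) => // t _; exact: kM.
exists (fun z t => u (k z t) t); split => //; last first.
  move=> z; have [N0 [n [rho [nN r0 rs rP]]]] := NP z.
  exists (N z), (Lam ^~ z), (M z), n, rho, (k z); split => //.
  by split => // [|j]; [exact: M1|rewrite L0 Lmono].
move=> zs z zc; have [dR ddR] := @dense_seq_real R.
have LG := Lp_norm_sum (M z) Lu; have LG2 := LpD p1 ddR LG LG.
have Mn' := Mn _ _ zc.
have leS (t : R) (i : nat) : (i < M z)%N -> `|u i t| <= \sum_(j < M z) `|u j t|.
  by move=> im; rewrite (bigD1 (Ordinal im))//= lerDl sumr_ge0.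
apply: (Lnrm_cvg0 mI p1 _ LG2).
- by move=> n; exact: (LpB p1 dd (Lv (zs n)) (Lv z)).1.
- apply: filterS Mn' => n Mn'; apply: aeW => t _ /=.
  have kn : (k (zs n) t < M z)%N.
    rewrite ltnNge; apply/negP => le.
    have /kP/andP[+ _] := erefl (k (zs n) t); rewrite Mn'// => h.
    by case/andP: (phase_itv (N (zs n)) t) => _ /(le_lt_trans h); rewrite ltxx.
  apply: le_trans (ler_normB _ _) _; rewrite ger0_norm; last first.
    by rewrite addr_ge0// sumr_ge0.
  by apply: lerD; apply: leS.
- have [N0 _] := NP z.
  have := countable_negligible (phase_level_countable (Lam ^~ z) N0).
  apply: negligibleS => t /= nt; apply: contrapT => nex; apply: nt => _.
  have ph0 : phase (N z) t != 0.
    by apply/eqP => ph; apply: nex; exists 0%N; rewrite Lam0.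
  have pc := phase_cvg (Nsc _ _ zc) ph0.
  have /kP/andP[lo hi] := erefl (k z t); set j := k z t in lo hi *.
  have lo' : Lam j z < phase (N z) t.
    by rewrite lt_neqAle lo andbT; apply/eqP => E; apply: nex; exists j.
  have n1 : \forall n \near \oo, 0 < phase (N (zs n)) t - Lam j (zs n).
    apply: (@cvgr_gt _ _ \oo _ _ (phase (N z) t - Lam j z)); rewrite ?subr_gt0//.
    by apply: cvgB => //; exact: Lsc.
  have n2 : \forall n \near \oo, 0 < Lam j.+1 (zs n) - phase (N (zs n)) t.
    apply: (@cvgr_gt _ _ \oo _ _ (Lam j.+1 z - phase (N z) t)); rewrite ?subr_gt0//.
    by apply: cvgB => //; exact: Lsc.
  apply: cvg_near_cst; apply: filterS2 n1 n2 => n; rewrite !subr_gt0 => lo1 hi1.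
  have -> : k (zs n) t = j by apply/kP; rewrite /chatter_set /= hi1 ltW.
  by rewrite /= subrr.
Qed.

End glue.

Lemma cvg_le_dist (R : realType) (V : normedModType R) (f : nat -> V) (a : V) (g : nat -> R) :
  (forall n, `|f n - a| <= g n) -> g n @[n --> \oo] --> (0 : R) -> f n @[n --> \oo] --> a.
Proof.
move=> fg g0; apply/cvgrPdist_lt => e e0.
apply: filterS (cvgr_lt _ g0 _ e0) => n; apply: le_lt_trans.
by rewrite distrC.
Qed.

(** * Distance to the values of the multifunction *)

Section real_distance.
Context {R : realType} {E : normedModType R}.
Implicit Types (x y e : E) (A B : set E) (c r : R).

(** The distance to the empty set is +oo, which [fine] sends to 0; hence the nonemptiness hypotheses
    below. *)
Definition rdist e A : R := fine (dist e A).

Lemma dist_ge0 e A : (0 <= dist e A)%E.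
Proof. by apply: le_ereal_inf_tmp => _ [y _ <-]; rewrite lee_fin. Qed.

Lemma dist_le e A y : A y -> (dist e A <= `|e - y|%:E)%E.
Proof. by move=> Ay; apply: ereal_inf_lbound; exists y. Qed.

Lemma rdist_ge0 e A : 0 <= rdist e A.
Proof. by rewrite fine_ge0// dist_ge0. Qed.

Lemma rdistE e A : A !=set0 -> dist e A = (rdist e A)%:E.
Proof.
move=> [y Ay]; rewrite /rdist fineK// ge0_fin_numE ?dist_ge0//.
by apply: le_lt_trans (dist_le e Ay) _; rewrite ltry.
Qed.

Lemma rdist_le e A y : A y -> rdist e A <= `|e - y|.
Proof. by move=> Ay; rewrite -lee_fin -rdistE; [exact: dist_le|exists y]. Qed.

Lemma rdist_lt e A r : A !=set0 -> rdist e A < r -> exists2 y, A y & `|e - y| < r.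
Proof.
move=> A0; rewrite -lte_fin -rdistE// => /ereal_inf_lt[_ [y Ay <-]].
by rewrite lte_fin => h; exists y.
Qed.

Lemma rdist_lb e A r : A !=set0 -> (forall y, A y -> r <= `|e - y|) -> r <= rdist e A.
Proof.
move=> A0 h; rewrite leNgt; apply/negP => /(rdist_lt A0)[y Ay].
by rewrite ltNge h.
Qed.

Lemma rdist_ball e e' A : A !=set0 -> rdist e A <= rdist e' A + `|e - e'|.
Proof.
move=> A0; rewrite -lerBlDr; apply: (rdist_lb A0) => y Ay; rewrite lerBlDr.
apply: le_trans (rdist_le e Ay) _.
by rewrite [leRHS]addrC (le_trans _ (ler_normD _ _))// addrA subrK.
Qed.

Lemma rdist_lip e e' A : A !=set0 -> `|rdist e A - rdist e' A| <= `|e - e'|.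
Proof.
move=> A0; have h1 := rdist_ball e e' A0; have := rdist_ball e' e A0.
by rewrite distrC => h2; rewrite ler_norml; apply/andP; split; lra.
Qed.

Lemma rdist_closed e A : A !=set0 -> closed A -> rdist e A = 0 -> A e.
Proof.
move=> A0 cA e0; apply: cA => B /nbhs_ballP[r /= r0 rB].
have : rdist e A < r by rewrite e0.
by move=> /(rdist_lt A0)[y Ay ey]; exists y; split => //; apply: rB; rewrite -ball_normE.
Qed.

Lemma rdist_hausdorff e A B c : A !=set0 -> B !=set0 ->
  (hausdorff_dist A B <= c%:E)%E -> rdist e B <= rdist e A + c.
Proof.
move=> A0 B0 hc; rewrite -lerBlDr; apply: (rdist_lb A0) => y Ay; rewrite lerBlDr.
apply: le_trans (rdist_ball e y B0) _; rewrite addrC lerD2l -lee_fin -rdistE//.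
apply: le_trans hc; rewrite /hausdorff_dist le_max; apply/orP; left.
by apply: ereal_sup_ubound; exists y.
Qed.

End real_distance.

(** * Measurable approximate selections *)

Section selection.
Context d (S : measurableType d) (R : realType) (D : set S).
Hypothesis mD : measurable D.

(** Taking the least index makes each level set a Boolean combination of measurable sets. *)
Lemma measurable_first (P : nat -> S -> bool) :
  (forall j, measurable (D `&` [set t | P j t])) -> (forall t, D t -> exists j, P j t) ->
  exists k : S -> nat, measurable_fun D k /\ forall t, D t -> P (k t) t.
Proof.
move=> mP ex.
pose k t := if pselect (exists j, P j t) is left e then ex_minn e else 0%N.
have kP t : D t -> P (k t) t /\ forall i, P i t -> (k t <= i)%N.
  move=> Dt; rewrite /k; case: pselect => [e|/(_ (ex t Dt))//].
  by case: ex_minnP.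
exists k; split => [|t /kP[]//]; apply/(measurable_idxP mD) => n.
rewrite (_ : _ `&` _ = (D `&` [set t | P n t]) `\` \bigcup_(i < n) (D `&` [set t | P i t])).
  apply: measurableD => //; apply: bigcup_measurable => i _; exact: mP.
apply/seteqP; split => t /=.
  move=> [Dt kn]; have [P1 P2] := kP _ Dt; split; first by rewrite -kn.
  by move=> [i /= ni [_ /P2]]; rewrite kn leqNgt ni.
move=> [[Dt Pn] nP]; split => //; have [P1 P2] := kP _ Dt.
apply/eqP; rewrite eqn_leq P2//= leqNgt; apply/negP => lt.
by apply: nP; exists (k t).
Qed.

Lemma measurable_le_set (f g : S -> R) : measurable_fun D f -> measurable_fun D g ->
  measurable (D `&` [set t | f t <= g t]).
Proof.
move=> mf mg; have := measurable_fun_ler mf mg mD (Y := [set true]).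
rewrite (_ : _ `&` _ @^-1` _ = D `&` [set t | f t <= g t]); first exact.
by apply/seteqP; split => t [].
Qed.

(** The slack [delta] lets the dense sequence supply an admissible value at each time, and the first
    such index is chosen. On the side of [G], only distances have to be measurable. *)
Lemma approx_selection (E : normedModType R) (e : nat -> E) (G : S -> set E) (v : S -> E) delta
  :
  dense_seq e -> (forall t, D t -> G t !=set0) ->
  (forall c, measurable_fun D (fun t => rdist c (G t))) ->
  measurable_fun D (fun t => rdist (v t) (G t)) -> smeas D v -> 0 < delta ->
  exists u, smeas D u /\ forall t, D t ->
    `|u t - v t| <= rdist (v t) (G t) + delta /\ rdist (u t) (G t) <= delta.
Proof.
move=> de G0 mG mvG mv d0.
pose P j t := (`|v t - e j| <= rdist (v t) (G t) + delta) && (rdist (e j) (G t) <= delta).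
have mP j : measurable (D `&` [set t | P j t]).
  rewrite (_ : _ `&` _ = (D `&` [set t | `|v t - e j| <= rdist (v t) (G t) + delta]) `&`
      (D `&` [set t | rdist (e j) (G t) <= delta])).
    apply: measurableI; apply: measurable_le_set => //.
    - exact: smeas_dist mv _.
    - by apply: measurable_funD => //; exact: measurable_cst.
  apply/seteqP; split => t /=; first by move=> [Dt /andP[]].
  by move=> [[Dt p1] [_ p2]]; split => //; apply/andP.
have ex t : D t -> exists j, P j t.
  move=> Dt; have d2 : 0 < delta / 2 by rewrite divr_gt0.
  have [|y Gy vy] := @rdist_lt _ _ (v t) (G t) (rdist (v t) (G t) + delta / 2) (G0 _ Dt).
    by rewrite ltrDl.
  have [j yj] := de y _ d2; exists j; apply/andP; split.
    have := ler_normD (v t - y) (y - e j); rewrite addrA subrK => /le_trans; apply.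
    by rewrite [delta]splitr addrA; apply: lerD; exact: ltW.
  apply: le_trans (rdist_le _ Gy) _; rewrite distrC (le_trans (ltW yj))//.
  by rewrite ler_pdivrMr// ler_peMr ?ltW// ltr1n.
have [k [mk kP]] := measurable_first mP ex.
exists (e \o k); split; first exact: smeas_idx.
by move=> t /kP/andP[h1 h2]; split => //=; rewrite distrC.
Qed.

End selection.

Section gap.
Context {R : realType} {E : normedModType R}.
Local Notation LT := (caratheodory_type (wlength (@idfun R))^*%mu).
Local Notation I T := (`[0, T]%classic : set LT).
Local Notation LR := (@completed_lebesgue_measure R).
Variables (T : R) (F : R -> E -> set E) (al : R -> R) (d : nat -> E).
Hypotheses (F0 : forall t x, `[0, T]%classic t -> F t x !=set0).
Hypothesis F_meas : forall x, Sigma_measurable T (F ^~ x).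
Hypothesis F_lip : {ae LR, forall t, `[0, T]%classic t -> forall x y e,
  `|rdist e (F t x) - rdist e (F t y)| <= al t * `|x - y|}.
Hypothesis dd : dense_seq d.
Let mI := measurable_I T.

(** d(e,A) >= r means that A lies in each of the open sets of points at distance more than r -
    1/(n+1) from e, and [F_meas] speaks of exactly such inclusions. *)
Lemma measurable_gap_cst e x : measurable_fun (I T) (fun t => rdist e (F t x)).
Proof.
move=> _; apply: (measurability _ (RGenCInfty.measurableE R)) => //= _ [_ [r ->] <-].
pose C n := [set y | r - n.+1%:R^-1 < `|e - y|].
have oC n : open (C n).
  apply: (@open_comp _ _ (fun y => `|e - y|) [set z | r - n.+1%:R^-1 < z]).
    move=> y _; apply: cvg_norm; apply: cvgB; [exact: cvg_cst|exact: cvg_id].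
  exact: open_gt.
rewrite (_ : _ `&` _ = \bigcap_n [set t | `[0, T]%classic t /\ F t x `<=` C n]).
  by apply: bigcap_measurable => // n _; exact: (F_meas x (oC n)).
apply/seteqP; split => t /=.
  rewrite !in_itv/= andbT => -[It rt] n _; split => // y Fy; rewrite /C /=.
  apply: lt_le_trans (rdist_le e Fy); apply: lt_le_trans rt.
  by rewrite ltrBlDr ltrDl invr_gt0.
move=> h; have It : `[0, T]%classic t by have [] := h 0%N Logic.I.
split => //; rewrite in_itv/= andbT; apply: rdist_lb; first exact: F0.
move=> y Fy; apply/ler_addgt0Pr => eps eps0.
have [n _ /(_ n (leqnn n)) /= ne] := near_infty_natSinv_lt (PosNum eps0).
have [_ /(_ _ Fy)] := h n Logic.I; rewrite /C /= => lt.
rewrite -lerBlDr; apply: le_trans (ltW lt); rewrite lerB// ltW//.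
Qed.

(** For [v] and [x] with countably many values the function is glued from the constant case. In
    general such functions approximate [v] and [x], and the Lipschitz bounds in both arguments give
    the limit almost everywhere. *)
Lemma measurable_gap (v x : R -> E) : smeas (I T) v -> smeas (I T) x ->
  measurable_fun (I T) (fun t => rdist (v t) (F t (x t))).
Proof.
move=> mv mx.
pose k n t := (nearest d (v t) n, nearest d (x t) n).
have mk n c : measurable (I T `&` k n @^-1` [set c]).
  apply: (@measurable_idx_pair _ LT (I T)) => {}c.
    have m1 : measurable_fun (I T) (fun t => nearest d (v t) n) by exact: measurable_nearest.
    exact: ((measurable_idxP mI _).2 m1 c).
  have m1 : measurable_fun (I T) (fun t => nearest d (x t) n) by exact: measurable_nearest.
    exact: ((measurable_idxP mI _).2 m1 c).
pose h n t := rdist (d (k n t).1) (F t (d (k n t).2)).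
have mh n : measurable_fun (I T) (h n).
  apply: (measurable_glue mI (mk n) (h := fun c t => rdist (d c.1) (F t (d c.2)))) => c.
  exact: measurable_gap_cst.
apply: (ae_cvg_measurable mI (@leb_complete R) mh).
move: F_lip; apply: negligibleS => t /= nt lip; apply: nt => It.
have h1 : `|d (nearest d (v t) n) - v t| @[n --> \oo] --> (0 : R).
  rewrite -(normr0 E) -(subrr (v t)); apply: cvg_norm; apply: cvgB; last exact: cvg_cst.
  exact: nearest_cvg.
have h2 : al t * `|d (nearest d (x t) n) - x t| @[n --> \oo] --> (0 : R).
  rewrite -(mulr0 (al t)); apply: cvgM; first exact: cvg_cst.
  rewrite -(normr0 E) -(subrr (x t)); apply: cvg_norm; apply: cvgB; last exact: cvg_cst.
  exact: nearest_cvg.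
apply: (@cvg_le_dist _ _ _ _ (fun n => `|d (nearest d (v t) n) - v t| +
    al t * `|d (nearest d (x t) n) - x t|)) => [n|]; last first.
  by rewrite -[X in _ --> X](addr0 (0 : R)); exact: cvgD.
rewrite /h /=; set a := d _; set b := d (nearest d (x t) n).
have -> : rdist a (F t b) - rdist (v t) (F t (x t)) =
  (rdist a (F t b) - rdist (v t) (F t b)) + (rdist (v t) (F t b) - rdist (v t) (F t (x t))).
  by rewrite addrA subrK.
apply: le_trans (ler_normD _ _) _; apply: lerD; last exact: lip.
exact: rdist_lip (F0 _ It).
Qed.

End gap.

Lemma dist_tri (R : realType) (V : normedModType R) (x y z : V) (e1 e2 : R) :
  `|x - y| <= e1 -> `|y - z| <= e2 -> `|x - z| <= e1 + e2.
Proof.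
move=> xy yz; have := ler_normD (x - y) (y - z); rewrite addrA subrK => /le_trans; apply.
exact: lerD.
Qed.

(** * Extension by zero to a larger domain *)

Section extension_by_zero.
Context d (S : measurableType d) (R : realType).
Variables (mu : {measure set S -> \bar R}) (D D' : set S).
Hypotheses (mD : measurable D) (mD' : measurable D') (DD' : D `<=` D').
Hypotheses (muD : (mu D < +oo)%E) (muD' : (mu D' < +oo)%E).
Hypothesis cmu : measure_is_complete mu.
Context {V : normedModType R}.
Implicit Types f s : S -> V.
Local Notation ext f := (patch (fun=> 0) D f).

Lemma fin_idx_patch s : fin_idx D s -> fin_idx D' (ext s).
Proof.
move=> [fs ms]; split.
  apply: (@sub_finite_set _ _ ([set 0] `|` s @` D)); last by rewrite finite_setU; split.
  move=> _ [t _ <-]; rewrite /patch; case: ifPn => [/set_mem Dt|_]; last by left.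
  by right; exists t.
move=> c; have [->|c0] := eqVneq c 0.
  rewrite (_ : _ `&` _ = (D `&` s @^-1` [set 0]) `|` (D' `\` D)).
    by apply: measurableU; [exact: ms|exact: measurableD].
  apply/seteqP; split => t /=; rewrite /patch.
    by move=> [D't]; case: ifPn => [/set_mem Dt ?|/negP nDt _]; [left|right; split => //;
      rewrite inE in nDt].
  by move=> [[Dt ?]|[D't nDt]]; [rewrite mem_set//; split => //; exact: DD'|rewrite memNset].
rewrite (_ : _ `&` _ = D `&` s @^-1` [set c]); first exact: ms.
apply/seteqP; split => t /=; rewrite /patch.
  move=> [D't]; case: ifPn => [/set_mem Dt ?|_ E]; first by split.
  by rewrite -E eqxx in c0.
by move=> [Dt ?]; rewrite mem_set//; split => //; exact: DD'.
Qed.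

Lemma simple_integral_patch s : fin_idx D s ->
  simple_integral mu D' (ext s) = simple_integral mu D s.
Proof.
move=> fs; have [r ur sr] := fin_idx_seq fs; pose r' := undup (0 :: r).
have ur' : uniq r' by exact: undup_uniq.
have sr1 t : D t -> s t \in r' by move=> Dt; rewrite mem_undup inE sr ?orbT.
have sr2 t : D' t -> ext s t \in r'.
  move=> _; rewrite /patch; case: ifPn => [/set_mem|_]; first exact: sr1.
  by rewrite mem_undup inE eqxx.
rewrite (simple_integral_idx mD' muD' (fun x => x) ur' sr2 (fin_idx_patch fs)).
rewrite (simple_integral_idx mD muD (fun x => x) ur' sr1 fs).
apply: eq_bigr => x _; have [->|x0] := eqVneq x 0; first by rewrite !scaler0.
congr (fine (mu _) *: _); apply/seteqP; split => t /=; rewrite /patch.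
  move=> [D't]; case: ifPn => [/set_mem Dt ?|_ E]; first by split.
  by rewrite -E eqxx in x0.
by move=> [Dt ?]; rewrite mem_set//; split => //; exact: DD'.
Qed.

Lemma strong_patch f : strongly_measurable mu D f -> strongly_measurable mu D' (ext f).
Proof.
move=> [s ss sf]; exists (fun n => ext (s n)).
  by move=> n; apply/(simple_onP mD' muD'); apply: fin_idx_patch; apply/(simple_onP mD muD).
apply: filterS sf => t h D't; rewrite /patch; case: ifPn => [/set_mem/h//|_].
exact: cvg_cst.
Qed.

(** Puts the integrals over [0,t], for different t, on the common domain [0,T], where the kernels
    can be subtracted. *)
Lemma bochner_patch f v : is_bochner_integral mu D f v -> is_bochner_integral mu D' (ext f) v.
Proof.
move=> [sf [s [ss sc sv]]]; split; first exact: strong_patch.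
have fs n : fin_idx D (s n) by apply/(simple_onP mD muD).
exists (fun n => ext (s n)); split.
- by move=> n; apply/(simple_onP mD' muD'); exact: fin_idx_patch.
- rewrite (_ : (fun n => _) = (fun n => (\int[mu]_(t in D) `|f t - s n t|%:E)%E))//.
  apply/funext => n; rewrite [LHS]integral_mkcond [RHS]integral_mkcond.
  apply: eq_integral => t _; rewrite /patch; case: ifPn => [D't|/negP nD't].
    by case: ifPn => // _; rewrite subr0 normr0.
  by rewrite memNset// => Dt; apply: nD't; rewrite inE; exact: DD'.
- by rewrite (_ : (fun n => _) = (fun n => simple_integral mu D (s n)))//; apply/funext => n;
  exact: simple_integral_patch.
Qed.

End extension_by_zero.

Section blin_theory.
Context {R : realType} {E : normedModType R}.

Lemma blin_norm (A : blin E) x : `|A x| <= `|A| * `|x|.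
Proof.
have [->|x0] := eqVneq x 0.
  by have := @blin_lin _ _ A (-1) 0 0; rewrite scaleN1r oppr0 addr0 scaleN1r addNr => ->;
    rewrite !normr0 mulr0.
have nx : 0 < `|x| by rewrite normr_gt0.
have xE : x = `|x| *: (`|x|^-1 *: x) by rewrite scalerA divff ?scale1r// gt_eqF.
have A0 : A 0 = 0 by have := @blin_lin _ _ A (-1) 0 0; rewrite scaleN1r oppr0 addr0 scaleN1r
  addNr.
have := @blin_lin _ _ A `|x| (`|x|^-1 *: x) 0; rewrite addr0 -xE A0 addr0 => ->.
rewrite normrZ normr_id mulrC ler_wpM2r//.
by apply: le_opnorm; rewrite normrZ normfV normr_id mulVf// gt_eqF.
Qed.

Lemma blin0 (A : blin E) : A 0 = 0.
Proof. by have := @blin_lin _ _ A (-1) 0 0; rewrite scaleN1r oppr0 addr0 scaleN1r addNr. Qed.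

Lemma blinB (A : blin E) x y : A (x - y) = A x - A y.
Proof.
by have := @blin_lin _ _ A (-1) y x; rewrite !scaleN1r => h; rewrite addrC h addrC.
Qed.

Lemma blin_sub (A B : blin E) x : (A - B) x = A x - B x.
Proof. by []. Qed.

Lemma blin_cvg (A : nat -> blin E) (x : nat -> E) (A0 : blin E) (x0 : E) : A n @[n --> \oo] -->
  A0 ->
  x n @[n --> \oo] --> x0 -> A n (x n) @[n --> \oo] --> A0 x0.
Proof.
move=> AA xx; apply: (@cvg_le_dist _ _ _ _ (fun n => `|A n - A0| * `|x n| + `|A0| * `|x n -
  x0|)).
  move=> n; rewrite (_ : A n (x n) - A0 x0 = (A n - A0) (x n) + A0 (x n - x0)).
    by apply: le_trans (ler_normD _ _) _; apply: lerD; exact: blin_norm.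
  by rewrite blin_sub blinB addrA subrK.
suff : `|A n - A0| * `|x n| + `|A0| * `|x n - x0| @[n --> \oo] --> 0 * `|x0| + `|A0| * 0.
  by rewrite mul0r mulr0 addr0.
have h1 : `|A n - A0| @[n --> \oo] --> (0 : R).
  by rewrite -(normr0 (blin E)) -(subrr A0); apply: cvg_norm; apply: cvgB => //; exact: cvg_cst.
have h2 : `|x n - x0| @[n --> \oo] --> (0 : R).
  by rewrite -(normr0 E) -(subrr x0); apply: cvg_norm; apply: cvgB => //; exact: cvg_cst.
apply: cvgD; apply: cvgM => //; first exact: cvg_norm.
exact: cvg_cst.
Qed.

End blin_theory.

(** * Volterra operator *)

Section volterra_operator.
Context {R : realType} {E : completeNormedModType R}.
Local Notation LT := (caratheodory_type (wlength (@idfun R))^*%mu).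
Local Notation I T := (`[0, T]%classic : set LT).
Local Notation LR := (@completed_lebesgue_measure R).
Variables (p T : R) (d : nat -> E) (k : R -> R -> blin E) (M : R).
Hypotheses (p1 : 1 <= p) (T0 : 0 <= T) (dd : dense_seq d) (M0 : 0 <= M).
Local Notation Lp t := (Lp LR (I t) p).
Local Notation Lnrm t := (Lnrm LR (I t) p).
Local Notation kk := (kernel_section k).

Hypothesis km : forall t, I T t -> strongly_measurable LR (I t) (k t).
Hypothesis kb : forall t, I T t -> forall u : R -> R, Lp t u ->
  (\int[LR]_(s in I t) (`|k t s| * `|u s|)%:E <= (M * Lnrm t u)%:E)%E.
Hypothesis kc : forall t0, I T t0 -> forall e : R, 0 < e ->
  \forall t \near t0, I T t -> (\int[LR]_(s in I T) `|kk t s - kk t0 s|%:E <= e%:E)%E.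

Let cmu := @leb_complete R.

Lemma subI t : I T t -> I t `<=` I T.
Proof.
move=> /=; rewrite in_itv/= => /andP[t0 tT] s /=; rewrite !in_itv/= => /andP[-> st].
exact: le_trans tT.
Qed.

Lemma smeas_subI (V : normedModType R) (w : R -> V) t : I T t ->
  smeas (I T) w -> smeas (I t) w.
Proof.
move=> It mw; split => c; apply: (measurable_funS (measurable_I T) (subI It)).
exact: smeas_dist mw c.
Qed.

Lemma nint_subI (V : normedModType R) (w : R -> V) t : I T t -> smeas (I T) w ->
  (nint LR (I t) p w <= nint LR (I T) p w)%E.
Proof.
move=> It mw; rewrite !nint_integral; apply: ge0_subset_integral.
- exact: measurable_I.
- exact: measurable_I.
- by apply: measurable_norm_powR; exact: mw.
- by move=> s _; rewrite lee_fin powR_ge0.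
- exact: subI.
Qed.

Lemma Lp_subI (V : normedModType R) (w : R -> V) t : I T t -> Lp T w -> Lp t w.
Proof.
move=> It [mw fw]; split; first exact: smeas_subI.
by apply: le_lt_trans fw; exact: nint_subI.
Qed.

Lemma Lnrm_subI (V : normedModType R) (w : R -> V) t : I T t -> Lp T w ->
  Lnrm t w <= Lnrm T w.
Proof.
move=> It Lw; apply: (nint_le p1 (Lnrm_ge0 _ _ _ _)).
apply: le_trans (nint_subI It Lw.1) _.
exact: (nint_le_powR p1 Lw (lexx _)).
Qed.

(** [blin E] has no dense sequence in general, so [smeas_comp2] does not apply. Strong measurability
    of the kernel provides simple approximations, which are applied to simple approximations of
    [w]. *)
Lemma smeas_kernel t w : I T t -> smeas (I t) w -> smeas (I t) (fun s => k t s (w s)).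
Proof.
move=> It mw; have [s ss sk] := km It; have [x [fx _ xw]] := simple_approx (measurable_I t) dd
  mw.
have fs n : fin_idx (I t) (s n) by apply/(simple_onP (measurable_I t) (leb_I_lty t)).
apply: (smeas_ae_cvg (measurable_I t) cmu (f_ := fun n r => s n r (x n r))).
  move=> n; apply: smeas_simple.
  exact: (fin_idx_comp (fun Ax : blin E * E => Ax.1 Ax.2) (fin_idx_pair (fs n) (fx n))).
move: sk; apply: negligibleS => r /= nr h; apply: nr => Ir.
by apply: blin_cvg; [exact: h|exact: xw].
Qed.

Lemma kernel_norm t : I T t -> measurable_fun (I t) (fun s => `|k t s|).
Proof. by move=> It; exact: (measurable_strong_norm (measurable_I t) (leb_I_lty t) cmu (km
  It)). Qed.

Lemma kernel_int_le t (w : R -> E) (f : R -> E) : I T t -> Lp t w ->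
  measurable_fun (I t) (fun s => `|f s|) ->
  (forall s, I t s -> `|f s| <= `|k t s| * `|w s|) ->
  (\int[LR]_(s in I t) `|f s|%:E <= (M * Lnrm t w)%:E)%E.
Proof.
move=> It Lw mf h; have mw := smeas_norm Lw.1.
have Lw' : Lp t (fun s => `|w s| : R).
  apply: (Lp_mono (measurable_I t) p1 _ Lw); first exact: smeas_measurable.
  by apply: aeW => s _; rewrite normr_id.
apply: (@le_trans _ _ (\int[LR]_(s in I t) (`|k t s| * `|w s|)%:E)%E).
  apply: ge0_le_integral.
  - exact: measurable_I.
  - by move=> s _; rewrite lee_fin.
  - by apply/measurable_EFinP.
  - by apply/measurable_EFinP; exact: (measurable_funM (kernel_norm It) mw).
  - by move=> s Is; rewrite lee_fin; exact: h.
have le : Lnrm t (fun s => `|w s| : R) <= Lnrm t w.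
  apply: (Lnrm_mono (measurable_I t) p1 Lw'.1 Lw).
  by apply: aeW => s _; rewrite normr_id.
have := kb It Lw'; under eq_integral do rewrite normr_id.
by move=> /le_trans; apply; rewrite lee_fin; exact: ler_wpM2l.
Qed.

(** The default 0 is not a fallback for w in L^p([0,t]): there the integral exists, by [voltP]. *)
Definition volt (w : R -> E) (t : R) : E :=
  xget 0 [set v | is_bochner_integral LR (I t) (fun s => k t s (w s)) v].

Lemma voltP w t : I T t -> Lp t w ->
  is_bochner_integral LR (I t) (fun s => k t s (w s)) (volt w t).
Proof.
move=> It Lw; have mk := smeas_kernel It Lw.1.
have fin : (\int[LR]_(s in I t) `|k t s (w s)|%:E < +oo)%E.
  apply: le_lt_trans (ltry (M * Lnrm t w)).
  by apply: (kernel_int_le It Lw (smeas_norm mk)) => s _; exact: blin_norm.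
have [v vP] := bochner_exists (measurable_I t) (leb_I_lty t) cmu dd mk fin.
by rewrite /volt; case: xgetP => [y -> //|/(_ v)].
Qed.

Lemma volt_unique w t v : I T t -> Lp t w ->
  is_bochner_integral LR (I t) (fun s => k t s (w s)) v -> v = volt w t.
Proof.
move=> It Lw vP.
exact: (bochner_unique (measurable_I t) (leb_I_lty t) cmu vP (voltP It Lw)).
Qed.

Lemma LpB_I (w w' : R -> E) t : Lp t w -> Lp t w' -> Lp t (w \- w').
Proof. exact: (LpB p1 dd). Qed.

Lemma volt_lip w w' t : I T t -> Lp t w -> Lp t w' ->
  `|volt w t - volt w' t| <= M * Lnrm t (w \- w').
Proof.
move=> It Lw Lw'; have LB := LpB_I Lw Lw'; have mk := smeas_kernel It LB.1.
rewrite -lee_fin; apply: le_trans (bochner_sub_norm (measurable_I t) (leb_I_lty t) cmu (voltP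
  It Lw) (voltP It Lw')) _.
have E1 : (fun s => `|k t s (w s) - k t s (w' s)|) = (fun s => `|k t s (w s - w' s)|).
  by apply/funext => s; rewrite blinB.
apply: (kernel_int_le It LB (f := fun s => k t s (w s) - k t s (w' s))).
  by rewrite E1; exact: (smeas_norm mk).
by move=> s _; rewrite -blinB; exact: blin_norm.
Qed.

Lemma kernel_section_strong t : I T t -> strongly_measurable LR (I T) (kk t).
Proof.
move=> It.
exact: (strong_patch (measurable_I t) (measurable_I T) (subI It) (leb_I_lty t) (leb_I_lty T)
  (km It)).
Qed.

(** The kernel varies continuously in L^1 only, so [w] has to be bounded. General controls are
    reached through simple ones. *)
Lemma volt_bounded_cont w t t0 C e : I T t -> I T t0 -> Lp T w -> 0 <= C ->
  (forall s, I T s -> `|w s| <= C) ->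
  (\int[LR]_(s in I T) `|kk t s - kk t0 s|%:E <= e%:E)%E ->
  `|volt w t - volt w t0| <= C * e.
Proof.
move=> It It0 Lw C0 wC ke.
have B t' : I T t' -> is_bochner_integral LR (I T) (fun s => kk t' s (w s)) (volt w t').
  move=> It'; have := bochner_patch (measurable_I t') (measurable_I T) (subI It') (leb_I_lty
    t') (leb_I_lty T) (voltP It' (Lp_subI It' Lw)).
  by apply: bochner_ext => s _; rewrite /kernel_section /patch; case: ifP.
rewrite -lee_fin; apply: le_trans (bochner_sub_norm (measurable_I T) (leb_I_lty T) cmu (B t It)
  (B t0 It0)) _.
have mk : measurable_fun (I T) (fun s => `|kk t s - kk t0 s|).
  have sl := strong_lin (measurable_I T) (leb_I_lty T) 1 (-1) (kernel_section_strong It)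
    (kernel_section_strong It0).
  apply: (measurable_strong_norm (measurable_I T) (leb_I_lty T) cmu).
  by apply: (strong_ext _ sl) => s _; rewrite scale1r scaleN1r.
have mf : measurable_fun (I T) (fun s => `|kk t s (w s) - kk t0 s (w s)|).
  have s1 := strong_smeas (measurable_I T) (leb_I_lty T) cmu (B t It).1.
  have s2 := strong_smeas (measurable_I T) (leb_I_lty T) cmu (B t0 It0).1.
  exact: (smeas_norm (smeasB (measurable_I T) dd s1 s2)).
apply: (@le_trans _ _ (\int[LR]_(s in I T) (C%:E * `|kk t s - kk t0 s|%:E))%E).
  apply: ge0_le_integral.
  - exact: measurable_I.
  - by move=> s _; rewrite lee_fin.
  - by apply/measurable_EFinP.
  - by apply: emeasurable_funM; [exact: measurable_cst|apply/measurable_EFinP].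
  - move=> s Is; rewrite -EFinM lee_fin mulrC -blin_sub.
    by apply: le_trans (blin_norm _ _) _; rewrite ler_wpM2l// wC.
rewrite ge0_integralZl_EFin; last 4 first.
- exact: measurable_I.
- by move=> s _; rewrite lee_fin.
- by apply/measurable_EFinP.
- exact: C0.
by rewrite EFinM; apply: lee_wpmul2l; [rewrite lee_fin|exact: ke].
Qed.

Lemma simple_bounded (s : R -> E) : fin_idx (I T) s ->
  exists2 C, 0 <= C & forall t, I T t -> `|s t| <= C.
Proof.
move=> fs; have [r ur sr] := fin_idx_seq fs; exists (\sum_(v <- r) `|v|).
  exact: sumr_ge0.
by move=> t It; rewrite (bigD1_seq (s t)) ?sr//= lerDl sumr_ge0.
Qed.

Lemma volt_cont w : Lp T w -> {within `[0, T], continuous (volt w)}.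
Proof.
move=> Lw; apply/subspace_continuousP => t0 It0; apply/cvgrPdist_le => e e0.
(* Three errors of e/3: [w] is replaced by a simple function at t and at t0, at the cost of [M]
   times their distance, and t is moved for the simple function, which is bounded by [C]. *)
have e3 : 0 < e / (3 * (1 + M)) by rewrite divr_gt0// mulr_gt0// ltr_pwDl.
have [s fs ws] := Lp_simple_approx p1 dd Lw e3.
have [C C0 sC] := simple_bounded fs; have Ls := Lp_simple p fs.
have e4 : 0 < e / (3 * (1 + C)) by rewrite divr_gt0// mulr_gt0// ltr_pwDl.
rewrite /within /=; apply: filterS (kc It0 e4) => t /[swap] It /(_ It) kt.
have h3 := volt_bounded_cont It It0 Ls C0 sC kt.
have close t' : I T t' -> `|volt w t' - volt s t'| <= e / 3.
  move=> It'; apply: le_trans (volt_lip It' (Lp_subI It' Lw) (Lp_subI It' Ls)) _.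
  have h : M * Lnrm t' (w \- s) <= M * (e / (3 * (1 + M))).
    apply: ler_wpM2l => //; apply: le_trans (ltW ws).
    exact: (Lnrm_subI It' (LpB_I Lw Ls)).
  apply: le_trans h _; have -> : M * (e / (3 * (1 + M))) = e / 3 * (M / (1 + M)) by rewrite
    invfM; ring.
  by rewrite ler_piMr ?divr_ge0 ?(ltW e0)// ler_pdivrMr ?ltr_pwDl// mul1r lerDr.
have h1 := close _ It; have h2 := close _ It0.
have h4 : `|volt s t - volt s t0| <= e / 3.
  apply: le_trans h3 _; have -> : C * (e / (3 * (1 + C))) = e / 3 * (C / (1 + C)) by rewrite
    invfM; ring.
  by rewrite ler_piMr ?divr_ge0 ?(ltW e0)// ler_pdivrMr ?ltr_pwDl// mul1r lerDr.
have -> : e = e / 3 + e / 3 + e / 3 by field.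
rewrite distrC; rewrite distrC in h2; exact: (dist_tri (dist_tri h1 h4) h2).
Qed.

Local Notation chi a b N f := (patch (fun=> 0) (chatter_set a b N) f).

(** At one t0 this is weak convergence of chattering for an integrand [k t0 r (s r)] with [s]
    simple. Chattered simple functions keep their bound, so the same frequency serves for t near t0,
    and compactness of [0,T] gives one frequency for all t. The five errors of e/5 are two simple
    approximations, two moves between t and t0, and the chattering itself. *)
Lemma volt_chatter w e : Lp T w -> 0 < e ->
  exists n : nat, forall N a b, n.+1%:R <= N -> 0 <= a -> a <= b -> b <= 1 ->
    forall t, I T t -> `|volt (chi a b N w) t - (b - a) *: volt w t| <= e.
Proof.
move=> Lw e0.
have e5 : 0 < e / 5 by rewrite divr_gt0.
have e3 : 0 < e / (5 * (1 + M)) by rewrite divr_gt0// mulr_gt0// ltr_pwDl.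
have [s fs ws] := Lp_simple_approx p1 dd Lw e3.
have [C C0 sC] := simple_bounded fs; have Ls := Lp_simple p fs.
have e4 : 0 < e / (5 * (1 + C)) by rewrite divr_gt0// mulr_gt0// ltr_pwDl.
have close t v v' : I T t -> Lp T v -> Lp T v' -> Lnrm T (v \- v') <= e / (5 * (1 + M)) ->
    `|volt v t - volt v' t| <= e / 5.
  move=> It Lv Lv' vv; apply: le_trans (volt_lip It (Lp_subI It Lv) (Lp_subI It Lv')) _.
  have h : M * Lnrm t (v \- v') <= M * (e / (5 * (1 + M))).
    apply: ler_wpM2l => //; apply: le_trans vv.
    exact: (Lnrm_subI It (LpB_I Lv Lv')).
  apply: le_trans h _; have -> : M * (e / (5 * (1 + M))) = e / 5 * (M / (1 + M)) by rewrite
    invfM; ring.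
  by rewrite ler_piMr ?divr_ge0 ?(ltW e0)// ler_pdivrMr ?ltr_pwDl// mul1r lerDr.
have equi t t0 v : I T t -> I T t0 -> Lp T v -> (forall r, I T r -> `|v r| <= C) ->
    (\int[LR]_(s in I T) `|kk t s - kk t0 s|%:E <= (e / (5 * (1 + C)))%:E)%E ->
    `|volt v t - volt v t0| <= e / 5.
  move=> It It0 Lv vC kt; apply: le_trans (volt_bounded_cont It It0 Lv C0 vC kt) _.
  have -> : C * (e / (5 * (1 + C))) = e / 5 * (C / (1 + C)) by rewrite invfM; ring.
  by rewrite ler_piMr ?divr_ge0 ?(ltW e0)// ler_pdivrMr ?ltr_pwDl// mul1r lerDr.
pose P (n : nat) t := I T t -> forall N a b, n.+1%:R <= N -> 0 <= a -> a <= b -> b <= 1 ->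
  `|volt (chi a b N w) t - (b - a) *: volt w t| <= e.
have /compact_near_coveringP := @segment_compact R 0 T.
move=> /(_ nat \oo P _) cov.
suff : \forall n \near \oo, `[0, T]%classic `<=` P n.
  by move=> [n _ /(_ n (leqnn n)) h]; exists n => N a b nN a0 ab b1 t It; exact: h.
apply: cov => t0 It0.
pose f r := k t0 r (s r).
have mf : smeas (I t0) f by exact: smeas_kernel (smeas_subI It0 Ls.1).
have Lf : smeas (I t0) f /\ (nint LR (I t0) 1 f < +oo)%E.
  split => //; rewrite nint_integral; under eq_integral do rewrite powRr1//.
  apply: le_lt_trans (ltry (M * Lnrm t0 s)).
  by apply: (kernel_int_le It0 (Lp_subI It0 Ls) (smeas_norm mf)) => r _; exact: blin_norm.
have t00 : 0 <= t0 by move: It0; rewrite /= in_itv/= => /andP[].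
have [N0 N00 N0P] := bochner_chatter t00 dd Lf e5.
have kct := kc It0 e4.
exists ([set t | I T t -> (\int[LR]_(s in I T) `|kk t s - kk t0 s|%:E <= (e / (5 * (1 +
  C)))%:E)%E],
        [set n : nat | N0 <= n.+1%:R]).
  split => //=; exists (Num.truncn N0) => // n /= nN.
  by apply: ltW; apply: lt_le_trans (truncnS_gt N0) _; rewrite ler_nat ltnS.
move=> [t n] /= [kt nN0] It N a b nN a0 ab b1; have {}kt := kt It.
have N0N : N0 <= N by exact: le_trans nN.
have Np : 0 < N by exact: lt_le_trans N0N.
have Lcw := Lp_chatter p1 Np a0 b1 Lw; have Lcs := Lp_chatter p1 Np a0 b1 Ls.
have b0 : 0 <= b - a by rewrite subr_ge0.
have b1' : b - a <= 1 by apply: le_trans b1; rewrite gerBl.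
have h1 : `|volt (chi a b N w) t - volt (chi a b N s) t| <= e / 5.
  apply: close => //; apply: le_trans (ltW ws).
  apply: (Lnrm_mono (measurable_I T) p1 (LpB_I Lcw Lcs).1 (LpB_I Lw Ls)); apply: aeW => r _ /=.
  by rewrite /patch; case: ifP => // _; rewrite subrr normr0.
have h2 : `|volt (chi a b N s) t - volt (chi a b N s) t0| <= e / 5.
  apply: equi => // r Ir; rewrite /patch; case: ifP => _; first exact: sC.
  by rewrite normr0.
have h3 : `|volt (chi a b N s) t0 - (b - a) *: volt s t0| <= e / 5.
  apply: (N0P N a b _ _ N0N a0 ab b1 (voltP It0 (Lp_subI It0 Ls))).
  apply: (bochner_ext _ (voltP It0 (Lp_subI It0 Lcs))) => r _; rewrite /patch /f.
  by case: ifP => // _; rewrite blin0.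
have h4 : `|volt s t0 - volt s t| <= e / 5 by rewrite distrC; exact: equi.
have h5 : `|volt s t - volt w t| <= e / 5 by rewrite distrC; apply: close => //; exact: ltW.
have h6 (v v' : E) : `|v - v'| <= e / 5 -> `|(b - a) *: v - (b - a) *: v'| <= e / 5.
  by rewrite -scalerBr normrZ ger0_norm// => h; apply: le_trans h; rewrite ler_piMl.
have h := dist_tri (dist_tri (dist_tri (dist_tri h1 h2) h3) (h6 _ _ h4)) (h6 _ _ h5).
by apply: le_trans h _; rewrite le_eqVlt; apply/orP; left; apply/eqP; field.
Qed.

End volterra_operator.

(** * Uniform error rates and norms of chattered combinations *)

Section sup_rate.
Context {R : realType} {Z : Type} (conv : (nat -> Z) -> Z -> Prop).
Variables (Q : Type) (A : nat -> set Q) (phi : Q -> Z -> R) (delta : Z -> Z -> R) (B : Z -> R).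

(** The rate is the supremum of the errors over all queries [q] admissible at level [n]. It inherits
    continuity in the parameter from the modulus [delta], which is uniform in [q]. *)
Lemma sup_rate : (forall n n', (n <= n')%N -> A n' `<=` A n) ->
  (forall n q z, A n q -> phi q z <= B z) ->
  (forall n q z z', A n q -> phi q z <= phi q z' + delta z z') ->
  (forall z z', 0 <= delta z z' /\ delta z z' = delta z' z) ->
  (forall zs z, conv zs z -> delta (zs n) z @[n --> \oo] --> (0 : R)) ->
  (forall z e, 0 < e -> exists n, forall q, A n q -> phi q z <= e) ->
  exists rate : nat -> Z -> R,
  [/\ forall n z, 0 <= rate n z, forall n, seqcont conv (rate n),
      forall n n' z, (n <= n')%N -> rate n' z <= rate n z,
      forall z, rate n z @[n --> \oo] --> (0 : R) &
      forall n q z, A n q -> phi q z <= rate n z].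
Proof.
move=> Amono phiB phid d0 dc phi0.
(* The element 0 keeps the set nonempty and its supremum nonnegative. *)
pose G n z := [set 0] `|` [set phi q z | q in A n].
have Gsup n z : has_sup (G n z).
  split; first by exists 0; left.
  exists (Num.max (B z) 0) => _ [->|[q Aq <-]]; rewrite le_max ?lexx ?orbT//.
  by rewrite (phiB n).
have ub n z x : G n z x -> x <= sup (G n z) by exact: sup_upper_bound.
have lub n z C : 0 <= C -> (forall q, A n q -> phi q z <= C) -> sup (G n z) <= C.
  move=> C0 h; apply: sup_le_ub; first by exists 0; left.
  by move=> _ [->//|[q Aq <-]]; exact: h.
have le n q z : A n q -> phi q z <= sup (G n z) by move=> Aq; apply: ub; right; exists q.
have ge0 n z : 0 <= sup (G n z) by apply: ub; left.
exists (fun n z => sup (G n z)); split => //.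
- move=> n zs z zc; apply: (@cvg_le_dist _ _ _ _ (fun i => delta (zs i) z)); last exact: dc.
  have half z1 z2 : sup (G n z1) <= sup (G n z2) + delta z1 z2.
    have [dd _] := d0 z1 z2; apply: lub => [|q Aq]; first by rewrite addr_ge0.
    by apply: le_trans (phid n q z1 z2 Aq) _; rewrite lerD2r le.
  move=> i; have h1 := half (zs i) z; have h2 := half z (zs i).
  have [_ E] := d0 (zs i) z; rewrite -E in h2.
  by rewrite ler_norml; apply/andP; split; lra.
- by move=> n n' z nn'; apply: lub => // q /(Amono _ _ nn'); exact: le.
- move=> z; apply/cvgrPdist_le => e e0; have [n nP] := phi0 z e e0.
  exists n => // n' /= nn'; rewrite sub0r normrN ger0_norm//.
  by apply: lub; [exact: ltW|move=> q /(Amono _ _ nn')/nP].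
Qed.

End sup_rate.

(** The enumerations of cover functions below carry a spare component, so each function recurs
    infinitely often; one positive value then makes the sums diverge. *)
Lemma sum_recurrent (R : realType) (f : nat -> R) (phi : nat -> nat) (g C : R) :
  (forall j, 0 <= f j) -> injective phi -> 0 < g -> (forall l, f (phi l) = g) ->
  exists m, C <= \sum_(j < m) f j.
Proof.
move=> f0 iphi g0 fg.
suff H L : exists m, g *+ L <= \sum_(j < m) f j.
  have [m mP] := H (Num.truncn (C / g)).+1; exists m; apply: le_trans mP.
  by rewrite -mulr_natr -ler_pdivrMl// mulrC; apply: ltW; exact: truncnS_gt.
elim: L => [|L [m mP]]; first by exists 0%N; rewrite big_ord0.
have [l ml] : exists l, (m <= phi l)%N.
  apply: contrapT => nex; have lt l : (phi l < m)%N.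
    by rewrite ltnNge; apply/negP => h; apply: nex; exists l.
  have : (size (map phi (iota 0 m.+1)) <= size (iota 0 m))%N.
    apply: uniq_leq_size; first by rewrite map_inj_uniq// iota_uniq.
    by move=> _ /mapP[l _ ->]; rewrite mem_iota/= add0n lt.
  by rewrite size_map !size_iota ltnn.
exists (phi l).+1; rewrite mulrSr big_ord_recr/= fg lerD2r (le_trans mP)//.
rewrite -(subnKC ml); elim: (phi l - m)%N => [|i IHi]; first by rewrite addn0.
by rewrite addnS big_ord_recr/= (le_trans IHi)// lerDl.
Qed.

Section power_sums.
Context {R : realType}.
Variable p : R.
Hypothesis p1 : 1 <= p.

Lemma powR_super (x y : R) : 0 <= x -> 0 <= y -> x `^ p + y `^ p <= (x + y) `^ p.
Proof.
move=> x0 y0; have h := powR_subadd p1 (powR_ge0 x p) (powR_ge0 y p).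
rewrite !(powRK p1)// in h.
have := powR_norm_le p1 (powR_ge0 _ p^-1) h; rewrite (powRKV p1)//.
by rewrite addr_ge0// powR_ge0.
Qed.

Lemma sum_powR_le (rho : nat -> R) m : (forall j, 0 <= rho j) ->
  \sum_(j < m) rho j `^ p <= (\sum_(j < m) rho j) `^ p.
Proof.
move=> r0; elim: m => [|m IHm]; first by rewrite !big_ord0 powR_ge0.
rewrite !big_ord_recr/=; apply: le_trans (powR_super _ (r0 m)); last exact: sumr_ge0.
by rewrite lerD2r.
Qed.

Lemma powR_sum2 (x y : R) : 0 <= x -> 0 <= y ->
  (x + y) `^ p <= 2 `^ p * (x `^ p + y `^ p).
Proof.
move=> x0 y0; have m0 : 0 <= Num.max x y by rewrite le_max x0.
have h : x + y <= 2 * Num.max x y.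
  by rewrite mulr_natl mulr2n lerD// le_max lexx ?orbT.
apply: le_trans (powR_norm_le p1 (addr_ge0 x0 y0) h) _.
rewrite powRM// ler_wpM2l ?powR_ge0//.
by case: (leP x y) => _; [rewrite lerDr|rewrite lerDl]; exact: powR_ge0.
Qed.

(** Since (x + y)^p <= 2^p (x^p + y^p), the sum is at most 2^p (e^p + e^p) <= 2^p (2e)^p, whence the
    constant 4. *)
Lemma sum_weighted_powR (w rho : nat -> R) m e : (forall j, 0 <= w j) -> (forall j, 0 <= rho j)
  ->
  0 <= e -> \sum_(j < m) w j <= 1 -> \sum_(j < m) rho j <= e ->
  \sum_(j < m) (w j `^ p^-1 * e + rho j) `^ p <= (4 * e) `^ p.
Proof.
move=> w0 r0 e0 w1 re.
apply: (@le_trans _ _ (2 `^ p * (e `^ p + e `^ p))).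
  apply: (@le_trans _ _ (\sum_(j < m) 2 `^ p * (w j * e `^ p + rho j `^ p))).
    apply: ler_sum => j _; apply: le_trans (powR_sum2 _ (r0 j)) _.
      by rewrite mulr_ge0// powR_ge0.
    by rewrite powRM ?powR_ge0// (powRKV p1).
  rewrite -mulr_sumr ler_wpM2l ?powR_ge0// big_split/= lerD//.
    by rewrite -mulr_suml ler_piMl// powR_ge0.
  apply: le_trans (sum_powR_le m r0) _; apply: powR_norm_le => //.
  exact: sumr_ge0.
have -> : 4 * e = 2 * (e + e) by ring.
rewrite [leRHS]powRM ?addr_ge0// ler_wpM2l ?powR_ge0//; exact: powR_super.
Qed.

End power_sums.

Section glue_norm.
Context {R : realType} {V : normedModType R}.
Local Notation LT := (caratheodory_type (wlength (@idfun R))^*%mu).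
Local Notation I T := (`[0, T]%classic : set LT).
Local Notation LR := (@completed_lebesgue_measure R).
Variables (p T : R).
Hypotheses (p1 : 1 <= p).
Local Notation Lp := (Lp LR (I T) p).
Local Notation Lnrm := (Lnrm LR (I T) p).
Local Notation chi a b N f := (patch (fun=> 0) (chatter_set a b N) f).
Variables (N : R) (Lam : nat -> R) (m : nat) (k : R -> nat).
Hypotheses (N0 : 0 < N) (Lam0 : Lam 0%N = 0) (Lam1 : Lam m = 1)
  (Lam01 : forall j, 0 <= Lam j <= Lam j.+1 /\ Lam j <= 1)
  (km : forall t, (k t < m)%N)
  (kP : forall t j, k t = j <-> chatter_set (Lam j) (Lam j.+1) N t).

Lemma glue_preimage j : k @^-1` [set j] = chatter_set (Lam j) (Lam j.+1) N.
Proof. by apply/seteqP; split => t /= /kP. Qed.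

Lemma measurable_glue_idx : measurable_fun (I T) k.
Proof.
apply/(measurable_idxP (measurable_I T)) => j; rewrite glue_preimage.
apply: measurableI; first exact: measurable_I.
have [/andP[h1 _] _] := Lam01 j; have [_ h2] := Lam01 j.+1.
exact: measurable_chatter_set.
Qed.

Lemma glue_weight_sum : \sum_(j < m) (Lam j.+1 - Lam j) = 1.
Proof.
rewrite -(big_mkord xpredT (fun j => Lam j.+1 - Lam j)) telescope_sumr//.
by rewrite Lam1 Lam0 subr0.
Qed.

(** The p-th powers of the norms add up over disjoint pieces and the weights add up to 1, so the
    bound depends neither on the number of pieces nor on the break points. *)
Lemma Lnrm_glue_le (h : nat -> R -> V) (rho : nat -> R) e : 0 <= e ->
  (forall j, Lp (h j)) -> (forall j, 0 <= rho j) -> \sum_(j < m) rho j <= e ->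
  (forall j, Lam j < Lam j.+1 -> Lnrm (chi (Lam j) (Lam j.+1) N (h j)) <=
     (Lam j.+1 - Lam j) `^ p^-1 * e + rho j) ->
  Lnrm (fun t => h (k t) t) <= 4 * e.
Proof.
move=> e0 Lh r0 rs hj; apply: (nint_le p1); first by rewrite mulr_ge0.
rewrite (nint_glue LR (measurable_I T) p1 (fun t _ => km t) measurable_glue_idx (fun j => (Lh
  j).1)).
have w0 j : 0 <= Lam j.+1 - Lam j by have [/andP[_ ?] _] := Lam01 j; rewrite subr_ge0.
have := sum_weighted_powR p1 w0 r0 e0 _ rs; rewrite glue_weight_sum => /(_ (lexx _)).
rewrite -lee_fin => h4; apply: le_trans h4; rewrite -sumEFin; apply: lee_sum => j _.
have [/andP[h1 h2] _] := Lam01 j; have [_ h3] := Lam01 j.+1.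
rewrite glue_preimage; have Lc := Lp_chatter p1 N0 h1 h3 (Lh j).
move: h2; rewrite le_eqVlt => /orP[/eqP E|lt].
  apply: (@le_trans _ _ 0%E); last by rewrite lee_fin powR_ge0.
  rewrite nint_integral integral0_eq// => t _.
  rewrite /patch memNset ?normr0 ?powR0// ?gt_eqF ?(lt_le_trans ltr01)//.
  by rewrite /chatter_set /= E => /andP[lo hi]; have := le_lt_trans lo hi; rewrite ltxx.
exact: (nint_le_powR p1 Lc (hj _ lt)).
Qed.

End glue_norm.

Section almost_everywhere.
Context {R : realType}.
Local Notation LR := (@completed_lebesgue_measure R).
Implicit Types P Q : R -> Prop.

Lemma ae_imply P Q : (forall t, P t -> Q t) -> {ae LR, forall t, P t} -> {ae LR, forall t, Q t}.
Proof. by move=> PQ; apply: (@filterS _ _ (ae_filter_ringOfSetsType LR)). Qed.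

Lemma ae_and P Q : {ae LR, forall t, P t} -> {ae LR, forall t, Q t} ->
  {ae LR, forall t, P t /\ Q t}.
Proof. by apply: (filterS2 (ae_filter_ringOfSetsType LR)). Qed.

End almost_everywhere.

Lemma improve_arith (R : realType) (c1 c2 w g1 g2 D : R) : c1 <= c2 + D -> g2 <= g1 + D ->
  w <= 1 -> 0 <= w -> 0 <= D -> c1 - w * g1 <= c2 - w * g2 + 2 * D.
Proof. by move=> h1 h2 w1 w0 D0; have := ler_wpM2l w0 h2; have := ler_wpM2r D0 w1; lra. Qed.

Lemma improve_arith2 (R : realType) (M e n1 na nb : R) : nb <= 4 * e ->
  e * n1 + M * e * na + 2 * nb <= e * (n1 + M * na + 8).
Proof. by move=> h; rewrite !mulrDr; lra. Qed.

Lemma improve_arith3 (R : realType) (a b c g d : R) :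
  a <= b + c -> b <= g + d -> a <= 1 * c + 1 * g + 1 * d.
Proof. by lra. Qed.

Lemma improve_arith4 (R : realType) (L x y r s : R) :
  L - x <= r -> r <= s -> x <= y -> L <= y + s.
Proof. by lra. Qed.

Lemma improve_arith5 (R : realType) (D g gi del b x y e : R) : D <= gi + del + b ->
  gi <= g + b + x -> x <= y -> del <= e -> D <= g + (e * 1 + y + 2 * b).
Proof. by lra. Qed.

Lemma improve_arith6 (R : realType) (r1 r2 del b x y e : R) : r2 <= del ->
  r1 - r2 <= x -> x <= y -> del <= e -> 0 <= b -> r1 <= e * 1 + y + 2 * b.
Proof. by lra. Qed.

Lemma ae_countable (R : realType) (P : nat -> R -> Prop) :
  (forall i, {ae (@completed_lebesgue_measure R), forall t, P i t}) ->
  {ae (@completed_lebesgue_measure R), forall t, forall i, P i t}.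
Proof.
move=> aP; have := @negligible_bigcup _ _ _ (@completed_lebesgue_measure R) (fun i => ~` [set t
  | P i t]) aP.
apply: negligibleS.
by move=> t /= nP; apply: contrapT => nex; apply: nP => i; apply: contrapT => nPi; apply: nex;
  exists i.
Qed.

(** * Successive approximations *)

Section inclusion.
Context {R : realType} {E : normedModType R}.
Local Notation LT := (caratheodory_type (wlength (@idfun R))^*%mu).
Local Notation I T := (`[0, T]%classic : set LT).
Local Notation LR := (@completed_lebesgue_measure R).
Variables (p T : R) (d : nat -> E) (F : R -> E -> set E) (al be : R -> R)
  (X : (R -> E) -> R -> E) (M : R).
Hypotheses (p1 : 1 <= p) (T0 : 0 <= T) (dd : dense_seq d) (M0 : 0 <= M).
Local Notation Lp_ t := (Lp LR (I t) p).
Local Notation Lnrm_ t := (Lnrm LR (I t) p).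
Local Notation Lp := (Lp_ T).
Local Notation Lnrm := (Lnrm_ T).
Local Notation chi a b N f := (patch (fun=> 0) (chatter_set a b N) f).

Hypotheses (F0 : forall t x, `[0, T]%classic t -> F t x !=set0)
  (F_meas : forall x, Sigma_measurable T (F ^~ x)).
Hypothesis F_lip : {ae LR, forall t, `[0, T]%classic t -> forall x y e,
  `|rdist e (F t x) - rdist e (F t y)| <= al t * `|x - y|}.
Hypothesis F_bound : {ae LR, forall t, `[0, T]%classic t -> rdist 0 (F t 0) <= be t}.
Hypotheses (Lal : Lp al) (Lbe : Lp be).
Hypotheses (X_meas : forall w, Lp w -> smeas (I T) (X w))
  (X_bdd : forall w, Lp w -> exists C, forall t, `[0, T]%classic t -> `|X w t| <= C)
  (X_lip : forall w w', Lp w -> Lp w' -> forall t, `[0, T]%classic t ->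
     `|X w t - X w' t| <= M * Lnrm_ t (w \- w')).
Let mI := measurable_I T.

(** The residual of the inclusion: when F has nonempty closed values, it vanishes exactly where
    [w t] belongs to [F t (X w t)]. *)
Definition gap (w : R -> E) (t : R) : R := rdist (w t) (F t (X w t)).

Lemma gap_ge0 w t : 0 <= gap w t. Proof. exact: rdist_ge0. Qed.

Lemma X_lipT w w' t : Lp w -> Lp w' -> `[0, T]%classic t ->
  `|X w t - X w' t| <= M * Lnrm (w \- w').
Proof.
move=> Lw Lw' It; apply: le_trans (X_lip Lw Lw' It) _; apply: ler_wpM2l => //.
exact: (Lnrm_subI p1 It (LpB p1 dd Lw Lw')).
Qed.

Lemma Lp_norm (V : normedModType R) (w : R -> V) : Lp w -> Lp (fun t => `|w t| : R).
Proof.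
move=> Lw; apply: (Lp_mono mI p1 _ Lw).
  by apply: smeas_measurable; exact: (smeas_norm Lw.1).
by apply: aeW => t _; rewrite normr_id.
Qed.

Lemma Lnrm_norm (V : normedModType R) (w : R -> V) : Lp w ->
  Lnrm (fun t => `|w t| : R) = Lnrm w.
Proof.
move=> Lw; have Ln := Lp_norm Lw; apply/eqP; rewrite eq_le; apply/andP; split.
  by apply: (Lnrm_mono mI p1 Ln.1 Lw); apply: aeW => t _; rewrite normr_id.
by apply: (Lnrm_mono mI p1 Lw.1 Ln); apply: aeW => t _; rewrite normr_id.
Qed.

Lemma LnrmC (V : normedModType R) (w w' : R -> V) : Lp (w \- w') -> Lp (w' \- w) ->
  Lnrm (w \- w') = Lnrm (w' \- w).
Proof.
move=> L1 L2; apply/eqP; rewrite eq_le; apply/andP; split.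
  by apply: (Lnrm_mono mI p1 L1.1 L2); apply: aeW => t _; rewrite /= distrC.
by apply: (Lnrm_mono mI p1 L2.1 L1); apply: aeW => t _; rewrite /= distrC.
Qed.

Lemma Lp_comb3 (f g h : R -> R) a b c : Lp f -> Lp g -> Lp h ->
  0 <= a -> 0 <= b -> 0 <= c ->
  Lp (fun t => a * f t + b * g t + c * h t) /\
  Lnrm (fun t => a * f t + b * g t + c * h t) <= a * Lnrm f + b * Lnrm g + c * Lnrm h.
Proof.
move=> Lf Lg Lh a0 b0 c0; have [dR ddR] := @dense_seq_real R.
have Laf : Lp (fun t => a * f t) := Lp_scale mI p1 a0 Lf.
have Lbg : Lp (fun t => b * g t) := Lp_scale mI p1 b0 Lg.
have Lch : Lp (fun t => c * h t) := Lp_scale mI p1 c0 Lh.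
have L1 := LpD p1 ddR Laf Lbg; have L2 := LpD p1 ddR L1 Lch.
split; first exact: L2.
apply: le_trans (LnrmD p1 ddR L1 Lch) _; apply: lerD.
  apply: le_trans (LnrmD p1 ddR Laf Lbg) _; apply: lerD.
    by apply: (Lnrm_dom mI p1 Laf.1 a0 Lf); apply: aeW => t _; rewrite normrM (ger0_norm a0).
  by apply: (Lnrm_dom mI p1 Lbg.1 b0 Lg); apply: aeW => t _; rewrite normrM (ger0_norm b0).
by apply: (Lnrm_dom mI p1 Lch.1 c0 Lh); apply: aeW => t _; rewrite normrM (ger0_norm c0).
Qed.

Lemma Lp_gap w : Lp w -> Lp (gap w).
Proof.
move=> Lw; have [C XC] := X_bdd Lw.
have C0 : 0 <= `|C| by [].
have [LG _] := Lp_comb3 (Lp_norm Lw) (Lp_norm Lbe) (Lp_norm Lal) ler01 ler01 C0.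
apply: (Lp_mono mI p1 _ LG).
  apply: smeas_measurable.
  exact: (measurable_gap F0 F_meas F_lip dd Lw.1 (X_meas Lw)).
apply: ae_imply (ae_and F_bound F_lip) => t [tb tl] It.
have {}tb := tb It; have {}tl := tl It (X w t) 0 (w t).
have h1 := rdist_ball (w t) 0 (F0 0 It); rewrite subr0 in tl; rewrite subr0 in h1.
rewrite (ger0_norm (gap_ge0 w t)); apply: le_trans (ler_norm _).
rewrite !mul1r /gap; have h2 : al t * `|X w t| <= `|C| * `|al t|.
  apply: (@le_trans _ _ (`|al t| * `|X w t|)); first by apply: ler_wpM2r => //; exact: ler_norm.
  by rewrite mulrC; apply: ler_wpM2r => //; apply: le_trans (XC t It) (ler_norm _).
have := le_trans (ler_norm _) tl; have := ler_norm (be t); lra.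
Qed.

Lemma gap_lip w w' : Lp w -> Lp w' -> {ae LR, forall t, `[0, T]%classic t ->
  gap w t <= gap w' t + `|w t - w' t| + `|al t| * `|X w t - X w' t|}.
Proof.
move=> Lw Lw'; apply: ae_imply F_lip => t tl It; rewrite /gap.
have h1 := rdist_ball (w t) (w' t) (F0 (X w' t) It).
have h2 := le_trans (ler_norm _) (tl It (X w t) (X w' t) (w t)).
have h3 : al t * `|X w t - X w' t| <= `|al t| * `|X w t - X w' t|.
  by apply: ler_wpM2r => //; exact: ler_norm.
lra.
Qed.

Section improve.
Context {Z : Type} (conv : (nat -> Z) -> Z -> Prop).
Local Notation Lpcont := (Lpcont conv p T).

Lemma seqcont_Lnrm_sub (v : Z -> R -> E) a : (forall z, Lp (v z)) -> Lpcont v -> Lp a ->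
  seqcont conv (fun z => Lnrm (v z \- a)).
Proof.
move=> Lv cv La zs z zc.
apply: (@cvg_le_dist _ _ _ _ (fun n => Lnrm (v (zs n) \- v z))) => [n|]; last exact: cv.
have h1 := Lnrm_sub_le p1 dd (Lv (zs n)) (Lv z) La.
have := Lnrm_sub_le p1 dd (Lv z) (Lv (zs n)) La.
rewrite (LnrmC (LpB p1 dd (Lv z) (Lv (zs n))) (LpB p1 dd (Lv (zs n)) (Lv z))) => h2.
by rewrite ler_norml; apply/andP; split; lra.
Qed.

(* One step of the successive approximations: [v' z] chatters approximate selections of [F t (X
   (v zi) t)], nearly closest to [v zi], for the members zi of a dense sequence that are close
   to z; the error [r] comes from replacing zi by z. *)
Lemma improve (v : Z -> R -> E) (eps : Z -> R) :
  (forall z, Lp (v z)) -> Lpcont v -> (forall z, 0 < eps z) -> seqcont conv eps ->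
  exists v' : Z -> R -> E, [/\ forall z, Lp (v' z), Lpcont v' &
    forall z, exists r : R -> R, [/\ Lp r, forall t, 0 <= r t, Lnrm r <= eps z &
      {ae LR, forall t, `[0, T]%classic t ->
        `|v' z t - v z t| <= gap (v z) t + r t /\
        rdist (v' z t) (F t (X (v z) t)) <= r t}]].
Proof.
move=> Lv cv e0 ce.
have [[z0 _]|nZ] := pselect (exists z : Z, True); last first.
  by exists v; split => // z; exfalso; apply: nZ; exists z.
(* The final error is ez + M ez |al| + 2 |B| with B of norm at most 4 ez. [K] bounds its norm
   divided by ez, and 8 is twice 4. *)
pose K := Lnrm (fun=> 1 : R) + M * Lnrm al + 8.
have N1 : 0 <= Lnrm (fun=> 1 : R) by exact: Lnrm_ge0.
have Na : 0 <= M * Lnrm al by rewrite mulr_ge0// Lnrm_ge0.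
have K0 : 0 < K by rewrite /K ltr_wpDl// addr_ge0.
pose ez z := eps z / K.
have ez0 z : 0 < ez z by rewrite /ez divr_gt0.
have cez : seqcont conv ez by move=> zs z zc; apply: cvgM; [exact: ce|exact: cvg_cst].
have [zd zdP] := Lp_dense_family p1 dd z0 Lv.
(* Approximate selections for each member of the dense sequence and each precision 1/(m+1), fixed
   once for all parameters. *)
have /boolp.choice[U UP] : forall im : nat * nat, exists u, smeas (I T) u /\
    forall t, I T t -> `|u t - v (zd im.1) t| <= gap (v (zd im.1)) t + im.2.+1%:R^-1 /\
      rdist (u t) (F t (X (v (zd im.1)) t)) <= im.2.+1%:R^-1.
  move=> [i m] /=; apply: (approx_selection mI dd (G := fun t => F t (X (v (zd i)) t))).
  - by move=> t It; exact: F0.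
  - move=> c; apply: (measurable_gap F0 F_meas F_lip dd _ (X_meas (Lv _))).
    by split => c'; exact: measurable_cst.
  - exact: (measurable_gap F0 F_meas F_lip dd (Lv _).1 (X_meas (Lv _))).
  - exact: (Lv _).1.
  - by rewrite invr_gt0.
have LU im : Lp (U im).
  have [mU hU] := UP im; have Lc : Lp (fun=> im.2.+1%:R^-1 : R) := Lp_cst p mI _ (leb_I_lty T).
  have [LG _] := Lp_comb3 (Lp_norm (Lv (zd im.1))) (Lp_gap (Lv (zd im.1))) Lc ler01 ler01 ler01.
  apply: (Lp_mono mI p1 mU LG); apply: aeW => t It.
  have [h1 _] := hU t It; apply: le_trans (ler_norm _).
  have := ler_normD (U im t - v (zd im.1) t) (v (zd im.1) t); rewrite subrK => h.
  exact: improve_arith3 h h1.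
(* A code holds a member, a precision and a spare number that makes each such pair recur infinitely
   often. *)
pose idx j : nat * nat := (odflt ((0, 0), 0)%N (unpickle j : option (nat * nat * nat))).1.
pose g j z := v z \- v (zd (idx j).1).
have Lg j z : Lp (g j z) by exact: (LpB p1 dd).
(* Positive exactly where the precision is finer than [ez z] and the member lies within [ez z] of
   [v z] in L^p. *)
pose gs j z := Num.max 0 (Num.min (ez z - (idx j).2.+1%:R^-1) (ez z - Lnrm (g j z))).
have gs0 j z : 0 <= gs j z by rewrite le_max lexx.
have cg j : seqcont conv (fun z => Lnrm (g j z)).
  exact: seqcont_Lnrm_sub.
have gsc j : seqcont conv (gs j).
  move=> zs z zc; apply: cvgr_max; first exact: cvg_cst.
  apply: cvgr_min; apply: cvgB; [exact: cez|exact: cvg_cst|exact: cez|exact: cg].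
have gsP j z : 0 < gs j z -> (idx j).2.+1%:R^-1 < ez z /\ Lnrm (g j z) < ez z.
  by rewrite /gs lt_max ltxx/= lt_min !subr_gt0 => /andP.
have gsdiv z C : exists m, C <= \sum_(j < m) gs j z.
  have [i iP] := zdP z (ez z) (ez0 z).
  have [m _ /(_ m (leqnn m)) /= mP] := near_infty_natSinv_lt (PosNum (ez0 z)).
  pose phi (l : nat) := pickle (i, m, l).
  have idxE l : idx (phi l) = (i, m) by rewrite /idx /phi pickleK.
  apply: (@sum_recurrent _ (fun j => gs j z) phi (gs (phi 0%N) z)) => //.
  - by move=> l l' /(pcan_inj pickleK) [].
  - by rewrite /gs /g idxE /= lt_max lt_min !subr_gt0 mP iP orbT.
  - by move=> l; rewrite /gs /g !idxE.
(* The error is the excess of the norm of the chattered difference v z - v zi over its ideal value,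
   for all end points and all frequencies at least n. It moves with z by at most twice the distance
   of the controls. *)
have rates j : exists rate : nat -> Z -> R,
  [/\ forall n z, 0 <= rate n z, forall n, seqcont conv (rate n),
      forall n n' z, (n <= n')%N -> rate n' z <= rate n z,
      forall z, rate n z @[n --> \oo] --> (0 : R) &
      forall n (q : R * R * R) z, [/\ 0 < q.1.1, n%:R <= q.1.1, 0 <= q.1.2, q.1.2 <= q.2 & q.2
        <= 1] ->
       Lnrm (chi q.1.2 q.2 q.1.1 (g j z)) - (q.2 - q.1.2) `^ p^-1 * Lnrm (g j z) <= rate n z].
  apply: (@sup_rate _ _ conv (R * R * R) (fun n q => [/\ 0 < q.1.1, n%:R <= q.1.1, 0 <= q.1.2,
    q.1.2 <= q.2 & q.2 <= 1])
    (fun q z => Lnrm (chi q.1.2 q.2 q.1.1 (g j z)) - (q.2 - q.1.2) `^ p^-1 * Lnrm (g j z))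
    (fun z z' => 2 * Lnrm (v z \- v z')) (fun z => Lnrm (g j z))).
  - move=> n n' nn' q [h1 h2 h3 h4 h5]; split => //; apply: le_trans h2.
    by rewrite ler_nat.
  - move=> n [[N a] b] z [/= h1 h2 h3 h4 h5].
    apply: le_trans (Lnrm_chatter_le p1 h1 h3 h5 (Lg j z)).
    by rewrite gerBl mulr_ge0// ?powR_ge0// Lnrm_ge0.
  - move=> n [[N a] b] z z' [/= h1 h2 h3 h4 h5].
    have Lc := Lp_chatter p1 h1 h3 h5 (Lg j z); have Lc' := Lp_chatter p1 h1 h3 h5 (Lg j z').
    have Lvv := LpB p1 dd (Lv z) (Lv z'); have Lvv' := LpB p1 dd (Lv z') (Lv z).
    have k1 : Lnrm (chi a b N (g j z)) <= Lnrm (chi a b N (g j z')) + Lnrm (v z \- v z').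
      apply: (Lnrm_tri mI p1 Lc.1 Lc' Lvv); apply: aeW => t _; rewrite /patch.
      case: ifP => _; last by rewrite normr0 add0r.
      rewrite /g /= -[v z t](subrK (v z' t)) -addrA addrC (le_trans (ler_normD _ _))//.
      by rewrite addrC subrK.
    have k2 : Lnrm (g j z') <= Lnrm (g j z) + Lnrm (v z \- v z').
      rewrite (LnrmC Lvv Lvv') addrC.
      exact: (Lnrm_sub_le p1 dd (Lv z') (Lv z) (Lv (zd (idx j).1))).
    have w1 : (b - a) `^ p^-1 <= 1.
      apply: (powR_le1 p1); first by rewrite subr_ge0.
      by apply: le_trans h5; rewrite gerBl.
    have w0 := powR_ge0 (b - a) p^-1; have L0 := Lnrm_ge0 LR (I T) p (v z \- v z').
    move: k1 k2 w1 w0 L0.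
    by exact: improve_arith.
  - move=> z z'; split; first by rewrite mulr_ge0// Lnrm_ge0.
    by rewrite (LnrmC (LpB p1 dd (Lv z) (Lv z')) (LpB p1 dd (Lv z') (Lv z))).
  - move=> zs z zc; suff : 2 * Lnrm (v (zs n) \- v z) @[n --> \oo] --> (2 * 0 : R) by rewrite
    mulr0.
    by apply: cvgM; [exact: cvg_cst|exact: cv].
  - move=> z e epos; have [N0 N00 N0P] := Lnrm_chatter p1 T0 dd (Lg j z) epos.
    exists (Num.truncn N0).+1 => -[[N a] b] [/= h1 h2 h3 h4 h5].
    rewrite lerBlDl; apply: N0P => //; apply: le_trans h2.
    by apply: ltW; exact: truncnS_gt.
have {rates} /boolp.choice[rate rateP] := rates.
have [v' [Lv' cv' v'P]] := chatter_glue p1 dd gs0 gsc gsdiv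
  (fun j n z => let: And5 h _ _ _ _ := rateP j in h n z)
  (fun j n => let: And5 _ h _ _ _ := rateP j in h n)
  (fun j n n' z => let: And5 _ _ h _ _ := rateP j in h n n' z)
  (fun j z => let: And5 _ _ _ h _ := rateP j in h z) ez0 cez (fun j => LU (idx j)).
exists v'; split => // z.
have [N [Lam [m [n [rho [k [[N0 nN Lam0 Lam1 Lam01] [r0 rs rP] vE km kP]]]]]]] := v'P z.
(* The difference between [v z] and the member in use. It switches between several members, but each
   piece is small in L^p, hence so is [B]. It counts twice in the error: once in the displacement
   and once in the gap. *)
pose B t := g (k t) z t.
have LB : Lp B.
  have mk : measurable_fun (I T) k by exact: (measurable_glue_idx N0 Lam01 kP).
  exact: (Lp_glue mI p1 (h := fun j => g j z) (fun t _ => km t) mk (fun j => Lg j z)).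
have nB : Lnrm B <= 4 * ez z.
  apply: (Lnrm_glue_le p1 N0 Lam0 Lam1 Lam01 km kP (ltW (ez0 z)) (fun j => Lg j z) r0 rs) => j
    lt.
  have [/gsP[_ gle] rle] := rP j lt; have [_ _ _ _ /(_ n (N, Lam j, Lam j.+1) z) /=] := rateP j.
  have [/andP[h1 h2] _] := Lam01 j; have [_ h3] := Lam01 j.+1.
  move=> /(_ (And5 N0 nN h1 h2 h3)).
  have w0 := powR_ge0 (Lam j.+1 - Lam j) p^-1.
  by move=> h; exact: improve_arith4 h rle (ler_wpM2l w0 (ltW gle)).
have Lone : Lp (fun=> 1 : R) := Lp_cst p mI _ (leb_I_lty T).
have Mez : 0 <= M * ez z by rewrite mulr_ge0// ltW.
have [Lr nr] := Lp_comb3 Lone (Lp_norm Lal) (Lp_norm LB) (ltW (ez0 z)) Mez (ler0n _ 2).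
exists (fun t => ez z * 1 + M * ez z * `|al t| + 2 * `|B t|); split.
- exact: Lr.
- move=> t; rewrite mulr1; apply: addr_ge0; last by rewrite mulr_ge0.
  by apply: addr_ge0; [exact: ltW|rewrite mulr_ge0].
- apply: le_trans nr _; rewrite (Lnrm_norm LB) (Lnrm_norm Lal).
  have -> : eps z = ez z * K by rewrite /ez divfK// gt_eqF.
  by rewrite /K; exact: improve_arith2 nB.
have gl := fun i => gap_lip (Lv (zd i)) (Lv z).
have gl' : {ae LR, forall t, forall i, `[0, T]%classic t ->
  gap (v (zd i)) t <= gap (v z) t + `|v (zd i) t - v z t| + `|al t| * `|X (v (zd i)) t - X (v
    z) t|}.
  exact: (ae_countable gl).
apply: ae_imply (ae_and gl' F_lip) => t [tg tl] It.
have [lo hi] : Lam (k t) <= phase N t /\ phase N t < Lam (k t).+1.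
  by have /kP/andP := erefl (k t).
have [/gsP[dlt glt] _] := rP _ (le_lt_trans lo hi).
set i := (idx (k t)).1 in glt *; have [_ /(_ t It) [h1 h2]] := UP (idx (k t)).
have hX : `|X (v (zd i)) t - X (v z) t| <= M * ez z.
  apply: le_trans (X_lipT (Lv _) (Lv z) It) _; apply: ler_wpM2l => //.
  by rewrite (LnrmC (LpB p1 dd (Lv (zd i)) (Lv z)) (LpB p1 dd (Lv z) (Lv (zd i)))) ltW.
have hXa : `|al t| * `|X (v (zd i)) t - X (v z) t| <= M * ez z * `|al t|.
  by rewrite mulrC; exact: ler_wpM2r.
have hB : `|v (zd i) t - v z t| = `|B t| by rewrite distrC.
have dlt' := ltW dlt; rewrite vE; split.
  have := dist_tri h1 (lexx `|v (zd i) t - v z t|); rewrite hB => h3.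
  by have := tg i It; rewrite hB => h4; exact: improve_arith5 h3 h4 hXa dlt'.
have h3 := le_trans (ler_norm _) (tl It (X (v z) t) (X (v (zd i)) t) (U (idx (k t)) t)).
rewrite distrC in h3.
have h4 : al t * `|X (v (zd i)) t - X (v z) t| <= `|al t| * `|X (v (zd i)) t - X (v z) t|.
  by apply: ler_wpM2r => //; exact: ler_norm.
exact: improve_arith6 h2 h3 (le_trans h4 hXa) dlt' (normr_ge0 (B t)).
Qed.

End improve.

End inclusion.

(** Exchange of summations: [a i] occurs with total weight 2^-i + ... + 2^-m = 2/2^i - 1/2^m, and
    the second term on the left makes up for the 1/2^m. *)
Lemma weighted_partial_sums (R : realType) (a : nat -> R) m :
  \sum_(j < m.+1) (\sum_(i < j.+1) a i) / 2 ^+ j + (\sum_(i < m.+1) a i) / 2 ^+ m =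
  2 * \sum_(j < m.+1) a j / 2 ^+ j.
Proof.
elim: m => [|m IHm]; first by rewrite !big_ord1 expr0 !divr1; ring.
rewrite big_ord_recr/= [in RHS]big_ord_recr/= mulrDr -IHm.
have E2 : (2 ^+ m.+1)^-1 = (2 ^+ m)^-1 / 2 :> R by rewrite exprSr invfM.
rewrite [\sum_(i < m.+2) a i]big_ord_recr/= !E2.
set s := \sum_(j < m.+1) _ / _; set q := \sum_(i < m.+1) a i; set h := (2 ^+ m)^-1.
by move: s q h => s q h; field.
Qed.

(** * A weighted norm that contracts Volterra estimates *)

Section weights.
Context {R : realType}.
Local Notation LT := (caratheodory_type (wlength (@idfun R))^*%mu).
Local Notation I T := (`[0, T]%classic : set LT).
Local Notation LR := (@completed_lebesgue_measure R).
Variables (p T : R).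
Hypotheses (p1 : 1 <= p) (T0 : 0 < T).
Local Notation Lp_ t := (Lp LR (I t) p).
Local Notation Lnrm_ t := (Lnrm LR (I t) p).
Local Notation Lp := (Lp_ T).
Local Notation Lnrm := (Lnrm_ T).
Let p0 : 0 < p. Proof. exact: lt_le_trans ltr01 p1. Qed.

Lemma Lnrm_I0 (V : normedModType R) (u : R -> V) : smeas (I 0) u -> Lnrm_ 0 u = 0.
Proof.
move=> mu; rewrite LnrmE nint_integral null_set_integral.
- by rewrite powR0// invr_neq0// gt_eqF.
- exact: measurable_I.
- by apply: measurable_norm_powR; exact: mu.
- by have := @leb_itv_bnd R 0 0 true false (lexx 0); rewrite subrr.
Qed.

Lemma Lnrm_patch_sub (V : normedModType R) (u : R -> V) a b : a <= b ->
  Lnrm_ b (patch (fun=> 0) `[0, a] u) = Lnrm_ a u.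
Proof.
move=> ab; suff E : nint LR (I b) p (patch (fun=> 0) `[0, a] u) = nint LR (I a) p u.
  by rewrite !LnrmE E.
rewrite !nint_integral [LHS]integral_mkcond [RHS]integral_mkcond; apply: eq_integral => t _.
rewrite /patch; case: (boolP (t \in `[0, a]%classic)) => ta.
  rewrite mem_set//; move: ta; rewrite inE /= !in_itv/= => /andP[-> ta].
  exact: le_trans ab.
by case: ifP => // _; rewrite normr0 powR0// gt_eqF.
Qed.

Let node J (j : nat) : R := j%:R * (T / J%:R).

Let node_step J j : node J j <= node J j.+1.
Proof. by apply: ler_wpM2r; [rewrite divr_ge0// ltW|rewrite ler_nat]. Qed.

Let node_in J j : (j <= J)%N -> (0 < J)%N -> I T (node J j).
Proof.
move=> jJ J0; rewrite /= in_itv/= /node mulr_ge0 ?divr_ge0 ?(ltW T0)//=.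
by rewrite mulrC -mulrA ler_piMr ?(ltW T0)// ler_pdivrMl ?ltr0n// mulr1 ler_nat.
Qed.

(** Absolute continuity of the L^p norm: up to eta/2, [al] is a simple function bounded by [C], and
    this one is small on intervals of length T/J. *)
Lemma small_pieces (al : R -> R) eta : Lp al -> 0 < eta ->
  exists2 J, (0 < J)%N & forall j, (j < J)%N ->
    Lnrm_ (node J j.+1) (patch (fun=> 0) `]node J j, node J j.+1] al) <= eta.
Proof.
move=> Lal eta0; have [dR ddR] := @dense_seq_real R.
have eta2 : 0 < eta / 2 by rewrite divr_gt0.
have [s fs als] := Lp_simple_approx p1 ddR Lal eta2.
have [r ur sr] := fin_idx_seq fs; pose C : R := \sum_(v <- r) `|v|.
have C0 : 0 <= C by exact: sumr_ge0.
have sC t : I T t -> `|s t| <= C by move=> It; rewrite /C (bigD1_seq (s t)) ?sr//= lerDl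
  sumr_ge0.
(* On an interval of length at most x^p the simple part has norm at most C x <= eta/2. *)
pose x := eta / 2 / (C + 1); have x0 : 0 < x by rewrite divr_gt0// ltr_wpDl.
have xp0 : 0 < x `^ p by rewrite powR_gt0.
pose J := (Num.truncn (T / x `^ p)).+1.
have TJ : T / J%:R <= x `^ p.
  by rewrite ler_pdivrMr ?ltr0n// mulrC -ler_pdivrMr//; apply: ltW; exact: truncnS_gt.
exists J => // j jJ; set b := node J j.+1; set A := `]node J j, b]%classic.
have Ib : I T b by exact: node_in.
have mb := measurable_I b; have mA : lebesgue_measurable A by exact: leb_itv_measurable.
have Ls := Lp_simple p fs; have LB := LpB p1 ddR Lal Ls.
have L1 : Lp_ b (fun t => \1_A t : R).
  apply: (Lp_mono mb p1 _ (Lp_cst p mb (1 : R) (leb_I_lty b))).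
    by apply: smeas_measurable; exact: (@measurable_indic _ LT R (I b) A mA).
  by apply: aeW => t _; rewrite indicE; case: (_ \in _); rewrite ?normr1 ?normr0.
have LC : Lp_ b (fun t => C * \1_A t : R) := Lp_scale mb p1 C0 L1.
have LBb := Lp_subI Ib LB; have Lalb := Lp_subI Ib Lal.
have mpa : smeas (I b) (patch (fun=> 0) A al).
  by apply: (smeas_patch mb _ Lalb.1); exact: measurableI.
have tri : Lnrm_ b (patch (fun=> 0) A al) <= Lnrm_ b (al \- s) + Lnrm_ b (fun t => C * \1_A t :
  R).
  apply: (Lnrm_tri mb p1 mpa LBb LC); apply: aeW => t tb; rewrite /patch indicE.
  have It := subI Ib tb; case: (t \in A) => /=; last by rewrite mulr0 normr0 addr0.
  rewrite mulr1 (ger0_norm C0) -{1}(subrK (s t) (al t)); apply: le_trans (ler_normD _ _) _.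
  by rewrite lerD2l sC.
apply: le_trans tri _; rewrite [leRHS]splitr; apply: lerD.
  by apply: le_trans (Lnrm_subI p1 Ib LB) _; exact: ltW.
have hC : Lnrm_ b (fun t => C * \1_A t : R) <= C * Lnrm_ b (fun t => \1_A t : R).
  by apply: (Lnrm_dom mb p1 LC.1 C0 L1); apply: aeW => t _; rewrite normrM (ger0_norm C0).
apply: le_trans hC _; rewrite Lnrm_indic//.
have AE : (LR A = (T / J%:R)%:E)%E.
  rewrite /A leb_itv_bnd ?node_step//; congr (_%:E).
  by rewrite /b /node -natr1 mulrDl mul1r addrC addKr.
have hA : fine (LR (A `&` I b)) `^ p^-1 <= x.
  rewrite -[leRHS](powRK p1 (ltW x0)); apply: ge0_ler_powR; rewrite ?nnegrE ?invr_ge0 ?(ltW p0)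
    ?(ltW xp0) ?fine_ge0 ?leb_ge0//.
  have fb : leb R (A `&` I b) \is a fin_num by apply: (@leb_fin_num _ _ b); exact: subIsetr.
  rewrite -lee_fin fineK//; apply: (@le_trans _ _ (leb R A)).
    by apply: leb_le; exact: subIsetl.
  by rewrite AE lee_fin.
apply: le_trans (ler_wpM2l C0 hA) _; have -> : C * x = eta / 2 * (C / (C + 1)) by rewrite /x;
  ring.
rewrite ler_piMr ?(ltW eta2)//.
by rewrite ler_pdivrMr ?ltr_wpDl// mul1r lerDl.
Qed.

(* The sum over nodes t_j = jT/J of 2^-j times the L^p([0,t_j]) norm; J is such that [al] has
   small norm between consecutive nodes. *)
Lemma weighted_norm (al : R -> R) (M : R) : Lp al -> 0 <= M ->
  exists (W : (R -> R) -> R) (C : R), [/\ 0 <= C,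
    forall u, Lp u -> [/\ 0 <= W u, W u <= 2 * Lnrm u & Lnrm u <= C * W u],
    forall u u', Lp u -> Lp u' -> W (u \+ u') <= W u + W u' &
    forall h r u, Lp h -> Lp r -> Lp u -> {ae LR, forall t, `[0, T]%classic t ->
      `|h t| <= `|r t| + `|al t| * (M * Lnrm_ t u)} -> W h <= W r + W u / 4].
Proof.
move=> Lal M0; have [dR ddR] := @dense_seq_real R.
(* So M eta <= 1/8; the exchange of summations doubles this to the factor 1/4. *)
pose eta := (8 * (M + 1))^-1; have eta0 : 0 < eta by rewrite invr_gt0 mulr_gt0// ltr_wpDl.
have [J J0 JP] := small_pieces Lal eta0.
have nJ : node J J = T by rewrite /node mulrC divfK// gt_eqF// ltr0n.
pose W (u : R -> R) := \sum_(j < J.+1) Lnrm_ (node J j) u / 2 ^+ j.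
have pow0 j : 0 < (2 ^+ j)^-1 :> R by rewrite invr_gt0 exprn_gt0.
have Ij (j : 'I_J.+1) : I T (node J j) by apply: node_in => //; rewrite -ltnS.
have Wtri h u u' : Lp h -> Lp u -> Lp u' -> {ae LR, forall t, `[0, T]%classic t ->
    `|h t| <= `|u t| + `|u' t|} -> W h <= W u + W u'.
  move=> Lh Lu Lu' huu; rewrite /W -big_split/=; apply: ler_sum => j _.
  rewrite -mulrDl; apply: ler_wpM2r; first exact: ltW.
  apply: (Lnrm_tri (measurable_I _) p1 (smeas_subI (Ij j) Lh.1) (Lp_subI (Ij j) Lu) (Lp_subI
    (Ij j) Lu')).
  by apply: ae_imply huu => t h1 tj; apply: h1; exact: subI (Ij j) _ tj.
exists W, (2 ^+ J); split.
- by rewrite exprn_ge0.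
- move=> u Lu; have ge j : 0 <= Lnrm_ (node J j) u / 2 ^+ j by rewrite mulr_ge0 ?Lnrm_ge0// ltW.
  split; first by apply: sumr_ge0 => j _; exact: ge.
    apply: (@le_trans _ _ (\sum_(j < J.+1) Lnrm u / 2 ^+ j)).
      apply: ler_sum => j _; apply: ler_wpM2r; first exact: ltW.
      exact: (Lnrm_subI p1 (Ij j) Lu).
    have := @geometric_sum_le R (Lnrm u) 0 J.+1 (Lnrm_ge0 _ _ _ _).
    by rewrite expr0 divr1; apply: le_trans; rewrite le_eqVlt; apply/orP; left; apply/eqP;
      apply: eq_bigr => j _; rewrite add0n.
  have e0 : 0 < 2 ^+ J :> R by rewrite exprn_gt0.
  rewrite -ler_pdivrMl// mulrC /W big_ord_recr/= nJ lerDr.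
  by apply: sumr_ge0 => j _; exact: ge.
- move=> u u' Lu Lu'; apply: (Wtri _ u u' (LpD p1 ddR Lu Lu') Lu Lu').
  by apply: aeW => t _; exact: ler_normD.
move=> h r u Lh Lr Lu hru.
(* The excess of |h| over |r|: the bound by [u] concerns this part alone. *)
pose h' t := Num.max 0 (`|h t| - `|r t|).
have h'0 t : 0 <= h' t by rewrite /h' le_max lexx.
have Lh' : Lp h'.
  apply: (Lp_mono (measurable_I T) p1 _ Lh).
    apply: smeas_measurable; apply: measurable_maxr; first exact: measurable_cst.
    by apply: measurable_funB; [exact: (smeas_norm Lh.1)|exact: (smeas_norm Lr.1)].
  apply: aeW => t _; rewrite ger0_norm// /h' ge_max normr_ge0/=.
  by rewrite gerBl.
have h'le : {ae LR, forall t, `[0, T]%classic t -> h' t <= `|al t| * (M * Lnrm_ t u)}.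
  apply: ae_imply hru => t h1 It; rewrite /h' ge_max lerBlDl h1// andbT.
  by rewrite mulr_ge0// mulr_ge0// Lnrm_ge0.
(* From one node to the next only the new interval contributes, and [al] is small there; the norms
   of [u] on [0,t] are replaced by the one at the right node. *)
have step j : (j < J)%N -> Lnrm_ (node J j.+1) h' <= Lnrm_ (node J j) h' +
    M * eta * Lnrm_ (node J j.+1) u.
  move=> jJ; set a := node J j; set b := node J j.+1; set A := `]a, b]%classic.
  have Ia : I T a by apply: node_in => //; exact: ltnW.
  have Ib : I T b by exact: node_in.
  have mb := measurable_I b; have L'b := Lp_subI Ib Lh'; have Lalb := Lp_subI Ib Lal.
  have mpatch (V : normedModType R) (B : set R) (f : R -> V) : lebesgue_measurable B -> Lp_ b f
    ->
      Lp_ b (patch (fun=> 0) B f).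
    move=> mB Lf; apply: (Lp_mono mb p1 _ Lf).
      by apply: (smeas_patch mb _ Lf.1); exact: measurableI.
    by apply: aeW => t _; rewrite /patch; case: ifP => // _; rewrite normr0.
  have mA : lebesgue_measurable A by exact: leb_itv_measurable.
  have P1 := mpatch _ _ _ (measurable_I a) L'b; have P2 := mpatch _ _ _ mA L'b.
  have P3 := mpatch _ _ _ mA Lalb.
  apply: (@le_trans _ _ (Lnrm_ b (patch (fun=> 0) `[0, a] h') + Lnrm_ b (patch (fun=> 0) A
    h'))).
    apply: (Lnrm_tri mb p1 L'b.1 P1 P2); apply: aeW => t tb.
    have [ta|ta] := leP t a.
      rewrite /patch (mem_set (_ : `[0, a]%classic t)) ?lerDl//.
      by move: tb; rewrite /= !in_itv/= ta => /andP[->].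
    rewrite [X in _ <= _ + `|X|]/patch (mem_set (_ : A t)) ?lerDr//.
    by move: tb; rewrite /A /= !in_itv/= ta => /andP[_ ->].
  rewrite Lnrm_patch_sub ?node_step// lerD2l.
  have c0 : 0 <= M * Lnrm_ b u by rewrite mulr_ge0// Lnrm_ge0.
  apply: (@le_trans _ _ (M * Lnrm_ b u * Lnrm_ b (patch (fun=> 0) A al))); last first.
    by rewrite mulrAC; apply: ler_wpM2r; [exact: Lnrm_ge0|apply: ler_wpM2l => //; exact: JP].
  apply: (Lnrm_dom mb p1 P2.1 c0 P3); apply: ae_imply h'le => t h1 tb.
  have It := subI Ib tb; rewrite /patch; case: ifP => _; last by rewrite !normr0 mulr0.
  rewrite (ger0_norm (h'0 t)); apply: le_trans (h1 It) _; rewrite mulrC; apply: ler_wpM2r => //.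
  apply: ler_wpM2l => //; apply: (Lnrm_subI p1 tb); exact: (Lp_subI Ib Lu).
have acc j : (j < J.+1)%N -> Lnrm_ (node J j) h' <= M * eta * \sum_(i < j.+1) Lnrm_ (node J i)
  u.
  elim: j => [_|j IHj jJ].
    rewrite /node mul0r Lnrm_I0; last by apply: (smeas_subI _ Lh'.1); rewrite /= in_itv/= lexx
      ltW.
    by rewrite mulr_ge0 ?mulr_ge0 ?(ltW eta0)// sumr_ge0// => i _; exact: Lnrm_ge0.
  rewrite big_ord_recr/= mulrDr; apply: le_trans (step j jJ) _.
  by rewrite lerD2r; apply: IHj; exact: ltnW.
have Wh' : W h' <= W u / 4.
  apply: (@le_trans _ _ (M * eta * (2 * W u))).
    rewrite /W -(weighted_partial_sums (fun j => Lnrm_ (node J j) u) J) mulrDr.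
    apply: (@le_trans _ _ (M * eta * \sum_(j < J.+1) (\sum_(i < j.+1) Lnrm_ (node J i) u) / 2
      ^+ j)).
      rewrite mulr_sumr; apply: ler_sum => j _; rewrite mulrA; apply: ler_wpM2r; first exact:
        ltW.
      exact: acc.
    rewrite lerDl; apply: mulr_ge0; first by rewrite mulr_ge0// ltW.
    apply: mulr_ge0; last exact: ltW.
    by apply: sumr_ge0 => i _; exact: Lnrm_ge0.
  have W0 : 0 <= W u by apply: sumr_ge0 => j _; rewrite mulr_ge0 ?Lnrm_ge0// ltW.
  have Me : M * eta <= 8^-1.
    rewrite /eta invfM mulrCA ler_piMr// ler_pdivrMr ?ltr_wpDl// mul1r lerDl//.
  apply: le_trans (ler_wpM2r (mulr_ge0 (ler0n _ 2) W0) Me) _.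
  by rewrite le_eqVlt; apply/orP; left; apply/eqP; field.
apply: le_trans (Wtri h r h' Lh Lr Lh' _) _; last by rewrite lerD2l.
apply: aeW => t _; rewrite (ger0_norm (h'0 t)) -lerBlDl /h' le_max lexx orbT//.
Qed.

End weights.

Section arithmetic.
Context {R : realType}.
Implicit Types a b c e g h : R.

Lemma ler_lim_cst (b : nat -> R) c a : b n @[n --> \oo] --> a -> (forall n, c <= b n) -> c <= a.
Proof.
move=> ba cb; rewrite leNgt; apply/negP => ac.
by have [n _ /(_ n (leqnn n)) /=] := cvgr_lt _ ba _ ac; rewrite ltNge cb.
Qed.

Lemma cvg_geometric_half c : c / 2 ^+ n @[n --> \oo] --> (0 : R).
Proof.
have h : `|2^-1| < 1 :> R by rewrite ger0_norm// invf_lt1// ltr1n.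
have := cvg_geometric c h; apply: cvg_trans; apply: near_eq_cvg; apply: nearW => n.
by rewrite /geometric /= exprVn.
Qed.

Lemma dist_le_of_two a b c : a <= b + c -> b <= a + c -> `|a - b| <= c.
Proof. by move=> h1 h2; rewrite ler_norml; apply/andP; split; lra. Qed.

Lemma gap_arith g r r' x y : r' <= r -> g - r' <= x -> x <= y -> g <= r + y.
Proof. by lra. Qed.

Lemma gap_arith2 (g' r e wr gr wg n : R) : n <= e -> wr <= 2 * n -> gr <= wg + wr ->
  g' <= wr + gr / 4 -> g' <= wg / 4 + 5 / 2 * e.
Proof. by lra. Qed.

Lemma gap_arith3 h g e W : 0 <= h -> 0 <= g -> 0 <= e -> W <= (2 * g + 10 * e) * h ->
  W / 4 + 5 / 2 * (e * h) <= (2 * g + 10 * e) * (h / 2).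
Proof.
move=> h0 g0 e0; have := mulr_ge0 g0 h0; have := mulr_ge0 e0 h0.
have -> : (2 * g + 10 * e) * (h / 2) = g * h + 5 * (e * h) by field.
have -> : (2 * g + 10 * e) * h = 2 * (g * h) + 10 * (e * h) by ring.
move: (g * h) (e * h) => x y; lra.
Qed.

Lemma gap_arith4 c g e : 0 <= c -> 0 <= g -> 0 <= e ->
  c * (2 * g + 10 * e) <= (10 * c + 2) * (g + e).
Proof.
move=> c0 g0 e0; have := mulr_ge0 c0 g0; have := mulr_ge0 c0 e0.
have -> : c * (2 * g + 10 * e) = 2 * (c * g) + 10 * (c * e) by ring.
have -> : (10 * c + 2) * (g + e) = 10 * (c * g) + 10 * (c * e) + 2 * g + 2 * e by ring.
move: (c * g) (c * e) => x y; lra.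
Qed.

Lemma gap_arith5 c g e h n : 0 <= c -> 0 <= g -> 0 <= e -> 0 <= h ->
  n <= c * ((2 * g + 10 * e) * h) -> n + e * h <= (10 * c + 2) * (g + e) * h.
Proof.
move=> c0 g0 e0 h0.
have := mulr_ge0 (mulr_ge0 c0 g0) h0; have := mulr_ge0 (mulr_ge0 c0 e0) h0.
have := mulr_ge0 g0 h0; have := mulr_ge0 e0 h0.
have -> : c * ((2 * g + 10 * e) * h) = 2 * (c * g * h) + 10 * (c * e * h) by ring.
have -> : (10 * c + 2) * (g + e) * h = 10 * (c * g * h) + 10 * (c * e * h) + 2 * (g * h) + 2 *
  (e * h) by ring.
move: (c * g * h) (c * e * h) (g * h) (e * h) => x y z t; lra.
Qed.

Lemma three_thirds (ww wv vw v2 vv e : R) : ww <= wv + vw -> vw <= v2 + vv ->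
  wv <= e / 3 -> vv <= e / 3 -> v2 <= e / 3 -> ww <= e.
Proof. by lra. Qed.

End arithmetic.

(** * Continuous families of solutions from approximate ones *)

Section solution_families.
Context {R : realType} {E : completeNormedModType R}.
Local Notation LT := (caratheodory_type (wlength (@idfun R))^*%mu).
Local Notation I T := (`[0, T]%classic : set LT).
Local Notation LR := (@completed_lebesgue_measure R).
Variables (p T : R) (d : nat -> E) (F : R -> E -> set E) (al be : R -> R)
  (X : (R -> E) -> R -> E) (M : R).
Hypotheses (p1 : 1 <= p) (T0 : 0 < T) (dd : dense_seq d) (M0 : 0 <= M).
Local Notation Lp_ t := (Lp LR (I t) p).
Local Notation Lnrm_ t := (Lnrm LR (I t) p).
Local Notation Lp := (Lp_ T).
Local Notation Lnrm := (Lnrm_ T).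
Hypotheses (F0 : forall t x, `[0, T]%classic t -> F t x !=set0)
  (F_closed : forall t x, `[0, T]%classic t -> closed (F t x))
  (F_meas : forall x, Sigma_measurable T (F ^~ x)).
Hypothesis F_lip : {ae LR, forall t, `[0, T]%classic t -> forall x y e,
  `|rdist e (F t x) - rdist e (F t y)| <= al t * `|x - y|}.
Hypothesis F_bound : {ae LR, forall t, `[0, T]%classic t -> rdist 0 (F t 0) <= be t}.
Hypotheses (Lal : Lp al) (Lbe : Lp be).
Hypotheses (X_meas : forall w, Lp w -> smeas (I T) (X w))
  (X_bdd : forall w, Lp w -> exists C, forall t, `[0, T]%classic t -> `|X w t| <= C)
  (X_lip : forall w w', Lp w -> Lp w' -> forall t, `[0, T]%classic t ->
     `|X w t - X w' t| <= M * Lnrm_ t (w \- w')).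
Let mI := measurable_I T.
Let T0' : 0 <= T. Proof. exact: ltW. Qed.
Local Notation gap := (gap F X).

Let Lgap w : Lp w -> Lp (gap w).
Proof. exact: (Lp_gap p1 dd F0 F_meas F_lip F_bound Lal Lbe X_meas X_bdd). Qed.

Let XlT w w' t : Lp w -> Lp w' -> `[0, T]%classic t ->
  `|X w t - X w' t| <= M * Lnrm (w \- w').
Proof. exact: (X_lipT p1 dd M0 X_lip). Qed.

Lemma Lnrm_gap_lip w w' : Lp w -> Lp w' ->
  Lnrm (gap w) <= Lnrm (gap w') + (1 + M * Lnrm al) * Lnrm (w \- w').
Proof.
move=> Lw Lw'; have LB := LpB p1 dd Lw Lw'.
have c0 : 0 <= M * Lnrm (w \- w') by rewrite mulr_ge0// Lnrm_ge0.
have [L3 n3] := Lp_comb3 p1 (Lgap Lw') (Lp_norm p1 LB) (Lp_norm p1 Lal) ler01 ler01 c0.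
have le : Lnrm (gap w) <= Lnrm (fun t => 1 * gap w' t + 1 * `|(w \- w') t| + M * Lnrm (w \- w')
  * `|al t|).
  apply: (Lnrm_mono mI p1 (Lgap Lw).1 L3); apply: ae_imply (gap_lip X F0 F_lip Lw Lw') => t h
    It.
  rewrite (ger0_norm (gap_ge0 _ _ _ _)); apply: le_trans (ler_norm _); apply: le_trans (h It) _.
  rewrite !mul1r; apply: lerD => //; rewrite mulrC; apply: ler_wpM2r => //; exact: XlT.
apply: le_trans le _; apply: le_trans n3 _.
rewrite (Lnrm_norm p1 LB) (Lnrm_norm p1 Lal) !mul1r mulrDl mul1r -addrA.
by rewrite (mulrAC M).
Qed.

(** Geometric decay makes the gaps tend to 0 almost everywhere; the Lipschitz estimate then gives
    gap 0 at the limit [w], and the values of F are closed. *)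
Lemma solution_of_approx (u : nat -> R -> E) w c : 0 <= c -> (forall n, Lp (u n)) -> Lp w ->
  (forall n, Lnrm (gap (u n)) <= c / 2 ^+ n) ->
  (forall n, Lnrm (w \- u n) <= c / 2 ^+ n) ->
  {ae LR, forall t, `[0, T]%classic t -> u n t @[n --> \oo] --> w t} ->
  {ae LR, forall t, `[0, T]%classic t -> F t (X w t) (w t)}.
Proof.
move=> c0 Lu Lw gu wu uw.
have g0 := Lp_fast_ae0 mI (leb_I_lty T) p1 c0 (fun n => Lgap (Lu n)) gu.
have gl := ae_countable (fun n => gap_lip X F0 F_lip Lw (Lu n)).
apply: ae_imply (ae_and g0 (ae_and uw gl)) => t [tg [tu tl]] It.
apply: rdist_closed; [exact: F0|exact: F_closed|].
apply/eqP; rewrite eq_le rdist_ge0 andbT.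
pose b n := gap (u n) t + `|w t - u n t| + `|al t| * (M * (c / 2 ^+ n)).
have bl n : rdist (w t) (F t (X w t)) <= b n.
  apply: le_trans (tl n It) _; rewrite /b lerD2l; apply: ler_wpM2l => //.
  by apply: le_trans (XlT Lw (Lu n) It) _; exact: ler_wpM2l.
suff : b n @[n --> \oo] --> (0 + 0 + `|al t| * (M * 0) : R).
  rewrite !mulr0 !addr0 => b0; apply: (@ler_lim_cst _ b _ 0); last exact: bl.
  exact: b0.
apply: cvgD; first apply: cvgD; first exact: tg.
- rewrite -(normr0 E) -(subrr (w t)); apply: cvg_norm; apply: cvgB; first exact: cvg_cst.
  exact: tu.
- apply: cvgM; first exact: cvg_cst; apply: cvgM; first exact: cvg_cst.
  exact: cvg_geometric_half.
Qed.

Section iterate.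
Context {Z : Type} (conv : (nat -> Z) -> Z -> Prop).
Local Notation Lpcont := (Lpcont conv p T).

Lemma seqcont_Lnrm_gap (v : Z -> R -> E) : (forall z, Lp (v z)) -> Lpcont v ->
  seqcont conv (fun z => Lnrm (gap (v z))).
Proof.
move=> Lv cv zs z zc; set K := 1 + M * Lnrm al.
apply: (@cvg_le_dist _ _ _ _ (fun n => K * Lnrm (v (zs n) \- v z))).
  move=> n; have h1 := Lnrm_gap_lip (Lv (zs n)) (Lv z).
  have := Lnrm_gap_lip (Lv z) (Lv (zs n)).
  rewrite (LnrmC p1 (LpB p1 dd (Lv z) (Lv (zs n))) (LpB p1 dd (Lv (zs n)) (Lv z))) => h2.
  exact: dist_le_of_two h1 h2.
suff : K * Lnrm (v (zs n) \- v z) @[n --> \oo] --> (K * 0 : R) by rewrite mulr0.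
by apply: cvgM; [exact: cvg_cst|exact: cv].
Qed.

(** From X v to X v' the distance to F changes by at most |al| M times the norm of v' - v on [0,t],
    and v' - v is bounded by gap v + r: this is the form contracted by [W]. The tolerance enters
    through W r <= 2e, once fully and once with factor 1/4, which gives 5/2. *)
Lemma gap_recursion (W : (R -> R) -> R) (v v' : R -> E) (r : R -> R) (e : R) :
  (forall u, Lp u -> [/\ 0 <= W u, W u <= 2 * Lnrm u & True]) ->
  (forall u u', Lp u -> Lp u' -> W (u \+ u') <= W u + W u') ->
  (forall h r u, Lp h -> Lp r -> Lp u -> {ae LR, forall t, `[0, T]%classic t ->
      `|h t| <= `|r t| + `|al t| * (M * Lnrm_ t u)} -> W h <= W r + W u / 4) ->
  Lp v -> Lp v' -> Lp r -> (forall t, 0 <= r t) -> Lnrm r <= e ->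
  {ae LR, forall t, `[0, T]%classic t ->
        `|v' t - v t| <= gap v t + r t /\ rdist (v' t) (F t (X v t)) <= r t} ->
  W (gap v') <= W (gap v) / 4 + (5 / 2) * e /\ Lnrm (v' \- v) <= Lnrm (gap v) + e.
Proof.
move=> W2 Wtri Wrec Lv Lv' Lr r0 re hv; have [dR ddR] := @dense_seq_real R.
have Lg := Lgap Lv; have Lu := LpD p1 ddR Lg Lr; have Lvv := LpB p1 dd Lv' Lv.
have near_le : {ae LR, forall t, `[0, T]%classic t -> `|v' t - v t| <= `|(gap v \+ r) t|}.
  by apply: ae_imply hv => t h It; have [h1 _] := h It; apply: le_trans h1 (ler_norm _).
split; last first.
  apply: le_trans (Lnrm_mono mI p1 Lvv.1 Lu near_le) _; apply: le_trans (LnrmD p1 ddR Lg Lr) _.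
  by rewrite lerD2l.
have : W (gap v') <= W r + W (gap v \+ r) / 4.
  apply: (Wrec _ _ _ (Lgap Lv') Lr Lu); apply: ae_imply (ae_and hv F_lip) => t [h tl] It.
  have [h1 h2] := h It; rewrite (ger0_norm (gap_ge0 _ _ _ _)) (ger0_norm (r0 t)).
  have h3 := le_trans (ler_norm _) (tl It (X v' t) (X v t) (v' t)).
  have h4 : al t * `|X v' t - X v t| <= `|al t| * (M * Lnrm_ t (gap v \+ r)).
    apply: (@le_trans _ _ (`|al t| * `|X v' t - X v t|)).
      by apply: ler_wpM2r => //; exact: ler_norm.
    apply: ler_wpM2l => //; apply: le_trans (X_lip Lv' Lv It) _; apply: ler_wpM2l => //.
    have mt := measurable_I t.
    apply: (Lnrm_mono mt p1 (smeas_subI It Lvv.1) (Lp_subI It Lu)).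
    by apply: ae_imply near_le => s hs ts; apply: hs; exact: (subI It).
  exact: gap_arith h2 h3 h4.
have [_ Wr _] := W2 r Lr; have := Wtri _ _ Lg Lr.
exact: gap_arith2 re Wr.
Qed.

(* Iterate [improve] with tolerances [eps / 2^n]. *)
Lemma solution_family : exists2 C : R, 0 <= C &
  forall (v : Z -> R -> E) (eps : Z -> R),
  (forall z, Lp (v z)) -> Lpcont v -> (forall z, 0 < eps z) -> seqcont conv eps ->
  exists w : Z -> R -> E, [/\ forall z, Lp (w z), Lpcont w,
    forall z, {ae LR, forall t, `[0, T]%classic t -> F t (X (w z) t) (w z t)} &
    forall z, Lnrm (w z \- v z) <= C * (Lnrm (gap (v z)) + eps z)].
Proof.
have [W [C0 [C00 W2 Wtri Wrec]]] := weighted_norm p1 T0 Lal M0.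
(* Twice the constant 10 C0 + 2 of the increments, as the geometric series sums to twice its first
   term. *)
exists (20 * C0 + 4) => [|v eps Lv cv e0 ce]; first by rewrite addr_ge0// mulr_ge0.
pose good (u : Z -> R -> E) := (forall z, Lp (u z)) /\ Lpcont u.
have /boolp.choice[f fP] : forall un : (Z -> R -> E) * nat, exists u', good un.1 ->
   good u' /\ forall z, exists r : R -> R, [/\ Lp r, forall t, 0 <= r t, Lnrm r <= eps z / 2 ^+
     un.2 &
      {ae LR, forall t, `[0, T]%classic t ->
        `|u' z t - un.1 z t| <= gap (un.1 z) t + r t /\
        rdist (u' z t) (F t (X (un.1 z) t)) <= r t}].
  move=> [u n] /=; have [[Lu cu]|ng] := pselect (good u); last by exists u => /ng.
  have [||u' [Lu' cu' h]] := improve p1 T0' dd M0 F0 F_meas F_lip F_bound Lal Lbe X_meas X_bdd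
    X_lip Lu cu (eps := fun z => eps z / 2 ^+ n).
  - by move=> z; rewrite divr_gt0// exprn_gt0.
  - by move=> zs z zc; apply: cvgM; [exact: ce|exact: cvg_cst].
  - by exists u'.
pose vs := fix vs n := if n is n'.+1 then f (vs n', n') else v.
have gvs n : good (vs n).
  elim: n => [|n IHn]; first exact: (conj Lv cv).
  by have [h _] := fP (vs n, n) IHn; exact: h.
pose B z := Lnrm (gap (v z)) + eps z.
pose c z := (10 * C0 + 2) * B z.
have B0 z : 0 <= B z by rewrite addr_ge0 ?Lnrm_ge0// ltW.
have c0 z : 0 <= c z by rewrite mulr_ge0// addr_ge0// mulr_ge0.
have W2' u : Lp u -> [/\ 0 <= W u, W u <= 2 * Lnrm u & True] by move=> /W2[].
have rec n z : W (gap (vs n.+1 z)) <= W (gap (vs n z)) / 4 + (5 / 2) * (eps z / 2 ^+ n) /\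
    Lnrm (vs n.+1 z \- vs n z) <= Lnrm (gap (vs n z)) + eps z / 2 ^+ n.
  have [_ /(_ z) [r [Lr r0 re hr]]] := fP (vs n, n) (gvs n).
  exact: (gap_recursion W2' Wtri Wrec ((gvs n).1 z) ((gvs n.+1).1 z) Lr r0 re hr).
(* The contraction 1/4 beats the decay 2^-n of the tolerances. The coefficient 10 solves x/4 + 5/2 =
   x/2, and 2 comes from W u <= 2 Lnrm u. *)
have Wg n z : W (gap (vs n z)) <= (2 * Lnrm (gap (v z)) + 10 * eps z) / 2 ^+ n.
  elim: n => [|n IHn].
    have [_ h _] := W2 _ (Lgap (Lv z)); rewrite expr0 divr1; apply: le_trans h _.
    by rewrite lerDl mulr_ge0// ltW.
  have [h _] := rec n z; apply: le_trans h _.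
  rewrite exprSr invfM; set h := (2 ^+ n)^-1 in IHn *.
  have h0 : 0 <= h by rewrite invr_ge0 exprn_ge0.
  exact: gap_arith3 h0 (Lnrm_ge0 _ _ _ _) (ltW (e0 z)) IHn.
have gn n z : Lnrm (gap (vs n z)) <= c z / 2 ^+ n.
  have [_ _ h] := W2 _ (Lgap ((gvs n).1 z)); apply: le_trans h _.
  apply: le_trans (ler_wpM2l C00 (Wg n z)) _; rewrite mulrA.
  apply: ler_wpM2r; first by rewrite invr_ge0 exprn_ge0.
  exact: gap_arith4 C00 (Lnrm_ge0 _ _ _ _) (ltW (e0 z)).
have dn n z : Lnrm (vs n.+1 z \- vs n z) <= c z / 2 ^+ n.
  have [_ h] := rec n z; apply: le_trans h _.
  have [_ _ h2] := W2 _ (Lgap ((gvs n).1 z)).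
  have := le_trans h2 (ler_wpM2l C00 (Wg n z)); set h := (2 ^+ n)^-1 => h3.
  have h0 : 0 <= h by rewrite invr_ge0 exprn_ge0.
  exact: gap_arith5 C00 (Lnrm_ge0 _ _ _ _) (ltW (e0 z)) h0 h3.
have /boolp.choice[w wP] : forall z, exists w, [/\ Lp w,
    {ae LR, forall t, I T t -> vs n z t @[n --> \oo] --> w t} &
    forall n, Lnrm (w \- vs n z) <= 2 * c z / 2 ^+ n].
  move=> z; exact: (Lp_complete mI (leb_I_lty T) (@leb_complete R) p1 dd (c0 z) (fun n => (gvs
    n).1 z) (dn^~ z)).
have c2 z : 0 <= 2 * c z by rewrite mulr_ge0.
have Lw z : Lp (w z) by case: (wP z).
exists w; split => //; last 2 first.
- move=> z; have [_ w1 w2] := wP z.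
  apply: (solution_of_approx (c2 z) (fun n => (gvs n).1 z) (Lw z) _ w2 w1) => n.
  apply: le_trans (gn n z) _; apply: ler_wpM2r; first by rewrite invr_ge0 exprn_ge0.
  by rewrite ler_peMl// ler1n.
- move=> z; have [_ _ /(_ 0%N)] := wP z; rewrite expr0 divr1 => h; apply: le_trans h _.
  by rewrite le_eqVlt; apply/orP; left; apply/eqP; rewrite /c /B; ring.
(* The approximations are continuous, and they converge at a rate governed by [c], which is bounded
   along [zs] eventually; the limit is therefore continuous. *)
move=> zs z zc; apply/cvgrPdist_le => e epos.
have cc : seqcont conv c.
  move=> zs' z' zc'; apply: cvgM; first exact: cvg_cst.
  by apply: cvgD; [exact: seqcont_Lnrm_gap|exact: ce].
have e3 : 0 < e / 3 by rewrite divr_gt0.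
have lt1 : c z < c z + 1 by rewrite ltrDl.
have nc := cvgr_lt _ (cc _ _ zc) _ lt1.
have [n nP] : exists n, 2 * (c z + 1) / 2 ^+ n <= e / 3.
  have [n _ /(_ n (leqnn n)) h] := cvgr_lt _ (@cvg_geometric_half R (2 * (c z + 1))) _ e3.
  by exists n; exact: ltW.
have nv := cvgr_lt _ ((gvs n).2 _ _ zc) _ e3.
have [N1 _ hN1] := nc; have [N2 _ hN2] := nv; exists (maxn N1 N2) => // i /=.
rewrite geq_max => /andP[/hN1 ci /hN2 vi]; rewrite /= in ci; rewrite /= in vi.
rewrite sub0r normrN (ger0_norm (Lnrm_ge0 _ _ _ _)).
have wi z' : c z' <= c z + 1 -> Lnrm (w z' \- vs n z') <= e / 3.
  move=> cz; have [_ _ /(_ n)] := wP z' => h; apply: le_trans h _; apply: le_trans nP.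
  by apply: ler_wpM2r; [rewrite invr_ge0 exprn_ge0|apply: ler_wpM2l].
have Lvi := (gvs n).1 (zs i); have Lvz := (gvs n).1 z.
have h1 := Lnrm_sub_le p1 dd (Lw (zs i)) Lvi (Lw z).
have h2 := Lnrm_sub_le p1 dd Lvi Lvz (Lw z).
have h3 := wi _ (ltW ci); have h4 := wi z (ltW lt1).
rewrite (LnrmC p1 (LpB p1 dd (Lw z) Lvz) (LpB p1 dd Lvz (Lw z))) in h4.
exact: three_thirds h1 h2 h3 h4 (ltW vi).
Qed.

End iterate.

End solution_families.

Section extension_arithmetic.
Context {R : realType}.
Implicit Types e K x : R.

Lemma extension_arith (M C a eta x : R) : 0 <= M -> 0 <= C -> 0 <= a -> 0 <= eta -> 0 <= x ->
  M * (C * ((2 * eta + x) * a + x)) + (eta + x) <= (M * (C * (2 * a + 1)) + 1) * (eta + x).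
Proof.
move=> M0 C0 a0 e0 x0; have MC := mulr_ge0 M0 C0.
have h1 := mulr_ge0 MC (mulr_ge0 a0 x0); have h2 := mulr_ge0 MC e0.
rewrite -subr_ge0 (_ : _ - _ = M * C * (a * x) + M * C * eta); first exact: addr_ge0.
ring.
Qed.

Lemma extension_arith2 K e x : 0 <= K -> 0 <= e -> x <= e / (2 * (K + 1)) ->
  K * (e / (2 * (K + 1)) + x) <= e.
Proof.
move=> K0 e0 xe; have K1 : 0 < K + 1 by rewrite ltr_wpDl.
apply: le_trans (ler_wpM2l K0 (lerD (lexx _) xe)) _.
have -> : K * (e / (2 * (K + 1)) + e / (2 * (K + 1))) = e * (K / (K + 1)).
  by field; rewrite gt_eqF.
by rewrite ler_piMr// ler_pdivrMr// mul1r lerDl.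
Qed.

Lemma extension_arith3 (d dyx dA r dx : R) : dx <= d + dyx -> dyx < 2 * dA -> dA <= d ->
  d < r / 3 -> dx < r.
Proof. by lra. Qed.

End extension_arithmetic.

(** * Extension of continuous families of solutions *)

Section extension.
Context {R : realType} {E : completeNormedModType R}.
Local Notation LT := (caratheodory_type (wlength (@idfun R))^*%mu).
Local Notation I T := (`[0, T]%classic : set LT).
Local Notation LR := (@completed_lebesgue_measure R).
Variables (p T M : R) (d : nat -> E) (k : R -> R -> blin E) (F : R -> E -> set E)
  (al be : R -> R) (h : cfun T E).
Hypotheses (p1 : 1 <= p) (T0 : 0 < T) (dd : dense_seq d) (M0 : 0 <= M).
Local Notation Lp_ t := (Lp LR (I t) p).
Local Notation Lnrm_ t := (Lnrm LR (I t) p).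
Local Notation Lp := (Lp_ T).
Local Notation Lnrm := (Lnrm_ T).
Local Notation chi a b N f := (patch (fun=> 0) (chatter_set a b N) f).
Hypothesis km : forall t, I T t -> strongly_measurable LR (I t) (k t).
Hypothesis kb : forall t, I T t -> forall u : R -> R, Lp_ t u ->
  (\int[LR]_(s in I t) (`|k t s| * `|u s|)%:E <= (M * Lnrm_ t u)%:E)%E.
Hypothesis kc : forall t0, I T t0 -> forall e : R, 0 < e ->
  \forall t \near t0, I T t ->
    (\int[LR]_(s in I T) `|kernel_section k t s - kernel_section k t0 s|%:E <= e%:E)%E.
Hypotheses (F0 : forall t x, `[0, T]%classic t -> F t x !=set0)
  (F_closed : forall t x, `[0, T]%classic t -> closed (F t x))
  (F_meas : forall x, Sigma_measurable T (F ^~ x)).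
Hypothesis F_lip : {ae LR, forall t, `[0, T]%classic t -> forall x y e,
  `|rdist e (F t x) - rdist e (F t y)| <= al t * `|x - y|}.
Hypothesis F_bound : {ae LR, forall t, `[0, T]%classic t -> rdist 0 (F t 0) <= be t}.
Hypotheses (Lal : Lp al) (Lbe : Lp be).
Let cmu := @leb_complete R.
Let T0' : 0 <= T. Proof. exact: ltW. Qed.

Lemma cfun_cont (x : cfun T E) : {within `[0, T], continuous x}.
Proof. by case: x => x /= /asboolP[]. Qed.

Lemma cfun_dist_le (x y : cfun T E) t : `|x t - y t| <= `|x - y|.
Proof. exact: (le_maxnorm (x - y) t). Qed.

Lemma continuous_smeas (f : R -> E) : {within `[0, T], continuous f} -> smeas (I T) f.
Proof.
move=> cf; split => c mD Y mY; apply: leb_measurable.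
have cn : {within `[0, T], continuous (fun t => `|f t - c|)}.
  by move=> t; apply: cvg_norm; apply: cvgB; [exact: cf|exact: cvg_cst].
exact: (subspace_continuous_measurable_fun (measurable_itv _) cn (measurable_itv _) mY).
Qed.

Lemma cfun_of_continuous (f : R -> E) : {within `[0, T], continuous f} ->
  exists x : cfun T E, forall t, `[0, T]%classic t -> x t = f t.
Proof.
move=> /subspace_continuousP cf.
pose g : R -> E := patch (fun=> 0) `[0, T] f.
have fP : g \in @cfun_pred R T E.
  apply/asboolP; split; last by move=> t nt; rewrite /g /patch memNset.
  apply/subspace_continuousP => t0 It0; change (g x @[x --> within `[0, T] (nbhs t0)] --> g t0).
  rewrite (_ : g t0 = f t0); last by rewrite /g /patch mem_set.
  apply: cvg_trans (cf t0 It0); apply: near_eq_cvg; rewrite near_withinE.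
  by apply: nearW => t It; rewrite /g /patch mem_set.
by exists (CFun fP) => t It; rewrite /= /g /patch mem_set.
Qed.

Definition Xop (w : R -> E) (t : R) : E := h t + volt k w t.

Lemma Xop_cont w : Lp w -> {within `[0, T], continuous (Xop w)}.
Proof.
move=> Lw t; apply: cvgD; first exact: cfun_cont.
exact: (volt_cont p1 dd M0 km kb kc Lw).
Qed.

Lemma Xop_lip w w' : Lp w -> Lp w' -> forall t, `[0, T]%classic t ->
  `|Xop w t - Xop w' t| <= M * Lnrm_ t (w \- w').
Proof.
move=> Lw Lw' t It; rewrite /Xop [X in `|X|](_ : _ = volt k w t - volt k w' t).
  exact: (volt_lip p1 dd M0 km kb It (Lp_subI It Lw) (Lp_subI It Lw')).
by rewrite opprD addrACA subrr add0r.
Qed.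

Lemma Xop_lipT w w' t : Lp w -> Lp w' -> `[0, T]%classic t ->
  `|Xop w t - Xop w' t| <= M * Lnrm (w \- w').
Proof. exact: (X_lipT p1 dd M0 Xop_lip). Qed.

Lemma Xop_bdd w : Lp w -> exists C, forall t, `[0, T]%classic t -> `|Xop w t| <= C.
Proof.
move=> Lw; have [x xE] := cfun_of_continuous (Xop_cont Lw).
by have [C xC] := cfun_bounded x; exists C => t It; rewrite -xE.
Qed.

Lemma Xop_meas w : Lp w -> smeas (I T) (Xop w).
Proof. by move=> Lw; apply: continuous_smeas; exact: Xop_cont. Qed.

Definition solution (x : cfun T E) : Prop := exists w, [/\ Lp w,
  {ae LR, forall t, `[0, T]%classic t -> F t (x t) (w t)} &
  forall t, `[0, T]%classic t -> x t = Xop w t].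

Lemma volt_norm w t : I T t -> Lp_ t w -> `|volt k w t| <= M * Lnrm_ t w.
Proof.
move=> It Lw; have vP := voltP p1 dd M0 km kb It Lw.
rewrite -lee_fin; apply: le_trans (bochner_norm (measurable_I t) (leb_I_lty t) cmu vP) _.
apply: (kernel_int_le p1 M0 km kb It Lw (f := fun s => k t s (w s))).
  exact: (smeas_norm (strong_smeas (measurable_I t) (leb_I_lty t) cmu vP.1)).
by move=> s _; exact: blin_norm.
Qed.

Lemma volt_add f g t : I T t -> Lp f -> Lp g ->
  volt k (f \+ g) t = volt k f t + volt k g t.
Proof.
move=> It Lf Lg; have Lf' := Lp_subI It Lf; have Lg' := Lp_subI It Lg.
have Lfg := Lp_subI It (LpD p1 dd Lf Lg).
apply/esym; apply: (volt_unique p1 dd M0 km kb It Lfg).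
have b := bochner_lin (measurable_I t) (leb_I_lty t) cmu 1 1
  (voltP p1 dd M0 km kb It Lf') (voltP p1 dd M0 km kb It Lg').
rewrite -[volt k f t]scale1r -[volt k g t]scale1r; apply: (bochner_ext _ b) => s _.
by have := @blin_lin _ _ (k t s) 1 (f s) (g s); rewrite !scale1r => ->.
Qed.

Lemma volt_zero t : I T t -> volt k (fun=> 0) t = 0.
Proof.
move=> It; have L0 : Lp (fun=> 0 : E) := Lp_cst p (measurable_I T) _ (leb_I_lty T).
have := volt_add It L0 L0; rewrite (_ : _ \+ _ = fun=> 0); last by apply/funext => s /=;
  rewrite addr0.
by move=> /eqP; rewrite -subr_eq0 opprD addrA subrr sub0r oppr_eq0 => /eqP.
Qed.

Lemma volt_sum (f : nat -> R -> E) m t : I T t -> (forall j, Lp (f j)) ->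
  Lp (fun s => \sum_(j < m) f j s) /\
  volt k (fun s => \sum_(j < m) f j s) t = \sum_(j < m) volt k (f j) t.
Proof.
move=> It Lf; elim: m => [|m [IH1 IH2]].
  rewrite (_ : (fun s => _) = fun=> 0); last by apply/funext => s; rewrite big_ord0.
  split; last by rewrite big_ord0 volt_zero.
  exact: (Lp_cst p (measurable_I T) (0 : E) (leb_I_lty T)).
rewrite (_ : (fun s => _) = (fun s => \sum_(j < m) f j s) \+ f m); last first.
  by apply/funext => s; rewrite big_ord_recr.
split; first exact: (LpD p1 dd IH1 (Lf m)).
by rewrite (volt_add It IH1 (Lf m)) IH2 big_ord_recr.
Qed.

Section volt_glue.
Variables (N : R) (Lam : nat -> R) (m : nat) (kk : R -> nat).
Hypotheses (N0 : 0 < N) (Lam0 : Lam 0%N = 0) (Lam1 : Lam m = 1)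
  (Lam01 : forall j, 0 <= Lam j <= Lam j.+1 /\ Lam j <= 1)
  (kkm : forall t, (kk t < m)%N)
  (kkP : forall t j, kk t = j <-> chatter_set (Lam j) (Lam j.+1) N t).
Variables (u : nat -> R -> E) (rho : nat -> R) (t : R) (b : E) (eta : R).
Hypotheses (It : `[0, T]%classic t) (Lu : forall j, Lp (u j)) (rho0 : forall j, 0 <= rho j).
Hypothesis urho : forall j, Lam j < Lam j.+1 ->
  `|volt k (chi (Lam j) (Lam j.+1) N (u j)) t - (Lam j.+1 - Lam j) *: volt k (u j) t| <= rho j.
Hypothesis ueta : forall j, Lam j < Lam j.+1 -> `|Xop (u j) t - b| <= eta.

(** Linearity splits the integral into chattered pieces, each near its weight times the full
    integral, and a convex combination of points within [eta] of [b] is within [eta] of [b]. *)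
Lemma Xop_glue : `|Xop (fun s => u (kk s) s) t - b| <= eta + \sum_(j < m) rho j.
Proof.
have w0 j : 0 <= Lam j.+1 - Lam j by have [/andP[_ ?] _] := Lam01 j; rewrite subr_ge0.
have dich j : Lam j < Lam j.+1 \/ Lam j.+1 - Lam j = 0.
  by have := w0 j; rewrite le_eqVlt => /orP[/eqP <-|]; [right|left; rewrite -subr_gt0].
have uE : (fun s => u (kk s) s) = (fun s => \sum_(j < m) chi (Lam j) (Lam j.+1) N (u j) s).
  apply/funext => s; rewrite (bigD1 (Ordinal (kkm s)))//= big1 ?addr0.
    by rewrite /patch mem_set//; exact/kkP.
  move=> j js; rewrite /patch memNset// => /kkP jE; move/eqP: js; apply.
  exact: val_inj.
have Lc j : Lp (chi (Lam j) (Lam j.+1) N (u j)).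
  have [/andP[h1 _] _] := Lam01 j; have [_ h3] := Lam01 j.+1.
  exact: (Lp_chatter p1 N0 h1 h3).
have [_ vE] := volt_sum m It Lc.
have h1 : `|volt k (fun s => u (kk s) s) t - \sum_(j < m) (Lam j.+1 - Lam j) *: volt k (u j) t|
    <= \sum_(j < m) rho j.
  rewrite uE vE -sumrB; apply: le_trans (ler_norm_sum _ _ _) _; apply: ler_sum => j _.
  have [/urho//|E0] := dich j.
  rewrite E0 scale0r subr0 (_ : patch _ _ _ = fun=> 0) ?volt_zero ?normr0//.
  apply/funext => s; rewrite /patch memNset// /chatter_set /= => /andP[lo hi].
  by have := le_lt_trans lo hi; rewrite -subr_gt0 E0 ltxx.
have h2 : `|h t + \sum_(j < m) (Lam j.+1 - Lam j) *: volt k (u j) t - b| <= eta.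
  have sE := glue_weight_sum Lam0 Lam1.
  have -> : h t + \sum_(j < m) (Lam j.+1 - Lam j) *: volt k (u j) t - b =
      \sum_(j < m) (Lam j.+1 - Lam j) *: (Xop (u j) t - b).
    rewrite addrAC -[h t - b]scale1r -sE scaler_suml -big_split/=.
    by apply: eq_bigr => j _; rewrite -scalerDr /Xop addrAC.
  apply: le_trans (ler_norm_sum _ _ _) _.
  apply: (@le_trans _ _ (\sum_(j < m) (Lam j.+1 - Lam j) * eta)); last by rewrite -mulr_suml sE
    mul1r.
  apply: ler_sum => j _; rewrite normrZ (ger0_norm (w0 j)).
  have [/ueta le|E0] := dich j; first exact: ler_wpM2l.
  by rewrite E0 !mul0r.
rewrite [leRHS]addrC; apply: (dist_tri (y := h t + \sum_(j < m) (Lam j.+1 - Lam j) *: volt k (u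
  j) t)) h2.
by rewrite /Xop opprD addrACA subrr add0r.
Qed.

End volt_glue.

Section metric_extension.
Variables (Y : Type) (dY : Y -> Y -> R) (A : set Y) (a : nat -> Y) (f : Y -> cfun T E).
Hypotheses (dY_ge0 : forall x y, 0 <= dY x y) (dYxx : forall x, dY x x = 0)
  (dYC : forall x y, dY x y = dY y x) (dY_tri : forall x y z, dY x z <= dY x y + dY y z).
Hypotheses (aA : forall j, A (a j))
  (a_dense : forall y e, A y -> 0 < e -> exists j, dY y (a j) < e)
  (A_closed : forall y, ~ A y -> exists2 r, 0 < r & forall x, A x -> r <= dY y x).
Hypotheses (f_sol : forall y, A y -> solution (f y))
  (f_cont : forall y e, A y -> 0 < e -> exists2 r, 0 < r &
     forall y', A y' -> dY y y' < r -> `|f y' - f y| <= e).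

Let dA y := inf [set dY y (a j) | j in [set: nat]].

Let dA_has_inf y : has_inf [set dY y (a j) | j in [set: nat]].
Proof. by split; [exists (dY y (a 0%N)), 0%N|exists 0 => _ [j _ <-]]. Qed.

Let dA_le y j : dA y <= dY y (a j).
Proof. by apply: ge_inf; [case: (dA_has_inf y)|exists j]. Qed.

Let dA_lb y r : (forall j, r <= dY y (a j)) -> r <= dA y.
Proof.
move=> hr; apply: lb_le_inf; first by case: (dA_has_inf y).
by move=> _ [j _ <-].
Qed.

Let dA_ge0 y : 0 <= dA y. Proof. exact: dA_lb. Qed.

Let dA_gt0 y : ~ A y -> 0 < dA y.
Proof.
move=> /A_closed[r r0 hr]; apply: lt_le_trans r0 _; apply: dA_lb => j; exact: hr.
Qed.

Let dA_near y : 0 < dA y -> exists j, dY y (a j) < 2 * dA y.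
Proof.
move=> d0; have lt : dA y < 2 * dA y by rewrite ltr_pMl// ltr1n.
by have [_ [j _ <-] lj] := inf_lt (dA_has_inf y).1 lt; exists j.
Qed.

Let dA_lip y y' : dA y <= dA y' + dY y y'.
Proof.
rewrite -lerBlDr; apply: dA_lb => j; rewrite lerBlDr; apply: le_trans (dA_le y j) _.
by rewrite addrC.
Qed.

Let dA_le_A y x : A x -> dA y <= dY y x.
Proof.
move=> Ax; apply/ler_addgt0Pr => e e0; have [j xj] := a_dense Ax e0.
apply: le_trans (dA_le y j) _; apply: le_trans (dY_tri y x (a j)) _.
by rewrite lerD2l ltW.
Qed.

(** Off [A] the distance [dA] is positive and can serve as tolerance; as it tends to 0 at [A],
    continuity there is recovered at the end. *)
Let Z := {y : Y | ~ A y}.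
Let conv (zs : nat -> Z) (z : Z) := dY (sval (zs n)) (sval z) @[n --> \oo] --> (0 : R).

Let seqcont_dist x : seqcont conv (fun z : Z => dY (sval z) x).
Proof.
move=> zs z zc; apply: cvg_le_dist zc => n.
have h1 := dY_tri (sval (zs n)) (sval z) x; have h2 := dY_tri (sval z) (sval (zs n)) x.
rewrite (dYC (sval z) (sval (zs n))) addrC in h2; rewrite addrC in h1.
exact: dist_le_of_two.
Qed.

Let seqcont_dA : seqcont conv (fun z : Z => dA (sval z)).
Proof.
move=> zs z zc; apply: cvg_le_dist zc => n.
have h1 := dA_lip (sval (zs n)) (sval z); have := dA_lip (sval z) (sval (zs n)).
by rewrite (dYC (sval z)) => h2; exact: dist_le_of_two.
Qed.

(* Near a point x of [A] the glued controls have gap at most [|al|] times the oscillation of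
   [f], so that the corrected solution stays close to [f x]. *)
Lemma extension_off : exists (w : Z -> R -> E) (K : R), [/\ forall z, Lp (w z), 0 <= K,
  Lpcont conv p T w,
  forall z, {ae LR, forall t, `[0, T]%classic t -> F t (Xop (w z) t) (w z t)} &
  forall z (x : cfun T E) eta, 0 <= eta ->
    (forall y, A y -> dY (sval z) y < 2 * dA (sval z) -> `|f y - x| <= eta) ->
    forall t, `[0, T]%classic t -> `|Xop (w z) t - x t| <= K * (eta + dA (sval z))].
Proof.
have /boolp.choice[wa waP] : forall j, exists w, [/\ Lp w,
    {ae LR, forall t, `[0, T]%classic t -> F t (f (a j) t) (w t)} &
    forall t, `[0, T]%classic t -> f (a j) t = Xop w t].
  by move=> j; exact: f_sol.
have Lwa j : Lp (wa j) by case: (waP j).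
pose idx (j : nat) : nat := (odflt (0, 0)%N (unpickle j : option (nat * nat))).1.
(* The cover of Dugundji's theorem: the point [a i] is used at z when its distance to z is less than
   twice [dA]. The spare component of the code makes each point recur. *)
pose gs j (z : Z) := Num.max 0 (2 * dA (sval z) - dY (sval z) (a (idx j))).
have gs0 j z : 0 <= gs j z by rewrite le_max lexx.
have gsc j : seqcont conv (gs j).
  move=> zs z zc; apply: cvgr_max; first exact: cvg_cst.
  apply: cvgB; last exact: seqcont_dist.
  by apply: cvgM; [exact: cvg_cst|exact: seqcont_dA].
have dZ (z : Z) : 0 < dA (sval z) by apply: dA_gt0; exact: svalP z.
have gsP j z : 0 < gs j z -> dY (sval z) (a (idx j)) < 2 * dA (sval z).
  by rewrite /gs lt_max ltxx/= subr_gt0.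
have gsdiv z C : exists m, C <= \sum_(j < m) gs j z.
  have [i iP] := dA_near (dZ z).
  pose phi (l : nat) := pickle (i, l).
  have idxE l : idx (phi l) = i by rewrite /idx /phi pickleK.
  apply: (@sum_recurrent _ (fun j => gs j z) phi (gs (phi 0%N) z)).
  - by [].
  - by move=> l l' /(pcan_inj pickleK) [].
  - by rewrite /gs idxE lt_max subr_gt0 iP orbT.
  - by move=> l; rewrite /gs !idxE.
(* Here a query includes the time, since the estimate has to be uniform on [0,T]. The controls [wa]
   are independent of z, so the modulus is 0. *)
have rates j : exists rate : nat -> Z -> R,
  [/\ forall n z, 0 <= rate n z, forall n, seqcont conv (rate n),
      forall n n' z, (n <= n')%N -> rate n' z <= rate n z,
      forall z, rate n z @[n --> \oo] --> (0 : R) &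
      forall n (q : R * R * R * R) z, [/\ 0 < q.1.1.1, n%:R <= q.1.1.1, 0 <= q.1.1.2, q.1.1.2
        <= q.1.2 & q.1.2 <= 1] /\ I T q.2 ->
       `|volt k (chi q.1.1.2 q.1.2 q.1.1.1 (wa (idx j))) q.2 - (q.1.2 - q.1.1.2) *: volt k (wa
         (idx j)) q.2| <= rate n z].
  apply: (@sup_rate _ _ conv (R * R * R * R)
    (fun n q => [/\ 0 < q.1.1.1, n%:R <= q.1.1.1, 0 <= q.1.1.2, q.1.1.2 <= q.1.2 & q.1.2 <= 1]
      /\ I T q.2)
    (fun q z => `|volt k (chi q.1.1.2 q.1.2 q.1.1.1 (wa (idx j))) q.2 - (q.1.2 - q.1.1.2) *:
      volt k (wa (idx j)) q.2|)
    (fun z z' => 0) (fun z => M * Lnrm (wa (idx j)) + M * Lnrm (wa (idx j)))).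
  - move=> n n' nn' q [[h1 h2 h3 h4 h5] It]; split => //; split => //; apply: le_trans h2.
    by rewrite ler_nat.
  - move=> n [[[N b] c] t] z [[/= h1 h2 h3 h4 h5] It].
    have Lc := Lp_chatter p1 h1 h3 h5 (Lwa (idx j)).
    apply: le_trans (ler_normB _ _) _; apply: lerD.
      apply: le_trans (volt_norm It (Lp_subI It Lc)) _; apply: ler_wpM2l => //.
      apply: le_trans (Lnrm_subI p1 It Lc) _; exact: Lnrm_chatter_le.
    have w0 : 0 <= c - b by rewrite subr_ge0.
    have w1 : c - b <= 1 by apply: le_trans h5; rewrite gerBl.
    rewrite normrZ (ger0_norm w0); apply: le_trans (ler_wpM2r (normr_ge0 _) w1) _; rewrite
      mul1r.
    apply: le_trans (volt_norm It (Lp_subI It (Lwa (idx j)))) _; apply: ler_wpM2l => //.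
    exact: (Lnrm_subI p1 It (Lwa (idx j))).
  - by move=> n q z z' _; rewrite addr0.
  - by [].
  - by move=> zs z _; exact: cvg_cst.
  - move=> z e epos; have [n nP] := volt_chatter p1 dd M0 km kb kc (Lwa (idx j)) epos.
    exists n.+1 => -[[[N b] c] t] [[/= h1 h2 h3 h4 h5] It]; exact: nP.
have {rates} /boolp.choice[rate rateP] := rates.
have [v [Lv cv vP]] := chatter_glue p1 dd gs0 gsc gsdiv
  (fun j n z => let: And5 h _ _ _ _ := rateP j in h n z)
  (fun j n => let: And5 _ h _ _ _ := rateP j in h n)
  (fun j n n' z => let: And5 _ _ h _ _ := rateP j in h n n' z)
  (fun j z => let: And5 _ _ _ h _ := rateP j in h z) dZ seqcont_dA (fun j => Lwa (idx j)).
have [C C0 fam] := solution_family p1 T0 dd M0 F0 F_closed F_meas F_lip F_bound Lal Lbe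
  Xop_meas Xop_bdd Xop_lip conv.
have [w [Lw cw Fw wv]] := fam v (fun z => dA (sval z)) Lv cv dZ seqcont_dA.
pose K := M * (C * (2 * Lnrm al + 1)) + 1.
have K0 : 0 <= M * (C * (2 * Lnrm al + 1)).
  by apply: mulr_ge0 => //; apply: mulr_ge0 => //; rewrite addr_ge0// mulr_ge0// Lnrm_ge0.
exists w, K; split => //; first by rewrite addr_ge0.
move=> z x eta eta0 fx t It.
have [N [Lam [m [n [rho [kk [[N0 nN Lam0 Lam1 Lam01] [r0 rs rP] vE kkm kkP]]]]]]] := vP z.
have vE' : v z = (fun s => wa (idx (kk s)) s) by apply/funext.
have glue (b : cfun T E) et : (forall j, Lam j < Lam j.+1 -> `|f (a (idx j)) - b| <= et) ->
    forall t, `[0, T]%classic t -> `|Xop (v z) t - b t| <= et + dA (sval z).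
  move=> hb s Is; rewrite vE'; apply: (@le_trans _ _ (et + \sum_(j < m) rho j)); last by
    rewrite lerD2l.
  apply: (Xop_glue N0 Lam0 Lam1 Lam01 kkm kkP Is (fun j => Lwa (idx j)) r0).
    move=> j lt; have [_ rle] := rP j lt; have [_ _ _ _ /(_ n (N, Lam j, Lam j.+1, s) z) /=] :=
      rateP j.
    have [/andP[h1 h2] _] := Lam01 j; have [_ h3] := Lam01 j.+1.
    by move=> /(_ (conj (And5 N0 nN h1 h2 h3) Is)) h4; exact: le_trans h4 rle.
  move=> j lt; have [_ _ <-//] := waP (idx j).
  by apply: le_trans (hb j lt); exact: cfun_dist_le.
have act j : Lam j < Lam j.+1 -> `|f (a (idx j)) - x| <= eta.
  by move=> /rP[/gsP lt _]; exact: fx.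
have hv := glue x eta act t It.
have dz := ltW (dZ z); have c0 : 0 <= 2 * eta + dA (sval z) by rewrite addr_ge0// mulr_ge0.
have gapv : Lnrm (gap F Xop (v z)) <= (2 * eta + dA (sval z)) * Lnrm al.
  have Lg := Lp_gap p1 dd F0 F_meas F_lip F_bound Lal Lbe Xop_meas Xop_bdd (Lv z).
  apply: (Lnrm_dom (measurable_I T) p1 Lg.1 c0 Lal).
  have sols := ae_countable (fun j => let: And3 _ h0 _ := waP j in h0).
  apply: ae_imply (ae_and sols F_lip) => s [hs tl] Is.
  rewrite (ger0_norm (gap_ge0 _ _ _ _)) /gap.
  have [lo hi] : Lam (kk s) <= phase N s /\ phase N s < Lam (kk s).+1.
    by have /kkP/andP := erefl (kk s).
  have lt := le_lt_trans lo hi; set i := idx (kk s).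
  have r00 : rdist (v z s) (F s (f (a i) s)) = 0.
    apply/eqP; rewrite eq_le rdist_ge0 andbT vE; apply: le_trans (rdist_le _ (hs i Is)) _.
    by rewrite subrr normr0.
  have := le_trans (ler_norm _) (tl Is (Xop (v z) s) (f (a i) s) (v z s)); rewrite r00 subr0 =>
    h1.
  apply: le_trans h1 _; apply: (@le_trans _ _ (`|al s| * `|Xop (v z) s - f (a i) s|)).
    by apply: ler_wpM2r => //; exact: ler_norm.
  rewrite mulrC; apply: ler_wpM2r => //.
  have h2 := glue x eta act s Is.
  have h4 : `|x s - f (a i) s| <= eta.
    by apply: le_trans (cfun_dist_le _ _ _) _; rewrite distrC; exact: act.
  by apply: le_trans (dist_tri h2 h4) _; rewrite [2 * eta]mulr_natl mulr2n addrAC.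
have h5 := Xop_lipT (Lw z) (Lv z) It.
have h6 : Lnrm (w z \- v z) <= C * ((2 * eta + dA (sval z)) * Lnrm al + dA (sval z)).
  by apply: le_trans (wv z) _; apply: ler_wpM2l => //; rewrite lerD2r.
apply: le_trans (dist_tri (le_trans h5 (ler_wpM2l M0 h6)) hv) _.
exact: extension_arith M0 C0 (Lnrm_ge0 _ _ _ _) eta0 dz.
Qed.

Lemma metric_extension : exists g : Y -> cfun T E, [/\ forall y, solution (g y),
  forall y, A y -> g y = f y &
  forall y e, 0 < e -> exists2 r, 0 < r & forall y', dY y y' < r -> `|g y' - g y| <= e].
Proof.
have [w [K [Lw K0 cw Fw wP]]] := extension_off.
have /boolp.choice[xw xwP] : forall z, exists x : cfun T E, forall t, `[0, T]%classic t -> x t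
  = Xop (w z) t.
  by move=> z; apply: cfun_of_continuous; exact: Xop_cont.
pose g y := if pselect (A y) is right nA then xw (exist _ y nA) else f y.
have gA y : A y -> g y = f y by move=> Ay; rewrite /g; case: pselect.
have gZ y (nA : ~ A y) : g y = xw (exist _ y nA).
  rewrite /g; case: pselect => [/nA//|nA']; congr (xw _); exact: eq_exist.
have off (x x' : cfun T E) e : 0 <= e -> (forall t, `[0, T]%classic t -> `|x t - x' t| <= e) ->
  `|x - x'| <= e.
  move=> e0 h0; change (maxnorm (x - x') <= e); apply: maxnorm_le => // t.
  have [It|nIt] := pselect (`[0, T]%classic t); first exact: h0.
  have z0 (b : cfun T E) : b t = 0 by case: b => b /= /asboolP[_]; exact.
  by rewrite z0 normr0.
exists g; split.
- move=> y; have [Ay|nA] := pselect (A y); first by rewrite gA//; exact: f_sol.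
  rewrite (gZ y nA); exists (w (exist _ y nA)); split => //; last exact: xwP.
  apply: ae_imply (Fw (exist _ y nA)) => t Ft It; rewrite xwP//; exact: Ft.
- exact: gA.
(* Off [A] sequential continuity suffices: a failure would produce a sequence tending to y, whose
   terms stay off [A] thanks to the bound [r0]. *)
move=> y e e0; have [Ay|nA] := pselect (A y); last first.
  apply: contrapT => nex; pose z0 : Z := exist _ y nA.
  have [r0 r00 r0P] := A_closed nA.
  have /boolp.choice[ys ysP] : forall n : nat, exists y', dY y y' < Num.min r0 n.+1%:R^-1 /\ ~
    `|g y' - g y| <= e.
    move=> n; apply: contrapT => nex'; apply: nex; exists (Num.min r0 n.+1%:R^-1).
      by rewrite lt_min r00/= invr_gt0.
    by move=> y' yy'; apply: contrapT => ng; apply: nex'; exists y'.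
  have nAs n : ~ A (ys n).
    by move=> /r0P; have [+ _] := ysP n; rewrite lt_min => /andP[lt0 _]; rewrite leNgt lt0.
  pose zs n : Z := exist _ (ys n) (nAs n).
  have zc : conv zs z0.
    apply/cvgrPdist_lt => eps eps0; have [n _ nP] := near_infty_natSinv_lt (PosNum eps0).
    exists n => // i /= ni; rewrite sub0r normrN ger0_norm// dYC.
    have [+ _] := ysP i; rewrite lt_min => /andP[_ lt1]; exact: lt_trans lt1 (nP i ni).
  have M1 : 0 < M + 1 by rewrite ltr_wpDl.
  have e1 : 0 < e / (M + 1) by rewrite divr_gt0.
  have [n _ /(_ n (leqnn n)) /= hn] := cvgr_lt _ (cw _ _ zc) _ e1.
  have [_ []] := ysP n; rewrite (gZ _ (nAs n)) (gZ y nA); apply: off; first exact: ltW.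
  move=> t It; rewrite !xwP//; apply: le_trans (Xop_lipT (Lw _) (Lw _) It) _.
  apply: le_trans (ler_wpM2l M0 (ltW hn)) _.
  by rewrite mulrCA ler_piMr ?(ltW e0)// ler_pdivrMr// mul1r lerDl.
have K1 : 0 < 2 * (K + 1) by rewrite mulr_gt0// ltr_wpDl.
pose eta := e / (2 * (K + 1)); have eta0 : 0 < eta by rewrite divr_gt0.
(* A point of [A] used at y' is at distance less than 2 dA y' <= 2 d(y,y') from y', hence less than
   r from y when d(y,y') < r/3. The bound K (eta + dA y') is then at most 2 K eta <= e. *)
have [r r0 rP] := f_cont Ay eta0.
exists (Num.min (r / 3) eta); first by rewrite lt_min eta0 divr_gt0.
move=> y' yy'; rewrite (gA y Ay); move: yy'; rewrite lt_min => /andP[yr yeta].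
have ele : eta <= e.
  by rewrite ler_pdivrMr// ler_peMr ?(ltW e0)// mulrDr mulr1; apply: le_trans (_ : 2 <= _);
    rewrite ?ler1n// lerDr mulr_ge0.
have [Ay'|nA'] := pselect (A y').
  rewrite (gA y' Ay'); apply: le_trans ele; apply: rP => //; apply: lt_le_trans yr _.
  by rewrite ler_pdivrMr// ler_peMr ?(ltW r0)// ler1n.
rewrite (gZ y' nA'); apply: off; first exact: ltW.
move=> t It; rewrite xwP//; have dAy : dA y' <= dY y y' by rewrite dYC; exact: dA_le_A.
apply: le_trans (wP (exist _ y' nA') (f y) eta (ltW eta0) _ t It) _ => /=.
  move=> x Ax xy; apply: rP => //; apply: (extension_arith3 (dY_tri y y' x) xy dAy yr).
exact: extension_arith2 K0 (ltW e0) (le_trans dAy (ltW yeta)).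
Qed.

End metric_extension.

End extension.

Section interval_compactness.
Context {R : realType}.

Lemma within_itv_cvg (V : normedModType R) (c : R -> V) (a b : R) :
  (forall t e, a <= t <= b -> 0 < e -> exists2 r, 0 < r &
     forall t', a <= t' <= b -> `|t' - t| < r -> `|c t' - c t| <= e) ->
  {within `[a, b], continuous c}.
Proof.
move=> cc; apply/subspace_continuousP => t; rewrite /= in_itv/= => It.
apply/cvgrPdist_le => e e0; have [r r0 rP] := cc t e It e0.
rewrite near_withinE; exists r => //= t'; rewrite /= => tt'; rewrite in_itv/= => It'.
by rewrite distrC; apply: rP => //; rewrite distrC.
Qed.

(* Apply the extreme value theorem to [max (be, e - al)], which is positive. *)
Lemma separation (a b e : R) (al be : R -> R) : a <= b -> 0 < e ->
  {within `[a, b], continuous al} -> {within `[a, b], continuous be} ->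
  (forall t, 0 <= be t) -> (forall t, a <= t <= b -> be t = 0 -> al t = 0) ->
  exists2 r, 0 < r & forall t, a <= t <= b -> be t < r -> al t < e.
Proof.
move=> ab e0 ca cb b0 ba.
pose f t := Num.max (be t) (e - al t).
have cf : {within `[a, b], continuous f}.
  have -> : f = (fun t => (be t + (e - al t) + `|be t - (e - al t)|) / 2).
    by apply/funext => t; rewrite /f maxr_absE.
  move=> t; have ce : {for t, continuous (fun t : subspace `[a, b] => e - al t)}.
    by apply: cvgB; [exact: cvg_cst|exact: ca].
  apply: cvgM; last exact: cvg_cst.
  apply: cvgD; first by apply: cvgD; [exact: cb|exact: ce].
  by apply: cvg_norm; apply: cvgB; [exact: cb|exact: ce].
have [c Ic cP] := EVT_min ab cf; exists (f c).
  have := Ic; rewrite in_itv/= => Ic'; rewrite /f lt_max.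
  have := b0 c; rewrite le_eqVlt => /orP[/eqP E|->//].
  by rewrite (ba c Ic' (esym E)) subr0 e0 orbT.
move=> t It bt; have := cP t; rewrite in_itv/= => /(_ It) ft.
have : f c <= e - al t.
  by move: ft; rewrite {2}/f le_max => /orP[/(lt_le_trans bt)|//]; rewrite ltxx.
have : 0 < f c.
  have := Ic; rewrite in_itv/= => Ic'; rewrite /f lt_max.
  have := b0 c; rewrite le_eqVlt => /orP[/eqP E|->//].
  by rewrite (ba c Ic' (esym E)) subr0 e0 orbT.
by move=> f0 fa; rewrite -subr_gt0; exact: lt_le_trans f0 fa.
Qed.

End interval_compactness.

(** * Arcs from paths *)

Section open_set_ends.
Context {R : realType}.
Implicit Types (U : set R) (a c s : R).

Lemma left_end U a c : open U -> ~ U a -> a <= c ->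
  exists l, [/\ a <= l, l <= c, ~ U l & forall s, l < s <= c -> U s].
Proof.
move=> oU nUa ac; pose A := [set s | a <= s <= c /\ ~ U s].
have hA : has_sup A by split; [exists a; split => //; rewrite lexx|exists c => s [/andP[]]].
have ub s : A s -> s <= sup A by exact: sup_upper_bound.
have al : a <= sup A by apply: ub; split => //; rewrite lexx.
have lc : sup A <= c by apply: sup_le_ub; [by case: hA|move=> s [/andP[]]].
exists (sup A); split => //.
- move=> Us; have /nbhs_ballP[r /= r0 rU] := open_nbhs_nbhs (conj oU Us).
  have [s As] := sup_adherent r0 hA; move=> sr; case: (As) => _; apply; apply: rU.
  by rewrite /ball /= ger0_norm ?subr_ge0 ?ub//; move: sr; lra.
- move=> s /andP[ls sc]; apply: contrapT => nUs.
  have : A s by split => //; rewrite sc (le_trans al (ltW ls)).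
  by move=> /ub; rewrite leNgt ls.
Qed.

Lemma right_end U b c : open U -> ~ U b -> c <= b ->
  exists r, [/\ c <= r, r <= b, ~ U r & forall s, c <= s < r -> U s].
Proof.
move=> oU nUb cb; pose V := [set s | U (- s)].
have oV : open V by apply: (@open_comp _ _ (fun s : R => - s) U) => // s _; exact:
  opp_continuous.
have [||l [h1 h2 h3 h4]] := @left_end V (- b) (- c) oV.
- by rewrite /V /= opprK.
- by rewrite lerN2.
exists (- l); split.
- by rewrite lerNr.
- by rewrite lerNl.
- exact: h3.
move=> s /andP[cs sl]; have := h4 (- s); rewrite /V /= opprK; apply.
by rewrite ltrNr sl lerN2.
Qed.

End open_set_ends.

Section loop_removal.
Context {R : realType} {V : normedModType R}.
Variable gam : R -> V.
Hypothesis gam_cont : forall t e, 0 < e ->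
  exists2 r, 0 < r & forall t', `|t' - t| < r -> `|gam t' - gam t| <= e.

(* The open set of parameters to be skipped: [gam] closes up over each gap. *)
Definition skippable (U : set R) : Prop := [/\ open U, U `<=` [set t | 0 < t < 1] &
  forall a b, 0 <= a -> a < b -> b <= 1 -> ~ U a -> ~ U b ->
    (forall s, a < s < b -> U s) -> gam a = gam b].

(** A gap ]a,b[ of the union need not be a gap of a member, but by compactness one member contains
    [a + del, b - del]. The ends of its gap around this interval are close to a and b, and [gam]
    takes the same value at both. *)
Lemma skippable_chain (FF : set (set R)) : FF `<=` skippable -> total_on FF subset ->
  skippable (\bigcup_(X in FF) X).
Proof.
move=> Fs Ft; split.
- by apply: bigcup_open => X /Fs[].
- by move=> t [X /Fs[_ h _]] /h.
move=> a b a0 ab b1 nUa nUb h; apply/eqP; rewrite -subr_eq0 -normr_le0.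
apply/ler_addgt0Pr => e e0; rewrite add0r.
have e2 : 0 < e / 2 by rewrite divr_gt0.
have [r1 r10 h1] := gam_cont a e2; have [r2 r20 h2] := gam_cont b e2.
pose del := Num.min (Num.min r1 r2) ((b - a) / 2) / 2.
have ba : 0 < b - a by rewrite subr_gt0.
have m0 : 0 < Num.min (Num.min r1 r2) ((b - a) / 2) by rewrite !lt_min r10 r20 divr_gt0.
have [le1 le2 le3] : [/\ Num.min (Num.min r1 r2) ((b - a) / 2) <= r1,
    Num.min (Num.min r1 r2) ((b - a) / 2) <= r2 & Num.min (Num.min r1 r2) ((b - a) / 2) <= (b -
      a) / 2].
  by rewrite !ge_min !lexx !orbT.
have [d0 d1 d2 d3] : [/\ 0 < del, del < r1, del < r2 & a + del <= b - del].
  by rewrite /del; move: m0 le1 le2 le3; set m := Num.min _ _; split; lra.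
have [X FX XP] : exists2 X, FF X & `[a + del, b - del]%classic `<=` X.
  have inU s : a + del <= s <= b - del -> exists2 X, FF X & X s.
    by move=> /andP[s1 s2]; apply: h; apply/andP; split; lra.
  (* The filter of all sufficiently large members of the chain; the compactness argument is run
     along it. *)
  pose G := [set Q : set (set R) | exists2 X, FF X & forall X', FF X' -> X `<=` X' -> Q X'].
  have [X0 FX0 _] : exists2 X, FF X & X (a + del) by apply: inU; rewrite lexx.
  have FG : Filter G.
    split; first by exists X0.
    - move=> P Q [X FX PX] [X' FX' QX'].
      have [s|s] := Ft _ _ FX FX'.
        exists X' => // W FW XW; split; first by apply: PX => //; exact: subset_trans s XW.
        exact: QX'.
      exists X => // W FW XW; split; first exact: PX.
      by apply: QX' => //; exact: subset_trans s XW.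
    - by move=> P Q PQ [X FX PX]; exists X => // W FW XW; apply: PQ; exact: PX.
  have /compact_near_coveringP := @segment_compact R (a + del) (b - del).
  move=> /(_ _ G (fun (X : set R) s => X s) FG) cov.
  have [|X FX XP] := cov; last by exists X => //; exact: XP.
  move=> s; rewrite /= in_itv/= => /inU[X FX Xs].
  have [oX _ _] := Fs X FX; exists (X, [set X' | X `<=` X']) => /=; last first.
    by move=> [s' X'] /= [Xs' XX']; exact: XX'.
  by split; [exact: open_nbhs_nbhs (conj oX Xs)|exists X].
have [[/= c1 _] [c2 _]] : (X (a + del) /\ True) /\ (X (b - del) /\ True).
  by split; split => //; apply: XP; rewrite /= in_itv/= ?d3 ?lexx ?andbT//.
have [oX _ gX] := Fs X FX.
have nXa : ~ X a by move=> Xa; apply: nUa; exists X.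
have nXb : ~ X b by move=> Xb; apply: nUb; exists X.
have [|l [l1 l2 l3 l4]] := @left_end _ X a (a + del) oX nXa; first by rewrite lerDl ltW.
have [|r [q1 q2 q3 q4]] := @right_end _ X b (b - del) oX nXb; first by rewrite gerBl ltW.
have lne : l != a + del by apply/eqP => E; rewrite E in l3.
have rne : r != b - del by apply/eqP => E; rewrite E in q3.
have lt1 : l < a + del by rewrite lt_neqAle lne.
have lt2 : b - del < r by rewrite lt_neqAle eq_sym rne.
have lr : l < r by apply: lt_trans lt1 _; exact: le_lt_trans d3 lt2.
have E : gam l = gam r.
  apply: gX => //; [exact: le_trans l1|exact: le_trans b1|].
  move=> s /andP[ls sr]; have [h5|h5] := leP s (a + del); first by apply: l4; rewrite ls.
  have [h6|h6] := leP s (b - del); last by apply: q4; rewrite (ltW h6).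
  by apply: XP; rewrite /= in_itv/= (ltW h5).
have la : `|l - a| < r1.
  by rewrite ger0_norm ?subr_ge0// ltrBlDl; apply: lt_trans lt1 _; rewrite ltrD2l.
have rb : `|r - b| < r2.
  by rewrite distrC ger0_norm ?subr_ge0//; move: lt2 d2; lra.
have := h1 l la; rewrite distrC => k1; have := h2 r rb; rewrite -E => k2.
by apply: le_trans (dist_tri k1 k2) _; rewrite -splitr.
Qed.

(** For a maximal skippable set U, the new path keeps throughout each gap the value at its left end.
    By maximality any two points outside U with equal images bound a gap, so a value once left is
    never taken again. *)
Lemma loop_removal : exists c : R -> V, [/\ c 0 = gam 0, c 1 = gam 1,
  forall t, 0 <= t <= 1 -> exists2 s, 0 <= s <= 1 & c t = gam s,
  {within `[0, 1], continuous c} &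
  forall s r t, 0 <= s -> s <= r -> r <= t -> t <= 1 -> c s = c t -> c r = c s].
Proof.
have [U [[oU U01 Ugap] Umax]] := Zorn_bigcup skippable_chain.
have nU0 : ~ U 0 by move=> /U01 /=; rewrite ltxx.
have nU1 : ~ U 1 by move=> /U01 /=; rewrite ltxx andbF.
have Umax' a b : 0 <= a -> a < b -> b <= 1 -> ~ U a -> ~ U b -> gam a = gam b ->
    forall s, a < s < b -> U s.
  move=> a0 ab b1 nUa nUb gab s sab; apply: contrapT => nUs.
  (* Adding ]a,b[ keeps the set skippable: a gap of W is one of U, or it consists of ]a,b[ with gaps
     of U on either side, and gam a = gam b links their end values. *)
  pose W := U `|` [set t | a < t < b].
  apply: (Umax W); first by split; [exact: subsetUl|move=> WU; apply: nUs; apply: WU; right].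
  split.
  - apply: openU => //; rewrite (_ : [set _ | _] = `]a, b[%classic); first exact: itv_open.
    by apply/seteqP; split => t /=; rewrite in_itv.
  - move=> t [/U01//|/= /andP[h1 h2]]; apply/andP; split; first exact: le_lt_trans h1.
    exact: lt_le_trans b1.
  move=> c e c0 ce e1 nWc nWe hW.
  have nUc : ~ U c by move=> Uc; apply: nWc; left.
  have nUe : ~ U e by move=> Ue; apply: nWe; left.
  have [cb|bc] := ltP c b; last first.
    apply: Ugap => // t /andP[h1 h2]; have [//|/= /andP[_ h3]] := hW t (introT andP (conj h1
      h2)).
    by have := lt_le_trans h3 (le_trans bc (ltW h1)); rewrite ltxx.
  have [ae|ea] := ltP a e; last first.
    apply: Ugap => // t /andP[h1 h2]; have [//|/= /andP[h3 _]] := hW t (introT andP (conj h1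
      h2)).
    by have := lt_trans h3 (lt_le_trans h2 ea); rewrite ltxx.
  have ca : c <= a by rewrite leNgt; apply/negP => ac; apply: nWc; right; apply/andP.
  have be : b <= e by rewrite leNgt; apply/negP => eb; apply: nWe; right; apply/andP.
  have gca : gam c = gam a.
    move: ca; rewrite le_eqVlt => /orP[/eqP -> //|ca].
    apply: Ugap => //; first exact: le_trans (ltW ab) b1.
    move=> t /andP[h1 h2]; have [|//|/= /andP[h3 _]] := hW t.
      by rewrite h1 (lt_trans h2 ae).
    by have := lt_trans h2 h3; rewrite ltxx.
  have gbe : gam b = gam e.
    move: be; rewrite le_eqVlt => /orP[/eqP -> //|be].
    apply: Ugap => //; first exact: le_trans a0 (ltW ab).
    move=> t /andP[h1 h2]; have [|//|/= /andP[_ h3]] := hW t.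
      by rewrite h2 (lt_trans cb h1).
    by have := lt_trans h1 h3; rewrite ltxx.
  by rewrite gca gab.
have /boolp.choice[lam lamP] : forall t, exists l, 0 <= t -> [/\ 0 <= l, l <= t, ~ U l & forall
  s, l < s <= t -> U s].
  move=> t; have [t0|//] := pselect (0 <= t); last by exists 0.
  by have [l h] := left_end oU nU0 t0; exists l.
have lam_mono s t : 0 <= s -> s <= t -> lam s <= lam t.
  move=> s0 st; have [h1 h2 h3 _] := lamP s s0; have [_ _ _ h4] := lamP t (le_trans s0 st).
  by rewrite leNgt; apply/negP => lt; apply: h3; apply: h4; rewrite lt (le_trans h2).
have lam_id t : 0 <= t -> ~ U t -> lam t = t.
  move=> t0 nUt; have [_ h2 _ h4] := lamP t t0; apply/eqP; rewrite eq_le h2/= leNgt.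
  by apply/negP => lt; apply: nUt; apply: h4; rewrite lt lexx.
(* The source of continuity: from t to t' the new path either returns to its value or ends at values
   that [gam] takes on [t,t'], as a gap may equally be represented by its right end. *)
have osc t t' : 0 <= t -> t <= t' -> t' <= 1 -> gam (lam t) = gam (lam t') \/
    exists s s', [/\ t <= s <= t', t <= s' <= t', gam (lam t) = gam s & gam (lam t') = gam s'].
  move=> t0 tt' t'1; have t'0 := le_trans t0 tt'.
  have [a1 a2 a3 a4] := lamP t t0; have [b1 b2 b3 b4] := lamP t' t'0.
  have [lt|ge] := ltP (lam t') t.
    left; congr gam; apply/eqP; rewrite eq_le lam_mono//= leNgt; apply/negP => lt2.
    by apply: b3; apply: a4; rewrite lt2 ltW.
  have [r [r1 r2 r3 r4]] := right_end oU nU1 (le_trans tt' t'1).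
  have rl : r <= lam t' by rewrite leNgt; apply/negP => lt; apply: b3; apply: r4; rewrite ge.
  right; exists r, (lam t'); split => //; first by rewrite r1 (le_trans rl b2).
    by rewrite ge.
  have [E|ne] := eqVneq (lam t) r; first by rewrite E.
  have ltr' : lam t < r by rewrite lt_neqAle ne (le_trans a2 r1).
  apply: Ugap => // s /andP[s1 s2]; have [st|ts] := leP s t; first by apply: a4; rewrite s1.
  by apply: r4; rewrite (ltW ts).
exists (gam \o lam); split => /=.
- by rewrite lam_id.
- by rewrite lam_id.
- move=> t /andP[t0 t1]; have [h1 h2 _ _] := lamP t t0; exists (lam t) => //.
  by rewrite h1 (le_trans h2 t1).
- apply: within_itv_cvg => t e /andP[t0 t1] e0; have e2 : 0 < e / 2 by rewrite divr_gt0.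
  have [r r0 rP] := gam_cont t e2; exists r => // t' /andP[t'0 t'1] tr.
  have close s : Num.min t t' <= s <= Num.max t t' -> `|gam s - gam t| <= e / 2.
    move=> h; apply: rP; apply: le_lt_trans tr.
    move: h; case: (leP t t') => h /andP[h1 h2].
      by rewrite !ger0_norm ?subr_ge0// lerD2r.
    by rewrite ler_norml ltr0_norm ?subr_lt0// opprK; apply/andP; split; lra.
  have tri x y : Num.min t t' <= x <= Num.max t t' -> Num.min t t' <= y <= Num.max t t' ->
      `|gam x - gam y| <= e.
    move=> /close h1 /close; rewrite distrC => h2.
    by apply: le_trans (dist_tri h1 h2) _; rewrite -splitr.
  change (`|gam (lam t') - gam (lam t)| <= e).
  have [tt'|/ltW t't] := leP t t'.
    have [->|[s [s' [h1 h2 -> ->]]]] := osc t t' t0 tt' t'1; first by rewrite subrr normr0 ltW.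
    by apply: tri; rewrite (min_l tt') (max_r tt').
  have [->|[s [s' [h1 h2 -> ->]]]] := osc t' t t'0 t't t1; first by rewrite subrr normr0 ltW.
  by apply: tri; rewrite (min_r t't) (max_l t't).
move=> s r t s0 sr rt t1 E; have r0 := le_trans s0 sr; have t0 := le_trans r0 rt.
have m1 := lam_mono s r s0 sr; have m2 := lam_mono r t r0 rt.
have [a1 a2 a3 a4] := lamP s s0; have [b1 b2 b3 b4] := lamP r r0; have [c1 c2 c3 c4] := lamP t
  t0.
have [E1|n1] := eqVneq (lam s) (lam r); first by rewrite E1.
have [E2|n2] := eqVneq (lam r) (lam t); first by rewrite E2.
(* Equal values at s and t make ]lam s, lam t[ part of U, but [lam r] lies there and outside U. *)
exfalso; apply: b3; apply: (Umax' (lam s) (lam t)) => //.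
- by apply: lt_le_trans m2; rewrite lt_neqAle n1.
- exact: le_trans c2 t1.
- by rewrite !lt_neqAle n1 n2 m1.
Qed.

End loop_removal.

Lemma geometric_series_sum (R : realType) (a : nat -> R) : (forall n, 0 <= a n <= 1) ->
  exists s, forall m, \sum_(n < m) a n / 2 ^+ n <= s <= \sum_(n < m) a n / 2 ^+ n + 2 / 2 ^+ m.
Proof.
move=> a01; pose S m := \sum_(n < m) a n / 2 ^+ n.
have pow0 n : 0 <= (2 ^+ n)^-1 :> R by rewrite invr_ge0 exprn_ge0.
have up m k : S (m + k)%N <= S m + 2 / 2 ^+ m.
  rewrite /S big_split_ord/= lerD2l; apply: (@le_trans _ _ (\sum_(n < k) 1 / 2 ^+ (m + n))).
    by apply: ler_sum => n _; apply: ler_wpM2r => //; have /andP[] := a01 (m + n)%N.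
  by have := @geometric_sum_le R 1 m k ler01; rewrite mulr1.
have mono m k : S m <= S (m + k)%N.
  rewrite /S big_split_ord/= lerDl; apply: sumr_ge0 => n _; apply: mulr_ge0 => //.
  by have /andP[] := a01 (m + n)%N.
have ub n m : S n <= S m + 2 / 2 ^+ m.
  have [nm|/ltnW mn] := leqP n m; last by rewrite -(subnKC mn).
  apply: (@le_trans _ _ (S m)); first by rewrite -(subnKC nm).
  by rewrite lerDl divr_ge0// exprn_ge0.
have hS : has_sup (range S).
  by split; [exists (S 0%N), 0%N|exists (S 0%N + 2 / 2 ^+ 0) => _ [n _ <-]].
exists (sup (range S)) => m; apply/andP; split; first by apply: sup_upper_bound => //; exists m.
by apply: sup_le_ub; [exists (S 0%N), 0%N|move=> _ [n _ <-]; exact: ub].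
Qed.

(** * Reparametrization of a path whose fibres are intervals *)

Section reparametrization.
Context {R : realType} {V : normedModType R}.
Variable c : R -> V.
Hypothesis cc : {within `[0, 1], continuous c}.
Hypothesis cmono : forall s r t, 0 <= s -> s <= r -> r <= t -> t <= 1 -> c s = c t -> c r = c s.

Let cdist v : {within `[0, 1], continuous (fun t => `|c t - v|)}.
Proof. by move=> t; apply: cvg_norm; apply: cvgB; [exact: cc|exact: cvg_cst]. Qed.

Let cnear t e : 0 <= t <= 1 -> 0 < e -> exists2 r, 0 < r &
  forall t', 0 <= t' <= 1 -> `|t' - t| < r -> `|c t' - c t| <= e.
Proof.
move=> It e0; have cid : {within `[0, 1], continuous (fun t' : R => `|t' - t|)}.
  apply: continuous_subspaceT => x; apply: cvg_norm; apply: cvgB; [exact: cvg_id|exact: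
    cvg_cst].
have [||r r0 rP] := separation ler01 e0 (@cdist (c t)) cid.
- by move=> x.
- by move=> x _ /eqP; rewrite normr_eq0 subr_eq0 => /eqP ->; rewrite subrr normr0.
by exists r => // t' It' h; apply: ltW; exact: rP.
Qed.

Let bump n (v : V) : R :=
  let x := odflt (0, 0%N) (unpickle n : option (rat * nat)) in
  Num.max 0 (x.2.+1%:R^-1 - `|v - c (ratr x.1)|).

Let bump01 n v : 0 <= bump n v <= 1.
Proof.
rewrite /bump; set x := odflt _ _; rewrite le_max lexx/= ge_max ler01/=.
by apply: (@le_trans _ _ x.2.+1%:R^-1); [rewrite gerBl|rewrite invf_le1// ler1n].
Qed.

Let bump_lip n v w : bump n v <= bump n w + `|v - w|.
Proof.
rewrite /bump; set x := odflt _ _; rewrite ge_max; apply/andP; split.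
  by rewrite addr_ge0// le_max lexx.
rewrite -lerBlDr le_max; apply/orP; right.
have := ler_normD (w - v) (v - c (ratr x.1)); rewrite addrA subrK (distrC w v).
by move: (x.2.+1%:R^-1) `|v - c _| `|v - w| `|w - _| => a1 a2 a3 a4; lra.
Qed.

Let rmax n t : R := sup [set bump n (c s) | s in [set s | 0 <= s <= t]].

Let rmax_ub n t s : 0 <= s <= t -> bump n (c s) <= rmax n t.
Proof.
move=> st; apply: ub_le_sup; last by exists s.
by exists 1 => _ [r _ <-]; have /andP[] := bump01 n (c r).
Qed.

Let rmax_lub n t x : 0 <= t -> (forall s, 0 <= s <= t -> bump n (c s) <= x) -> rmax n t <= x.
Proof.
move=> t0 h; apply: sup_le_ub; first by exists (bump n (c 0)), 0 => //=; rewrite lexx.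
by move=> _ [s st <-]; exact: h.
Qed.

Let rmax01 n t : 0 <= t -> 0 <= rmax n t <= 1.
Proof.
move=> t0; apply/andP; split.
  have := @rmax_ub n t 0; rewrite lexx t0 => /(_ isT); apply: le_trans.
  by have /andP[] := bump01 n (c 0).
by apply: rmax_lub => // s _; have /andP[] := bump01 n (c s).
Qed.

Let rmax_mono n s t : 0 <= s -> s <= t -> rmax n s <= rmax n t.
Proof.
move=> s0 st; apply: rmax_lub => // r /andP[r0 rs]; apply: rmax_ub.
by rewrite r0 (le_trans rs).
Qed.

Let rmax_incr n s t e : 0 <= s -> s <= t -> 0 <= e ->
  (forall r, s <= r <= t -> `|c r - c s| <= e) -> rmax n t <= rmax n s + e.
Proof.
move=> s0 st e0 h; apply: rmax_lub; first exact: le_trans st.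
move=> r /andP[r0 rt]; have [rs|sr] := leP r s.
  by apply: (@le_trans _ _ (rmax n s)); [apply: rmax_ub; rewrite r0|rewrite lerDl].
apply: le_trans (bump_lip n _ (c s)) _; apply: lerD; first by apply: rmax_ub; rewrite s0 lexx.
by apply: h; rewrite (ltW sr).
Qed.

(* The sum of 2^-n times the running maxima of bump functions centred at rational points of the
   path. *)
Lemma level_function : exists phi : R -> R, [/\ {within `[0, 1], continuous phi},
  forall s t, 0 <= s -> s <= t -> t <= 1 -> phi s <= phi t,
  forall s t, 0 <= s -> s <= t -> t <= 1 -> c s = c t -> phi s = phi t &
  forall s t, 0 <= s -> s <= t -> t <= 1 -> c s <> c t -> phi s < phi t].
Proof.
have /boolp.choice[phi phiP] : forall t, exists x, 0 <= t -> forall m,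
    \sum_(n < m) rmax n t / 2 ^+ n <= x <= \sum_(n < m) rmax n t / 2 ^+ n + 2 / 2 ^+ m.
  move=> t; have [t0|//] := pselect (0 <= t); last by exists 0.
  by have [x xP] := geometric_series_sum (fun n => rmax01 n t0); exists x.
have pow0 n : 0 < (2 ^+ n)^-1 :> R by rewrite invr_gt0 exprn_gt0.
have small (x y : R) : (forall m : nat, x <= y + 2 / 2 ^+ m) -> x <= y.
  move=> h; apply/ler_addgt0Pr => e e0.
  have [m _ /(_ m (leqnn m)) lt] := cvgr_lt _ (@cvg_geometric_half R 2) _ e0.
  by apply: le_trans (h m) _; rewrite lerD2l; exact: ltW.
have incr s t e : 0 <= s -> 0 <= t -> 0 <= e -> (forall n, rmax n s <= rmax n t + e) -> phi s
  <= phi t + 2 * e.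
  move=> s0 t0 e0 h; apply: small => m.
  have /andP[_ h1] := phiP s s0 m; have /andP[h2 _] := phiP t t0 m.
  apply: le_trans h1 _; rewrite lerD2r; apply: le_trans (lerD h2 (lexx _)).
  apply: (@le_trans _ _ (\sum_(n < m) (rmax n t / 2 ^+ n + e / 2 ^+ n))).
    by apply: ler_sum => n _; rewrite -mulrDl; apply: ler_wpM2r; [exact: ltW|exact: h].
  rewrite big_split/= lerD2l; have := @geometric_sum_le R e 0 m e0.
  by rewrite expr0 divr1; apply: le_trans; rewrite le_eqVlt; apply/orP; left; apply/eqP; apply:
    eq_bigr => n _; rewrite add0n.
have mono s t : 0 <= s -> s <= t -> t <= 1 -> phi s <= phi t.
  move=> s0 st t1; have := incr s t 0 s0 (le_trans s0 st) (lexx 0).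
  by rewrite mulr0 addr0; apply => n; rewrite addr0 rmax_mono.
exists phi; split => //.
- apply: within_itv_cvg => t e It e0; have e4 : 0 < e / 4 by rewrite divr_gt0.
  have [r r0 rP] := cnear It e4; exists r => // t' It' tr.
  have /andP[t0 t1] := It; have /andP[t'0 t'1] := It'.
  have e2 : 0 <= e / 2 by rewrite ltW// divr_gt0.
  have osc x y : 0 <= x -> x <= y -> y <= 1 -> (forall s, x <= s <= y -> `|s - t| < r) -> phi y
    <= phi x + e.
    move=> x0 xy y1 h; have -> : e = 2 * (e / 2) by field.
    apply: incr => // [|n]; first exact: le_trans xy.
    have xin : 0 <= x <= 1 by rewrite x0 (le_trans xy y1).
    apply: rmax_incr => // s sxy; have /andP[xs sy] := sxy.
    have sin : 0 <= s <= 1 by rewrite (le_trans x0 xs) (le_trans sy y1).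
    have k1 := rP s sin (h s sxy); have := rP x xin (h x _); rewrite lexx xy => /(_ isT).
    rewrite distrC => k2; apply: le_trans (dist_tri k1 k2) _.
    by rewrite le_eqVlt; apply/orP; left; apply/eqP; field.
  have [tt'|/ltW t't] := leP t t'.
    rewrite ger0_norm ?subr_ge0 ?mono// lerBlDl; apply: osc => // s /andP[s1 s2].
    rewrite ger0_norm ?subr_ge0//; apply: le_lt_trans tr; rewrite ger0_norm ?subr_ge0//.
    by rewrite lerD2r.
  rewrite distrC ger0_norm ?subr_ge0 ?mono// lerBlDl; apply: osc => // s /andP[s1 s2].
  rewrite distrC ger0_norm ?subr_ge0//; apply: le_lt_trans tr; rewrite distrC ger0_norm
    ?subr_ge0//.
  by rewrite lerD2l lerN2.
- move=> s t s0 st t1 E; apply/eqP; rewrite eq_le mono//=.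
  have := incr t s 0 (le_trans s0 st) s0 (lexx 0); rewrite mulr0 addr0; apply => n.
  apply: rmax_incr => // r /andP[sr rt]; rewrite (cmono s0 sr rt t1 E) subrr normr0//.
move=> s t s0 st t1 ne; have t0 := le_trans s0 st.
have s1 := le_trans st t1.
have cs : {within `[0, s], continuous (fun r => `|c r - c t|)}.
  by apply: (continuous_subspaceW _ (@cdist (c t))); apply: subset_itvl; rewrite bnd_simp.
(* The point [c t] has positive distance to the path up to s: a common value would, by [cmono], be
   taken at s as well. *)
have [r0 Ir0 r0P] := EVT_min s0 cs; set del := `|c r0 - c t| in r0P.
have del0 : 0 < del.
  rewrite /del normr_gt0 subr_eq0; apply/eqP => E.
  move: Ir0; rewrite in_itv/= => /andP[r00 r0s].
  by apply: ne; rewrite (cmono r00 r0s st t1 E).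
have d2 : 0 < del / 2 by rewrite divr_gt0.
(* A bump of radius 1/(m+1) < del/2, centred within half that radius of [c t], vanishes on the path
   up to s and is at least half the radius at t; so its running maximum grows from s to t. *)
have [m _ /(_ m (leqnn m)) /= mP] := near_infty_natSinv_lt (PosNum d2).
have m0 : 0 < m.+1%:R^-1 / 2 :> R by rewrite divr_gt0// invr_gt0.
have It : 0 <= t <= 1 by rewrite t0.
have [r rpos rP] := cnear It m0.
have [q /andP[q1 q2]] : exists q : rat, Num.max 0 (t - r) < ratr q < Num.min 1 (t + r).
  have lt : Num.max 0 (t - r) < Num.min 1 (t + r).
    rewrite gt_max !lt_min ltr01 /=; apply/andP; split.
      by rewrite (le_lt_trans t0)// ltrDl.
    by apply/andP; split; move: rpos t1; lra.
  by have [q] := rat_in_itvoo lt; rewrite in_itv/= => h; exists q.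
have hq : 0 <= (ratr q : R) <= 1 /\ `|ratr q - t| < r.
  move: q1 q2; rewrite gt_max lt_min => /andP[a1 a2] /andP[b1 b2].
  by rewrite (ltW a1) (ltW b1); split => //; rewrite ltr_norml; apply/andP; split; move: a2 b2;
    lra.
have cq := rP _ hq.1 hq.2.
pose n : nat := pickle (q, m).
have bE v : bump n v = Num.max 0 (m.+1%:R^-1 - `|v - c (ratr q)|) by rewrite /bump /n pickleK.
have b0 x : 0 <= x <= s -> bump n (c x) <= 0.
  move=> xs; rewrite bE ge_max lexx/= subr_le0.
  have xs' : x \in `[0, s] by rewrite in_itv/=.
  have h1 := r0P x xs'; have := ler_normD (c x - c (ratr q)) (c (ratr q) - c t).
  rewrite addrA subrK => h2; move: mP m0 cq h1 h2.
  move: (m.+1%:R^-1) `|_ - c (ratr q)| `|c (ratr q) - _| `|c x - c t| (del) => a1 a2 a3 a4 a5;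
    lra.
have bt : m.+1%:R^-1 / 2 <= bump n (c t).
  rewrite bE le_max; apply/orP; right; move: cq; rewrite distrC.
  by move: (m.+1%:R^-1) `|_| => a1 a2; lra.
have jump : rmax n s + m.+1%:R^-1 / 2 <= rmax n t.
  have h1 : rmax n s <= 0 by exact: rmax_lub.
  have h2 : bump n (c t) <= rmax n t by apply: rmax_ub; rewrite t0 lexx.
  by move: h1 h2 bt; move: (rmax n s) (rmax n t) (bump n _) (m.+1%:R^-1) => a1 a2 a3 a4; lra.
have gain : phi s + m.+1%:R^-1 / 2 / 2 ^+ n <= phi t.
  apply: small => l; pose L := (n.+1 + l)%N.
  have /andP[_ h1] := phiP s s0 L; have /andP[h2 _] := phiP t t0 L.
  have nL : (n < L)%N by rewrite /L addSn ltnS leq_addr.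
  have h3 : \sum_(i < L) rmax i s / 2 ^+ i + m.+1%:R^-1 / 2 / 2 ^+ n <= \sum_(i < L) rmax i t /
    2 ^+ i.
    rewrite (bigD1 (Ordinal nL))//= [leRHS](bigD1 (Ordinal nL))//= addrAC -mulrDl.
    apply: lerD; first by apply: ler_wpM2r; [exact: ltW|exact: jump].
    by apply: ler_sum => i _; apply: ler_wpM2r; [exact: ltW|exact: rmax_mono].
  have h4 : 2 / 2 ^+ L <= 2 / 2 ^+ l :> R.
    apply: ler_wpM2l => //; rewrite lef_pV2 ?posrE ?exprn_gt0//.
    by apply: ler_weXn2l; [rewrite ler1n|rewrite /L leq_addl].
  have h5 := le_trans h3 h2.
  move: h1 h4 h5; move: (\sum_(i < L) rmax i s / 2 ^+ i) (2 / 2 ^+ L) (2 / 2 ^+ l) (m.+1%:R^-1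
    / 2 / 2 ^+ n) (phi s) (phi t) => a1 a2 a3 a4 a5 a6; lra.
by apply: lt_le_trans gain; rewrite ltrDl mulr_gt0.
Qed.

(** [phi] and [c] have the same fibres, so [c \o psi] is independent of the choice of the preimages
    [psi u]. Applying [separation] to the two functions in either order gives continuity of the arc
    and of its inverse. *)
Lemma arc_of_monotone_path : c 0 <> c 1 -> exists g : R -> V,
  [/\ forall u, 0 <= u <= 1 -> exists2 t, 0 <= t <= 1 & g u = c t, g 0 = c 0, g 1 = c 1,
    forall u e, 0 <= u <= 1 -> 0 < e -> exists2 r, 0 < r &
      forall u', 0 <= u' <= 1 -> `|u' - u| < r -> `|g u' - g u| < e &
    forall u e, 0 <= u <= 1 -> 0 < e -> exists2 r, 0 < r &
      forall u', 0 <= u' <= 1 -> `|g u' - g u| < r -> `|u' - u| < e].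
Proof.
move=> c01; have [phi [cphi pmono peq plt]] := level_function.
pose w := phi 1 - phi 0; have w0 : 0 < w by rewrite subr_gt0; exact: plt.
have /boolp.choice[psi psiP] : forall u, exists t, 0 <= u <= 1 -> 0 <= t <= 1 /\ phi t = phi 0
  + u * w.
  move=> u; have [/andP[u0 u1]|//] := pselect (0 <= u <= 1); last by exists 0.
  have p01 : phi 0 <= phi 1 by exact: pmono.
  have [|t It tE] := @IVT R phi 0 1 (phi 0 + u * w) ler01 cphi.
    rewrite (min_l p01) (max_r p01) lerDl mulr_ge0 ?(ltW w0)//= -lerBrDl.
    by rewrite ler_piMl// ltW.
  by exists t => _; move: It; rewrite in_itv.
have same s t : 0 <= s <= 1 -> 0 <= t <= 1 -> phi s = phi t -> c s = c t.
  move=> /andP[s0 s1] /andP[t0 t1] E; apply: contrapT => ne.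
  have [st|/ltW ts] := leP s t; first by have := plt s t s0 st t1 ne; rewrite E ltxx.
  by have := plt t s t0 ts s1 (nesym ne); rewrite E ltxx.
have same' s t : 0 <= s <= 1 -> 0 <= t <= 1 -> c s = c t -> phi s = phi t.
  move=> /andP[s0 s1] /andP[t0 t1] E; have [st|/ltW ts] := leP s t; first exact: peq.
  by apply/esym; exact: peq.
have I0 : 0 <= (0 : R) <= 1 by rewrite lexx ler01.
have I1 : 0 <= (1 : R) <= 1 by rewrite lexx ler01.
have cpd v : {within `[0, 1], continuous (fun t => `|phi t - v|)}.
  by move=> t; apply: cvg_norm; apply: cvgB; [exact: cphi|exact: cvg_cst].
have pd u u' : 0 <= u <= 1 -> 0 <= u' <= 1 -> `|phi (psi u') - phi (psi u)| = `|u' - u| * w.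
  move=> Iu Iu'; rewrite (psiP u Iu).2 (psiP u' Iu').2 opprD addrACA subrr add0r -mulrBl normrM.
  by rewrite (gtr0_norm w0).
exists (c \o psi); split => /=.
- by move=> u Iu; have [h _] := psiP u Iu; exists (psi u).
- by apply: same; [exact: (psiP 0 I0).1|exact: I0|rewrite (psiP 0 I0).2 mul0r addr0].
- by apply: same; [exact: (psiP 1 I1).1|exact: I1|rewrite (psiP 1 I1).2 mul1r addrC subrK].
- move=> u e Iu e0; have Ip := (psiP u Iu).1.
  have [||r r0 rP] := separation ler01 e0 (@cdist (c (psi u))) (cpd (phi (psi u))).
  + by move=> t.
  + move=> t It /eqP; rewrite normr_eq0 subr_eq0 => /eqP/(same _ _ It Ip) ->.
    by rewrite subrr normr0.
  exists (r / w); first by rewrite divr_gt0.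
  move=> u' Iu' h; apply: rP; first exact: (psiP u' Iu').1.
  by rewrite pd// -ltr_pdivlMr.
- move=> u e Iu e0; have Ip := (psiP u Iu).1; have ew : 0 < e * w by rewrite mulr_gt0.
  have [||r r0 rP] := separation ler01 ew (cpd (phi (psi u))) (@cdist (c (psi u))).
  + by move=> t.
  + move=> t It /eqP; rewrite normr_eq0 subr_eq0 => /eqP/(same' _ _ It Ip) ->.
    by rewrite subrr normr0.
  exists r => // u' Iu' h; have := rP _ (psiP u' Iu').1 h.
  by rewrite pd// ltr_pM2r.
Qed.

End reparametrization.

(** * Kernels *)

Section hoelder_le.
Context d (S : measurableType d) (R : realType).
Variables (mu : {measure set S -> \bar R}) (D : set S) (p : R).
Hypotheses (mD : measurable D) (p1 : 1 <= p) (muT : (0 < mu [set: S])%E).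

Lemma hoelder_le (q : \bar R) (k : S -> R) : (1 < q)%E ->
  (p%:E^-1 + q^-1 = 1)%E -> measurable_fun D k ->
  ('N[mu]_q[EFin \o (k \_ D)] < +oo)%E ->
  forall u : S -> R, Lp mu D p u ->
  (\int[mu]_(t in D) (`|k t| * `|u t|)%:E <= (fine 'N[mu]_q[EFin \o (k \_ D)] * Lnrm mu D p
    u)%:E)%E.
Proof.
move=> q1 pq mk kq; have p0 : 0 < p by exact: lt_le_trans p1.
have mpatch (f : S -> R) : measurable_fun D f -> measurable_fun setT (f \_ D).
  by move=> mf; apply/(measurable_restrict _ mD measurableT); rewrite setTI.
have mpk := mpatch _ mk.
have mu_ (u : S -> R) : Lp mu D p u -> measurable_fun D (fun t => `|u t|).
  by move=> Lu; exact: smeas_norm Lu.1.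
have mku (u : S -> R) : Lp mu D p u -> measurable_fun D (fun t => `|k t| * `|u t|).
  move=> Lu; apply: measurable_funM; last exact: mu_.
  exact: measurableT_comp.
move=> u Lu.
have pE : p%:E^-1%E = p^-1%:E by rewrite inver gt_eqF.
case: q q1 pq kq => [r||//] q1 pq kq.
- have r0 : 0 < r by apply: lt_trans ltr01 _; rewrite -lte_fin.
  have pr : p^-1 + r^-1 = 1.
    by move: pq; rewrite pE inver gt_eqF// -EFinD => -[].
  have := hoelder mu (mpatch _ (mu_ _ Lu)) mpk p0 r0 pr.
  rewrite Lnorm1 Lnorm_norm_patchE// (nintE p1 Lu) poweR_EFin powRK ?Lnrm_ge0//.
  have -> : ((Lnrm mu D p u)%:E * 'N[mu]_r%:E[EFin \o (k \_ D)] =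
      (fine 'N[mu]_r%:E[EFin \o (k \_ D)] * Lnrm mu D p u)%:E)%E.
    by rewrite EFinM fineK 1?muleC// ge0_fin_numE// Lnorm_ge0.
  apply: le_trans; rewrite integral_mkcond.
  rewrite le_eqVlt; apply/orP; left; apply/eqP; apply: eq_integral => t _.
  rewrite /patch /=; case: ifP => _; last by rewrite mul0r normr0.
  by rewrite normrM normr_id mulrC.
(* q = +oo forces p = 1, and the norm of [k] is an essential supremum; [muT] selects this branch of
   its definition. *)
- have p_1 : p = 1.
    by move: pq; rewrite pE invey adde0 => -[/(congr1 GRing.inv)]; rewrite invrK invr1.
  rewrite unlock muT in kq *; set Q := ess_sup_inf.ess_sup _ _ in kq *.
  have Q0 : (0 <= Q)%E.
    by apply: ess_sup_inf.ess_sup_gee => //; apply: nearW => t /=; rewrite lee_fin.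
  have kQ : {ae mu, forall t, D t -> `|k t| <= fine Q}.
    have := @ess_sup_inf.ess_sup_ge _ _ R mu (abse \o (EFin \o (k \_ D))).
    apply: filterS => t /= + Dt; rewrite /patch mem_set//= -/Q.
    by rewrite -[X in (_ <= X)%E]fineK// ge0_fin_numE.
  have := nintE p1 Lu; rewrite p_1 powRr1 ?Lnrm_ge0// EFinM => <-.
  rewrite nint_integral; under [X in (_ <= _ * X)%E]eq_integral do rewrite powRr1//.
  rewrite -ge0_integralZl_EFin//; last 2 first.
  + by apply/measurable_EFinP; exact: mu_.
  + by rewrite fine_ge0.
  apply: ae_ge0_le_integral.
  + exact: mD.
  + by move=> t _; rewrite lee_fin mulr_ge0.
  + by apply/measurable_EFinP; exact: mku.
  + by move=> t _; rewrite mule_ge0 ?lee_fin ?fine_ge0.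
  + by apply: emeasurable_funM => //; apply/measurable_EFinP; exact: mu_.
  + by apply: filterS kQ => t kt Dt; rewrite -EFinM lee_fin ler_wpM2r// kt.
Qed.


End hoelder_le.

Section Lebesgue_classes.
Context {R : realType}.
Local Notation LT := (caratheodory_type (wlength (@idfun R))^*%mu).
Local Notation I T := (`[0, T]%classic : set LT).
Local Notation LR := (@completed_lebesgue_measure R).
Variables (p : R).
Hypotheses (p1 : 1 <= p).
Let cmu := @leb_complete R.

Lemma Lpnorm_abs (V : normedModType R) (D : set LT) (q : \bar R) (f : R -> V) :
  Lpnorm LR D q f = 'N[LR]_q[EFin \o ((fun s => `|f s|%R) \_ D)]%E.
Proof.
congr (Lnorm _ _ _); apply/funext => s; rewrite /patch /=.
by case: ifP => // _; rewrite normr0.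
Qed.

Lemma in_Lp_Lp (V : normedModType R) (t : R) (w : R -> V) :
  in_Lp LR (I t) p%:E w -> Lp LR (I t) p w.
Proof.
move=> [sw wp]; split; first exact: (strong_smeas (measurable_I t) (leb_I_lty t) cmu sw).
move: wp; rewrite Lpnorm_abs Lnorm_norm_patchE//.
by apply: lty_poweRy; rewrite invr_neq0// gt_eqF// (lt_le_trans ltr01).
Qed.

Lemma Lp_in_Lp (V : normedModType R) (e : nat -> V) (t : R) (w : R -> V) : dense_seq e ->
  Lp LR (I t) p w -> in_Lp LR (I t) p%:E w.
Proof.
move=> de Lw; split; first exact: (smeas_strong (measurable_I t) (leb_I_lty t) de Lw.1).
rewrite Lpnorm_abs Lnorm_norm_patchE//.
by rewrite (nintE p1 Lw) poweR_EFin ltry.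
Qed.

Lemma leb_setT_gt0 : (0 < LR [set: LT])%E.
Proof.
apply: (@lt_le_trans _ _ (leb R `[0, 1]%classic)); last exact: leb_le.
by have := @leb_itv_bnd R 0 1 true false ler01; rewrite subr0 => ->; rewrite lte_fin ltr01.
Qed.

Lemma Lnorm_one_fin (q : \bar R) (t : R) : (1 < q)%E ->
  ('N[LR]_q[EFin \o ((fun=> 1%R : R) \_ (I t))] < +oo)%E.
Proof.
case: q => [q| |//] q1.
  have q1' : 1 <= q by rewrite -lee_fin ltW.
  have L1 := Lp_cst q (measurable_I t) (1 : R) (leb_I_lty t).
  have E1 : (fun=> 1 : R) = (fun s : R => `|(fun=> 1 : R) s|) by apply/funext => s; rewrite
    normr1.
  rewrite E1 Lnorm_norm_patchE//.
  by rewrite (nintE q1' L1) poweR_EFin ltry.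
rewrite unlock leb_setT_gt0; apply: (@le_lt_trans _ _ 1%E); last by rewrite ltry.
apply/ess_sup_inf.ess_supP; apply: aeW => s /=; rewrite lee_fin /patch.
by case: ifP => _; rewrite ?normr1 ?normr0.
Qed.

End Lebesgue_classes.

(** Consider the supremum of the x for which the bound holds on [a,x]. The local estimate to its
    left shows that the bound holds there, the one to its right that it cannot lie before b. *)
Lemma mean_value_le (R : realType) (V : normedModType R) (f : R -> V) (a b c : R) : a <= b ->
  (forall x, a <= x <= b -> exists2 r, 0 < r &
     forall y, a <= y <= b -> `|y - x| < r -> `|f y - f x| <= c * `|y - x|) ->
  `|f b - f a| <= c * (b - a).
Proof.
move=> ab loc; pose A := [set x | a <= x <= b /\ forall y, a <= y <= x -> `|f y - f a| <= c *
  (y - a)].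
have Aa : A a.
  split; first by rewrite lexx ab.
  by move=> y; rewrite -eq_le => /eqP <-; rewrite !subrr normr0 mulr0.
have hA : has_sup A by split; [exists a|exists b => x [/andP[]]].
have ub x : A x -> x <= sup A by exact: sup_upper_bound.
have aS : a <= sup A by exact: ub.
have Sb : sup A <= b by apply: sup_le_ub; [exists a|move=> x [/andP[]]].
have IS : a <= sup A <= b by rewrite aS.
have [r r0 rP] := loc _ IS.
have below y : a <= y -> y < sup A -> `|f y - f a| <= c * (y - a).
  move=> ay yS; have e0 : 0 < sup A - y by rewrite subr_gt0.
  have [x [_ Ax] yx] := sup_adherent e0 hA.
  by apply: Ax; rewrite ay ltW//; move: yx; rewrite opprB addrC subrK.
have atS : `|f (sup A) - f a| <= c * (sup A - a).
  move: aS; rewrite le_eqVlt => /orP[/eqP <-|aS]; first by rewrite !subrr normr0 mulr0.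
  pose y := Num.max a (sup A - r / 2).
  have ay : a <= y by rewrite le_max lexx.
  have yS : y < sup A by rewrite gt_max aS ltrBlDr ltrDl divr_gt0.
  have yr : `|y - sup A| < r.
    rewrite distrC ger0_norm ?subr_ge0 ?(ltW yS)// ltrBlDr -ltrBlDl.
    apply: (@lt_le_trans _ _ (sup A - r / 2)); last by rewrite le_max lexx orbT.
    by rewrite ltrD2l ltrN2 ltr_pdivrMr// ltr_pMr// ltr1n.
  have h1 := rP y _ yr; have {h1} := h1 (introT andP (conj ay (ltW (lt_le_trans yS Sb)))).
  rewrite distrC [`|y - _|]distrC ger0_norm ?subr_ge0 ?(ltW yS)// => h1.
  apply: le_trans (dist_tri h1 (below y ay yS)) _.
  by rewrite -mulrDr addrA subrK.
have [Sb'|bS] := ltP (sup A) b; last first.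
  have E : sup A = b by apply/eqP; rewrite eq_le Sb bS.
  by rewrite -E.
exfalso; pose z := Num.min b (sup A + r / 2).
have Sz : sup A < z by rewrite lt_min Sb' ltrDl divr_gt0.
suff /ub : A z by rewrite leNgt Sz.
split; first by rewrite (le_trans aS (ltW Sz)) ge_min lexx.
move=> y /andP[ay yz]; have [yS|Sy] := ltP y (sup A); first exact: below.
have yr : `|y - sup A| < r.
  rewrite ger0_norm ?subr_ge0// ltrBlDl; apply: le_lt_trans yz _.
  apply: (@le_lt_trans _ _ (sup A + r / 2)); first by rewrite ge_min lexx orbT.
  by rewrite ltrD2l ltr_pdivrMr// ltr_pMr// ltr1n.
have yb : y <= b by apply: le_trans yz _; rewrite ge_min lexx.
have := rP y (introT andP (conj ay yb)) yr; rewrite ger0_norm ?subr_ge0// => h1.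
by apply: le_trans (dist_tri h1 atS) _; rewrite -mulrDr addrA subrK.
Qed.

(** Values at the grid points j/(n+1) just to the left, which stay in [0,t], are simple and converge
    by continuity. This serves the operator-valued kernel, for which no dense sequence is at
    hand. *)
Lemma continuous_strong (R : realType) (V : normedModType R) (f : R -> V) (t : R) : 0 <= t ->
  {within `[0, t], continuous f} ->
  strongly_measurable (@completed_lebesgue_measure R)
    (`[0, t]%classic : set (caratheodory_type (wlength (@idfun R))^*%mu)) f.
Proof.
move=> t0 /subspace_continuousP cf.
pose idx n (x : R) : nat := Num.truncn (x * n.+1%:R).
pose node n x : R := (idx n x)%:R / n.+1%:R.
have N0 n : 0 < n.+1%:R :> R by rewrite ltr0n.
have idxP n x : 0 <= x -> (idx n x)%:R <= x * n.+1%:R < (idx n x).+1%:R.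
  by move=> x0; apply: truncn_itv; rewrite mulr_ge0.
have fi n : fin_idx (`[0, t]%classic : set (caratheodory_type (wlength (@idfun R))^*%mu)) (idx
  n).
  split.
    apply: (@sub_finite_set _ _ `I_(Num.truncn (t * n.+1%:R)).+1); last exact: finite_II.
    move=> _ [x /= + <-]; rewrite in_itv/= ltnS => /andP[x0 xt].
    by apply: le_truncn; rewrite ler_pM2r.
  move=> j; rewrite (_ : _ `&` _ = `[0, t]%classic `&` `[j%:R / n.+1%:R, j.+1%:R /
    n.+1%:R[%classic).
    by apply: measurableI; exact: leb_itv_measurable.
  apply/seteqP; split => x /=; rewrite !in_itv/= => -[/andP[x0 xt]].
    by move=> <-; rewrite ler_pdivrMr// ltr_pdivlMr// idxP// x0 xt.
  rewrite ler_pdivrMr// ltr_pdivlMr// => h; split; first by rewrite x0.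
  exact: truncn_def.
exists (fun n x => f (node n x)).
  move=> n; apply/(simple_onP (measurable_I t) (leb_I_lty t)).
  exact: (fin_idx_comp (fun j : nat => f (j%:R / n.+1%:R)) (fi n)).
apply: aeW => x It; have := It; rewrite /= in_itv/= => /andP[x0 xt].
have near_node n : 0 <= x - node n x /\ x - node n x < n.+1%:R^-1.
  have /andP[h1 h2] := idxP n x x0; rewrite subr_ge0 /node ler_pdivrMr// h1; split => //.
  rewrite ltrBlDr -[X in X + _]mul1r -mulrDl addrC natr1 ltr_pdivlMr//.
have node_in n : `[0, t]%classic (node n x).
  have [h1 _] := near_node n; rewrite /= in_itv/= divr_ge0//=.
  by apply: le_trans xt; rewrite -subr_ge0.
apply/cvgrPdist_lt => e e0.
have := cf x It => /cvgrPdist_lt/(_ _ e0); rewrite near_withinE => -[r /= r0 rP].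
have [n _ nP] := near_infty_natSinv_lt (PosNum r0).
exists n => // m /= nm; apply: (rP (node m x) _ (node_in m)) => /=.
have [h1 h2] := near_node m; rewrite /ball /= ger0_norm//.
exact: lt_trans h2 (nP m nm).
Qed.

(** * Bounds and continuity of the kernel under either assumption *)

Section hoelder_kernel.
Context {R : realType} {E : completeNormedModType R}.
Local Notation LT := (caratheodory_type (wlength (@idfun R))^*%mu).
Local Notation I T := (`[0, T]%classic : set LT).
Local Notation LR := (@completed_lebesgue_measure R).
Variables (p T : R) (q : \bar R) (k : R -> R -> blin E).
Hypotheses (p1 : 1 <= p) (T0 : 0 <= T) (q1 : (1 < q)%E) (pq : (p%:E^-1 + q^-1 = 1)%E).
Local Notation kk := (kernel_section k).
Local Notation Lp_ t := (Lp LR (I t) p).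
Local Notation Lnrm_ t := (Lnrm LR (I t) p).
Let cmu := @leb_complete R.

Lemma Lp_extend (u : R -> R) t : I T t -> Lp_ t u ->
  Lp_ T (patch (fun=> 0) (I t) u) /\ Lnrm_ T (patch (fun=> 0) (I t) u) = Lnrm_ t u.
Proof.
move=> It Lu; have tT : t <= T by move: It; rewrite /= in_itv/= => /andP[].
have E1 := @Lnrm_patch_sub R p p1 _ u t T tT.
split; last exact: E1.
have [dR ddR] := @dense_seq_real R.
have st := smeas_strong (measurable_I t) (leb_I_lty t) ddR Lu.1.
have sT := strong_patch (measurable_I t) (measurable_I T) (subI It) (leb_I_lty t) (leb_I_lty T)
  st.
split; first exact: (strong_smeas (measurable_I T) (leb_I_lty T) cmu sT).
apply: le_lt_trans (_ : (nint LR (I t) p u < +oo)%E); last exact: Lu.2.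
rewrite !nint_integral [leLHS]integral_mkcond [leRHS]integral_mkcond.
rewrite le_eqVlt; apply/orP; left; apply/eqP; apply: eq_integral => s _.
rewrite /patch; case: (boolP (s \in `[0, t]%classic)) => st'.
  rewrite mem_set//; move: st'; rewrite inE; exact: (subI It).
by case: ifP => // _; rewrite normr0 powR0// gt_eqF// (lt_le_trans ltr01).
Qed.

Section from_sections.
Hypothesis ks : forall t, I T t -> in_Lp LR (I t) q (k t).
Hypothesis kcont : forall t0, I T t0 ->
  Lpnorm LR (I T) q (kk t \- kk t0) @[t --> within `[0, T] (nbhs t0)] --> 0%E.

Let kks t : I T t -> strongly_measurable LR (I T) (kk t).
Proof.
move=> It; exact: (strong_patch (measurable_I t) (measurable_I T) (subI It) (leb_I_lty t)
  (leb_I_lty T) (ks It).1).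
Qed.

Let kkd t t0 : I T t -> I T t0 -> measurable_fun (I T) (fun s => `|(kk t \- kk t0) s|).
Proof.
move=> It It0.
have sl := strong_lin (measurable_I T) (leb_I_lty T) 1 (-1) (kks It) (kks It0).
apply: (measurable_strong_norm (measurable_I T) (leb_I_lty T) cmu).
by apply: (strong_ext _ sl) => s _; rewrite scale1r scaleN1r.
Qed.

Let near_small t0 e : I T t0 -> 0 < e -> \forall t \near t0, I T t ->
  (Lpnorm LR (I T) q (kk t \- kk t0)%R < e%:E)%E.
Proof.
move=> It0 e0; have /(_ [set x | (x < e%:E)%E]) := kcont It0.
have o : nbhs 0%E [set x : \bar R | (x < e%:E)%E].
  by apply: open_nbhs_nbhs; split; [exact: open_ereal_lt_ereal|rewrite /= lte_fin].
by move=> /(_ o).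
Qed.

Let hoelder_diff t t0 e (u : R -> R) : I T t -> I T t0 -> 0 <= e ->
  (Lpnorm LR (I T) q (kk t \- kk t0)%R < e%:E)%E -> Lp_ T u ->
  (\int[LR]_(s in I T) (`|kk t s - kk t0 s| * `|u s|)%:E <= (e * Lnrm_ T u)%:E)%E.
Proof.
move=> It It0 e0 lt Lu; rewrite Lpnorm_abs in lt.
have fin := lt_trans lt (ltry e).
have := hoelder_le (measurable_I T) p1 leb_setT_gt0 q1 pq (kkd It It0) fin Lu.
under eq_integral do rewrite normr_id.
move=> /le_trans; apply; rewrite lee_fin; apply: ler_wpM2r; first exact: Lnrm_ge0.
by rewrite -lee_fin fineK ?(ltW lt)// ge0_fin_numE// Lnorm_ge0.
Qed.

Lemma kernel_cont1 t0 e : I T t0 -> 0 < e -> \forall t \near t0, I T t ->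
  (\int[LR]_(s in I T) `|kk t s - kk t0 s|%:E <= e%:E)%E.
Proof.
move=> It0 e0; have L1 := Lp_cst p (measurable_I T) (1 : R) (leb_I_lty T).
have N0 := Lnrm_ge0 LR (I T) p (fun=> 1 : R); set N := Lnrm_ T _ in N0.
have e1 : 0 < e / (N + 1) by rewrite divr_gt0// ltr_wpDl.
apply: filterS (near_small It0 e1) => t h It.
have := hoelder_diff It It0 (ltW e1) (h It) L1.
under eq_integral do rewrite normr1 mulr1.
move=> /le_trans; apply; rewrite lee_fin -/N mulrAC -mulrA ler_piMr ?(ltW e0)//.
by rewrite ler_pdivrMr ?ltr_wpDl// mul1r lerDl.
Qed.

(** Near t0 the section is within 1 of the one at t0 in L^q, so its norm is bounded there;
    compactness of [0,T] makes the bound uniform, and Hoelder's inequality concludes. *)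
Lemma kernel_bound1 : exists2 M, 0 <= M & forall t, I T t -> forall u : R -> R, Lp_ t u ->
  (\int[LR]_(s in I t) (`|k t s| * `|u s|)%:E <= (M * Lnrm_ t u)%:E)%E.
Proof.
pose P (n : nat) t := I T t -> forall u : R -> R, Lp_ t u ->
  (\int[LR]_(s in I t) (`|k t s| * `|u s|)%:E <= (n%:R * Lnrm_ t u)%:E)%E.
have /compact_near_coveringP := @segment_compact R 0 T.
move=> /(_ nat \oo P _) cov.
suff : \forall n \near \oo, `[0, T]%classic `<=` P n.
  by move=> [n _ /(_ n (leqnn n)) h]; exists n%:R => // t It u; exact: (h t It It).
apply: cov => t0 It0.
have [_ k0] := ks It0.
have fin0 : ('N[LR]_q[EFin \o ((fun s => `|kk t0 s|%R) \_ (I T))] < +oo)%E.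
  rewrite Lpnorm_abs in k0; rewrite (_ : _ \_ _ = (fun s => `|k t0 s|%R) \_ (I t0))//.
  apply/funext => s; rewrite /kernel_section /patch.
  case: (boolP (s \in `[0, t0]%classic)) => st.
    rewrite mem_set//; move: st; rewrite inE; exact: (subI It0).
  by case: ifP => // _; rewrite normr0.
have mk0 := measurable_strong_norm (measurable_I T) (leb_I_lty T) cmu (kks It0).
set B := fine 'N[LR]_q[EFin \o ((fun s => `|kk t0 s|%R) \_ (I T))]%E.
exists ([set t | I T t -> (Lpnorm LR (I T) q (kk t \- kk t0)%R < 1%:E)%E], [set n : nat | B + 1
  <= n%:R]).
  split => /=; first exact: near_small.
  exists (Num.truncn (B + 1)).+1 => // n /= nB; apply: (@le_trans _ _ (Num.truncn (B +
    1)).+1%:R).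
    by apply: ltW; exact: truncnS_gt.
  by rewrite ler_nat.
move=> [t n] /= [kt Bn] It u Lu; have [LU EU] := Lp_extend It Lu.
set U := patch _ _ u in LU EU.
have h1 := hoelder_diff It It0 ler01 (kt It) LU.
have := hoelder_le (measurable_I T) p1 leb_setT_gt0 q1 pq mk0 fin0 LU; rewrite -/B.
under eq_integral do rewrite normr_id.
move=> h0; have mU := smeas_norm LU.1.
have mkt := measurable_strong_norm (measurable_I T) (leb_I_lty T) cmu (kks It).
have e1 : (\int[LR]_(s in I t) (`|k t s| * `|u s|)%:E = \int[LR]_(s in I T) (`|kk t s| * `|U
  s|)%:E)%E.
  rewrite [LHS]integral_mkcond [RHS]integral_mkcond; apply: eq_integral => s _.
  rewrite /U /kernel_section /patch; case: (boolP (s \in `[0, t]%classic)) => st.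
    rewrite mem_set//; move: st; rewrite inE; exact: (subI It).
  by case: ifP => // _; rewrite !normr0 mulr0.
have m1 : measurable_fun (I T) (fun s => (`|kk t s - kk t0 s| * `|U s|)%:E).
  by apply/measurable_EFinP; exact: (measurable_funM (kkd It It0) mU).
have m2 : measurable_fun (I T) (fun s => (`|kk t0 s| * `|U s|)%:E).
  by apply/measurable_EFinP; exact: (measurable_funM mk0 mU).
rewrite e1; apply: (@le_trans _ _ (\int[LR]_(s in I T) ((`|kk t s - kk t0 s| * `|U s|)%:E +
  (`|kk t0 s| * `|U s|)%:E))%E).
  apply: ge0_le_integral.
  - exact: measurable_I.
  - by move=> s _; rewrite lee_fin mulr_ge0.
  - by apply/measurable_EFinP; exact: (measurable_funM mkt mU).
  - exact: emeasurable_funD.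
  - move=> s _; rewrite -EFinD lee_fin -mulrDl; apply: ler_wpM2r => //.
    by have := ler_normD (kk t s - kk t0 s) (kk t0 s); rewrite subrK.
rewrite ge0_integralD; last 5 first.
- exact: measurable_I.
- by move=> s _; rewrite lee_fin mulr_ge0.
- exact: m1.
- by move=> s _; rewrite lee_fin mulr_ge0.
- exact: m2.
apply: le_trans (leeD h1 h0) _; rewrite -EFinD lee_fin EU -mulrDl; apply: ler_wpM2r.
  exact: Lnrm_ge0.
by rewrite addrC.
Qed.

End from_sections.

Section from_derivative.
Hypothesis T_gt0 : 0 < T.
Variables (dk : R -> R -> blin E) (mu : R -> R).
Hypothesis kd : forall t s, 0 <= s -> s <= t -> t <= T ->
  (t' - t)^-1 *: (k t' s - k t s) @[t' --> within `[s, T] t^'] --> dk t s.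
Hypothesis Lmu : in_Lp LR (I T) q mu.
Hypothesis dk_mu : forall t s, 0 <= s -> s <= t -> t <= T -> `|dk t s| <= mu s.
Hypothesis k_cont : forall t, I T t -> {within `[0, t], continuous (k t)}.
Hypothesis k_diag : {within `[0, T], continuous (fun t => k t t)}.

Let mu_ge0 s : 0 <= s -> s <= T -> 0 <= mu s.
Proof. by move=> s0 sT; apply: le_trans (dk_mu s0 (lexx s) sT). Qed.

(** The mean value inequality in t. The derivative bounds difference quotients only up to a slack,
    chosen so that it contributes at most [e] in total. *)
Lemma kernel_lip t t' s : 0 <= s -> s <= t -> t <= t' -> t' <= T ->
  `|k t' s - k t s| <= mu s * (t' - t).
Proof.
move=> s0 st tt' t'T; apply/ler_addgt0Pr => e e0.
pose c := mu s + e / (t' - t + 1).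
have d0 : 0 <= t' - t by rewrite subr_ge0.
have d1 : 0 < t' - t + 1 by rewrite ltr_wpDl.
have ec : 0 < e / (t' - t + 1) by rewrite divr_gt0.
apply: (@le_trans _ _ (c * (t' - t))); last first.
  rewrite /c mulrDl lerD2l mulrAC -mulrA ler_piMr ?(ltW e0)//.
  by rewrite ler_pdivrMr// mul1r lerDl.
apply: (@mean_value_le _ _ (fun x => k x s)) => // x /andP[tx xt'].
have sx := le_trans st tx; have xT := le_trans xt' t'T.
have /cvgrPdist_lt/(_ _ ec) := kd s0 sx xT.
rewrite near_withinE => -[r /= r0 rP]; exists r => // y /andP[ty yt'] yx.
have [->|yx0] := eqVneq y x; first by rewrite !subrr !normr0 mulr0.
have Iy : `[s, T]%classic y by rewrite /= in_itv/= (le_trans st ty) (le_trans yt' t'T).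
have xy : ball x r y by rewrite /ball /= distrC.
have := rP y xy yx0 Iy => /= lt.
have n0 : 0 < `|y - x| by rewrite normr_gt0 subr_eq0.
rewrite -ler_pdivrMr// mulrC -normfV -normrZ.
have := ler_normB (dk x s) (dk x s - (y - x)^-1 *: (k y s - k x s)); rewrite opprB addrC subrK.
move=> /le_trans; apply; rewrite /c; apply: lerD; last exact: ltW.
exact: dk_mu.
Qed.

(** Compare k(t,s) with the diagonal value k(s,s): the latter is bounded by compactness, and the
    increment is at most T mu(s). *)
Lemma kernel_dom : exists2 C, 0 <= C & forall t s, 0 <= s -> s <= t -> t <= T ->
  `|k t s| <= C + T * `|mu s|.
Proof.
have cn : {within `[0, T], continuous (fun t => `|k t t|)}.
  by move=> t; apply: cvg_norm; exact: k_diag.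
have [c _ cP] := EVT_max T0 cn; exists `|k c c| => // t s s0 st tT.
have sT := le_trans st tT.
have h1 : `|k s s| <= `|k c c| by apply: cP; rewrite in_itv/= s0.
have h2 := kernel_lip s0 (lexx s) st tT.
rewrite -(subrK (k s s) (k t s)); apply: le_trans (ler_normD _ _) _; rewrite addrC.
apply: lerD => //; apply: le_trans h2 _; rewrite mulrC.
apply: ler_pM; rewrite ?subr_ge0 ?mu_ge0//; last exact: ler_norm.
by rewrite lerBlDr (le_trans tT)// lerDl.
Qed.

Lemma kernel_strong2 t : I T t -> strongly_measurable LR (I t) (k t).
Proof.
move=> It; apply: continuous_strong; last exact: k_cont.
by move: It; rewrite /= in_itv/= => /andP[].
Qed.

Let mmu : measurable_fun (I T) (fun s => `|mu s|).
Proof. exact: (measurable_strong_norm (measurable_I T) (leb_I_lty T) cmu Lmu.1). Qed.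

Let hoelder_mu (u : R -> R) : Lp_ T u -> (\int[LR]_(s in I T) (`|mu s| * `|u s|)%:E <=
  (fine 'N[LR]_q[EFin \o ((fun s => `|mu s|%R) \_ (I T))] * Lnrm_ T u)%:E)%E.
Proof.
move=> Lu; have [_ fin] := Lmu; rewrite Lpnorm_abs in fin.
have := hoelder_le (measurable_I T) p1 leb_setT_gt0 q1 pq mmu fin Lu.
by under eq_integral do rewrite normr_id.
Qed.

Let hoelder_one (u : R -> R) : Lp_ T u -> (\int[LR]_(s in I T) `|u s|%:E <=
  (fine 'N[LR]_q[EFin \o ((fun=> 1%R : R) \_ (I T))] * Lnrm_ T u)%:E)%E.
Proof.
move=> Lu; have m1 : measurable_fun (I T) (fun=> 1 : R) by exact: measurable_cst.
have := hoelder_le (measurable_I T) p1 leb_setT_gt0 q1 pq m1 (Lnorm_one_fin T q1) Lu.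
by under eq_integral do rewrite normr1 mul1r.
Qed.

Lemma kernel_bound2 : exists2 M, 0 <= M & forall t, I T t -> forall u : R -> R, Lp_ t u ->
  (\int[LR]_(s in I t) (`|k t s| * `|u s|)%:E <= (M * Lnrm_ t u)%:E)%E.
Proof.
have [C C0 CP] := kernel_dom.
have ho := hoelder_one; have hm := hoelder_mu.
set B1 := fine 'N[LR]_q[EFin \o ((fun=> 1%R : R) \_ (I T))]%E in ho.
set B2 := fine 'N[LR]_q[EFin \o ((fun s => `|mu s|%R) \_ (I T))]%E in hm.
have B10 : 0 <= B1 by rewrite fine_ge0// Lnorm_ge0.
have B20 : 0 <= B2 by rewrite fine_ge0// Lnorm_ge0.
exists (C * B1 + T * B2); first by rewrite addr_ge0 ?mulr_ge0.
move=> t It u Lu; have [LU EU] := Lp_extend It Lu; set U := patch _ _ u in LU EU.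
have tT : t <= T by move: It; rewrite /= in_itv/= => /andP[].
have mU := smeas_norm LU.1.
have mk : measurable_fun (I T) (fun s => `|kk t s|).
  apply: (measurable_strong_norm (measurable_I T) (leb_I_lty T) cmu).
  exact: (strong_patch (measurable_I t) (measurable_I T) (subI It) (leb_I_lty t) (leb_I_lty T)
    (kernel_strong2 It)).
have e1 : (\int[LR]_(s in I t) (`|k t s| * `|u s|)%:E = \int[LR]_(s in I T) (`|kk t s| * `|U
  s|)%:E)%E.
  rewrite [LHS]integral_mkcond [RHS]integral_mkcond; apply: eq_integral => s _.
  rewrite /U /kernel_section /patch; case: (boolP (s \in `[0, t]%classic)) => st.
    rewrite mem_set//; move: st; rewrite inE; exact: (subI It).
  by case: ifP => // _; rewrite !normr0 mulr0.
have m1 : measurable_fun (I T) (fun s => `|U s|%:E) by apply/measurable_EFinP.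
have m2 : measurable_fun (I T) (fun s => (`|mu s| * `|U s|)%:E).
  by apply/measurable_EFinP; exact: (measurable_funM mmu mU).
rewrite e1; apply: (@le_trans _ _ (\int[LR]_(s in I T) (C%:E * `|U s|%:E + T%:E * (`|mu s| *
  `|U s|)%:E))%E).
  apply: ge0_le_integral.
  - exact: measurable_I.
  - by move=> s _; rewrite lee_fin mulr_ge0.
  - by apply/measurable_EFinP; exact: (measurable_funM mk mU).
  - by apply: emeasurable_funD; [exact: measurable_funeM|exact: measurable_funeM].
  - move=> s Is; rewrite -!EFinM -EFinD lee_fin mulrA -mulrDl; apply: ler_wpM2r => //.
    rewrite /kernel_section /patch; case: ifPn => [/set_mem|_].
      by rewrite /= in_itv/= => /andP[s0 st]; exact: CP.
    by rewrite normr0 addr_ge0// mulr_ge0.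
rewrite ge0_integralD; last 5 first.
- exact: measurable_I.
- by move=> s _; rewrite -EFinM lee_fin mulr_ge0.
- exact: measurable_funeM.
- by move=> s _; rewrite -EFinM lee_fin !mulr_ge0.
- exact: measurable_funeM.
rewrite ge0_integralZl_EFin; last 4 first.
- exact: measurable_I.
- by move=> s _; rewrite lee_fin.
- exact: m1.
- exact: C0.
rewrite ge0_integralZl_EFin; last 4 first.
- exact: measurable_I.
- by move=> s _; rewrite lee_fin mulr_ge0.
- exact: m2.
- exact: T0.
have h1 : (C%:E * \int[LR]_(s in I T) `|U s|%:E <= (C * B1 * Lnrm_ t u)%:E)%E.
  rewrite -mulrA EFinM; apply: lee_wpmul2l; first by rewrite lee_fin.
  by rewrite -EU; exact: ho.
have h2 : (T%:E * \int[LR]_(s in I T) (`|mu s| * `|U s|)%:E <= (T * B2 * Lnrm_ t u)%:E)%E.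
  rewrite -mulrA EFinM; apply: lee_wpmul2l; first by rewrite lee_fin.
  by rewrite -EU; exact: hm.
by apply: le_trans (leeD h1 h2) _; rewrite -EFinD -mulrDl.
Qed.

(** Dominated convergence in s along a sequence tending to t0: for s different from t0, eventually
    either both sections contain s, and [kernel_lip] applies, or both vanish there. The single point
    t0 is negligible. *)
Lemma kernel_cont2 t0 e : I T t0 -> 0 < e -> \forall t \near t0, I T t ->
  (\int[LR]_(s in I T) `|kk t s - kk t0 s|%:E <= e%:E)%E.
Proof.
move=> It0 e0; have [C C0 CP] := kernel_dom.
have le11 : (1 : R) <= 1 by [].
have kks t : I T t -> strongly_measurable LR (I T) (kk t).
  by move=> It; exact: (strong_patch (measurable_I t) (measurable_I T) (subI It) (leb_I_lty t)
    (leb_I_lty T) (kernel_strong2 It)).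
have L1p := Lp_cst p (measurable_I T) (1 : R) (leb_I_lty T).
have L1 := Lp_cst 1 (measurable_I T) (1 : R) (leb_I_lty T).
have Lm : Lp LR (I T) 1 (fun s => `|mu s| : R).
  split; first exact: smeas_measurable.
  rewrite nint_integral; under eq_integral do rewrite normr_id powRr1//.
  have E1 : (\int[LR]_(s in I T) (`|mu s| * `|1 : R|)%:E = \int[LR]_(s in I T) `|mu s|%:E)%E.
    by apply: eq_integral => s _; rewrite normr1 mulr1.
  have := hoelder_mu L1p; rewrite E1.
  by move=> /le_lt_trans; apply; rewrite ltry.
have C20 : 0 <= 2 * C by rewrite mulr_ge0.
have T20 : 0 <= 2 * T by rewrite mulr_ge0.
have [LG _] := Lp_comb3 le11 L1 Lm L1 C20 T20 (lexx 0).
have domk t s : I T t -> `|kk t s| <= C + T * `|mu s|.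
  rewrite /= in_itv/= => /andP[_ tT]; rewrite /kernel_section /patch.
  case: ifPn => [/set_mem|_]; last by rewrite normr0 addr_ge0// mulr_ge0.
  by rewrite /= in_itv/= => /andP[s0 st]; exact: CP.
(* Dominated convergence is sequential, so a failure is first turned into a sequence. *)
apply: contrapT => nnear.
have /boolp.choice[ts tsP] : forall n : nat, exists t, [/\ `|t0 - t| < n.+1%:R^-1, I T t &
    ~ (\int[LR]_(s in I T) `|kk t s - kk t0 s|%:E <= e%:E)%E].
  move=> n; apply: contrapT => nex; apply: nnear.
  exists n.+1%:R^-1 => /=; first by rewrite invr_gt0.
  by move=> t /= tt0 It; apply: contrapT => nle; apply: nex; exists t.
have sd n : strongly_measurable LR (I T) (fun s => kk (ts n) s - kk t0 s).
  have [_ It _] := tsP n.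
  have sl := strong_lin (measurable_I T) (leb_I_lty T) 1 (-1) (kks _ It) (kks _ It0).
  by apply: (strong_ext _ sl) => s _; rewrite scale1r scaleN1r.
have md n := strong_smeas (measurable_I T) (leb_I_lty T) cmu (sd n).
have dom n s : `|kk (ts n) s - kk t0 s| <= `|2 * C * 1 + 2 * T * `|mu s| + 0 * 1|.
  have [_ It _] := tsP n.
  rewrite mul0r addr0 mulr1 -mulrA -mulrDr; apply: le_trans (ler_norm _).
  apply: le_trans (ler_normB _ _) _; rewrite mulr_natl mulr2n.
  by apply: lerD; exact: domk.
have := @Lnrm_cvg0 _ LT R LR (I T) 1 (measurable_I T) le11 (blin E)
  (fun n s => kk (ts n) s - kk t0 s) (fun s => 2 * C * 1 + 2 * T * `|mu s| + 0 * 1) md LG.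
move=> /(_ _ _)/cvgrPdist_lt H.
have [||n _ /(_ n (leqnn n)) /=] := H _ _ e e0.
- by apply: nearW => n; apply: aeW => s _; exact: dom.
- have := countable_negligible (countable1 t0); apply: negligibleS => s /= ns; apply: contrapT
  => st0.
  apply: ns => Is; have := Is; rewrite /= in_itv/= => /andP[s0 sT].
  have d0 : 0 < `|t0 - s| by rewrite normr_gt0 subr_eq0; apply/eqP => h0; apply: st0.
  apply/cvgrPdist_le => eps eps0.
  have m0 : 0 < Num.min `|t0 - s| (eps / (mu s + 1)).
    by rewrite lt_min d0 divr_gt0// ltr_wpDl// mu_ge0.
  have [n _ nP] := near_infty_natSinv_lt (PosNum m0).
  exists n => // m /= nm; rewrite sub0r normrN.
  have [tm Itm _] := tsP m; have := nP m nm => /= lt.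
  have := lt_trans tm lt; rewrite lt_min => /andP[h1 h2].
  have := Itm; rewrite /= in_itv/= => /andP[tm0 tmT].
  have := It0; rewrite /= in_itv/= => /andP[t00 t0T].
  have mu1 : 0 < mu s + 1 by rewrite ltr_wpDl// mu_ge0.
  have fin x : 0 <= x -> x = `|t0 - ts m| -> mu s * x <= eps.
    move=> x0 ->; apply: (@le_trans _ _ ((mu s + 1) * (eps / (mu s + 1)))).
      by apply: ler_pM => //; [exact: mu_ge0|rewrite lerDl|exact: ltW].
    by rewrite mulrC divfK// gt_eqF.
  rewrite /kernel_section /patch; have [st|ts'] := leP s t0.
    have st' : s < t0 by rewrite lt_neqAle st andbT; apply/eqP => h0; apply: st0.
    have sm : s <= ts m.
      have h : t0 - ts m < t0 - s.
        by apply: le_lt_trans (ler_norm _) _; apply: lt_le_trans h1 _; rewrite ger0_norm//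
          subr_ge0.
      by move: h; rewrite ltrD2l ltrN2 => /ltW.
    rewrite !mem_set /= ?in_itv/= ?s0//.
    have [tt|/ltW tt] := leP t0 (ts m).
      apply: le_trans (kernel_lip s0 st tt tmT) _; apply: fin; rewrite ?subr_ge0//.
      by rewrite distrC ger0_norm// subr_ge0.
    rewrite distrC; apply: le_trans (kernel_lip s0 sm tt t0T) _; apply: fin; rewrite
      ?subr_ge0//.
    by rewrite ger0_norm// subr_ge0.
  have sm : ts m < s.
    have h : ts m - t0 < s - t0.
      apply: le_lt_trans (ler_norm _) _; rewrite distrC; apply: lt_le_trans h1 _.
      by rewrite distrC ger0_norm// subr_ge0 ltW.
    by move: h; rewrite ltrD2r.
  rewrite !memNset /= ?in_itv/=; first by rewrite subrr normr0 ltW.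
    by rewrite s0/=; apply/negP; rewrite -ltNge.
  by rewrite s0/=; apply/negP; rewrite -ltNge.
rewrite sub0r normrN ger0_norm ?Lnrm_ge0// => lt; have [_ _] := tsP n; apply.
have Lf : Lp LR (I T) 1 (fun s => kk (ts n) s - kk t0 s).
  by apply: (Lp_mono (measurable_I T) le11 (md n) LG); apply: aeW => s _; exact: dom.
have := nintE le11 Lf; rewrite powRr1 ?Lnrm_ge0// nint_integral.
under eq_integral do rewrite powRr1//.
by move=> ->; rewrite lee_fin ltW.
Qed.

End from_derivative.

End hoelder_kernel.

(** * The solution set *)

Section metric_topology.
Context {R : realType}.

Definition metric_for (X : topologicalType) (d : X -> X -> R) : Prop :=
  [/\ forall x y, 0 <= d x y, forall x y, d x y = 0 <-> x = y,
      forall x y, d x y = d y x, forall x y z, d x z <= d x y + d y z &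
      forall x (U : set X), nbhs x U <-> exists2 e : R, 0 < e & [set y | d x y < e] `<=` U].

Lemma set_type_metric (V : normedModType R) (A : set V) :
  metric_for (fun x y : A => `|set_val x - set_val y|).
Proof.
split => [x y|x y|x y|x y z|x U].
- by [].
- split => [/eqP|->]; last by rewrite subrr normr0.
  by rewrite normr_eq0 subr_eq0 => /eqP; exact: val_inj.
- exact: distrC.
- by have := ler_normD (set_val x - set_val y) (set_val y - set_val z); rewrite addrA subrK.
split.
  rewrite nbhsE => -[B [[W oW WB] Bx] BU].
  have : nbhs (set_val x) W by apply: open_nbhs_nbhs; split => //; rewrite -WB in Bx.
  move=> /nbhs_ballP[e /= e0 eW]; exists e => // y /= xy; apply: BU; rewrite -WB.
  by apply: eW; rewrite -ball_normE.
move=> [e e0 eU]; have H : nbhs x (set_val @^-1` ball (set_val x) e).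
  exact: (@initial_continuous A V set_val x (ball (set_val x) e) (nbhsx_ballx _ _ e0)).
apply: filterS H => y /=; rewrite -ball_normE /= => h; exact: eU.
Qed.

Lemma open_metric (X : topologicalType) (d : X -> X -> R) (U : set X) : metric_for d ->
  (forall x, U x -> exists2 e : R, 0 < e & [set y | d x y < e] `<=` U) -> open U.
Proof. by case=> _ _ _ _ dn h; rewrite openE => x /h; exact: (dn x U).2. Qed.

Lemma embedding_of_metric (X Y : topologicalType) (dX : X -> X -> R) (dY : Y -> Y -> R)
    (f : X -> Y) : metric_for dX -> metric_for dY ->
  (forall x e, 0 < e -> exists2 r, 0 < r & forall x', dX x x' < r -> dY (f x) (f x') < e) ->
  (forall x e, 0 < e -> exists2 r, 0 < r & forall x', dY (f x) (f x') < r -> dX x x' < e) ->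
  embedding f.
Proof.
move=> mX mY fc fi; have [X0 XX XC XT Xn] := mX; have [Y0 YY YC YT Yn] := mY; split.
  move=> x x' E; apply/XX/eqP; rewrite eq_le X0 andbT; apply/ler_addgt0Pr => e e0.
  have [r r0 rP] := fi x e e0; rewrite add0r ltW// rP//.
  by have /YY -> := E.
move=> U; split => [oU|[V oV ->]]; last first.
  apply: (open_metric mX) => x Vx.
  have /Yn[e e0 eV] : nbhs (f x) V by exact: open_nbhs_nbhs.
  by have [r r0 rP] := fc x e e0; exists r => // x' /rP/eV.
(* The union of the balls about image points whose preimage lies in [U]. *)
exists [set y | exists x r, [/\ U x, dY (f x) y < r & forall x', dY (f x) (f x') < r -> U x']].
  apply: (open_metric mY) => y [x [r [Ux xy rP]]].
  exists (r - dY (f x) y); first by rewrite subr_gt0.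
  move=> y' /= yy'; exists x, r; split => //; apply: le_lt_trans (YT _ y _) _.
  by rewrite addrC -ltrBrDr.
apply/seteqP; split => [x Ux|x [x1 [r [_ h]]]]; last exact.
have /Xn[e e0 eU] : nbhs x U by exact: open_nbhs_nbhs.
have [r r0 rP] := fi x e e0; exists x, r; split => //; first by have /YY -> := erefl (f x).
by move=> x' /rP/eU.
Qed.

End metric_topology.

Lemma separable_dense_seq (R : realType) (V : normedModType R) : separable V ->
  exists d : nat -> V, dense_seq d.
Proof.
move=> [S /countable_injP[n injn] dS].
exists (fun j => xget 0 [set x | S x /\ n x = j]) => x r r0.
have [y [xy Sy]] : ball x r `&` S !=set0.
  have := dS (ball x r)°; rewrite setIC; have o := @open_interior V (ball x r).
  move=> /(_ _ o)[|y [Sy by']]; last by exists y; split => //; exact: interior_subset.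
  by exists x; exact: nbhsx_ballx.
exists (n y); case: xgetP => [z zE [Sz nz]|/(_ y)[]//].
by rewrite -(injn y z) ?inE//; move: xy; rewrite -ball_normE.
Qed.

Section solution_space.
Context {R : realType} {E : completeNormedModType R}.
Local Notation LT := (caratheodory_type (wlength (@idfun R))^*%mu).
Local Notation I T := (`[0, T]%classic : set LT).
Local Notation LR := (@completed_lebesgue_measure R).
Variables (p T M : R) (d : nat -> E) (k : R -> R -> blin E) (F : R -> E -> set E)
  (al be : R -> R) (h : cfun T E).
Hypotheses (p1 : 1 <= p) (T0 : 0 < T) (dd : dense_seq d) (M0 : 0 <= M).
Local Notation Lp_ t := (Lp LR (I t) p).
Local Notation Lnrm_ t := (Lnrm LR (I t) p).
Local Notation Lp := (Lp_ T).
Local Notation Lnrm := (Lnrm_ T).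
Hypothesis km : forall t, I T t -> strongly_measurable LR (I t) (k t).
Hypothesis kb : forall t, I T t -> forall u : R -> R, Lp_ t u ->
  (\int[LR]_(s in I t) (`|k t s| * `|u s|)%:E <= (M * Lnrm_ t u)%:E)%E.
Hypothesis kc : forall t0, I T t0 -> forall e : R, 0 < e ->
  \forall t \near t0, I T t ->
    (\int[LR]_(s in I T) `|kernel_section k t s - kernel_section k t0 s|%:E <= e%:E)%E.
Hypotheses (F0 : forall t x, `[0, T]%classic t -> F t x !=set0)
  (F_closed : forall t x, `[0, T]%classic t -> closed (F t x))
  (F_meas : forall x, Sigma_measurable T (F ^~ x)).
Hypothesis F_lip : {ae LR, forall t, `[0, T]%classic t -> forall x y e,
  `|rdist e (F t x) - rdist e (F t y)| <= al t * `|x - y|}.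
Hypothesis F_bound : {ae LR, forall t, `[0, T]%classic t -> rdist 0 (F t 0) <= be t}.
Hypotheses (Lal : Lp al) (Lbe : Lp be).

Local Notation sol := (volterra_solutions p F k h).

Lemma volterra_solutionsP x : sol x <-> solution p k F h x.
Proof.
split => -[w [Lw Fw xw]]; exists w.
  have Lw' := in_Lp_Lp p1 Lw; split => // t It.
  have [v vP ->] := xw t It; rewrite /Xop.
  by rewrite (volt_unique p1 dd M0 km kb It (Lp_subI It Lw') vP).
split => //; first exact: (Lp_in_Lp p1 dd Lw).
move=> t It; exists (volt k w t); last exact: xw.
exact: (voltP p1 dd M0 km kb It (Lp_subI It Lw)).
Qed.

Let X_meas := Xop_meas h p1 dd M0 km kb kc.
Let X_bdd := Xop_bdd h p1 dd M0 km kb kc.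
Let X_lip := Xop_lip h p1 dd M0 km kb.

(** A family over a one-point space without convergent sequences, started from the control 0.
    Nonemptiness supplies the base point in [sol_dense_seq]. *)
Lemma solution_exists : exists x : cfun T E, sol x.
Proof.
have [C C0 fam] := solution_family p1 T0 dd M0 F0 F_closed F_meas F_lip F_bound Lal Lbe
  X_meas X_bdd X_lip (fun (_ : nat -> unit) (_ : unit) => False).
have L0 : Lp (fun=> 0 : E) := Lp_cst p (measurable_I T) _ (leb_I_lty T).
have [||||w [Lw _ Fw _]] := fam (fun _ : unit => fun=> 0) (fun=> 1).
- by move=> _; exact: L0.
- by [].
- by move=> _; exact: ltr01.
- by [].
have [x xE] := cfun_of_continuous (Xop_cont (h := h) p1 dd M0 km kb kc (Lw tt)).
exists x; apply/volterra_solutionsP; exists (w tt); split => //.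
by apply: ae_imply (Fw tt) => t Ft It; rewrite xE//; exact: Ft.
Qed.

(** A solution depends Lipschitz continuously on its control, so separability of L^p passes to the
    solution set. This provides the dense sequence in the closed set of [metric_extension]. *)
Lemma sol_dense_seq : exists s : nat -> sol, forall (x : sol) e, 0 < e ->
  exists j, `|set_val x - set_val (s j)| < e.
Proof.
have [x0 sx0] := solution_exists; pose s0 : sol := exist _ x0 (mem_set sx0).
have /boolp.choice[w wP] : forall x : sol, exists w, Lp w /\
    forall t, `[0, T]%classic t -> set_val x t = Xop k h w t.
  by move=> x; have /volterra_solutionsP[w [Lw _ xw]] := set_valP x; exists w.
have [s sP] := Lp_dense_family p1 dd s0 (fun x => (wP x).1).
exists s => x e e0; have M1 : 0 < M + 1 by rewrite ltr_wpDl.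
have e1 : 0 < e / (M + 1) by rewrite divr_gt0.
have [j jP] := sP x _ e1; exists j.
have eM : M * (e / (M + 1)) < e.
  by rewrite mulrCA -[ltRHS]mulr1 ltr_pM2l// ltr_pdivrMr// mul1r ltrDl ltr01.
apply: le_lt_trans eM; change (maxnorm (set_val x - set_val (s j)) <= M * (e / (M + 1))).
have b0 : 0 <= M * (e / (M + 1)) by rewrite mulr_ge0// ltW.
apply: maxnorm_le => // t; have [It|nIt] := pselect (`[0, T]%classic t); last first.
  have z0 (b : cfun T E) : b t = 0 by case: b => b /= /asboolP[_]; exact.
  by rewrite z0 normr0.
change (`|set_val x t - set_val (s j) t| <= M * (e / (M + 1))).
rewrite (wP x).2// (wP (s j)).2//.
apply: le_trans (Xop_lipT h p1 dd M0 km kb (wP x).1 (wP (s j)).1 It) _.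
by apply: ler_wpM2l => //; exact: ltW.
Qed.

Lemma solutions_absolute_retract : absolute_retract R sol.
Proof.
have mS := set_type_metric (sol : set (cfun T E)).
split; first by exists (fun x y : sol => `|set_val x - set_val y|).
move=> Y i [dY mY] [iinj iemb] cA; have [Y0 YY YC YT Yn] := mY.
have [_ _ _ _ Sn] := mS.
have [s sP] := sol_dense_seq.
(* The inverse of [i] on its range, with default 0; its extension by [metric_extension] is the
   retraction. *)
have /boolp.choice[f fP] : forall y, exists x : cfun T E, forall s : sol, i s = y -> x =
  set_val s.
  move=> y; have [[s0 is0]|nex] := pselect (exists s0, i s0 = y).
    by exists (set_val s0) => s1; rewrite -is0 => /iinj ->.
  by exists 0 => s1 is1; exfalso; apply: nex; exists s1.
have fi s0 : f (i s0) = set_val s0 by exact: fP.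
have [|||||g [gsol gA gc]] := @metric_extension R E p T M d k F al be h p1 T0 dd M0 km kb kc
  F0 F_closed F_meas F_lip F_bound Lal Lbe Y dY (range i) (i \o s) f Y0 YC YT.
- by move=> j; exists (s j).
- move=> _ e [s0 _ <-] e0.
  have : nbhs (i s0) [set y | dY (i s0) y < e] by apply/Yn; exists e.
  rewrite nbhsE => -[V [oV Vi] Ve].
  have oU : open (i @^-1` V) by apply/iemb; exists V.
  have /Sn[r r0 rV] : nbhs s0 (i @^-1` V) by exact: open_nbhs_nbhs.
  by have [j jP] := sP s0 r r0; exists j; apply: Ve; exact: rV.
- move=> y nA; have : nbhs y (~` range i).
    by apply: open_nbhs_nbhs; split => //; exact: closed_openC.
  move=> /Yn[r r0 rA]; exists r => // x [s0 _ <-]; rewrite leNgt; apply/negP => lt.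
  by apply: (rA _ lt); exists s0.
- move=> _ [s0 _ <-]; rewrite fi; apply/volterra_solutionsP; exact: set_valP.
- move=> _ e [s0 _ <-] e0.
  have : nbhs s0 [set s1 | `|set_val s0 - set_val s1| < e] by apply/Sn; exists e.
  rewrite nbhsE => -[U [/iemb[V oV ->] Vi] Ue].
  have /Yn[r r0 rV] : nbhs (i s0) V by exact: open_nbhs_nbhs.
  exists r => // _ [s1 _ <-] lt; rewrite !fi distrC ltW//; apply: Ue; exact: rV.
have gsol' y : sol (g y) by apply/volterra_solutionsP.
exists (fun y => exist _ (g y) (mem_set (gsol' y))); last first.
  move=> s0; apply: val_inj => /=; rewrite gA ?fi//; exists s0 => //.
move=> y U /Sn[e e0 eU]; apply/Yn; have e2 : 0 < e / 2 by rewrite divr_gt0.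
have [r r0 rP] := gc y _ e2; exists r => // y' /rP le; apply: eU => /=.
by rewrite distrC; apply: le_lt_trans le _; rewrite ltr_pdivrMr// ltr_pMr// ltr1n.
Qed.

Lemma solutions_arcwise_connected : arcwise_connected R sol.
Proof.
move=> x y xy; pose dR (a b : R) := `|a - b|.
(* On a two-point set every map is continuous, so the extension to the line is a path of
   solutions. *)
pose A : set R := [set t | t = 0 \/ t = 1].
pose a (j : nat) : R := if j is 0%N then 0 else 1.
pose f (t : R) : cfun T E := if t == 0 then set_val x else set_val y.
have f0 : f 0 = set_val x by rewrite /f eqxx.
have f1 : f 1 = set_val y by rewrite /f oner_eq0.
have [||||||||gam [gsol gA gc]] := @metric_extension R E p T M d k F al be h p1 T0 dd M0 km kb
  kc
  F0 F_closed F_meas F_lip F_bound Lal Lbe R dR A a f.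
- by move=> u v; exact: normr_ge0.
- by move=> u v; exact: distrC.
- by move=> u v w; have := ler_normD (u - v) (v - w); rewrite addrA subrK.
- by case=> [|j]; [left|right].
- by move=> t e [->|->] e0; [exists 0%N|exists 1%N]; rewrite /dR subrr normr0.
- move=> t nA; exists (Num.min `|t| `|t - 1|).
    rewrite lt_min !normr_gt0 subr_eq0; apply/andP; split; apply/eqP => E0; apply: nA.
      by left.
    by right.
  by move=> s [->|->]; rewrite /dR ge_min ?subr0 lexx ?orbT.
- by move=> t [->|->]; rewrite ?f0 ?f1; apply/volterra_solutionsP; exact: set_valP.
- have d01 : dR 0 1 < 1 -> False by rewrite /dR sub0r normrN normr1 ltxx.
  have d10 : dR 1 0 < 1 -> False by rewrite /dR subr0 normr1 ltxx.
  move=> t e At e0; exists 1 => // t' At'.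
  case: At => ->; case: At' => -> //; rewrite ?subrr ?normr0 ?ltW//.
have gam_cont t e : 0 < e -> exists2 r, 0 < r & forall t', `|t' - t| < r -> `|gam t' - gam t|
  <= e.
  move=> e0; have [r r0 rP] := gc t e e0; exists r => // t' lt; apply: rP.
  by rewrite /dR distrC.
have [c [c0 c1 cg cc cm]] := loop_removal gam_cont.
have g0 : gam 0 = set_val x by rewrite gA ?f0//; left.
have g1 : gam 1 = set_val y by rewrite gA ?f1//; right.
have ne : c 0 <> c 1.
  by rewrite c0 c1 g0 g1 => /val_inj.
have [g [gc' gg0 gg1 gcont ginv]] := arc_of_monotone_path cc cm ne.
have gsol' (u : (`[0, 1]%classic : set R)) : sol (g (set_val u)).
  have := set_valP u; rewrite /= in_itv/= => /gc'[t /cg[s _ ->] ->].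
  by apply/volterra_solutionsP; exact: gsol.
exists (fun u => exist _ (g (set_val u)) (mem_set (gsol' u))); split.
- apply: (embedding_of_metric (set_type_metric (`[0, 1]%classic : set R)) (set_type_metric (sol
  : set (cfun T E)))).
    move=> u e e0; have := set_valP u; rewrite /= in_itv/= => Iu.
    have [r r0 rP] := gcont _ e Iu e0; exists r => // u' lt.
    have := set_valP u'; rewrite /= in_itv/= => Iu'.
    by rewrite distrC; apply: rP => //; rewrite distrC.
  move=> u e e0; have := set_valP u; rewrite /= in_itv/= => Iu.
  have [r r0 rP] := ginv _ e Iu e0; exists r => // u' lt.
  have := set_valP u'; rewrite /= in_itv/= => Iu'.
  by rewrite distrC; apply: rP => //; rewrite distrC.
- by move=> t t0; apply: val_inj; rewrite /= t0 gg0 c0 g0.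
- by move=> t t1; apply: val_inj; rewrite /= t1 gg1 c1 g1.
Qed.

End solution_space.

Theorem corollary2 (R : realType) (E : completeNormedModType R)
  (Esep : separable E)
  (T : R) (T_gt0 : 0 < T)
  (p : R) (p_ge1 : 1 <= p)
  (q : \bar R) (q_gt1 : (1 < q)%E) (pq : (p%:E^-1 + q^-1 = 1)%E)
  (F : R -> E -> set E)
  (H1 : forall t x, `[0, T]%classic t ->
     [/\ F t x !=set0, closed (F t x) & bounded_set (F t x)])
  (H2 : forall x, Sigma_measurable T (F ^~ x))
  (H3 : exists2 alpha : R -> R,
     in_Lp (leb R) `[0, T] p%:E alpha &
     {ae leb R, forall t, `[0, T]%classic t -> forall x y : E,
        (hausdorff_dist (F t x) (F t y) <= (alpha t * `|x - y|)%:E)%E})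
  (H4 : exists2 beta : R -> R,
     in_Lp (leb R) `[0, T] p%:E beta &
     {ae leb R, forall t, `[0, T]%classic t ->
        (dist 0%R (F t 0%R) <= (beta t)%:E)%E})
  (Fconvex : 1 < p -> forall t x, `[0, T]%classic t -> @convex_set R E (F t x))
  (k : R -> R -> blin E) (h : cfun T E) :
  ((forall t, `[0, T]%classic t -> in_Lp (leb R) `[0, t] q (k t)) ->
   (forall t0, `[0, T]%classic t0 ->
      Lpnorm (leb R) `[0, T] q (kernel_section k t \- kernel_section k t0)
        @[t --> within `[0, T] (nbhs t0)] --> 0%E) ->
   arcwise_connected R (volterra_solutions p F k h))
  /\
  ((exists (dk : R -> R -> blin E) (mu : R -> R),
      [/\ (* at s = t = T the limit below is over the trivial filter *)
          forall t s, 0 <= s -> s <= t -> t <= T ->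
            (t' - t)^-1 *: (k t' s - k t s)
              @[t' --> within `[s, T] t^'] --> dk t s,
          in_Lp (leb R) `[0, T] q mu &
          forall t s, 0 <= s -> s <= t -> t <= T -> `|dk t s| <= mu s]) ->
   (forall t, `[0, T]%classic t -> {within `[0, t], continuous (k t)}) ->
   {within `[0, T], continuous (fun t => k t t)} ->
   (forall t, `[0, T]%classic t -> invertible (k t t)) ->
   absolute_retract R (volterra_solutions p F k h)).
Proof.
have [d dd] := separable_dense_seq Esep.
have [al Lal Hal] := H3; have [be Lbe Hbe] := H4.
have F0 t x : `[0, T]%classic t -> F t x !=set0 by move=> /(H1 t x)[].
have F_closed t x : `[0, T]%classic t -> closed (F t x) by move=> /(H1 t x)[].
(* The Hausdorff bound, used in both directions, becomes a Lipschitz estimate for distances to the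
   values of F, the form in which all estimates use it. *)
have F_lip : {ae leb R, forall t, `[0, T]%classic t -> forall x y e,
    `|rdist e (F t x) - rdist e (F t y)| <= al t * `|x - y|}.
  apply: ae_imply Hal => t ht It x y e.
  have h1 := rdist_hausdorff e (F0 t x It) (F0 t y It) (ht It x y).
  have := rdist_hausdorff e (F0 t y It) (F0 t x It) (ht It y x).
  by rewrite distrC => h2; exact: dist_le_of_two.
have F_bound : {ae leb R, forall t, `[0, T]%classic t -> rdist 0 (F t 0) <= be t}.
  by apply: ae_imply Hbe => t ht It; rewrite -lee_fin -rdistE; [exact: ht|exact: F0].
have T0 := ltW T_gt0.
split => [ks kcont|[dk [mu [kd Lmu dkmu]]] k_cont k_diag _].
  have [M M0 kb] := kernel_bound1 p_ge1 q_gt1 pq ks kcont.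
  exact: (solutions_arcwise_connected (h := h) p_ge1 T_gt0 dd M0 (fun t It => (ks t It).1) kb
    (fun t It e e0 => kernel_cont1 p_ge1 q_gt1 pq ks kcont It e0)
    F0 F_closed H2 F_lip F_bound (in_Lp_Lp p_ge1 Lal) (in_Lp_Lp p_ge1 Lbe)).
have [M M0 kb] := kernel_bound2 p_ge1 T0 q_gt1 pq kd Lmu dkmu k_cont k_diag.
exact: (solutions_absolute_retract h p_ge1 T_gt0 dd M0 (kernel_strong2 k_cont) kb
    (fun t It e e0 => kernel_cont2 p_ge1 T0 q_gt1 pq kd Lmu dkmu k_cont k_diag It e0)
    F0 F_closed H2 F_lip F_bound (in_Lp_Lp p_ge1 Lal) (in_Lp_Lp p_ge1 Lbe)).
Qed.
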